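(* Let $r\in T$ be a residual point and let $\delta\in\Delta_{W_0r}$ be an irreducible discrete series representation of $\mathcal H$ with central character $W_0r$. The formal dimension $\mu_{Pl}(\delta)$ of $\delta$ equals $$\mu_{Pl}(\delta)=\operatorname{fdim}(\delta)=d_\delta\,\nu(\{W_0r\})=|W_0r|\,\bar\kappa_{W_0r}\,d_\delta\,m_{\{r\}}(r),$$ where $\bar\kappa_{W_0r}\in\mathbb Q$ is the constant in the mass $\nu(\{r\})=\bar\kappa_{W_0r}m_{\{r\}}(r)$ (it depends only on the orbit $W_0r$, not on $\delta$), and $$m_{\{r\}}(r)=q(w_0)\,\frac{\prod'_{\alpha\in R_1}(\alpha(r)-1)}{\prod'_{\alpha\in R_1}(q_{\alpha^\vee}^{1/2}\alpha(r)^{1/2}+1)\ \prod'_{\alpha\in R_1}(q_{\alpha^\vee}^{1/2}q_{2\alpha^\vee}\alpha(r)^{1/2}-1)},$$ $\prod'$ meaning that factors equal to $0$ are omitted.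
   Context: **Hecke algebra.** $\mathcal R=(X,Y,R_0,R_0^\vee,F_0)$ is a reduced root datum ($X,Y$ lattices in perfect duality, $R_0\subset X$ a reduced root system with coroots $R_0^\vee\subset Y$, basis $F_0$, positive roots $R_{0,+}$), $W_0$ its Weyl group with longest element $w_0$, $W=W_0\ltimes X$. $W$ acts on affine functions $(y,k)\in Y\times\mathbb Z$, $(y,k)(x)=\langle x,y\rangle+k$, by $(wf)(x)=f(w^{-1}x)$. $R^{\rm aff}=R_0^\vee\times\mathbb Z$; $(\alpha^\vee,k)$ is positive if $k>0$, or $k=0$ and $\alpha\in R_{0,+}$. $F^{\rm aff}=\{(\alpha^\vee,0):\alpha\in F_0\}\cup\{(\alpha^\vee,1):\alpha^\vee$ a minimal coroot in the dominance order$\}$; for $a=(\alpha^\vee,k)$ put $s_a(x)=x-a(x)\alpha$; $S^{\rm aff}=\{s_a:a\in F^{\rm aff}\}$; $l(w)=|R^{\rm aff}_+\cap w^{-1}R^{\rm aff}_-|$. Fix $\mathbf q>1$ and reals $f_s$ ($s\in S^{\rm aff}$), equal for $W$-conjugate $s$, and put $q(s)=\mathbf q^{f_s}$; extend $q$ to $W$ by $q(ww')=q(w)q(w')$ if $l(ww')=l(w)+l(w')$ and $q(\omega)=1$ if $l(\omega)=0$. $\mathcal H$ is the complex algebra with basis $(T_w)_{w\in W}$, $T_wT_{w'}=T_{ww'}$ if lengths add, $(T_s+1)(T_s-q(s))=0$ for $s\in S^{\rm aff}$; $T_w^*=T_{w^{-1}}$ (conjugate-linear anti-involution); $\tau(T_w)=\delta_{w,e}$;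 $(h_1,h_2)=\tau(h_1^*h_2)$; $N_w=q(w)^{-1/2}T_w$ is an orthonormal basis; $\mathfrak H$ is the Hilbert completion; $\mathfrak C$ is the completion of $\mathcal H$ in the operator norm of left multiplication on $\mathfrak H$; $\hat{\mathfrak C}$ its spectrum (all irreducibles are finite dimensional). The Plancherel measure $\mu_{Pl}$ is the unique positive Borel measure on $\hat{\mathfrak C}$ with $\tau(h)=\int\chi_\pi(h)d\mu_{Pl}(\pi)$. A discrete series representation is an irreducible representation isomorphic to a subrepresentation of the left regular representation on $\mathfrak H$; its formal dimension is $\operatorname{fdim}(\delta)=\mu_{Pl}(\{\delta\})$. **Center.** $X^+=\{x:\langle x,\alpha^\vee\rangle\ge0\ \forall\alpha\in R_{0,+}\}$; $x\mapsto\theta_x$ is the homomorphism $X\to\mathcal H^\times$ with $\theta_x=N_{t_x}$ for $x\in X^+$ ($t_x$ the translation by $x$); $\mathcal A=\operatorname{span}\{\theta_x\}\simeq\mathbb C[X]$ is the ring of regular functions on $T=\operatorname{Hom}(X,\mathbb C^\times)$, $\theta_x(t)=x(t)$; the center of $\mathcal H$ is $\mathcal Z=\mathcal A^{W_0}$, so central characters are orbits $W_0t$. $\Delta_{W_0r}$ is a set of representatives of the irreducible discrete series with central character $W_0r$. **Measure $\nu$, local traces, residual degrees.** The spectrum of the closure $\overline{\mathcal Z}$ of $\mathcal Z$ in $\mathfrak C$ is identified with a compact subset $S$ of $W_0\backslash T$. $\nu$ is the $W_0$-invariant Borel probability measure on $T$, supported on the preimage of $S$, with $\tau(z)=\int_Tz\,d\nu$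 for $z\in\mathcal Z$; $\nu(\{W_0r\})$ is the total mass of the orbit. $t\mapsto\chi_t(h)$ ($h\in\mathcal H$) is the $W_0$-invariant density with $\tau(zh)=\int_Tz(t)\chi_t(h)d\nu(t)$ for all $z\in\mathcal Z$. For a residual point $r$ one has $\nu(\{r\})>0$, so $\chi_r$ is well defined; it is a tracial state and a positive linear combination $\chi_r=\sum_{\delta\in\Delta_{W_0r}}d_\delta\chi_\delta$ of the characters of the irreducible discrete series with central character $W_0r$. The coefficient $d_\delta>0$ is the residual degree of $\delta$. **Root labels.** Labels $q_a$, $a\in R^{\rm aff}$: $q_{wa}=q_a$, $q(s_a)=q_{a+1}$ for $a\in F^{\rm aff}$. $q_{\alpha^\vee}:=q_{(\alpha^\vee,0)}$. $R_{nr}=R_0\cup\{2\alpha:\alpha\in R_0,\alpha^\vee\in2Y\}$; for $\alpha^\vee\in2Y$, $q_{\alpha^\vee/2}:=q_{(\alpha^\vee,1)}/q_{(\alpha^\vee,0)}$ (label of $2\alpha$), and $q_{\alpha^\vee/2}:=1$ if $2\alpha\notin R_{nr}$. $R_1=\{\alpha\in R_{nr}:2\alpha\notin R_{nr}\}$. If $\alpha\in R_1$ and $\alpha/2\notin R_0$ one puts $q_{2\alpha^\vee}=1$ and combines the two denominator factors of $m_{\{r\}}$ for $\alpha$ into $q_{\alpha^\vee}\alpha(r)-1$. **Residual points.** For a coset $L$ of a subtorus $T^L\subset T$ let $R_L=\{\alpha\in R_0:\alpha(T^L)=1\}$, $R_L^p=\{\alpha\in R_L:\alpha(L)=-q_{\alpha^\vee/2}^{1/2}$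 or $\alpha(L)=q_{\alpha^\vee/2}^{1/2}q_{\alpha^\vee}\}$, $R_L^z=\{\alpha\in R_L:\alpha(L)=\pm1\}$, $i_L=|R_L^p|-|R_L^z|$. $L$ is residual if $L=T$, or if there is a residual coset $M\supset L$ with $\dim M=\dim L+1$ and $i_L\ge i_M+1$. A residual point is a residual coset of dimension $0$. *)

(* Defs.v *)
From HB Require Import structures.
From mathcomp Require Import all_boot all_order all_algebra finmap.
From mathcomp Require Import generic_quotient complex.
From mathcomp Require Import all_classical all_reals all_analysis.

Set Implicit Arguments.
Unset Strict Implicit.
Unset Printing Implicit Defensive.

Import Order.TTheory GRing.Theory Num.Theory.
Import numFieldNormedType.Exports.

Local Open Scope classical_set_scope.
Local Open Scope fset_scope.
Local Open Scope ring_scope.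
Local Open Scope quotient_scope.

Definition is_lattice (X : zmodType) : Prop :=
  exists (n : nat) (e : 'I_n -> X),
    forall x, exists! c : {ffun 'I_n -> int}, x = \sum_i e i *~ c i.

Record rootDatum := RootDatum {
  latX : zmodType;
  latY : zmodType;
  pairing : latX -> latY -> int;
  roots : {fset latX};
  (* only the values of [coroot] on [roots] matter *)
  coroot : latX -> latY;
  simple : {fset latX};
  _ : is_lattice latX;
  _ : is_lattice latY;
  pairingDl : forall x x' y, pairing (x + x') y = pairing x y + pairing x' y;
  pairingDr : forall x y y', pairing x (y + y') = pairing x y + pairing x y';
  perfectl : forall f : {additive latX -> int},
    exists! y, forall x, f x = pairing x y;
  perfectr : forall f : {additive latY -> int},
    exists! x, forall y, f y = pairing x y;
  coroot_inj : {in roots &, injective coroot};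
  pairing_coroot : forall a, a \in roots -> pairing a (coroot a) = 2;
  roots_refl : forall a b, a \in roots -> b \in roots ->
    b - a *~ pairing b (coroot a) \in roots;
  coroots_refl : forall a b, a \in roots -> b \in roots ->
    exists2 c, c \in roots &
      coroot c = coroot b - coroot a *~ pairing a (coroot b);
  roots_reduced : forall a b (m n : int), a \in roots -> b \in roots ->
    m != 0 -> a *~ m = b *~ n -> b = a \/ b = - a;
  simple_sub : simple `<=` roots;
  simple_free : forall c : latX -> int,
    \sum_(a <- simple) a *~ c a = 0 -> forall a, a \in simple -> c a = 0;
  simple_basis : forall b, b \in roots -> exists c : latX -> nat,
    b = \sum_(a <- simple) a *+ c a \/ b = - \sum_(a <- simple) a *+ c a
}.

Section AffineWeylGroup.
Variable D : rootDatum.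
Local Notation X := (latX D).
Local Notation Y := (latY D).
Local Notation "<< x , y >>" := (@pairing D x y).

Definition pos_roots : {fset X} :=
  [fset b in roots D |
    `[< exists c : X -> nat, b = \sum_(a <- simple D) a *+ c a >]].

Definition dominant (x : X) : Prop :=
  forall a, a \in pos_roots -> 0 <= <<x, coroot a>>.

Definition dominance (y y' : Y) : Prop :=
  exists c : X -> nat, y' - y = \sum_(a <- pos_roots) coroot a *+ c a.

Definition minimal_coroot (a : X) : Prop :=
  a \in roots D /\
  forall b, b \in roots D ->
    dominance (coroot b) (coroot a) -> coroot b = coroot a.

(* The affine root (a^vee, k) is encoded as the pair (a, k); this is faithful
   because [coroot] is injective on [roots]. *)
Definition aff_root (a : X * int) : Prop := a.1 \in roots D.

Definition aff_eval (a : X * int) (x : X) : int := <<x, coroot a.1>> + a.2.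

Definition aff_refl (a : X * int) (x : X) : X := x - a.1 *~ aff_eval a x.

Definition aff_pos (a : X * int) : Prop :=
  aff_root a /\ (0 < a.2 \/ (a.2 = 0 /\ a.1 \in pos_roots)).

Definition aff_neg (a : X * int) : Prop := aff_root a /\ ~ aff_pos a.

Definition aff_simple (a : X * int) : Prop :=
  (a.1 \in simple D /\ a.2 = 0) \/ (minimal_coroot a.1 /\ a.2 = 1).

Definition S_aff : set (X -> X) := [set aff_refl a | a in aff_simple].

(* Both W_0 and W = W_0 |x X are realised by their (faithful) action on X. *)
Inductive W0 : (X -> X) -> Prop :=
| W0_id : W0 id
| W0_refl a w : a \in roots D -> W0 w -> W0 (aff_refl (a, 0) \o w).

Definition transl (x : X) : X -> X := fun y => y + x.

Definition W : set (X -> X) := [set g | exists w x, W0 w /\ g = transl x \o w].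

(* b = w a, where (w f)(x) = f (w^-1 x) *)
Definition aff_act (w : X -> X) (a b : X * int) : Prop :=
  forall x, aff_eval b (w x) = aff_eval a x.

Definition wlength (w : X -> X) : nat :=
  #|` fset_set [set a : X * int |
        aff_pos a /\ exists2 b, aff_neg b & aff_act w a b] |.

Definition longest (w0 : X -> X) : Prop :=
  W0 w0 /\ forall w, W0 w -> (wlength w <= wlength w0)%N.

(* co-root divisible by 2 in Y, i.e. 2a belongs to R_nr *)
Definition even_coroot (a : X) : bool := `[< exists y : Y, coroot a = y *+ 2 >].

Definition roots_nr : {fset X} :=
  roots D `|` [fset a *+ 2 | a in [fset b in roots D | even_coroot b]].

Definition roots_1 : {fset X} := [fset a in roots_nr | a *+ 2 \notin roots_nr].

Definition half_root (a : X) : option X :=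
  ohead [seq b <- roots D | b *+ 2 == a].

End AffineWeylGroup.

(* [qexp s] is f_s and [bfq] is the base of the powers; [qW] is the extension
   of q to W and [qlab] is the label function a |-> q_a on affine roots.  Both
   are determined by [bfq] and [qexp]. *)
Record labels (R : realType) (D : rootDatum) := Labels {
  bfq : R;
  qexp : (latX D -> latX D) -> R;
  qW : (latX D -> latX D) -> R;
  qlab : latX D * int -> R;
  bfq_gt1 : 1 < bfq;
  qexp_conj : forall s s' w w', @S_aff D s -> @S_aff D s' ->
    @W D w -> @W D w' -> w \o w' = id -> s' = w \o s \o w' ->
    qexp s = qexp s';
  qW_simple : forall s, @S_aff D s -> qW s = bfq `^ qexp s;
  qW_mul : forall w w', @W D w -> @W D w' ->
    wlength (w \o w') = (wlength w + wlength w')%N ->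
    qW (w \o w') = qW w * qW w';
  qW_length0 : forall w, @W D w -> wlength w = 0%N -> qW w = 1;
  qlab_act : forall w a b, @W D w -> @aff_root D a -> @aff_root D b ->
    aff_act w a b -> qlab b = qlab a;
  qlab_simple : forall a, @aff_simple D a ->
    qlab (a.1, a.2 + 1) = qW (aff_refl a)
}.

(* the label q_{a^vee/2} *)
Definition qhalf (R : realType) (D : rootDatum) (L : labels R D) (a : latX D) : R :=
  if even_coroot a then qlab L (a, 1) / qlab L (a, 0) else 1.

Record heckeAlgebra (R : realType) (D : rootDatum) (L : labels R D) := HeckeAlgebra {
  hecke :> algType R[i];
  hT : (latX D -> latX D) -> hecke;
  hstar : hecke -> hecke;
  htau : {scalar hecke};
  htheta : latX D -> hecke;
  hT_span : forall h, exists (s : {fset latX D -> latX D}) (c : (latX D -> latX D) -> R[i]),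
    (forall w, w \in s -> W w) /\ h = \sum_(w <- s) c w *: hT w;
  hT_free : forall (s : {fset latX D -> latX D}) (c : (latX D -> latX D) -> R[i]),
    (forall w, w \in s -> W w) -> \sum_(w <- s) c w *: hT w = 0 ->
    forall w, w \in s -> c w = 0;
  hT_mul : forall w w', W w -> W w' ->
    wlength (w \o w') = (wlength w + wlength w')%N ->
    hT w * hT w' = hT (w \o w');
  hT_quad : forall s, S_aff s -> (hT s + 1) * (hT s - (qW L s)%:C%C%:A) = 0;
  hstarD : forall h h', hstar (h + h') = hstar h + hstar h';
  hstarZ : forall (c : R[i]) h, hstar (c *: h) = c^* *: hstar h;
  hstarM : forall h h', hstar (h * h') = hstar h' * hstar h;
  hstar_T : forall w w', W w -> W w' -> w \o w' = id -> hstar (hT w) = hT w';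
  htau_1 : htau (hT id) = 1;
  htau_T : forall w, W w -> w <> id -> htau (hT w) = 0;
  htheta0 : htheta 0 = 1;
  hthetaD : forall x y, htheta (x + y) = htheta x * htheta y;
  (* theta_x = N_{t_x} = q(t_x)^(-1/2) T_{t_x} *)
  htheta_dom : forall x, dominant x ->
    htheta x = (qW L (transl x) `^ (- 2^-1))%:C%C *: hT (transl x)
}.

(* Elements of A = C[X] are finitely supported coefficient functions on X;
   the W_0-invariant ones form the center Z = A^{W_0}. *)
Notation coefX R D := {fsfun latX D -> R[i] with 0}.

Definition W0_inv (R : realType) (D : rootDatum) (z : coefX R D) : Prop :=
  forall w x, W0 w -> z (w x) = z x.

Definition theta_comb (R : realType) (D : rootDatum) (L : labels R D)
    (H : heckeAlgebra L) (z : coefX R D) : H :=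
  \sum_(x <- finsupp z) z x *: htheta H x.

Record hilbertCompletion (R : realType) (D : rootDatum) (L : labels R D)
    (H : heckeAlgebra L) := HilbertCompletion {
  hilb :> completeNormedModType R[i];
  inner : hilb -> hilb -> R[i];
  hilb_in : {linear H -> hilb};
  innerD : forall u v w, inner u (v + w) = inner u v + inner u w;
  innerZ : forall (c : R[i]) u v, inner u (c *: v) = c * inner u v;
  inner_conj : forall u v, inner v u = (inner u v)^*;
  inner_norm : forall v, `|v| ^+ 2 = inner v v;
  inner_in : forall h h', inner (hilb_in h) (hilb_in h') = htau H (hstar h * h');
  hilb_in_dense : dense (range hilb_in)
}.

Definition opnorm_le (R : realType) (V : normedModType R[i]) (F : V -> V) (c : R) : Prop :=
  forall v, `|F v| <= c%:C%C * `|v|.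

(* [cact] is the action on the Hilbert space extending left multiplication; the
   norm of [a] is the operator norm of [cact a]. *)
Record cstarCompletion (R : realType) (D : rootDatum) (L : labels R D)
    (H : heckeAlgebra L) (V : hilbertCompletion H) := CstarCompletion {
  cstar :> algType R[i];
  cact : cstar -> V -> V;
  cadj : cstar -> cstar;
  cin : {lrmorphism H -> cstar};
  cact_linearl : forall v, linear (cact^~ v);
  cact_linearr : forall a, linear (cact a);
  cactM : forall a b v, cact (a * b) v = cact a (cact b v);
  cact1 : forall v, cact 1 v = v;
  cact_faithful : forall a, (forall v, cact a v = 0) -> a = 0;
  cact_bounded : forall a, exists c, opnorm_le (cact a) c;
  cact_in : forall h h', cact (cin h) (hilb_in V h') = hilb_in V (h * h');
  cadjP : forall a u v, inner (cact a u) v = inner u (cact (cadj a) v);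
  cin_dense : forall a (e : R), 0 < e -> exists h, opnorm_le (cact (a - cin h)) e;
  cstar_complete : forall u : nat -> cstar,
    (forall e : R, 0 < e -> exists N, forall m n, (N <= m)%N -> (N <= n)%N ->
       opnorm_le (cact (u m - u n)) e) ->
    exists a, forall e : R, 0 < e -> exists N, forall n, (N <= n)%N ->
       opnorm_le (cact (u n - a)) e
}.

Section Spectrum.
Variables (R : realType) (D : rootDatum) (L : labels R D).
Variables (H : heckeAlgebra L) (V : hilbertCompletion H).
Variable A : cstarCompletion V.

Definition adjmx (m n : nat) (M : 'M[R[i]]_(m, n)) : 'M[R[i]]_(n, m) :=
  map_mx Num.conj M^T.

(* Irreducible *-representations on C^(irrep_dim + 1) acting on column vectors;
   all irreducible representations are finite dimensional. *)
Record irrep := Irrep {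
  irrep_dim : nat;
  irrep_rho :> {lrmorphism A -> 'M[R[i]]_irrep_dim.+1};
  irrep_star : forall a, irrep_rho (cadj a) = adjmx (irrep_rho a);
  irrep_irr : forall U : {vspace 'cV[R[i]]_irrep_dim.+1},
    (forall a v, v \in U -> irrep_rho a *m v \in U) -> U = 0%VS \/ U = fullv
}.

HB.instance Definition _ := gen_eqMixin irrep.
HB.instance Definition _ := gen_choiceMixin irrep.

Definition irrep_equiv (p p' : irrep) : bool :=
  `[< exists U : 'M[R[i]]_((irrep_dim p').+1, (irrep_dim p).+1),
      [/\ adjmx U *m U = 1%:M, U *m adjmx U = 1%:M
        & forall a, U *m p a = p' a *m U] >].

Lemma adjmxK m n (M : 'M[R[i]]_(m, n)) : adjmx (adjmx M) = M.
Proof. by apply/matrixP => i j; rewrite !mxE conjCK. Qed.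

Lemma adjmxM m n k (M : 'M[R[i]]_(m, n)) (N : 'M[R[i]]_(n, k)) :
  adjmx (M *m N) = adjmx N *m adjmx M.
Proof. by rewrite /adjmx trmx_mul map_mxM. Qed.

Lemma irrep_equiv_refl : reflexive irrep_equiv.
Proof.
move=> p; apply/asboolP; exists 1%:M; split => [||a].
- by rewrite mulmx1 /adjmx trmx1 map_mx1.
- by rewrite mul1mx /adjmx trmx1 map_mx1.
- by rewrite mul1mx mulmx1.
Qed.

Lemma irrep_equiv_symr p p' : irrep_equiv p p' -> irrep_equiv p' p.
Proof.
move=> /asboolP[U [U1 U2 UP]]; apply/asboolP; exists (adjmx U).
rewrite adjmxK; split => // a.
by rewrite -[LHS]mulmx1 -U2 !mulmxA -[_ *m p' a *m U]mulmxA -UP mulmxA U1 mul1mx.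
Qed.

Lemma irrep_equiv_sym : symmetric irrep_equiv.
Proof. by move=> p p'; apply/idP/idP; exact: irrep_equiv_symr. Qed.

Lemma irrep_equiv_trans : transitive irrep_equiv.
Proof.
move=> p2 p1 p3 /asboolP[U [U1 U2 UP]] /asboolP[U' [U1' U2' UP']].
apply/asboolP; exists (U' *m U); split => [||a].
- by rewrite adjmxM mulmxA -(mulmxA (adjmx U)) U1' mulmx1.
- by rewrite adjmxM mulmxA -(mulmxA U') U2 mulmx1.
- by rewrite -mulmxA UP mulmxA UP' mulmxA.
Qed.

Canonical irrep_equiv_rel :=
  EquivRel irrep_equiv irrep_equiv_refl irrep_equiv_sym irrep_equiv_trans.

(* Measurable types are pointed: [p0] only provides the base point. *)
Definition spectrum (p0 : irrep) : Type := {eq_quot irrep_equiv_rel}.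

HB.instance Definition _ p0 := Choice.on (spectrum p0).
HB.instance Definition _ p0 :=
  isPointed.Build (spectrum p0) (\pi_{eq_quot irrep_equiv_rel} p0).

Definition rep_of p0 (d : spectrum p0) : irrep :=
  repr (d : {eq_quot irrep_equiv_rel}).

Definition irrep_char p0 (d : spectrum p0) (a : A) : R[i] := \tr (rep_of d a).

(* Open sets of the hull-kernel topology; [I] need not be an ideal, as
   the hull of a set is the hull of the closed ideal that it generates. *)
Definition spectrum_open p0 : set (set (spectrum p0)) :=
  [set ~` [set d | forall a, I a -> rep_of d a = 0] | I in [set: set A]].

Definition spectrumB p0 := g_sigma_algebraType (@spectrum_open p0).

Definition discrete_series p0 (d : spectrum p0) : Prop :=
  exists J : {linear 'cV[R[i]]_(irrep_dim (rep_of d)).+1 -> V},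
    (forall u v, inner (J u) (J v) = (adjmx u *m v) 0 0) /\
    (forall a v, J (rep_of d a *m v) = cact a (J v)).

End Spectrum.

Section ComplexIntegral.
Variables (d : measure_display) (T : measurableType d) (R : realType).
Variables (mu : {measure set T -> \bar R}) (f : T -> R[i]).

Definition cintegrable : Prop :=
  mu.-integrable setT (fun x => (complex.Re (f x))%:E) /\
  mu.-integrable setT (fun x => (complex.Im (f x))%:E).

Definition cintegral : R[i] :=
  Complex (\int[mu]_x complex.Re (f x)) (\int[mu]_x complex.Im (f x)).

End ComplexIntegral.

Definition is_plancherel (R : realType) (D : rootDatum) (L : labels R D)
    (H : heckeAlgebra L) (V : hilbertCompletion H) (A : cstarCompletion V)
    (p0 : irrep A) (mu : {measure set (spectrumB p0) -> \bar R}) : Prop :=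
  forall h : H,
    cintegrable mu (fun p : spectrumB p0 => @irrep_char _ _ _ _ _ _ p0 p (cin A h)) /\
    htau H h = cintegral mu (fun p : spectrumB p0 => @irrep_char _ _ _ _ _ _ p0 p (cin A h)).

Definition fdim (R : realType) (D : rootDatum) (L : labels R D)
    (H : heckeAlgebra L) (V : hilbertCompletion H) (A : cstarCompletion V)
    (p0 : irrep A) (mu : {measure set (spectrumB p0) -> \bar R})
    (d : spectrum p0) : \bar R :=
  mu [set d].

Section Torus.
Variables (R : realType) (D : rootDatum).
Local Notation X := (latX D).

(* values are nonzero, since t x * t (- x) = 1 *)
Record torus := TorusPoint {
  tchar :> X -> R[i];
  tchar0 : tchar 0 = 1;
  tcharD : forall x y, tchar (x + y) = tchar x * tchar y
}.

Definition torus1 : torus :=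
  @TorusPoint (fun=> 1) erefl (fun _ _ => esym (mulr1 1)).

HB.instance Definition _ := gen_eqMixin torus.
HB.instance Definition _ := gen_choiceMixin torus.
HB.instance Definition _ := isPointed.Build torus torus1.

(* topology of pointwise convergence on X *)
Definition torus_open : set (set torus) :=
  [set [set t : torus | U (tchar t)] |
    U in @open (prod_topology (fun _ : X => R[i]^o))].

Definition torusB := g_sigma_algebraType torus_open.

(* t and t' = w^-1 t, where (w t)(x) = t (w^-1 x) *)
Definition torus_act (w : X -> X) (t t' : torus) : Prop :=
  forall x, t' x = t (w x).

Definition torus_orbit (t : torus) : set torus :=
  [set t' | exists2 w, W0 w & torus_act w t t'].

Definition teval (z : coefX R D) (t : torus) : R[i] :=
  \sum_(x <- finsupp z) z x * t x.

(* [subtorus n A]: [A] is a subtorus of dimension [n], i.e. the image of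
   (C - {0})^n under n independent cocharacters. *)
Definition subtorus (n : nat) (A : set torus) : Prop :=
  exists y : 'I_n -> latY D,
    (forall c : 'I_n -> int, \sum_i y i *~ c i = 0 -> forall i, c i = 0) /\
    A = [set t | exists z : 'I_n -> R[i], (forall i, z i != 0) /\
          forall x, t x = \prod_i z i ^ pairing x (y i)].

Definition torus_coset (n : nat) (C : set torus) : Prop :=
  exists (A : set torus) (r : torus), subtorus n A /\
    C = [set t : torus | exists2 u : torus, A u & forall x, t x = r x * u x].

(* the subtorus T^C of which C is a coset: all quotients of points of C *)
Definition direction (C : set torus) : set torus :=
  [set u : torus | exists t s : torus, [/\ C t, C s & forall x, u x * s x = t x]].

End Torus.

Section Residual.
Variables (R : realType) (D : rootDatum) (L : labels R D).
Local Notation X := (latX D).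
Local Notation T := (torus R D).

(* a(C) = c *)
Definition const_on (C : set T) (a : X) (c : R[i]) : Prop :=
  forall t, C t -> t a = c.

Definition coset_roots (C : set T) : {fset X} :=
  [fset a in roots D | `[< const_on (direction C) a 1 >]].

Definition pole_roots (C : set T) : {fset X} :=
  [fset a in coset_roots C |
    `[< const_on C a (- (Num.sqrt (qhalf L a))%:C%C) \/
        const_on C a (Num.sqrt (qhalf L a) * qlab L (a, 0))%:C%C >]].

Definition zero_roots (C : set T) : {fset X} :=
  [fset a in coset_roots C | `[< const_on C a 1 \/ const_on C a (- 1) >]].

Definition coset_index (C : set T) : int :=
  #|` pole_roots C|%:Z - #|` zero_roots C|%:Z.

(* [residual n C]: C is a residual coset of dimension n *)
Inductive residual : nat -> set T -> Prop :=
| residual_torus n : torus_coset n [set: T] -> residual n setT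
| residual_step n (C M : set T) : torus_coset n C -> residual n.+1 M -> (C `<=` M)%classic ->
    coset_index M + 1 <= coset_index C -> residual n C.

Definition residual_point (r : T) : Prop := residual 0 [set r].

Definition omit0 (z : R[i]) : R[i] := if z == 0 then 1 else z.

(* For a = 2b with b in R_0, the labels are q_{a^vee} = q_{b^vee/2} and
   q_{2 a^vee} = q_{b^vee}, and a(r)^{1/2} stands for b(r).  For the other
   a in R_1, which lie in R_0, the two factors for a are combined. *)
Definition mdenom (r : T) (a : X) : R[i] :=
  if half_root a is Some b then
    omit0 ((Num.sqrt (qhalf L b))%:C%C * r b + 1) *
    omit0 ((Num.sqrt (qhalf L b) * qlab L (b, 0))%:C%C * r b - 1)
  else omit0 ((qlab L (a, 0))%:C%C * r a - 1).

Definition mres (w0 : X -> X) (r : T) : R[i] :=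
  (qW L w0)%:C%C * (\prod_(a <- roots_1 D) omit0 (r a - 1))
                 / \prod_(a <- roots_1 D) mdenom r a.

End Residual.

Section LocalTraces.
Variables (R : realType) (D : rootDatum) (L : labels R D).
Variables (H : heckeAlgebra L) (V : hilbertCompletion H).
Variable A : cstarCompletion V.

(* the closure of the center Z in the C*-completion *)
Definition center_closure : set A :=
  [set a | forall e : R, 0 < e -> exists2 z, W0_inv z &
             opnorm_le (cact (a - cin A (theta_comb H z))) e].

Definition center_closure_char (phi : A -> R[i]) : Prop :=
  [/\ phi 1 = 1,
      forall (c : R[i]) a b, center_closure a -> center_closure b ->
        phi (c *: a + b) = c * phi a + phi b
    & forall a b, center_closure a -> center_closure b ->
        phi (a * b) = phi a * phi b].

(* preimage in T of the spectrum S of the closure of Z *)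
Definition center_spectrum : set (torus R D) :=
  [set t | exists phi, center_closure_char phi /\
     forall z, W0_inv z -> phi (cin A (theta_comb H z)) = teval z t].

Definition is_nu (nu : probability (torusB R D) R) : Prop :=
  [/\ forall w (B : set (torusB R D)), W0 w -> measurable B ->
        nu [set t' | exists2 t, B t & torus_act w t t'] = nu B,
      nu.-negligible (~` center_spectrum)
    & forall z, W0_inv z -> cintegrable nu (teval z) /\
        htau H (theta_comb H z) = cintegral nu (teval z)].

Definition is_local_trace (nu : probability (torusB R D) R)
    (chi : torus R D -> H -> R[i]) : Prop :=
  [/\ forall h, cintegrable nu (fun t : torusB R D => chi t h),
      forall w t t' h, W0 w -> torus_act w t t' -> chi t' h = chi t h
    & forall z h, W0_inv z -> htau H (theta_comb H z * h) =
        cintegral nu (fun t : torusB R D => teval z t * chi t h)].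

(* irreducible discrete series with central character W_0 r *)
Definition Delta (p0 : irrep A) (r : torus R D) : set (spectrum p0) :=
  [set d | discrete_series d /\ forall z, W0_inv z ->
     rep_of d (cin A (theta_comb H z)) = (teval z r)%:M].

Definition residual_degree (p0 : irrep A) (chi : torus R D -> H -> R[i])
    (r : torus R D) (deg : spectrum p0 -> R) : Prop :=
  (forall d, Delta r d -> 0 < deg d) /\
  (forall h, chi r h =
     \sum_(d \in @Delta p0 r) (deg d)%:C%C * irrep_char d (cin A h)).

End LocalTraces.

(* Submission.v *)
Require Import Defs.
From HB Require Import structures.
From mathcomp Require Import all_boot all_order all_algebra finmap complex.
From mathcomp Require Import all_classical all_reals all_analysis.
From mathcomp Require Import ring lra zify spectral measurable_realfun.
Require Import Defs.

(** The function [x |-> tau (theta_x)] vanishes when the height of [x] is large, and the group algebra element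
    [prod_b (1 + h_b e^b) (1 - c_b e^b)], [b] running over all roots, sends it to [q(w0) prod_b (1 - e^{-2b})]
    applied to the delta function at [0]; this follows from the Bernstein relations and the resulting intertwiners.
    On the other hand [tau (theta_x)] is the integral over the spectrum of [sum_t x(t)], [t] running over the
    weights of a representation.  Let [b_r] be the product of the factors of the denominator that do not vanish
    at [r].  The weights charged by [tau (theta_x b_r)] are no larger than [r] in the directions where [r] is
    dominant, so the behaviour of [tau (theta_x b_r)] along such a direction isolates the atom at [r].  The
    difference equation shows that, after averaging over a box, this function is there an integral multiple of
    [q(w0) prod' (1 - r(-2b))]; hence the atom is a rational multiple of the [W_0]-invariant number [m_{r}(r)];
    the sum of the atoms over the orbit is [nu {W_0 r}].  Finally, let [z_j] be central elements peaking on
    [W_0 r].  Computing the limit of [tau (z_j h)] from [nu] and from the Plancherel measure gives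
    [nu {W_0 r} chi_r = sum_d mu {d} chi_d], a finite sum over the irreducibles with central character [W_0 r];
    their characters are linearly independent. *)

Set Implicit Arguments.
Unset Strict Implicit.
Unset Printing Implicit Defensive.
Import Order.TTheory GRing.Theory Num.Theory.
Import numFieldNormedType.Exports.
Local Open Scope classical_set_scope.
Local Open Scope fset_scope.
Local Open Scope ring_scope.

(** A difference equation determines its solution only within a class of functions on which the
    factors [1 - c e^b] act injectively. Vanishing at large height provides such a class, which is
    why heights are tracked throughout. Denominators are cleared by the product over all roots
    rather than over one, since its W_0-invariance lets it commute with every T_w. The subalgebra A
    is not stable under the star, so no functional calculus is available on it. Functions of weights
    arise as bounded limits of elements of A, and complex conjugates are patched from interpolations
    on finite orbits by means of W_0-invariant cutoffs. After a twist by [r] the factors vanishing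
    at [r] become [1 - e^b], and the twisted trace is a combination of translates of an
    integer-valued partition function. Along a generic ray such a function is comparable to a
    quasi-polynomial. Averaging over a box removes the period, and boundedness, known from the
    spectral side, removes the higher degrees. Integrality then gives rationality. *)

Section GroupAlgebra.

(** * Group algebra of an abelian group *)

Variables (K : comNzRingType) (X : zmodType).

Definition galg := {fsfun X -> K with 0}.
HB.instance Definition _ := Choice.on galg.
Implicit Types f g h : galg.

(** The linear extension of [phi] from the basis elements [e^x]. The ring axioms are tested against
    all such functionals ([gev_eq]), which avoids comparing supports of sums. *)
Definition gev (V : lmodType K) (phi : X -> V) f : V :=
  \sum_(x <- finsupp f) f x *: phi x.

Lemma gevE (V : lmodType K) (phi : X -> V) f (S : {fset X}) :
  finsupp f `<=` S -> gev phi f = \sum_(x <- S) f x *: phi x.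
Proof.
move=> sub; rewrite /gev (big_fsetID _ (mem (finsupp f)) S) /=.
rewrite [X in _ = _ + X]big1_fset ?addr0; last first.
  by move=> x; rewrite !inE /= => /andP[_ /fsfun_dflt ->] _; rewrite scale0r.
apply: eq_fbigl => x; rewrite !inE /=.
by apply/idP/andP => [xf|[]//]; split => //; apply: (fsubsetP sub).
Qed.

Definition gadd f g : galg :=
  [fsfun x in finsupp f `|` finsupp g => f x + g x].
Definition gopp f : galg := [fsfun x in finsupp f => - f x].
Definition gzero : galg := [fsfun].

Lemma gaddE f g x : gadd f g x = f x + g x.
Proof.
rewrite fsfunE inE; case: ifPn => //; rewrite negb_or => /andP[xf xg].
by rewrite !fsfun_dflt // addr0.
Qed.

Lemma goppE f x : gopp f x = - f x.
Proof. by rewrite fsfunE; case: ifPn => // xf; rewrite fsfun_dflt // oppr0. Qed.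

Lemma gzeroE x : gzero x = 0. Proof. by rewrite fsfunE. Qed.

Fact gaddA : associative gadd.
Proof. by move=> f g h; apply/fsfunP => x; rewrite !gaddE addrA. Qed.
Fact gaddC : commutative gadd.
Proof. by move=> f g; apply/fsfunP => x; rewrite !gaddE addrC. Qed.
Fact gadd0 : left_id gzero gadd.
Proof. by move=> f; apply/fsfunP => x; rewrite gaddE gzeroE add0r. Qed.
Fact gaddN : left_inverse gzero gopp gadd.
Proof. by move=> f; apply/fsfunP => x; rewrite gaddE goppE gzeroE addNr. Qed.
HB.instance Definition _ := GRing.isZmodule.Build galg gaddA gaddC gadd0 gaddN.

Lemma galgD f g x : (f + g) x = f x + g x. Proof. exact: gaddE. Qed.
Lemma galgN f x : (- f) x = - f x. Proof. exact: goppE. Qed.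
Lemma galg0 x : (0 : galg) x = 0. Proof. exact: gzeroE. Qed.

Lemma galg_sum I (r : seq I) (P : pred I) (F : I -> galg) x :
  (\sum_(i <- r | P i) F i) x = \sum_(i <- r | P i) F i x.
Proof. by elim/big_rec2: _ => [|i y1 y2 _ <-]; rewrite ?galg0 ?galgD. Qed.

Lemma gevD (V : lmodType K) (phi : X -> V) f g :
  gev phi (f + g) = gev phi f + gev phi g.
Proof.
pose S := finsupp f `|` finsupp g.
have Sfg : finsupp (f + g) `<=` S.
  apply/fsubsetP => x; rewrite !mem_finsupp galgD.
  by apply: contraR; rewrite !inE negb_or !mem_finsupp !negbK => /andP[/eqP-> /eqP->]; rewrite addr0.
rewrite (gevE _ Sfg) (@gevE _ _ f S) ?fsubsetUl // (@gevE _ _ g S) ?fsubsetUr //.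
by rewrite -big_split; apply: eq_bigr => x _; rewrite galgD scalerDl.
Qed.

Lemma gev0 (V : lmodType K) (phi : X -> V) : gev phi 0 = 0.
Proof. by apply: (addrI (gev phi 0)); rewrite -gevD !addr0. Qed.

Lemma gev_sum (V : lmodType K) (phi : X -> V) I (r : seq I) (P : pred I) (F : I -> galg) :
  gev phi (\sum_(i <- r | P i) F i) = \sum_(i <- r | P i) gev phi (F i).
Proof. by elim/big_rec2: _ => [|i y1 y2 _ <-]; rewrite ?gev0 ?gevD. Qed.

Definition gmono (c : K) (x : X) : galg := [fsfun y in [fset x] => c].

Lemma gmonoE c x y : gmono c x y = if y == x then c else 0.
Proof. by rewrite fsfunE inE. Qed.

Lemma gev_mono (V : lmodType K) (phi : X -> V) c x : gev phi (gmono c x) = c *: phi x.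
Proof.
rewrite (@gevE _ _ _ [fset x]); first by rewrite big_seq_fset1 gmonoE eqxx.
by apply/fsubsetP => y; rewrite mem_finsupp gmonoE inE; case: (y == x); rewrite ?eqxx.
Qed.

Lemma galgE f : f = \sum_(x <- finsupp f) gmono (f x) x.
Proof.
apply/fsfunP => y; rewrite galg_sum.
have [yf|yf] := boolP (y \in finsupp f).
  rewrite (big_rem y) //= gmonoE eqxx big_seq big1 ?addr0 // => x.
  by rewrite (rem_filter _ (fset_uniq _)) mem_filter gmonoE => /andP[/= xy _]; rewrite eq_sym (negPf xy).
rewrite fsfun_dflt // big_seq big1 // => x xf; rewrite gmonoE.
by case: eqP => // yx; rewrite -yx (negPf yf) in xf.
Qed.

Definition gmul f g : galg :=
  \sum_(x <- finsupp f) \sum_(y <- finsupp g) gmono (f x * g y) (x + y).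

Lemma gev_mul (V : lmodType K) (phi : X -> V) f g :
  gev phi (gmul f g) = gev (fun x => gev (fun y => phi (x + y)) g) f.
Proof.
rewrite /gmul gev_sum {2}/gev; apply: eq_bigr => x _.
rewrite gev_sum [in RHS]/gev scaler_sumr; apply: eq_bigr => y _.
by rewrite gev_mono scalerA.
Qed.

Lemma galg_coef f z : f z = gev (fun x => (x == z)%:R : K^o) f.
Proof.
rewrite {1}(galgE f) galg_sum; apply: eq_bigr => x _.
by rewrite gmonoE eq_sym /GRing.scale /=; case: eqP; rewrite ?mulr1 ?mulr0.
Qed.

Lemma gev_eq f g : (forall phi : X -> K^o, gev phi f = gev phi g) -> f = g.
Proof. by move=> H; apply/fsfunP => z; rewrite !galg_coef H. Qed.

Lemma eq_gev (V : lmodType K) (phi psi : X -> V) f : phi =1 psi -> gev phi f = gev psi f.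
Proof. by move=> H; apply: eq_bigr => x _; rewrite H. Qed.

Fact gmulA : associative gmul.
Proof.
move=> f g h; apply: gev_eq => phi; rewrite !gev_mul; apply: eq_gev => x.
by rewrite gev_mul; apply: eq_gev => y; apply: eq_gev => z; rewrite addrA.
Qed.

Fact gmulC : commutative gmul.
Proof.
move=> f g; apply: gev_eq => phi; rewrite !gev_mul /gev.
under eq_bigr do rewrite scaler_sumr.
rewrite exchange_big; apply: eq_bigr => y _; rewrite scaler_sumr.
by apply: eq_bigr => x _; rewrite !scalerA mulrC addrC.
Qed.

Definition gone : galg := gmono 1 0.

Fact gmul1 : left_id gone gmul.
Proof.
move=> f; apply: gev_eq => phi; rewrite gev_mul gev_mono scale1r.
by apply: eq_gev => x; rewrite add0r.
Qed.

Fact gmulDl : left_distributive gmul gadd.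
Proof.
by move=> f g h; apply: gev_eq => phi; rewrite gev_mul gevD [RHS]gevD !gev_mul.
Qed.

Fact gone_neq0 : gone != 0.
Proof.
apply/eqP => /fsfunP/(_ 0); rewrite gmonoE eqxx galg0.
by apply/eqP/oner_neq0.
Qed.

HB.instance Definition _ :=
  GRing.Zmodule_isComNzRing.Build galg gmulA gmulC gmul1 gmulDl gone_neq0.

Lemma gevM (V : lmodType K) (phi : X -> V) f g :
  gev phi (f * g) = gev (fun x => gev (fun y => phi (x + y)) g) f.
Proof. exact: gev_mul. Qed.

Lemma gmonoM c d x y : gmono c x * gmono d y = gmono (c * d) (x + y).
Proof.
by apply: gev_eq => phi; rewrite gevM !gev_mono scalerA.
Qed.

Lemma gmonoD c d x : gmono c x + gmono d x = gmono (c + d) x.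
Proof. by apply: gev_eq => phi; rewrite gevD !gev_mono scalerDl. Qed.

Lemma gmono1 : gmono 1 0 = 1. Proof. by []. Qed.

Lemma gevN (V : lmodType K) (phi : X -> V) f : gev phi (- f) = - gev phi f.
Proof. by apply: (addrI (gev phi f)); rewrite -gevD !subrr gev0. Qed.

Definition gpush (w : X -> X) f : galg := \sum_(x <- finsupp f) gmono (f x) (w x).

Lemma gev_push (V : lmodType K) (phi : X -> V) w f :
  gev phi (gpush w f) = gev (phi \o w) f.
Proof. by rewrite /gpush gev_sum; apply: eq_bigr => x _; rewrite gev_mono. Qed.

Lemma gpushD w f g : gpush w (f + g) = gpush w f + gpush w g.
Proof. by apply: gev_eq => phi; rewrite gev_push !gevD !gev_push. Qed.

Lemma gpush_mono w c x : gpush w (gmono c x) = gmono c (w x).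
Proof. by apply: gev_eq => phi; rewrite gev_push !gev_mono. Qed.

Lemma gpush_comp w v f : gpush w (gpush v f) = gpush (w \o v) f.
Proof. by apply: gev_eq => phi; rewrite !gev_push. Qed.

Lemma gpush0 w : gpush w 0 = 0.
Proof. by apply: (addrI (gpush w 0)); rewrite -gpushD !addr0. Qed.

Lemma gpushN w f : gpush w (- f) = - gpush w f.
Proof. by apply: (addrI (gpush w f)); rewrite -gpushD !subrr gpush0. Qed.

Lemma gpushM w f g : {morph w : x y / x + y} ->
  gpush w (f * g) = gpush w f * gpush w g.
Proof.
move=> wD; apply: gev_eq => phi; rewrite !(gev_push, gevM).
by apply: eq_gev => x /=; rewrite gev_push; apply: eq_gev => y; rewrite /= wD.
Qed.

Lemma gpush1 w : w 0 = 0 -> gpush w 1 = 1.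
Proof. by move=> w0; rewrite -gmono1 gpush_mono w0. Qed.

Lemma gpush_coef w w' f x : cancel w w' -> cancel w' w -> gpush w f x = f (w' x).
Proof.
move=> wK wK'; rewrite !galg_coef gev_push; apply: (@eq_gev K^o) => y /=.
by congr (_%:R); rewrite (can2_eq wK wK').
Qed.

Lemma gpush_id f : gpush id f = f.
Proof. by apply: gev_eq => phi; rewrite gev_push. Qed.

Lemma gind (P : galg -> Prop) : P 0 -> (forall c x, P (gmono c x)) ->
  (forall f g, P f -> P g -> P (f + g)) -> forall f, P f.
Proof. by move=> P0 Pm PD f; rewrite (galgE f); elim/big_rec: _ => // x y _; apply: PD. Qed.

(** The basis element [e^z] acts by [F -> F(. + z)], so the group algebra acts by difference
    operators with constant coefficients. *)
Definition gact (f : galg) (F : X -> K) (x : X) : K :=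
  \sum_(z <- finsupp f) f z * F (x + z).

Lemma gactE f F x : gact f F x = gev (fun z => F (x + z) : K^o) f.
Proof. by []. Qed.

Lemma gactM f g F : gact (f * g) F = gact f (gact g F).
Proof.
apply/funext => x; rewrite !gactE gevM; apply: (@eq_gev K^o) => z.
by rewrite gactE; apply: (@eq_gev K^o) => z'; rewrite addrA.
Qed.

Lemma gactD f g F x : gact (f + g) F x = gact f F x + gact g F x.
Proof. by rewrite !gactE gevD. Qed.

Lemma gactN f F x : gact (- f) F x = - gact f F x.
Proof. by rewrite !gactE gevN. Qed.

Lemma gact_mono c z F x : gact (gmono c z) F x = c * F (x + z).
Proof. by rewrite gactE gev_mono. Qed.

Lemma gact1 F : gact 1 F = F.

Proof. by apply/funext => x; rewrite gact_mono mul1r addr0. Qed.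

End GroupAlgebra.

Lemma perm_map_stable (T : eqType) (f : T -> T) (s : seq T) : uniq s ->
  injective f -> (forall x, x \in s -> f x \in s) -> perm_eq (map f s) s.
Proof.
move=> us fI fs.
have um : uniq (map f s) by rewrite map_inj_uniq.
have sub : {subset map f s <= s} by move=> y /mapP[x xs ->]; apply: fs.
have [|_ eqs] := uniq_min_size um sub; first by rewrite size_map.
exact: uniq_perm.
Qed.

Lemma big_if1 (V : nmodType) (T : eqType) (s : seq T) (t : T) (G : T -> V) :
  uniq s -> t \in s -> \sum_(f <- s) (if f == t then G f else 0) = G t.
Proof.
by move=> us ts; rewrite -big_mkcond -big_filter filter_pred1_uniq // big_seq1.
Qed.

(** * Root data: reflections and the invariant form *)

Section RootDatum.
Variable D : rootDatum.
Local Notation X := (latX D).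
Local Notation Y := (latY D).
Local Notation pr := (@pairing D).
Implicit Types (x : X) (y : Y) (a b : X).

Lemma pr0l y : pr 0 y = 0.
Proof. by apply: (addrI (pr 0 y)); rewrite -pairingDl !addr0. Qed.
Lemma pr0r x : pr x 0 = 0.
Proof. by apply: (addrI (pr x 0)); rewrite -pairingDr !addr0. Qed.
Lemma prNl x y : pr (- x) y = - pr x y.
Proof. by apply: (addrI (pr x y)); rewrite -pairingDl !subrr pr0l. Qed.
Lemma prNr x y : pr x (- y) = - pr x y.
Proof. by apply: (addrI (pr x y)); rewrite -pairingDr !subrr pr0r. Qed.
Lemma prBl x x' y : pr (x - x') y = pr x y - pr x' y.
Proof. by rewrite pairingDl prNl. Qed.
Lemma prBr x y y' : pr x (y - y') = pr x y - pr x y'.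
Proof. by rewrite pairingDr prNr. Qed.
Lemma prMnl x y n : pr (x *+ n) y = pr x y *+ n.
Proof. by elim: n => [|n IH]; rewrite ?pr0l // !mulrS pairingDl IH. Qed.
Lemma prMnr x y n : pr x (y *+ n) = pr x y *+ n.
Proof. by elim: n => [|n IH]; rewrite ?pr0r // !mulrS pairingDr IH. Qed.
Lemma prMzl x y (n : int) : pr (x *~ n) y = n * pr x y.
Proof.
case: n => n; first by rewrite -pmulrn prMnl -mulr_natl natz.
by rewrite NegzE mulrNz -pmulrn prNl prMnl mulNr -[X in - (X * _)]natz mulr_natl.
Qed.
Lemma prMzr x y (n : int) : pr x (y *~ n) = n * pr x y.
Proof.
case: n => n; first by rewrite -pmulrn prMnr -mulr_natl natz.
by rewrite NegzE mulrNz -pmulrn prNr prMnr mulNr -[X in - (X * _)]natz mulr_natl.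
Qed.
Lemma pr_suml I (r : seq I) (P : pred I) (F : I -> X) y :
  pr (\sum_(i <- r | P i) F i) y = \sum_(i <- r | P i) pr (F i) y.
Proof. by elim/big_rec2: _ => [|i z1 z2 _ <-]; rewrite ?pr0l ?pairingDl. Qed.
Lemma pr_sumr I (r : seq I) (P : pred I) (F : I -> Y) x :
  pr x (\sum_(i <- r | P i) F i) = \sum_(i <- r | P i) pr x (F i).
Proof. by elim/big_rec2: _ => [|i z1 z2 _ <-]; rewrite ?pr0r ?pairingDr. Qed.

Lemma pr_injr y y' : (forall x, pr x y = pr x y') -> y = y'.
Proof.
move=> H; pose f : X -> int := fun x => pr x y.
have fB : zmod_morphism f by move=> u v; rewrite /f prBl.
pose fA : {additive X -> int} := HB.pack f (GRing.isZmodMorphism.Build _ _ f fB).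
have [z [_ zU]] := perfectl fA.
by rewrite -(zU y) // -(zU y') // => x; rewrite -H.
Qed.

Definition srefl a x : X := x - a *~ pr x (coroot a).
Definition csrefl a y : Y := y - coroot a *~ pr a y.

Lemma aff_refl0 a : aff_refl (a, 0) = srefl a.
Proof. by apply/funext => x; rewrite /aff_refl /aff_eval /srefl /= addr0. Qed.

Lemma sreflD a x x' : srefl a (x + x') = srefl a x + srefl a x'.
Proof. by rewrite /srefl pairingDl mulrzDr opprD addrACA. Qed.
Lemma srefl0 a : srefl a 0 = 0.
Proof. by apply: (addrI (srefl a 0)); rewrite -sreflD !addr0. Qed.
Lemma sreflN a x : srefl a (- x) = - srefl a x.
Proof. by apply: (addrI (srefl a x)); rewrite -sreflD !subrr srefl0. Qed.

Lemma sreflK a : a \in roots D -> involutive (srefl a).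
Proof.
move=> ar x; rewrite /srefl prBl prMzl pairing_coroot //.
by rewrite -!addrA -!mulrNz -!mulrzDr [X in _ *~ X](_ : _ = 0) ?mulr0z ?addr0 //; ring.
Qed.

Lemma csreflK a : a \in roots D -> involutive (csrefl a).
Proof.
move=> ar y; rewrite /csrefl prBr prMzr pairing_coroot //.
by rewrite -!addrA -!mulrNz -!mulrzDr [X in _ *~ X](_ : _ = 0) ?mulr0z ?addr0 //; ring.
Qed.

Lemma pr_srefl a x y : pr (srefl a x) y = pr x (csrefl a y).
Proof. by rewrite prBl prMzl prBr prMzr mulrC. Qed.

Lemma srefl_self a : a \in roots D -> srefl a a = - a.
Proof.
by move=> ar; rewrite /srefl pairing_coroot // -{1}[a]mulr1z -mulrzBr.
Qed.

Lemma srefl_root a b : a \in roots D -> b \in roots D -> srefl a b \in roots D.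
Proof. exact: roots_refl. Qed.

Lemma rootN a : a \in roots D -> - a \in roots D.
Proof. by move=> ar; rewrite -srefl_self // srefl_root. Qed.

Lemma rootNE a : (- a \in roots D) = (a \in roots D).
Proof. by apply/idP/idP => [/rootN|/rootN//]; rewrite opprK. Qed.

Lemma root_neq0 a : a \in roots D -> a != 0.
Proof.
by move=> ar; apply/eqP => a0; have := pairing_coroot ar; rewrite {1}a0 pr0l.
Qed.

(** The canonical invariant form. It supplies integral root lengths in a datum that carries no
    scalar product, and its invariance rests only on the reflections permuting the coroots. *)
Definition cform (x x' : X) : int := \sum_(b <- roots D) pr x (coroot b) * pr x' (coroot b).

Lemma cformC x x' : cform x x' = cform x' x.
Proof. by apply: eq_bigr => b _; rewrite mulrC. Qed.
Lemma cformDl x1 x2 x : cform (x1 + x2) x = cform x1 x + cform x2 x.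
Proof. by rewrite -big_split; apply: eq_bigr => b _; rewrite pairingDl mulrDl. Qed.
Lemma cformMzl x x' n : cform (x *~ n) x' = n * cform x x'.
Proof. by rewrite mulr_sumr; apply: eq_bigr => b _; rewrite prMzl mulrA. Qed.
Lemma cformNl x x' : cform (- x) x' = - cform x x'.
Proof. by rewrite -mulrN1z cformMzl mulN1r. Qed.
Lemma cformDr x1 x2 x : cform x (x1 + x2) = cform x x1 + cform x x2.
Proof. by rewrite cformC cformDl !(cformC x). Qed.
Lemma cformMzr x x' n : cform x (x' *~ n) = n * cform x x'.
Proof. by rewrite cformC cformMzl cformC. Qed.
Lemma cformNr x x' : cform x (- x') = - cform x x'.
Proof. by rewrite cformC cformNl cformC. Qed.
Lemma cform0l x : cform 0 x = 0.
Proof. by rewrite -(mulr0z 0) cformMzl mul0r. Qed.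
Lemma cform_sumr I (r : seq I) (P : pred I) (F : I -> X) x :
  cform x (\sum_(i <- r | P i) F i) = \sum_(i <- r | P i) cform x (F i).
Proof.
elim/big_rec2: _ => [|i z1 z2 _ <-]; first by rewrite cformC cform0l.
by rewrite cformDr.
Qed.

Lemma cform_srefl a x x' : a \in roots D ->
  cform (srefl a x) (srefl a x') = cform x x'.
Proof.
move=> ar; pose cr := [seq coroot b | b <- roots D].
have ucr : uniq cr by rewrite map_inj_in_uniq ?fset_uniq //; exact: coroot_inj.
have E u v : cform u v = \sum_(c <- cr) pr u c * pr v c by rewrite big_map.
rewrite !E -[RHS](perm_big _ (@perm_map_stable _ (csrefl a) _ ucr (inv_inj (csreflK ar)) _)) /=.
  by rewrite big_map; apply: eq_bigr => c _; rewrite !pr_srefl.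
move=> c /mapP[b br ->]; have [d dr dE] := coroots_refl ar br.
by rewrite /csrefl -dE map_f.
Qed.

Lemma cform_ge0 x : 0 <= cform x x.
Proof. by apply: sumr_ge0 => b _; rewrite -expr2 sqr_ge0. Qed.

Lemma cform_root_gt0 a : a \in roots D -> 0 < cform a a.
Proof.
move=> ar; rewrite /cform (big_rem a) //= pairing_coroot //.
by apply: ltr_wpDr => //; apply: sumr_ge0 => b _; rewrite -expr2 sqr_ge0.
Qed.

Lemma cform_coroot x a : a \in roots D ->
  2 * cform x a = pr x (coroot a) * cform a a.
Proof.
move=> ar; have := cform_srefl x a ar.
rewrite srefl_self // cformNr /srefl cformDl cformNl cformMzl.
by move=> H; lia.
Qed.

(** [coroots_refl] only provides some root for the reflected coroot. Since <x, b^vee> is 2(x, b)/(b,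
    b) for an invariant form, that root must be [srefl a b]. *)
Lemma coroot_srefl a b x : a \in roots D -> b \in roots D ->
  pr x (coroot (srefl a b)) = pr (srefl a x) (coroot b).
Proof.
move=> ar br.
have bb : cform (srefl a b) (srefl a b) = cform b b by rewrite cform_srefl.
have b0 := cform_root_gt0 br.
apply: (mulIf (lt0r_neq0 b0)).
rewrite -{1}bb -!cform_coroot ?srefl_root //; congr (_ * _).
by rewrite -[in RHS](cform_srefl _ _ ar) sreflK.
Qed.

Lemma corootN x a : a \in roots D -> pr x (coroot (- a)) = - pr x (coroot a).
Proof.
move=> ar; rewrite -srefl_self // coroot_srefl // /srefl prBl prMzl pairing_coroot //.
by ring.
Qed.

(** * Positive roots *)

Lemma pos_rootP b : reflect (b \in roots D /\
  exists c : X -> nat, b = \sum_(a <- simple D) a *+ c a) (b \in pos_roots D).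
Proof.
rewrite !inE /=; apply: (iffP andP) => [[br /asboolP cb]|[br cb]]; split=> //.
exact/asboolP.
Qed.

Lemma pos_root_root b : b \in pos_roots D -> b \in roots D.
Proof. by case/pos_rootP. Qed.

Lemma pos_or_neg b : b \in roots D -> (b \in pos_roots D) || (- b \in pos_roots D).
Proof.
move=> br; have [c [H|H]] := simple_basis br.
  by apply/orP; left; apply/pos_rootP; split => //; exists c.
by apply/orP; right; apply/pos_rootP; split; [exact: rootN|exists c; rewrite H opprK].
Qed.

Lemma pos_neg b : b \in pos_roots D -> - b \notin pos_roots D.
Proof.
move=> /pos_rootP[br [c cE]]; apply/negP => /pos_rootP[_ [d dE]].
have H : \sum_(a <- simple D) a *~ ((c a)%:Z + (d a)%:Z) = 0.
  rewrite (eq_bigr (fun a => a *+ c a + a *+ d a)) ?big_split /= -?cE -?dE ?subrr //.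
  by move=> a _; rewrite mulrzDr -!pmulrn.
have c0 a : a \in simple D -> c a = 0%N by move=> /(simple_free H); lia.
have := root_neq0 br; rewrite cE big_seq big1 ?eqxx // => a /c0 ->.
by rewrite mulr0n.
Qed.

Lemma simple_pos a : a \in simple D -> a \in pos_roots D.
Proof.
move=> aS; apply/pos_rootP; split; first exact: (fsubsetP (@simple_sub D)).
exists (fun b => (b == a : nat)).
rewrite (big_rem a) //= eqxx mulr1n big_seq big1 ?addr0 // => b.
rewrite (rem_filter _ (fset_uniq _)) mem_filter => /andP[/= /negPf -> _].
by rewrite mulr0n.
Qed.

Lemma simple_root a : a \in simple D -> a \in roots D.
Proof. by move=> /simple_pos/pos_root_root. Qed.

(** As the roots are reduced, a positive root other than [a] has a positive coefficient at another
    simple root [g]. The reflection in [a] does not change that coefficient, so the image cannot be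
    negative. *)
Lemma simple_perm a b : a \in simple D -> b \in pos_roots D -> b != a ->
  srefl a b \in pos_roots D.
Proof.
move=> aS bp ba; have ar := simple_root aS.
have [br [c cE]] := pos_rootP _ bp.
have [g [gS ga gc]] : exists g, [/\ g \in simple D, g != a & c g != 0%N].
  apply: contrapT => H.
  have bE : b = a *~ (c a)%:Z.
    rewrite cE (big_rem a) //= big_seq big1 ?addr0 ?pmulrn // => g.
    rewrite (rem_filter _ (fset_uniq _)) mem_filter => /andP[/= ga gS].
    have [->|gc] := eqVneq (c g) 0%N; first by rewrite mulr0n.
    by case: H; exists g.
  have ca : (c a)%:Z != 0.
    apply: contraTneq (root_neq0 br) => c0.
    by rewrite bE c0 mulr0z eqxx.
  have [E|E] := @roots_reduced D a b (c a) 1 ar br ca (etrans (esym bE) (esym (mulr1z _))).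
    by rewrite E eqxx in ba.
  by have := pos_neg (simple_pos aS); rewrite -E bp.
have sr := srefl_root ar br.
have /orP[//|/pos_rootP[_ [d dE]]] := pos_or_neg sr.
set m := pr b (coroot a) in dE.
have H : \sum_(f <- simple D) f *~ ((c f)%:Z + (d f)%:Z - (if f == a then m else 0)) = 0.
  rewrite (eq_bigr (fun f => (f *+ c f + f *+ d f) - (if f == a then f *~ m else 0))); last first.
    by move=> f _; rewrite mulrzBr mulrzDr -!pmulrn; case: eqP; rewrite ?mulr0z.
  rewrite sumrB big_split /= -cE -dE.
  rewrite (big_rem a) //= eqxx big_seq big1 ?addr0; last first.
    by move=> f; rewrite (rem_filter _ (fset_uniq _)) mem_filter => /andP[/= /negPf ->].
  by rewrite /srefl -/m opprB addrCA subrr addr0 subrr.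
have := simple_free H gS; rewrite (negPf ga) subr0.
by move: gc; case: (c g) => // n _; lia.
Qed.

Lemma simple_perm_eq a : a \in simple D ->
  perm_eq [seq srefl a b | b <- [seq b <- pos_roots D | b != a]] [seq b <- pos_roots D | b != a].
Proof.
move=> aS; have ar := simple_root aS; apply: perm_map_stable.
- by rewrite filter_uniq ?fset_uniq.
- exact: inv_inj (sreflK ar).
- move=> b; rewrite !mem_filter => /andP[ba bp]; rewrite simple_perm // andbT.
  apply: contraTneq bp => /(congr1 (srefl a)); rewrite sreflK // srefl_self // => ->.
  by apply: pos_neg; rewrite simple_pos.
Qed.

Lemma big_pos_simple a (F : X -> int) : a \in simple D ->
  \sum_(b <- pos_roots D) F b = F a + \sum_(b <- pos_roots D | b != a) F b.
Proof.
move=> aS; rewrite (bigID (fun b => b == a)) /=; congr (_ + _).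
rewrite -big_filter (_ : [seq i <- _ | i == a] = [:: a]) ?big_seq1 //.
by rewrite filter_pred1_uniq ?fset_uniq // simple_pos.
Qed.

Lemma big_pos_srefl a (F : X -> int) : a \in simple D ->
  \sum_(b <- pos_roots D | b != a) F (srefl a b) = \sum_(b <- pos_roots D | b != a) F b.
Proof.
move=> aS; rewrite -[RHS]big_filter -[LHS]big_filter.
by rewrite -[RHS](perm_big _ (simple_perm_eq aS)) big_map.
Qed.

(** The pairing with the sum of the positive coroots: twice the usual height on the root lattice. *)
Definition ht x : int := \sum_(b <- pos_roots D) pr x (coroot b).

Lemma htD x x' : ht (x + x') = ht x + ht x'.
Proof. by rewrite -big_split; apply: eq_bigr => b _; rewrite pairingDl. Qed.
Lemma htMz x n : ht (x *~ n) = n * ht x.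
Proof. by rewrite mulr_sumr; apply: eq_bigr => b _; rewrite prMzl. Qed.
Lemma htN x : ht (- x) = - ht x.
Proof. by rewrite -mulrN1z htMz mulN1r. Qed.
Lemma ht0 : ht 0 = 0. Proof. by rewrite -(mulr0z 0) htMz mul0r. Qed.

Lemma ht_simple a : a \in simple D -> ht a = 2.
Proof.
move=> aS; have ar := simple_root aS.
rewrite /ht (big_pos_simple _ aS) pairing_coroot //.
suff : \sum_(b <- pos_roots D | b != a) pr a (coroot b) =
     - \sum_(b <- pos_roots D | b != a) pr a (coroot b) by lia.
rewrite -{1}(big_pos_srefl (fun b => pr a (coroot b)) aS) -sumrN [LHS]big_seq_cond [RHS]big_seq_cond.
apply: eq_bigr => b /andP[bp _].
by rewrite (coroot_srefl _ ar (pos_root_root bp)) srefl_self // prNl.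
Qed.

Lemma ht_pos b : b \in pos_roots D -> 0 < ht b.
Proof.
move=> /pos_rootP[br [c cE]].
have E : ht b = \sum_(a <- simple D) (c a)%:Z * 2.
  rewrite {1}cE /ht; under eq_bigr do rewrite pr_suml.
  rewrite exchange_big /=; apply: eq_big_seq => a aS.
  by rewrite -(ht_simple aS) /ht mulr_sumr; apply: eq_bigr => d _; rewrite pmulrn prMzl.
rewrite lt_neqAle; apply/andP; split; last first.
  by rewrite E; apply: sumr_ge0 => a _; lia.
apply: contraTneq (root_neq0 br) => /esym; rewrite E => /eqP.
rewrite psumr_eq0 => [/allP H|a _]; last by lia.
rewrite cE big_seq big1 ?eqxx // => a aS.
by have := H a aS => /= /eqP; case: (c a) => [_|n]; rewrite ?mulr0n //; lia.
Qed.

Definition rho2 : X := \sum_(b <- pos_roots D) b.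

Lemma rho2_simple a : a \in simple D -> pr rho2 (coroot a) = 2.
Proof.
move=> aS; have ar := simple_root aS.
rewrite /rho2 pr_suml (big_pos_simple _ aS) pairing_coroot //.
suff : \sum_(b <- pos_roots D | b != a) pr b (coroot a) =
     - \sum_(b <- pos_roots D | b != a) pr b (coroot a) by lia.
rewrite -{1}(big_pos_srefl (fun b => pr b (coroot a)) aS) -sumrN.
apply: eq_bigr => b _.
by rewrite /srefl prBl prMzl pairing_coroot //; ring.
Qed.

(** Expands (b, b)<x, b^vee> = 2(x, b) along the simple roots; the factor [cform b b] keeps the
    coefficients integral. *)
Lemma pos_coroot b : b \in pos_roots D -> exists c : X -> int,
  (forall a, a \in simple D -> 0 <= c a) /\
  forall x, cform b b * pr x (coroot b) = \sum_(a <- simple D) c a * pr x (coroot a).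
Proof.
move=> /pos_rootP[br [c cE]]; exists (fun a => (c a)%:Z * cform a a); split.
  by move=> a aS; rewrite mulr_ge0 ?cform_ge0.
move=> x; rewrite mulrC -cform_coroot // [in LHS]cE cform_sumr mulr_sumr.
apply: eq_big_seq => a /simple_root ar.
by rewrite pmulrn cformMzr mulrCA cform_coroot // -mulrA; congr (_ * _); rewrite mulrC.
Qed.

Lemma dominant_simple x : (forall a, a \in simple D -> 0 <= pr x (coroot a)) -> dominant x.
Proof.
move=> H b bp; have [c [c0 cE]] := pos_coroot bp.
rewrite -(pmulr_rge0 _ (cform_root_gt0 (pos_root_root bp))) cE big_seq.
by apply: sumr_ge0 => a aS; rewrite mulr_ge0 ?c0 ?H.
Qed.

Lemma rho2_pos b : b \in pos_roots D -> 0 < pr rho2 (coroot b).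
Proof.
move=> bp; have [c [c0 cE]] := pos_coroot bp.
have b0 := cform_root_gt0 (pos_root_root bp).
rewrite -(pmulr_rgt0 _ b0) cE lt_neqAle big_seq sumr_ge0 ?andbT; last first.
  by move=> a aS; rewrite rho2_simple // mulr_ge0 ?c0.
rewrite eq_sym; apply/eqP => /eqP; rewrite psumr_eq0; last first.
  by move=> a aS; rewrite rho2_simple // mulr_ge0 ?c0.
move=> /allP H.
have := cE b; rewrite pairing_coroot ?pos_root_root // big_seq big1; last first.
  move=> a aS; have := H a aS; rewrite aS rho2_simple //= mulf_eq0 orbF => /eqP->.
  by rewrite mul0r.
by lia.
Qed.

(** [srefl b a] is positive by [simple_perm], and its coefficient at [b] is the negative of this
    pairing. *)
Lemma simple_pr_le0 a b : a \in simple D -> b \in simple D -> a != b ->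
  pr a (coroot b) <= 0.
Proof.
move=> aS bS ab; have ar := simple_root aS; have br := simple_root bS.
have /pos_rootP[_ [d dE]] := simple_perm bS (simple_pos aS) ab.
have H : \sum_(f <- simple D) f *~ ((d f)%:Z - (f == a)%:Z + (if f == b then pr a (coroot b) else 0)) = 0.
  rewrite (eq_bigr (fun f => (f *+ d f - (if f == a then f else 0)) + (if f == b then f *~ pr a (coroot b) else 0))); last first.
    by move=> f _; rewrite mulrzDr mulrzBr -!pmulrn; case: (f == a); case: (f == b); rewrite ?mulr0z ?mulr0n ?mulr1n.
  rewrite big_split sumrB /= -dE !big_if1 ?fset_uniq // /srefl.
  by rewrite [a - _]addrC addrK addNr.
have := simple_free H bS; rewrite eqxx eq_sym (negPf ab) /=; lia.
Qed.

End RootDatum.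

Section AffineWeyl.
Variable D : rootDatum.
Local Notation X := (latX D).
Local Notation Y := (latY D).
Local Notation pr := (@pairing D).
Implicit Types (x : X) (y : Y) (w v g : X -> X).

(** * The finite and the affine Weyl group *)

Lemma W0D w : @W0 D w -> {morph w : x x' / x + x'}.
Proof.
elim=> [//|a v ar _ IH] x x' /=.
by rewrite IH aff_refl0 sreflD.
Qed.

Lemma W0_0 w : @W0 D w -> w 0 = 0.
Proof. by move=> ww; apply: (addrI (w 0)); rewrite -W0D // !addr0. Qed.
Lemma W0N w x : @W0 D w -> w (- x) = - w x.
Proof. by move=> ww; apply: (addrI (w x)); rewrite -W0D // !subrr W0_0. Qed.
Lemma W0B w x x' : @W0 D w -> w (x - x') = w x - w x'.
Proof. by move=> ww; rewrite W0D // W0N. Qed.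
Lemma W0Mn w x n : @W0 D w -> w (x *+ n) = w x *+ n.
Proof. by move=> ww; elim: n => [|n IH]; rewrite ?mulr0n ?W0_0 // !mulrS W0D // IH. Qed.
Lemma W0Mz w x (n : int) : @W0 D w -> w (x *~ n) = w x *~ n.
Proof.
move=> ww; case: n => n; first by rewrite -!pmulrn W0Mn.
by rewrite NegzE !mulrNz W0N // -!pmulrn W0Mn.
Qed.

Lemma W0_comp w v : @W0 D w -> W0 v -> W0 (w \o v).
Proof. by elim=> [//|a u ar _ IH] vv; apply: (W0_refl ar (IH vv)). Qed.

Lemma W0_srefl a : a \in roots D -> W0 (srefl a).
Proof. by move=> ar; rewrite -aff_refl0; apply: (W0_refl ar (W0_id D)). Qed.

Lemma W0_inv_ex w : @W0 D w -> exists v, [/\ W0 v, w \o v = id & v \o w = id].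
Proof.
elim=> [|a u ar _ [v [vv uv vu]]]; first by exists id; split=> //; apply: W0_id.
exists (v \o srefl a); split; first by apply: W0_comp => //; apply: W0_srefl.
- apply/funext => x; rewrite /= aff_refl0.
  by have := congr1 (@^~ (srefl a x)) uv => /= ->; rewrite sreflK.
- apply/funext => x; rewrite /= aff_refl0 sreflK //.
  by have := congr1 (@^~ x) vu.
Qed.

(** Elements of [W] are plain functions, so inverses are chosen; the default [id] occurs only for
    maps without a two-sided inverse. *)
Definition winv g : X -> X :=
  if pselect (exists v : X -> X, g \o v = id /\ v \o g = id) is left e
  then projT1 (cid e) else id.

Lemma winv_uniq g v : g \o v = id -> v \o g = id -> winv g = v.
Proof.
move=> gv vg; have [gi ig] : g \o winv g = id /\ winv g \o g = id.
  rewrite /winv; case: pselect => [e|[]]; last by exists v.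
  exact: (projT2 (cid e)).
apply/funext => x; have -> : v x = (winv g \o g) (v x) by rewrite ig.
by rewrite /= (congr1 (@^~ x) gv : g (v x) = x).
Qed.

Lemma W0_winv w : @W0 D w -> W0 (winv w).
Proof. by move=> /W0_inv_ex[v [vv wv vw]]; rewrite (winv_uniq wv vw). Qed.

Lemma W0_winvK w : @W0 D w -> cancel w (winv w).
Proof.
move=> /W0_inv_ex[v [vv wv vw]] x; rewrite (winv_uniq wv vw).
exact: (congr1 (@^~ x) vw).
Qed.

Lemma W0_winvKr w : @W0 D w -> cancel (winv w) w.
Proof.
move=> /W0_inv_ex[v [vv wv vw]] x; rewrite (winv_uniq wv vw).
exact: (congr1 (@^~ x) wv).
Qed.

Lemma W0_inj w : @W0 D w -> injective w.
Proof. by move=> ww; apply: can_inj (W0_winvK ww). Qed.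

Lemma W0_root w b : @W0 D w -> (w b \in roots D) = (b \in roots D).
Proof.
suff H v c : @W0 D v -> c \in roots D -> v c \in roots D.
  move=> ww; apply/idP/idP; last exact: H.
  by move=> /(H _ _ (W0_winv ww)); rewrite W0_winvK.
by elim=> [//|a u ar _ IH] /IH ucr; rewrite /= aff_refl0 srefl_root.
Qed.

Lemma W0_pr w x b : @W0 D w -> b \in roots D ->
  pr (w x) (coroot (w b)) = pr x (coroot b).
Proof.
elim=> [//|a u ar uu IH] br /=.
by rewrite aff_refl0 coroot_srefl ?W0_root // sreflK // IH.
Qed.

Lemma W0_pr_winv w x b : @W0 D w -> b \in roots D ->
  pr x (coroot (w b)) = pr (winv w x) (coroot b).
Proof. by move=> ww br; rewrite -{1}(W0_winvKr ww x) W0_pr. Qed.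

Definition lin g x : X := g x - g 0.

Lemma W_P g : @W D g -> W0 (lin g) /\ forall x, g x = lin g x + g 0.
Proof.
move=> [w [x [ww ->]]]; have E : lin (transl x \o w) = w.
  by apply/funext => z; rewrite /lin /transl /= W0_0 // add0r addrK.
by rewrite E; split => // z; rewrite /transl /= W0_0 // add0r.
Qed.

Lemma W_lin g : @W D g -> W0 (lin g). Proof. by move=> /W_P[]. Qed.
Lemma W_E g x : @W D g -> g x = lin g x + g 0. Proof. by move=> /W_P[]. Qed.

Lemma W0_W w : @W0 D w -> W w.
Proof. by move=> ww; exists w, 0; split => //; apply/funext => x; rewrite /transl /= addr0. Qed.

Lemma lin_W0 w : @W0 D w -> lin w = w.
Proof. by move=> ww; apply/funext => x; rewrite /lin W0_0 // subr0. Qed.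

Lemma W_transl x : @W D (transl x).
Proof. by exists id, x; split => //; apply: W0_id. Qed.

Lemma lin_transl x : lin (transl x) = id :> (X -> X).
Proof. by apply/funext => z; rewrite /lin /transl add0r addrK. Qed.

Lemma W_comp g h : @W D g -> @W D h -> W (g \o h).
Proof.
move=> gW hW; exists (lin g \o lin h), (g (h 0)); split.
  by apply: W0_comp; apply: W_lin.
apply/funext => x; rewrite /transl /= (W_E (h x) gW) (W_E x hW).
have -> := W_E (h 0) gW; rewrite addrA; congr (_ + _); exact: (W0D (W_lin gW)).
Qed.

Lemma W_inv_ex g : @W D g -> exists v, [/\ W v, g \o v = id & v \o g = id].
Proof.
move=> [w [x [ww ->]]]; have iw := W0_winv ww.
exists (winv w \o transl (- x)); split.
- by apply: W_comp; [apply: W0_W|apply: W_transl].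
- by apply/funext => z; rewrite /transl /= W0_winvKr // subrK.
- by apply/funext => z; rewrite /transl /= addrK W0_winvK.
Qed.

Lemma W_winv g : @W D g -> W (winv g).
Proof. by move=> /W_inv_ex[v [vv wv vw]]; rewrite (winv_uniq wv vw). Qed.
Lemma W_winvK g : @W D g -> cancel g (winv g).
Proof.
move=> /W_inv_ex[v [vv wv vw]] x; rewrite (winv_uniq wv vw).
exact: (congr1 (@^~ x) vw).
Qed.
Lemma W_winvKr g : @W D g -> cancel (winv g) g.
Proof.
move=> /W_inv_ex[v [vv wv vw]] x; rewrite (winv_uniq wv vw).
exact: (congr1 (@^~ x) wv).
Qed.
Lemma W_winvV g : @W D g -> winv g \o g = id.
Proof. by move=> gW; apply/funext => x; rewrite /= W_winvK. Qed.
Lemma W_winvVr g : @W D g -> g \o winv g = id.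
Proof. by move=> gW; apply/funext => x; rewrite /= W_winvKr. Qed.
Lemma winvK g : @W D g -> winv (winv g) = g.
Proof. by move=> gW; apply: winv_uniq; [exact: W_winvV|exact: W_winvVr]. Qed.
Lemma winv_comp g h : @W D g -> @W D h -> winv (g \o h) = winv h \o winv g.
Proof.
move=> gW hW; apply: winv_uniq; apply/funext => x /=.
  by rewrite W_winvKr // W_winvKr.
by rewrite W_winvK // W_winvK.
Qed.

Lemma W_aff_refl a : aff_root a -> @W D (aff_refl a).
Proof.
move=> ar; exists (srefl a.1), (- a.1 *~ a.2); split; first exact: W0_srefl.
apply/funext => x; rewrite /aff_refl /aff_eval /transl /srefl /=.
by rewrite mulrzDr opprD addrA mulNrz.
Qed.

Lemma lin_aff_refl a : lin (aff_refl a) = srefl a.1 :> (X -> X).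
Proof.
apply/funext => x; rewrite /lin /aff_refl /aff_eval /srefl pr0l !add0r opprK.
by rewrite mulrzDr opprD addrA subrK.
Qed.

Lemma aff_refl_inv a : aff_root a -> @aff_refl D a \o aff_refl a = id.
Proof.
move=> ar; apply/funext => x; rewrite /= /aff_refl /aff_eval prBl prMzl pairing_coroot //=.
by rewrite -addrA -!mulrNz -mulrzDr [X in _ *~ X](_ : _ = 0) ?mulr0z ?addr0 //; ring.
Qed.

Lemma winv_aff_refl a : aff_root a -> winv (aff_refl a) = @aff_refl D a.
Proof. by move=> ar; apply: winv_uniq; apply: aff_refl_inv. Qed.

(** * Action on affine roots *)

Definition wact g (a : X * int) : X * int :=
  (lin g a.1, a.2 - pr (g 0) (coroot (lin g a.1))).
Definition aopp (a : X * int) : X * int := (- a.1, - a.2).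
Definition apos (a : X * int) : bool :=
  (a.1 \in roots D) && ((0 < a.2) || (a.2 == 0) && (a.1 \in pos_roots D)).

Lemma wact_root g a : W g -> aff_root (wact g a) <-> @aff_root D a.
Proof. by move=> /W_lin gl; rewrite /aff_root /= W0_root. Qed.

Lemma aff_eval_wact g a x : W g -> aff_root a ->
  aff_eval (wact g a) (g x) = aff_eval a x :> int.
Proof.
move=> gW ar; rewrite /aff_eval /= (W_E x gW) pairingDl (W0_pr _ (W_lin gW)) //.
by ring.
Qed.

Lemma aff_eval_inj a b : @aff_root D a -> aff_root b ->
  (forall x, aff_eval a x = aff_eval b x) -> a = b.
Proof.
case: a b => [a k] [b l] ar br H.
have kl : k = l by have := H 0; rewrite /aff_eval /= !pr0l !add0r.
congr (_, _) => //; apply: (@coroot_inj D) => //; apply: pr_injr => x.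
by have := H x; rewrite /aff_eval /= kl => /addIr.
Qed.

Lemma aff_actP g a b : W g -> aff_root a -> aff_root b ->
  aff_act g a b <-> b = wact g a.
Proof.
move=> gW ar br; split => [H|-> x]; last by rewrite aff_eval_wact.
apply: aff_eval_inj => // [|x]; first exact/wact_root.
by rewrite -(W_winvKr gW x) H aff_eval_wact.
Qed.

Lemma wact_comp g h a : W g -> W h -> aff_root a ->
  wact (g \o h) a = wact g (wact h a).
Proof.
move=> gW hW ar; have gh := W_comp gW hW.
symmetry; apply/(aff_actP gh ar); first by rewrite !wact_root.
by move=> x /=; rewrite !aff_eval_wact // wact_root.
Qed.

Lemma wact_id a : aff_root a -> wact id a = a.
Proof. by case: a => b k ar; rewrite /wact /lin subr0 /= pr0l subr0. Qed.

Lemma wact_winvK g a : W g -> aff_root a -> wact (winv g) (wact g a) = a.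
Proof. by move=> gW ar; rewrite -wact_comp ?W_winvV ?wact_id //; apply: W_winv. Qed.
Lemma wact_winvKr g a : W g -> aff_root a -> wact g (wact (winv g) a) = a.
Proof. by move=> gW ar; rewrite -wact_comp ?W_winvVr ?wact_id //; apply: W_winv. Qed.

Lemma aoppK : involutive aopp.
Proof. by case=> b k; rewrite /aopp /= !opprK. Qed.
Lemma aopp_root a : aff_root (aopp a) <-> @aff_root D a.
Proof. by rewrite /aff_root /= rootNE. Qed.
Lemma wact_aopp g a : W g -> aff_root a -> wact g (aopp a) = aopp (wact g a).
Proof.
move=> gW ar; have gl := W_lin gW; rewrite /wact /aopp /= W0N //.
by congr (_, _); rewrite corootN ?W0_root // opprK opprB addrC.
Qed.

Lemma apos_root a : apos a -> aff_root a. Proof. by case/andP. Qed.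

Lemma aposP a : aff_pos a <-> apos a.
Proof.
rewrite /aff_pos /apos; split => [[-> [->//|[-> ->]]]|/andP[ar H]]; first by rewrite eqxx orbT.
by split => //; case/orP: H => [->|/andP[/eqP-> ->]]; [left|right].
Qed.

Lemma apos_aopp a : aff_root a -> apos (aopp a) = ~~ apos a.
Proof.
case: a => b k ar; have br : b \in roots D := ar.
rewrite /apos /= rootNE br /= oppr_gt0 oppr_eq0.
case: (ltgtP k 0) => //= _.
case: (boolP (b \in pos_roots D)) => [/pos_neg/negPf -> //|bn].
by have := pos_or_neg br; rewrite (negPf bn) /= => ->.
Qed.

Lemma anegP a : aff_neg a <-> apos (aopp a).
Proof.
rewrite /aff_neg aposP; split => [[ar /negP]|H]; first by rewrite apos_aopp.
have ar : aff_root a by rewrite -aopp_root; apply: apos_root.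
by split=> //; apply/negP; rewrite -apos_aopp.
Qed.

(* [hC] exceeds every [<rho2, b^vee>], so an affine root is positive iff [aval rho2] is. *)
Definition hC : int := 1 + \sum_(b <- roots D) `|pr (rho2 D) (coroot b)|.
Definition aval (p : X) (a : X * int) : int := pr p (coroot a.1) + hC * a.2.
(** The image under [g] of the point [p / hC], scaled back by [hC] to stay in [X]. For [p = rho2]
    that point lies in the interior of the fundamental alcove. *)
Definition pact g p : X := lin g p + g 0 *~ hC.

Lemma hC_bound b : b \in roots D -> `|pr (rho2 D) (coroot b)| < hC.
Proof.
move=> br; rewrite /hC (big_rem b) //=.
by rewrite addrCA ltrDl ltr_pwDl // sumr_ge0.
Qed.

Lemma hC_gt0 : 0 < hC.
Proof. by rewrite /hC ltr_pwDl // sumr_ge0. Qed.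

Lemma aval_pact g p a : W g -> aff_root a -> aval (pact g p) (wact g a) = aval p a.
Proof.
move=> gW ar; rewrite /aval /pact /= pairingDl (W0_pr _ (W_lin gW)) // prMzl.
by ring.
Qed.

Lemma aval_aopp p a : aff_root a -> aval p (aopp a) = - aval p a.
Proof. by move=> ar; rewrite /aval /= corootN // mulrN opprD. Qed.

Lemma pos_rho2 b : b \in roots D -> (b \in pos_roots D) = (0 < pr (rho2 D) (coroot b)).
Proof.
move=> br; apply/idP/idP => [/rho2_pos//|H].
have /orP[//|/rho2_pos] := pos_or_neg br.
by rewrite corootN // => H'; lia.
Qed.

Lemma aposE a : aff_root a -> apos a = (0 < aval (rho2 D) a).
Proof.
case: a => b k ar; have br : b \in roots D := ar.
rewrite /apos /aval /= br /= pos_rho2 //.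
have := hC_bound br; have := hC_gt0; have := pos_rho2 br.
have := @pos_rho2 (- b); rewrite rootNE corootN // => /(_ br) E1 E2 hp hb.
have := pos_or_neg br; rewrite E1 E2 => E3.
case: (ltgtP k 0) => k0 /=.
- by apply/esym/negbTE; rewrite -leNgt; nia.
- by apply/esym; nia.
- by rewrite k0 mulr0 addr0.
Qed.

Lemma aval_winv g p a : W g -> aff_root a -> aval p (wact (winv g) a) = aval (pact g p) a.
Proof.
move=> gW ar; rewrite -[in RHS](wact_winvKr gW ar) aval_pact //.
by apply/wact_root => //; apply: W_winv.
Qed.

Definition invs g : set (X * int) := [set a | apos a /\ apos (aopp (wact g a))].

(** The level of an inverted affine root lies between 0 and a pairing of [g 0] with a coroot. *)
Lemma finite_invs g : W g -> finite_set (invs g).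
Proof.
move=> gW; pose N := \sum_(b <- roots D) `|pr (g 0) (coroot b)|.
pose F := [fset (b, k%:Z) | b in (roots D : seq X), k in iota 0 `|N|.+1].
apply: (sub_finite_set _ (finite_fset F)) => -[b k] [/andP[/= br ap] an].
have lr : lin g b \in roots D by rewrite (W0_root _ (W_lin gW)).
have k0 : 0 <= k by case/orP: ap => [/ltW//|/andP[/eqP->]].
have kN : k <= N.
  rewrite /N (big_rem _ lr) /= ler_wpDr ?sumr_ge0 //.
  by move: an; rewrite /apos /= => /andP[_ /orP[|/andP[/eqP]]]; lia.
apply/imfset2P; exists b => //; exists `|k|%N.
  by rewrite mem_iota; lia.
by congr (_, _); lia.
Qed.

Lemma wlengthE g : W g -> wlength g = #|` fset_set (invs g)|.
Proof.
move=> gW; rewrite /wlength; congr (#|` fset_set _|).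
apply/seteqP; split => a /=.
  move=> [/aposP ap [b bn H]]; split => //; apply/anegP.
  by have /(aff_actP gW (apos_root ap) (proj1 bn)) <- := H.
move=> [ap an]; split; first exact/aposP.
exists (wact g a); first exact/anegP.
by apply/aff_actP; rewrite ?wact_root //; apply: apos_root.
Qed.

Lemma mem_invs g a : W g -> (a \in fset_set (invs g)) = apos a && apos (aopp (wact g a)).
Proof.
move=> gW; rewrite in_fset_set; last exact: finite_invs.
by apply/idP/andP; rewrite inE.
Qed.

(** The inversions of [g \o h] are those of [h] together with the preimages under [h] of those of
    [g], as long as [g] does not make an inversion of [h] positive again. *)
Lemma len_add g h : W g -> W h ->
  (forall a, apos a -> apos (aopp (wact h a)) -> apos (aopp (wact g (wact h a)))) ->
  wlength (g \o h) = (wlength g + wlength h)%N.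
Proof.
move=> gW hW H; have gh := W_comp gW hW; have hi := W_winv hW.
rewrite !wlengthE //.
set B := [fset wact (winv h) b | b in fset_set (invs g)].
have -> : fset_set (invs (g \o h)) = fset_set (invs h) `|` B.
  apply/fsetP => a; rewrite inE !mem_invs //; apply/idP/idP.
    move=> /andP[ap an]; have ar := apos_root ap.
    rewrite ap /=; case: (boolP (apos (aopp (wact h a)))) => //= hn.
    apply/imfsetP; exists (wact h a); last by rewrite wact_winvK.
    move: hn; rewrite /= mem_invs // apos_aopp ?wact_root // negbK => ->.
    by rewrite -wact_comp.
  move=> /orP[/andP[ap an]|/imfsetP[b /=]].
    by rewrite ap wact_comp ?H //; apply: apos_root.
  rewrite mem_invs // => /andP[bp bn] ->; have br := apos_root bp.
  have ar : aff_root (wact (winv h) b) by apply/wact_root.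
  rewrite wact_comp // wact_winvKr // bn andbT.
  rewrite -[X in apos X]aoppK apos_aopp ?aopp_root //; apply/negP => na.
  have := H _ na; rewrite !wact_aopp ?wact_root // wact_winvKr // aoppK => /(_ bp).
  rewrite aoppK => gb; move: bn; rewrite apos_aopp ?gb //.
  exact/wact_root.
rewrite cardfsU (_ : _ `&` _ = fset0) ?cardfs0 ?subn0; last first.
  apply/fsetP => a; rewrite !inE mem_invs //; apply/negP => /andP[/andP[_ an]].
  move=> /imfsetP[b /=]; rewrite mem_invs // => /andP[bp _] aE.
  by move: an; rewrite aE wact_winvKr ?apos_aopp ?bp //; apply: apos_root bp.
rewrite addnC; congr (_ + _)%N; apply: card_in_imfset => b c /=.
rewrite !mem_invs // => /andP[/apos_root br _] /andP[/apos_root cr _] E.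
by rewrite -(wact_winvKr hW br) E wact_winvKr.
Qed.

Lemma wlength_winv g : W g -> wlength (winv g) = wlength g.
Proof.
move=> gW; have gi := W_winv gW; rewrite !wlengthE //.
rewrite (_ : fset_set (invs (winv g)) = [fset aopp (wact g a) | a in fset_set (invs g)]).
  apply: card_in_imfset => b c /=.
  rewrite !mem_invs // => /andP[/apos_root br _] /andP[/apos_root cr _] /(inv_inj aoppK) E.
  by rewrite -(wact_winvK gW br) E wact_winvK.
apply/fsetP => a; rewrite mem_invs //; apply/andP/imfsetP.
  move=> [ap an]; have ar := apos_root ap; exists (aopp (wact (winv g) a)) => /=.
    by rewrite mem_invs // an /= wact_aopp ?wact_root // wact_winvKr // aoppK.
  by rewrite wact_aopp ?wact_root // wact_winvKr // aoppK.
move=> [b /=]; rewrite mem_invs // => /andP[bp bn] ->; have br := apos_root bp.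
by rewrite wact_aopp ?wact_root // wact_winvK // aoppK bn bp.
Qed.

End AffineWeyl.

(** * Pairs of roots *)

Section LengthFunction.
Variable D : rootDatum.
Local Notation X := (latX D).
Local Notation Y := (latY D).
Local Notation pr := (@pairing D).
Implicit Types (x : X) (y : Y) (w v g : X -> X).

Lemma pr_injl x x' : (forall y, pr x y = pr x' y) -> x = x'.
Proof.
move=> H; pose f : Y -> int := fun y => pr x y.
have fB : zmod_morphism f by move=> u v; rewrite /f prBr.
pose fA : {additive Y -> int} := HB.pack f (GRing.isZmodMorphism.Build _ _ f fB).
have [z [_ zU]] := perfectr fA.
by rewrite -(zU x) // -(zU x') // => y; rewrite -H.
Qed.

Lemma X_torsionfree x (n : int) : x *~ n = 0 -> n != 0 -> x = 0.
Proof.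
move=> xn n0; apply: pr_injl => y; rewrite pr0l.
by apply: (mulfI n0); rewrite -prMzl xn pr0l mulr0.
Qed.

Lemma cform_CS (a b : X) : cform a b ^+ 2 <= cform a a * cform b b :> int.
Proof.
have := cform_ge0 (b *~ cform a a - a *~ cform a b : X).
rewrite cformDl !cformDr !cformNl !cformNr !cformMzl !cformMzr (cformC b a).
have := cform_ge0 a; rewrite le_eqVlt => /orP[/eqP a0 _|a0 H]; last by nia.
suff -> : cform a b = 0 by rewrite -a0 mul0r.
rewrite /cform big_seq big1 // => c cr.
have /eqP := esym a0; rewrite psumr_eq0 => [/allP/(_ c cr)|e _]; last by rewrite -expr2 sqr_ge0.
by rewrite mulf_eq0 orbb => /eqP ->; rewrite mul0r.
Qed.

Lemma pr_coroot_le4 a b : a \in roots D -> b \in roots D ->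
  pr a (coroot b) * pr b (coroot a) <= 4.
Proof.
move=> ar br; have := cform_CS a b.
have := cform_coroot a br; have := cform_coroot b ar; rewrite (cformC b a).
have := cform_root_gt0 ar; have := cform_root_gt0 br.
move: (cform a a) (cform b b) (cform a b) (pr _ _) (pr _ _) => A B C m n A0 B0 E1 E2 E3.
have H : 4 * C ^+ 2 = (m * n) * (A * B).
  have -> : 4 * C ^+ 2 = (2 * C) * (2 * C) by ring.
  by rewrite {1}E1 E2; ring.
have AB0 : 0 < A * B by rewrite mulr_gt0.
by rewrite -(ler_pM2r AB0) -H; lia.
Qed.

Lemma pr_coroot_sgn a b : a \in roots D -> b \in roots D ->
  (0 < pr a (coroot b)) = (0 < pr b (coroot a)).
Proof.
move=> ar br; have := cform_coroot a br; have := cform_coroot b ar; rewrite (cformC b a).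
have := cform_root_gt0 ar; have := cform_root_gt0 br.
move: (cform a a) (cform b b) (cform a b) (pr _ _) (pr _ _) => A B C m n A0 B0 E1 E2.
by apply/idP/idP => H; nia.
Qed.

(** Both reflections fix [a - b], and their product moves [a] by [2 (a - b)]. Unless [a = b],
    iterating it would produce infinitely many roots. *)
Lemma pr_coroot22 a b : a \in roots D -> b \in roots D ->
  pr a (coroot b) = 2 -> pr b (coroot a) = 2 -> a = b.
Proof.
move=> ar br ab ba; pose x := a - b.
have xa : pr x (coroot a) = 0 by rewrite prBl ba pairing_coroot.
have xb : pr x (coroot b) = 0 by rewrite prBl ab pairing_coroot.
pose t := srefl a \o srefl b.
have tx z : t (z + x) = t z + x.
  rewrite /t /= (sreflD b); have -> : srefl b x = x by rewrite /srefl xb mulr0z subr0.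
  by rewrite sreflD; have -> : srefl a x = x by rewrite /srefl xa mulr0z subr0.
have ta : t a = a + x *+ 2.
  rewrite /t /=; apply: pr_injl => y.
  by rewrite /srefl !(pairingDl, prNl, prMzl, prMnl) ab ba pairing_coroot //; ring.
have tk k : a + x *+ (2 * k)%N \in roots D.
  elim: k => [|k IH]; first by rewrite muln0 mulr0n addr0.
  have -> : a + x *+ (2 * k.+1)%N = t (a + x *+ (2 * k)%N).
    have tM n z : t (z + x *+ n) = t z + x *+ n.
      by elim: n => [|n IHn]; rewrite ?mulr0n ?addr0 // mulrSr [in LHS]addrA tx IHn -addrA.
    by rewrite tM ta mulnS mulrnDr addrA.
  by rewrite /t /= !srefl_root.
apply/eqP; rewrite -subr_eq0 -/x; apply/eqP; apply: contrapT => /eqP x0.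
pose f (i : 'I_(size (roots D)).+1) : X := a + x *+ (2 * i)%N.
have fI : injective f.
  move=> i j /addrI /eqP; rewrite -subr_eq0 => /eqP.
  rewrite !pmulrn -mulrzBr => /X_torsionfree H; apply/ord_inj.
  have [//|ne] := eqVneq (i : nat) j; case/eqP: x0; apply: H; lia.
have : uniq [seq f i | i <- enum 'I_(size (roots D)).+1].
  by rewrite map_inj_uniq // enum_uniq.
move=> /(@uniq_leq_size _ _ (roots D : seq X)).
rewrite size_map size_enum_ord ltnn => F.
by apply: notF; apply: F => c /mapP[i _ ->]; apply: tk.
Qed.

(** * Simple affine reflections *)

Lemma aff_simple_root a : @aff_simple D a -> aff_root a.
Proof. by case=> [[/simple_root]|[[]]]. Qed.

Lemma aff_simple_pos a : @aff_simple D a -> apos a.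
Proof.
move=> aS; have ar := aff_simple_root aS; rewrite /apos; rewrite /aff_root in ar; rewrite ar /=.
by case: aS => [[/simple_pos -> ->]|[_ ->]] //; rewrite eqxx orbT.
Qed.

Lemma wact_aff_refl a b : @aff_root D a -> aff_root b ->
  wact (aff_refl a) b = (srefl a.1 b.1, b.2 - a.2 * pr a.1 (coroot b.1)).
Proof.
move=> ar br; rewrite /wact lin_aff_refl; congr (_, _).
rewrite coroot_srefl // /aff_refl /aff_eval pr0l !add0r.
by rewrite sreflN prNl -mulrN1z; rewrite /srefl !prBl !prMzl pairing_coroot //; ring.
Qed.

Lemma wact_aff_refl_self a : @aff_root D a -> wact (aff_refl a) a = aopp a.
Proof.
move=> ar; rewrite wact_aff_refl // /aopp srefl_self // pairing_coroot //.
by congr (_, _); ring.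
Qed.

(** Otherwise the reflection in [a] would subtract a positive multiple of a simple coroot and give a
    smaller coroot. *)
Lemma minimal_anti mu a : minimal_coroot mu -> a \in simple D -> pr a (coroot mu) <= 0.
Proof.
move=> [mr mm] aS; have ar := simple_root aS.
rewrite leNgt; apply/negP => H.
have sr : srefl a mu \in roots D by rewrite srefl_root.
have E p : pr p (coroot (srefl a mu)) = pr p (coroot mu - coroot a *~ pr a (coroot mu)).
  by rewrite coroot_srefl // prBr prMzr /srefl prBl prMzl mulrC.
have E' := pr_injr E.
have dom : dominance (coroot (srefl a mu)) (coroot mu).
  exists (fun b => if b == a then `|pr a (coroot mu)|%N else 0%N).
  rewrite E' opprB addrC subrK.
  rewrite (eq_bigr (fun b => if b == a then coroot b *~ pr a (coroot mu) else 0)); last first.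
    by move=> b _; case: eqP => // _; rewrite pmulrn gtz0_abs.
  by rewrite big_if1 ?fset_uniq ?simple_pos.
have := mm _ sr dom; rewrite E' => /eqP; rewrite -subr_eq0 addrAC subrr sub0r oppr_eq0 => /eqP E0.
have := prMzr a (coroot a) (pr a (coroot mu)); rewrite E0 pr0r pairing_coroot //; lia.
Qed.

Lemma minimal_le0 mu b : minimal_coroot mu -> b \in pos_roots D -> pr mu (coroot b) <= 0.
Proof.
move=> mm bp; have [c [c0 cE]] := pos_coroot bp; have mr := mm.1.
rewrite -(pmulr_rle0 _ (cform_root_gt0 (pos_root_root bp))) cE big_seq.
apply: sumr_le0 => a aS; rewrite mulr_ge0_le0 ?c0 //.
have ar := simple_root aS; rewrite leNgt pr_coroot_sgn // -leNgt.
exact: minimal_anti.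
Qed.

Lemma minimal_neg mu : minimal_coroot mu -> mu \notin pos_roots D.
Proof.
move=> mm; apply/negP => mp; have := minimal_le0 mm mp.
by rewrite pairing_coroot //; case: mm.
Qed.

Lemma root_neg_rho2 b : b \in roots D -> b \notin pos_roots D -> pr (rho2 D) (coroot b) < 0.
Proof.
move=> br bn; have := pos_or_neg br; rewrite (negPf bn) /= => /rho2_pos.
by rewrite corootN // oppr_gt0.
Qed.

(** The coroot of [srefl b mu] is [mu^vee - b^vee]. Were that root positive, [b^vee] would lie below
    the minimal coroot; being negative, it yields the inequality at [rho2]. *)
Lemma minimal_gt mu b : minimal_coroot mu -> b \in roots D -> b != mu ->
  pr b (coroot mu) = 1 -> pr (rho2 D) (coroot mu) < pr (rho2 D) (coroot b).
Proof.
move=> mm br bmu n1; have [mr mU] := mm.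
have gr : srefl b mu \in roots D by rewrite srefl_root.
have E p : pr p (coroot (srefl b mu)) = pr p (coroot mu) - pr p (coroot b).
  by rewrite coroot_srefl // /srefl prBl prMzl n1; ring.
have [gp|gn] := boolP (srefl b mu \in pos_roots D); last first.
  by have := root_neg_rho2 gr gn; rewrite E; lia.
case/eqP: bmu; apply: (@coroot_inj D) => //; apply: mU => //.
exists (fun c => if c == srefl b mu then 1%N else 0%N).
rewrite (eq_bigr (fun c => if c == srefl b mu then coroot c else 0)); last first.
  by move=> c _; case: eqP => //; rewrite mulr1n.
rewrite big_if1 ?fset_uniq //; apply: pr_injr => p.
by rewrite prBr E.
Qed.

(** For [a = (mu, 1)], suppose that [b] and [b' = - s_a b] are both positive. They add up to [m a],
    and evaluation at the interior point gives [m > 0]. Roots pairing positively with [mu] have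
    positive level here, so [m >= 2]. If the gradient of [b] is not [mu], the bound on products of
    pairings leaves <be, mu^vee> = 1; then [minimal_gt], applied to [b] and [b'], contradicts
    [m >= 2]. *)
Lemma aff_simple_perm a b : @aff_simple D a -> apos b -> b != a ->
  apos (wact (aff_refl a) b).
Proof.
move=> aS bp ba; have ar := aff_simple_root aS; have br := apos_root bp.
case: (aS) => [[a1 a2]|[mm a2]].
  case: a b a1 a2 aS ar bp ba br => [al k] [be l] /= a1 -> aS ar bp ba br.
  rewrite wact_aff_refl //= mul0r subr0; move: bp; rewrite /apos /= => /andP[b1].
  rewrite srefl_root //=; case/orP => [-> //|/andP[/eqP l0 bpp]].
  by rewrite l0 eqxx simple_perm ?orbT //; apply: contra_neq ba => ->; rewrite l0.
rewrite -[apos _]negbK -apos_aopp ?wact_root; [|exact: br|exact: W_aff_refl]; apply/negP.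
case: a b mm a2 aS ar bp ba br => [mu k] [be l] /= mm -> aS mr bp ba br.
have [mr' mU] := mm; have br' : be \in roots D := br.
rewrite wact_aff_refl //= mul1r /aopp /=; set m := pr mu (coroot be).
have b'r : - srefl mu be \in roots D by rewrite rootNE srefl_root.
move=> b'p.
have Eb' p : pr p (coroot (- srefl mu be)) = m * pr p (coroot mu) - pr p (coroot be).
  by rewrite corootN ?srefl_root // coroot_srefl // /srefl prBl prMzl -/m; ring.
have mb' : pr mu (coroot (- srefl mu be)) = m by rewrite Eb' pairing_coroot // -/m; ring.
have bneg c j : c \in roots D -> pr mu (coroot c) = m -> 0 < m -> apos (c, j) -> 0 < j.
  move=> cr cm m0; rewrite /apos /= => /andP[_ /orP[//|/andP[_ cp]]].
  by have := minimal_le0 mm cp; rewrite cm; lia.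
have m0 : 0 < m.
  have := aposE br; rewrite bp => /esym; have := @aposE D (- srefl mu be, - (l - m)) b'r.
  rewrite b'p => /esym; have := aposE mr; rewrite (aff_simple_pos aS) => /esym.
  rewrite /aval /= Eb'; set A := pr _ _; set B := pr _ _; have := hC_gt0 D.
  move: (hC D) => h h0 H1 H2 H3.
  have : 0 < m * (A + h * 1) by lia.
  by rewrite pmulr_lgt0.
have l0 := bneg _ _ br' erefl m0 bp; have l'0 := bneg _ _ b'r mb' m0 b'p.
have n0 : 0 < pr be (coroot mu) by rewrite -pr_coroot_sgn.
have [E|bmu] := eqVneq be mu.
  move: l'0; rewrite /m E pairing_coroot // => l'0.
  have l1 : l = 1 by lia.
  by rewrite E l1 eqxx in ba.
have mn := pr_coroot_le4 mr' br'; rewrite -/m in mn.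
have n1 : pr be (coroot mu) = 1.
  have [n2|n2] := eqVneq (pr be (coroot mu)) 2; last by nia.
  case/eqP: bmu; apply: pr_coroot22 => //; rewrite -/m; nia.
have b'mu : - srefl mu be != mu.
  apply: contra_neq bmu => /(congr1 (srefl mu)); rewrite sreflN sreflK // srefl_self //.
  exact: oppr_inj.
have n1' : pr (- srefl mu be) (coroot mu) = 1.
  by rewrite prNl /srefl prBl prMzl pairing_coroot // n1.
have := minimal_gt mm br' bmu n1; have := minimal_gt mm b'r b'mu n1'.
have := root_neg_rho2 mr' (minimal_neg mm); rewrite Eb'.
by move: (pr _ _) (pr _ _) => A B; nia.
Qed.

Lemma dominance_trans y1 y2 y3 : @dominance D y1 y2 -> dominance y2 y3 -> dominance y1 y3.
Proof.
move=> [c cE] [d dE]; exists (fun a => (d a + c a)%N).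
rewrite (eq_bigr (fun a => coroot a *+ d a + coroot a *+ c a)) => [|a _]; last exact: mulrnDr.
by rewrite big_split /= -cE -dE addrA subrK.
Qed.

Lemma dominance_le p y1 y2 : (forall b, b \in pos_roots D -> 0 <= pr p (coroot b)) ->
  dominance y1 y2 -> pr p y1 <= pr p y2.
Proof.
move=> H [c cE]; rewrite -subr_ge0 -prBr cE pr_sumr big_seq.
by apply: sumr_ge0 => a ap; rewrite prMnr mulrn_wge0 ?H.
Qed.

(** Descent on the value at [rho2], which drops strictly along the dominance order and is bounded
    below on coroots by [- hC]. *)
Lemma minimal_ex b : b \in roots D ->
  exists2 mu, minimal_coroot mu & dominance (coroot mu) (coroot b).
Proof.
have [n] := ubnP (`|(pr (rho2 D) (coroot b) + hC D)%R|%N).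
elim: n b => // n IH b bn br.
have dom_refl (y : Y) : @dominance D y y.
  by exists (fun=> 0%N); rewrite subrr big1 // => a _; rewrite mulr0n.
case: (pselect (minimal_coroot b)) => [mb|nm]; first by exists b.
have [c [cr cb cne]] : exists c, [/\ c \in roots D, dominance (coroot c) (coroot b) & coroot c <> coroot b].
  apply: contrapT => H; apply: nm; split => // c cr cb.
  by apply: contrapT => cne; apply: H; exists c.
have lt : pr (rho2 D) (coroot c) < pr (rho2 D) (coroot b).
  rewrite lt_neqAle; apply/andP; split; last first.
    by apply: dominance_le cb => d /rho2_pos/ltW.
  apply/eqP => E; case: cne; case: cb => d dE.
  have : pr (rho2 D) (coroot b - coroot c) = 0 by rewrite prBr E subrr.
  rewrite dE pr_sumr big_seq => /eqP; rewrite psumr_eq0 => [/allP H|a ap]; last first.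
    by rewrite prMnr mulrn_wge0 // ltW ?rho2_pos.
  apply/esym/eqP; rewrite -subr_eq0 dE big_seq big1 // => a ap.
  have := H a ap; rewrite ap /= prMnr mulrn_eq0 => /orP[/eqP->|]; first by rewrite mulr0n.
  by rewrite gt_eqF // rho2_pos.
have := hC_bound br; have := hC_bound cr => h1 h2.
have [|//|mu mm mc] := IH c; first by lia.
by exists mu => //; apply: dominance_trans cb.
Qed.

(** * Length and descents *)

Lemma invs_simple a b : @aff_simple D a -> apos b -> apos (aopp (wact (aff_refl a) b)) -> b = a.
Proof.
move=> aS bp bn; apply/eqP; apply: contraLR bn => ba.
rewrite apos_aopp ?negbK ?aff_simple_perm //.
by rewrite wact_root; [exact: apos_root|apply: W_aff_refl; apply: aff_simple_root].
Qed.

Lemma wlength_simple a : @aff_simple D a -> wlength (aff_refl a) = 1%N.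
Proof.
move=> aS; have ar := aff_simple_root aS; have sW := W_aff_refl ar.
rewrite wlengthE // (_ : fset_set _ = [fset a]) ?cardfs1 //.
apply/fsetP => b; rewrite mem_invs // inE; apply/andP/eqP => [[bp bn]|->].
  exact: invs_simple.
by rewrite wact_aff_refl_self // aoppK aff_simple_pos.
Qed.

Lemma len_simple_r a g : @aff_simple D a -> W g -> apos (wact g a) ->
  wlength (g \o aff_refl a) = (wlength g).+1.
Proof.
move=> aS gW H; have ar := aff_simple_root aS; have sW := W_aff_refl ar.
rewrite len_add ?wlength_simple ?addn1 // => b bp bn.
rewrite (invs_simple aS bp bn) wact_aff_refl_self // wact_aopp // aoppK //.
Qed.

Lemma W_simpleK a g : @aff_simple D a -> (g \o aff_refl a) \o aff_refl a = g.
Proof.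
move=> /aff_simple_root ar; apply/funext => x /=; congr (g _).
exact: (congr1 (@^~ x) (aff_refl_inv ar)).
Qed.

Lemma W_simpleKl a g : @aff_simple D a -> aff_refl a \o (aff_refl a \o g) = g.
Proof.
move=> /aff_simple_root ar; apply/funext => x /=.
exact: (congr1 (@^~ (g x)) (aff_refl_inv ar)).
Qed.

Lemma len_simple_rN a g : @aff_simple D a -> W g -> apos (aopp (wact g a)) ->
  wlength g = (wlength (g \o aff_refl a)).+1.
Proof.
move=> aS gW H; have ar := aff_simple_root aS; have sW := W_aff_refl ar.
rewrite -{1}(W_simpleK g aS) len_simple_r //; first exact: W_comp.
by rewrite wact_comp // wact_aff_refl_self // wact_aopp.
Qed.

Lemma len_simple_l a g : @aff_simple D a -> W g -> apos (wact (winv g) a) ->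
  wlength (aff_refl a \o g) = (wlength g).+1.
Proof.
move=> aS gW H; have ar := aff_simple_root aS; have sW := W_aff_refl ar.
have gi := W_winv gW.
have E : winv (aff_refl a \o g) = winv g \o aff_refl a by rewrite winv_comp // winv_aff_refl.
by rewrite -(wlength_winv (W_comp sW gW)) E len_simple_r // wlength_winv.
Qed.

Lemma len_simple_lN a g : @aff_simple D a -> W g -> apos (aopp (wact (winv g) a)) ->
  wlength g = (wlength (aff_refl a \o g)).+1.
Proof.
move=> aS gW H; have ar := aff_simple_root aS; have sW := W_aff_refl ar.
have gi := W_winv gW.
have E : winv (aff_refl a \o g) = winv g \o aff_refl a by rewrite winv_comp // winv_aff_refl.
by rewrite -(wlength_winv (W_comp sW gW)) E -len_simple_rN // wlength_winv.
Qed.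

Lemma aval_neq0 g b : @W D g -> aff_root b -> aval (pact g (rho2 D)) b != 0.
Proof.
move=> gW br; rewrite -aval_winv //.
have cr : aff_root (wact (winv g) b) by rewrite wact_root //; apply: W_winv.
move: (aposE cr) (apos_aopp cr) (@aposE D (aopp (wact (winv g) b))).
rewrite aopp_root => E1 E2 /(_ cr); rewrite E2 E1 aval_aopp //.
by rewrite oppr_gt0; case: ltgtP.
Qed.

(** Positivity is tested at the point [pact g rho2]. It is nonnegative on the simple affine roots,
    hence on positive coroots, and then on affine roots of positive level by comparison with a
    minimal coroot below; [aval_neq0] makes the inequality strict. *)
Lemma all_simple_pos g b : W g -> (forall a, @aff_simple D a -> apos (wact (winv g) a)) ->
  apos b -> apos (wact (winv g) b).
Proof.
move=> gW H bp; have gi := W_winv gW; have br := apos_root bp.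
have := aval_neq0 gW br; rewrite -aval_winv // => ne0.
rewrite aposE ?wact_root // lt_neqAle eq_sym ne0 /= aval_winv //.
set p := pact g _.
have Hs a : aff_simple a -> 0 <= aval p a.
  move=> aS; have ar := aff_simple_root aS.
  by have := H a aS; rewrite aposE ?wact_root // aval_winv // => /ltW.
have Hp c : c \in pos_roots D -> 0 <= pr p (coroot c).
  move=> cp; have [d [d0 dE]] := pos_coroot cp.
  rewrite -(pmulr_rge0 _ (cform_root_gt0 (pos_root_root cp))) dE big_seq.
  apply: sumr_ge0 => a aS; rewrite mulr_ge0 ?d0 //.
  by have := Hs (a, 0) (or_introl (conj aS erefl)); rewrite /aval /= mulr0 addr0.
case: b bp br {ne0} => be k; rewrite /apos /= => /andP[ber].
case/orP => [k0 _|/andP[/eqP-> bep] _]; last by rewrite /aval /= mulr0 addr0 Hp.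
have [mu mm md] := minimal_ex ber.
have := dominance_le Hp md; have := Hs (mu, 1) (or_intror (conj mm erefl)).
by rewrite /aval /=; have := hC_gt0 D; move: (hC D) (pr _ _) (pr _ _) => h A B; nia.
Qed.

Lemma left_descent g : W g -> wlength g != 0%N ->
  exists2 a, @aff_simple D a & apos (aopp (wact (winv g) a)).
Proof.
move=> gW; apply: contra_neqP => H; have gi := W_winv gW.
rewrite -wlength_winv // wlengthE // (_ : fset_set _ = fset0) ?cardfs0 //.
apply/fsetP => b; rewrite mem_invs // inE; apply/negP => /andP[bp bn].
have := all_simple_pos gW _ bp; rewrite -[apos _]negbK -apos_aopp ?bn; last first.
  by rewrite wact_root //; apply: apos_root.
move=> F; apply: notF; apply: F => a aS; apply: contrapT => /negP na; apply: H.
by exists a => //; rewrite apos_aopp // wact_root //; apply: aff_simple_root.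
Qed.

Lemma aff_refl_wact g a x : W g -> aff_root a ->
  aff_refl (wact g a) (g x) = g (aff_refl a x).
Proof.
move=> gW ar; rewrite {1}/aff_refl aff_eval_wact // /aff_refl /=.
rewrite (W_E x gW) (W_E (x - _) gW) (W0B _ _ (W_lin gW)) (W0Mz _ _ (W_lin gW)).
by rewrite addrAC.
Qed.

(** A left descent [a] of [g] is stripped off and [b] is replaced by its image under [s_a], until
    [b] is itself the descent. *)
Lemma refl_length_lt g b : W g -> apos b -> apos (aopp (wact (winv g) b)) ->
  (wlength (aff_refl b \o g) < wlength g)%N.
Proof.
have [n] := ubnP (wlength g); elim: n g b => // n IH g b gn gW bp bn.
have br := apos_root bp; have gi := W_winv gW; have sbW := W_aff_refl br.
have l0 : wlength g != 0%N.
  apply/eqP => g0; have : b \in fset_set (invs (winv g)) by rewrite mem_invs ?bp.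
  have := wlength_winv gW; rewrite g0 wlengthE // => /eqP; rewrite cardfs_eq0 => /eqP->.
  by rewrite inE.
have [a aS an] := left_descent gW l0; have ar := aff_simple_root aS.
have saW := W_aff_refl ar; have lg := len_simple_lN aS gW an.
have [ba|ba] := eqVneq b a; first by rewrite ba lg.
pose b' := wact (aff_refl a) b; have b'p : apos b' by apply: aff_simple_perm.
have b'r := apos_root b'p.
have sgW := W_comp saW gW.
have E : wact (winv (aff_refl a \o g)) b' = wact (winv g) b.
  rewrite winv_comp // winv_aff_refl // wact_comp // /b'.
  by rewrite -(wact_comp saW saW) // aff_refl_inv // wact_id.
have lt1 : (wlength (aff_refl a \o g) < n)%N by move: gn; rewrite lg; lia.
have := IH (aff_refl a \o g) b' lt1 sgW b'p; rewrite E => /(_ bn) lt.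
have E2 : aff_refl b \o g = aff_refl a \o (aff_refl b' \o (aff_refl a \o g)).
  apply/funext => x /=; rewrite aff_refl_wact //.
  by have /= -> := congr1 (@^~ (aff_refl b (g x))) (aff_refl_inv ar).
have slW : W (aff_refl b' \o (aff_refl a \o g)) by apply: W_comp => //; apply: W_aff_refl.
rewrite E2 lg ltnS; apply: leq_trans lt.
have [H|H] := boolP (apos (wact (winv (aff_refl b' \o (aff_refl a \o g))) a)).
  by rewrite len_simple_l.
rewrite -apos_aopp ?wact_root in H => //; last exact: W_winv.
by have := len_simple_lN aS slW H => ->; lia.
Qed.

End LengthFunction.

(** * Lengths of translations *)

Section Translations.
Variable D : rootDatum.
Local Notation X := (latX D).
Local Notation Y := (latY D).
Local Notation pr := (@pairing D).
Implicit Types (x y a b : X) (w v g : X -> X).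

Lemma wact_transl x b k : wact (transl x) (b, k) = (b, k - pr x (coroot b)).
Proof. by rewrite /wact lin_transl /transl add0r. Qed.

Lemma wact_W0 w b k : @W0 D w -> wact w (b, k) = (w b, k).
Proof. by move=> ww; rewrite /wact lin_W0 // W0_0 // pr0l subr0. Qed.

Lemma dominant_neg x b : dominant x -> b \in roots D -> b \notin pos_roots D ->
  pr x (coroot b) <= 0.
Proof.
move=> xd br bn; have := pos_or_neg br; rewrite (negPf bn) /= => /xd.
by rewrite corootN // oppr_ge0.
Qed.

Lemma invs_transl x b k : dominant x ->
  (apos (b, k) && apos (aopp (wact (transl x) (b, k)))) =
  [&& b \in pos_roots D, 0 <= k & k < pr x (coroot b)].
Proof.
move=> xd; rewrite wact_transl /apos /aopp /= rootNE.
case: (boolP (b \in roots D)) => br /=; last first.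
  by apply/esym/negbTE; rewrite negb_and; apply/orP; left; apply: contraNN br; apply: pos_root_root.
case: (boolP (b \in pos_roots D)) => bp /=; last first.
  rewrite andbF orbF; apply/negbTE/negP => /andP[k0 H].
  by have := dominant_neg xd br bp; case/orP: H => [|/andP[/eqP]]; lia.
rewrite andbT (negPf (pos_neg bp)) andbF orbF oppr_gt0 subr_lt0.
by have := xd b bp; case: (ltgtP k 0) => //= k0; lia.
Qed.

Lemma len_transl x : dominant x -> (wlength (transl x))%:Z = ht x.
Proof.
move=> xd; have tW := W_transl x; rewrite wlengthE //.
pose s := [seq (b, k%:Z) | b <- pos_roots D, k <- iota 0 `|pr x (coroot b)|%N].
have us : uniq s.
  apply: allpairs_uniq_dep => [||[b k] [c l] _ _ [-> /eqP]]; rewrite ?fset_uniq //.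
    by move=> b _; apply: iota_uniq.
  by move=> /eqP ->.
rewrite (@perm_size _ _ s); last first.
  apply: uniq_perm => // [|[b k]]; first exact: fset_uniq.
  rewrite mem_invs // invs_transl //; apply/and3P/allpairsPdep.
    move=> [bp k0 kx]; exists b, `|k|%N; split => //; first by rewrite mem_iota; lia.
    by congr (_, _); lia.
  move=> [c [l [cp]]]; rewrite mem_iota => /andP[_ lx] [-> ->]; split => //.
  by have := xd c cp; lia.
rewrite size_allpairs_dep sumnE big_map /ht !big_seq.
rewrite (big_morph _ PoszD (erefl _ : Posz 0 = 0)).
by apply: eq_bigr => b bp; rewrite size_iota gez0_abs ?xd.
Qed.

Lemma transl_comp x y : transl x \o transl y = transl (x + y) :> (X -> X).
Proof. by apply/funext => z; rewrite /transl /= -addrA [y + x]addrC. Qed.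

Lemma W0_transl w x : @W0 D w -> w \o transl x = transl (w x) \o w.
Proof. by move=> ww; apply/funext => z; rewrite /transl /= W0D. Qed.

(** A dominant translation moves each of its inversions to a negative level, and elements of W_0
    preserve levels. *)
Lemma len_W0_transl w x : @W0 D w -> dominant x ->
  wlength (w \o transl x) = (wlength w + wlength (transl x))%N.
Proof.
move=> ww xd; have wW := W0_W ww; have tW := W_transl x.
apply: len_add => // -[b k] bp bn; have br := apos_root bp.
have : apos (b, k) && apos (aopp (wact (transl x) (b, k))) by rewrite bp.
rewrite invs_transl // => /and3P[b1 k0 kx].
rewrite wact_transl wact_W0 // /apos /aopp /= rootNE W0_root // (pos_root_root b1) /=.
by rewrite oppr_gt0 subr_lt0 kx.
Qed.

Lemma longest_neg w0 b : longest w0 -> b \in pos_roots D -> w0 b \notin pos_roots D.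
Proof.
move=> [ww wmax] bp; have wW := W0_W ww; have br := pos_root_root bp.
have H a : a \in simple D -> pr (winv w0 (rho2 D)) (coroot a) <= 0.
  move=> aS; have ar := simple_root aS; rewrite -W0_pr_winv //.
  rewrite leNgt -pos_rho2 ?W0_root //; apply/negP => wp.
  have aS' : @aff_simple D (a, 0) by left.
  have := wmax (w0 \o srefl a) (W0_comp ww (W0_srefl ar)).
  rewrite -aff_refl0 len_simple_r ?ltnn // wact_W0 // /apos /= W0_root // ar.
  by rewrite wp.
rewrite pos_rho2 ?W0_root // -leNgt W0_pr_winv //.
have [c [c0 cE]] := pos_coroot bp.
rewrite -(pmulr_rle0 _ (cform_root_gt0 br)) cE big_seq; apply: sumr_le0 => a aS.
by rewrite mulr_ge0_le0 ?c0 ?H.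
Qed.

Lemma len_transl_w0 w0 x : longest w0 -> dominant x ->
  wlength (transl (w0 x) \o w0) = (wlength (transl (w0 x)) + wlength w0)%N.
Proof.
move=> w0l xd; have ww := w0l.1; have wW := W0_W ww; have tW := W_transl (w0 x).
apply: len_add => // -[b k] bp; have br : b \in roots D := apos_root bp.
rewrite wact_W0 // wact_transl W0_pr //; move: bp.
rewrite /apos /aopp /= !rootNE W0_root // br /= => /orP[k0|/andP[/eqP-> bp] _].
  by move=> /orP[|/andP[/eqP]]; lia.
have := longest_neg w0l bp; have := pos_or_neg (_ : w0 b \in roots D).
rewrite W0_root // => /(_ br) /orP[->//|->] _; have := xd b bp.
by rewrite sub0r opprK andbT le_eqVlt => /orP[/eqP <-|-> //]; rewrite eqxx orbT.
Qed.

Lemma aff_simple0 a : a \in simple D -> @aff_simple D (a, 0).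
Proof. by left. Qed.

Lemma len_transl_srefl a x : a \in simple D -> dominant x -> 0 < pr x (coroot a) ->
  wlength (transl x) = (wlength (transl x \o srefl a)).+1.
Proof.
move=> aS xd xa; rewrite -aff_refl0; apply: len_simple_rN => //; first exact: aff_simple0.
  exact: W_transl.
by rewrite wact_transl /apos /aopp /= rootNE simple_root //= sub0r opprK xa.
Qed.

(** For [g = t_x s_a] the square is the translation by [2 x - a]. This additivity gives
    [T_g T_g = T_(g g)], on which [th_half] rests. *)
Lemma len_half_square a x : a \in simple D -> dominant x -> pr x (coroot a) = 1 ->
  wlength ((transl x \o srefl a) \o (transl x \o srefl a)) =
  (wlength (transl x \o srefl a) + wlength (transl x \o srefl a))%N.
Proof.
move=> aS xd xa; have ar := simple_root aS; have sw := W0_srefl ar.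
have tW := W_transl x; have sW := W0_W sw; have gW := W_comp tW sW.
have E b k : b \in roots D -> wact (transl x \o srefl a) (b, k) = (srefl a b, k - pr x (coroot (srefl a b))).
  by move=> br; rewrite wact_comp // wact_W0 // wact_transl.
apply: len_add => // -[b k] bp; have br := apos_root bp; have br' : b \in roots D := br.
rewrite !E ?srefl_root // sreflK //.
move: bp; rewrite /apos /aopp /= !rootNE srefl_root // br' /=.
have sx : pr x (coroot (srefl a b)) = pr x (coroot b) - pr a (coroot b).
  by rewrite coroot_srefl // /srefl prBl prMzl xa mul1r.
have [ba|ba] := eqVneq b a.
  rewrite sx ba xa pairing_coroot // => Hp /orP[|/andP[/eqP]];
    by case/orP: Hp => [|/andP[/eqP ->]]; lia.
have [bna|bna] := eqVneq b (- a).
  rewrite sx bna !corootN // xa pairing_coroot // (negPf (pos_neg (simple_pos aS))).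
  rewrite sreflN srefl_self // opprK (negPf (pos_neg (simple_pos aS))) !andbF !orbF.
  by lia.
have spos : (srefl a b \in pos_roots D) = (b \in pos_roots D).
  have [bp|bn] := boolP (b \in pos_roots D); first by rewrite simple_perm.
  apply/negbTE; have := pos_or_neg br'; rewrite (negPf bn) /= => bp.
  have := simple_perm aS bp; rewrite sreflN eqr_oppLR => /(_ bna) /pos_neg.
  by rewrite opprK.
have [bp|bn] := boolP (b \in pos_roots D).
  have sp : srefl a b \in pos_roots D by rewrite spos.
  rewrite (negPf (pos_neg sp)) andbF orbF => _ H; apply/orP; left.
  by have := xd b bp; lia.
have sn : srefl a b \notin pos_roots D by rewrite spos.
have := dominant_neg xd (srefl_root ar br') sn.
by rewrite andbF orbF => A0 k0 /orP[|/andP[/eqP]]; lia.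
Qed.

Lemma simple_perp a : a \in simple D -> forall b, b \in simple D -> b != a ->
  2 <= pr (rho2 D - a) (coroot b).
Proof.
move=> aS b bS ba; rewrite prBl rho2_simple //.
by have := simple_pr_le0 aS bS; rewrite eq_sym => /(_ ba); lia.
Qed.

Lemma simple_perp0 a : a \in simple D -> pr (rho2 D - a) (coroot a) = 0.
Proof. by move=> aS; rewrite prBl rho2_simple // pairing_coroot ?simple_root // subrr. Qed.

Lemma dominant_perp a : a \in simple D -> dominant (rho2 D - a).
Proof.
move=> aS; apply: dominant_simple => b bS.
by have [->|/(simple_perp aS bS)] := eqVneq b a; [rewrite simple_perp0|lia].
Qed.

Lemma dominant_rho2 : dominant (rho2 D).
Proof. by apply: dominant_simple => b bS; rewrite rho2_simple. Qed.

Lemma dominant_shift x : exists y, dominant y /\ dominant (x + y).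
Proof.
pose N := \sum_(b <- roots D) `|pr x (coroot b)|%N.
exists (rho2 D *+ N); split; apply: dominant_simple => a aS.
  by rewrite prMnl rho2_simple // mulrn_wge0.
rewrite pairingDl prMnl rho2_simple //.
have : (`|pr x (coroot a)|%N <= N)%N by rewrite /N (big_rem a) ?leq_addr //= simple_root.
lia.
Qed.

Lemma dominant_shift_perp a x : a \in simple D -> pr x (coroot a) = 0 ->
  exists y, [/\ dominant y, dominant (x + y), pr y (coroot a) = 0 & pr (x + y) (coroot a) = 0].
Proof.
move=> aS xa; pose N := \sum_(b <- roots D) `|pr x (coroot b)|%N.
have yd b : b \in simple D -> 0 <= pr ((rho2 D - a) *+ N) (coroot b).
  by move=> bS; rewrite prMnl mulrn_wge0 // (dominant_perp aS) ?simple_pos.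
exists ((rho2 D - a) *+ N); split; last 2 first.
- by rewrite prMnl simple_perp0 // mul0rn.
- by rewrite pairingDl prMnl simple_perp0 // mul0rn xa.
- exact: dominant_simple.
apply: dominant_simple => b bS.
have [->|ba] := eqVneq b a; first by rewrite pairingDl xa add0r yd.
rewrite pairingDl prMnl; have := simple_perp aS bS ba.
have : (`|pr x (coroot b)|%N <= N)%N by rewrite /N (big_rem b) ?leq_addr //= simple_root.
move: (pr _ _) (pr _ _) => u v; rewrite -mulr_natl natz; nia.
Qed.

Lemma evenP b : even_coroot b <-> forall x, (pr x (coroot b) %% 2)%Z = 0.
Proof.
split=> [/asboolP[y yE] x|ev]; first by rewrite yE prMnr; lia.
apply/asboolP; pose f : X -> int := fun x => (pr x (coroot b) %/ 2)%Z.
have fB : zmod_morphism f.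
  by move=> u v; rewrite /f; have := ev u; have := ev v; have := ev (u - v); rewrite prBl; lia.
pose fA : {additive X -> int} := HB.pack f (GRing.isZmodMorphism.Build _ _ f fB).
have [y [yE _]] := perfectl fA; exists y; apply: pr_injr => z.
by rewrite prMnr -yE /= /f; have := ev z; lia.
Qed.

Lemma odd_pairing b : ~~ even_coroot b -> exists x, (pr x (coroot b) %% 2)%Z = 1.
Proof.
move=> ne; apply: contrapT => no; case/negP: ne; apply/evenP => x.
by case: (pselect ((pr x (coroot b) %% 2)%Z = 1)) => [h|]; [case: no; exists x|lia].
Qed.

(** An odd pairing is reduced to 1 by subtracting multiples of [a]; multiples of [rho2 - a], which
    pairs to zero with [a^vee], then restore dominance. *)
Lemma odd_coroot a : a \in simple D -> ~~ even_coroot a ->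
  exists2 x, dominant x & pr x (coroot a) = 1.
Proof.
move=> aS ne; have ar := simple_root aS; have [x xo] := odd_pairing ne.
pose z := x - a *~ (pr x (coroot a) %/ 2)%Z.
have za : pr z (coroot a) = 1 by rewrite prBl prMzl pairing_coroot //; lia.
pose N := \sum_(b <- roots D) `|pr z (coroot b)|%N.
exists (z + (rho2 D - a) *+ N); last by rewrite pairingDl prMnl simple_perp0 // mul0rn za.
apply: dominant_simple => b bS.
have [->|ba] := eqVneq b a; first by rewrite pairingDl prMnl simple_perp0 // mul0rn za.
rewrite pairingDl prMnl; have := simple_perp aS bS ba.
have : (`|pr z (coroot b)|%N <= N)%N by rewrite /N (big_rem b) ?leq_addr //= simple_root.
move: (pr _ _) (pr _ _) => u v; rewrite -mulr_natl natz; nia.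
Qed.

Lemma fin_descent w : @W0 D w -> wlength w != 0%N ->
  exists2 a, a \in simple D & apos (aopp (wact (winv w) (a, 0))).
Proof.
move=> ww l0; have [[a k] aS an] := left_descent (W0_W ww) l0.
case: (aS) => [[/= a1 k0]|[/= [ar _] k1]]; first by exists a => //; rewrite -k0.
move: an; rewrite wact_W0 ?k1; last exact: W0_winv.
by rewrite /apos /aopp /= andbC.
Qed.

Lemma longest_uniq w0 v : longest w0 -> @W0 D v ->
  (forall b, b \in pos_roots D -> v b \notin pos_roots D) -> wlength v = wlength w0.
Proof.
move=> w0l vv H; have ww := w0l.1; have vW := W0_W vv; have wW := W0_W ww.
rewrite !wlengthE //; congr (#|` _|); apply/fsetP => -[b k]; rewrite !mem_invs // !wact_W0 //.
have [bp|//] := boolP (apos (b, k)).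
have br := apos_root bp; have br' : b \in roots D := br.
move: bp; rewrite /apos /aopp /= !rootNE !W0_root // br' /= oppr_gt0 oppr_eq0.
case/orP => [k0|/andP[/eqP-> bp]]; first by case: ltgtP k0.
have h u : @W0 D u -> u b \notin pos_roots D -> - u b \in pos_roots D.
  by move=> uu un; have := pos_or_neg (_ : u b \in roots D); rewrite W0_root // => /(_ br'); rewrite (negPf un).
by rewrite !h // ?H // longest_neg.
Qed.

Lemma W0_adjoint w (y : Y) : @W0 D w -> exists n : X -> int, forall x,
  pr (w x) y = pr x (y + \sum_(b <- roots D) coroot b *~ n b).
Proof.
move=> ww; elim: ww y => [|a u ar _ IH] y.
  by exists (fun=> 0) => x; rewrite big1 ?addr0 // => b _; rewrite mulr0z.
have [n nE] := IH (csrefl a y).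
exists (fun b => n b + (if b == a then - pr a y else 0)) => x.
rewrite /= aff_refl0 pr_srefl nE; congr (pr _ _).
rewrite /csrefl -addrA; congr (_ + _); rewrite addrC.
rewrite [RHS](eq_bigr (fun b => coroot b *~ n b + (if b == a then coroot b *~ - pr a y else 0))); last first.
  by move=> b _; rewrite mulrzDr; case: eqP; rewrite ?mulr0z.
by rewrite big_split /= big_if1 ?fset_uniq // mulrNz.
Qed.

(** Dually, [w] moves [y] by a combination [y'] of coroots, and [y'] pairs to zero with all roots.
    The invariant form represents a multiple of [y'] by a vector [v] of norm 0, and Cauchy-Schwarz
    shows that [y'] pairs to zero with everything. *)
Lemma W0_faithful w : @W0 D w -> (forall b, b \in roots D -> w b = b) -> w = id.
Proof.
move=> ww wid; apply/funext => x; apply: pr_injl => y.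
have [n nE] := W0_adjoint y ww; rewrite nE /= pairingDr.
set y' := \sum_(b <- _) _ in nE *; suff -> : pr x y' = 0 by rewrite addr0.
have b0 b : b \in roots D -> pr b y' = 0.
  by move=> br; have := nE b; rewrite wid // pairingDr => /eqP; rewrite -subr_eq0 opprD addrA subrr sub0r oppr_eq0 => /eqP.
pose M := \prod_(b <- roots D) cform b b.
have Mb b : b \in roots D -> (M %/ cform b b)%Z * cform b b = M.
  by move=> br; rewrite divzK // /M (big_rem b) //= dvdz_mulr.
(* The functional of b^vee is represented by 2b/(b, b); the common multiple [M] clears these
   denominators. *)
pose v := \sum_(b <- roots D) b *~ (2 * n b * (M %/ cform b b)%Z).
have vE z : cform z v = M * pr z y'.
  rewrite cform_sumr /y' pr_sumr mulr_sumr; apply: eq_big_seq => b br.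
  rewrite cformMzr prMzr -{2}(Mb b br).
  have := cform_coroot z br; move: (cform z b) (pr _ _) (cform b b) (_ %/ _)%Z => A B C E F.
  have -> : 2 * n b * E * A = n b * E * (2 * A) by ring.
  by rewrite F; ring.
have vy : pr v y' = 0.
  by rewrite pr_suml big_seq big1 // => b br; rewrite prMzl b0 // mulr0.
have vv : cform v v = 0 by rewrite vE vy mulr0.
have M0 : M != 0.
  by rewrite /M prodf_seq_neq0; apply/allP => b br /=; rewrite gt_eqF // cform_root_gt0.
apply: (mulfI M0); rewrite mulr0 -vE.
by have := cform_CS x v; rewrite vv mulr0 => h; apply/eqP; rewrite -sqrf_eq0 -lte_anti // sqr_ge0 h.
Qed.

Lemma W0_finite : finite_set [set w | @W0 D w].
Proof.
pose RT := roots D : finType.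
pose phi (w : X -> X) : {ffun RT -> RT} := [ffun b : RT => insubd b (w (val b))].
pose psi (F : {ffun RT -> RT}) : X -> X := xget (fun x => x : X) [set w | W0 w /\ phi w = F].
apply: (@sub_finite_set _ _ (psi @` setT)); last exact: finite_image.
move=> w /= ww; exists (phi w) => //; rewrite /psi; case: xgetP => [v _ [vv vE]|/(_ w)]; last by case.
have K : forall b, b \in roots D -> v b = w b.
  move=> b br; have /ffunP/(_ [` br]) := vE; rewrite !ffunE /= => /(congr1 val).
  by rewrite !insubdK // -topredE /= W0_root.
have : winv w \o v = id.
  apply: W0_faithful; first by apply: W0_comp => //; apply: W0_winv.
  by move=> b br /=; rewrite K // W0_winvK.
move=> E; apply/funext => x; have := congr1 (@^~ x) E => /= /(congr1 w).
by rewrite W0_winvKr.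
Qed.

End Translations.

(** * The Hecke algebra: inverses and the trace form *)

Section Hecke.
Variables (R : realType) (D : rootDatum) (L : labels R D) (H : heckeAlgebra L).
Local Notation X := (latX D).
Local Notation T := (hT H).
Local Notation th := (htheta H).
Local Notation q := (qW L).
Local Notation qc w := ((qW L w)%:C%C).
Implicit Types (x y : X) (w v g u s : X -> X) (h : H).

Lemma W_id : W (fun x : X => x).
Proof. exact: W0_W (W0_id D). Qed.

Lemma wlength_id : wlength (fun x : X => x) = 0%N.
Proof.
rewrite wlengthE; last exact: W_id.
rewrite (_ : fset_set _ = fset0) ?cardfs0 //; apply/fsetP => a.
rewrite mem_invs ?inE; last exact: W_id.
apply/negbTE/negP => /andP[ap]; have ar := apos_root ap.
by rewrite (wact_id ar) apos_aopp // ap.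
Qed.

Lemma hecke_ind (P : H -> Prop) : (forall w, W w -> P (T w)) ->
  (forall c h, P h -> P (c *: h)) -> (forall h h', P h -> P h' -> P (h + h')) ->
  P 0 -> forall h, P h.
Proof.
move=> PT PZ PD P0 h; have [s [c [sW ->]]] := hT_span h.
by rewrite big_seq; elim/big_rec: _ => // w h' /sW wW Ph'; apply: PD => //; apply: PZ; apply: PT.
Qed.

Lemma T_id : T (fun x => x) = 1.
Proof.
have E h : T (fun x => x) * h = h.
  elim/hecke_ind: h => [w wW|c h E|h h' E E'|]; last by rewrite mulr0.
  - by rewrite (hT_mul H W_id wW) // wlength_id.
  - by rewrite -scalerAr E.
  - by rewrite mulrDr E E'.
by rewrite -[LHS]mulr1 E.
Qed.

Lemma S_affP a : @aff_simple D a -> S_aff (aff_refl a).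
Proof. by exists a. Qed.

Lemma q_simple_gt0 a : @aff_simple D a -> 0 < q (aff_refl a).
Proof.
move=> aS; rewrite qW_simple; last exact: S_affP.
by apply: powR_gt0; apply: lt_trans (bfq_gt1 L).
Qed.

Lemma W_simple_ind (P : (X -> X) -> Prop) :
  (forall w, W w -> wlength w = 0%N -> P w) ->
  (forall a w, @aff_simple D a -> W w -> wlength (aff_refl a \o w) = (wlength w).+1 ->
    P w -> P (aff_refl a \o w)) ->
  forall w, W w -> P w.
Proof.
move=> P0 PS w; have [n] := ubnP (wlength w); elim: n w => // n IH w wn wW.
have [/eqP l0|l0] := boolP (wlength w == 0%N); first exact: P0.
have [a aS an] := left_descent wW l0; have lw := len_simple_lN aS wW an.
have saW : W (aff_refl a \o w).
  by apply: W_comp => //; apply: W_aff_refl; apply: aff_simple_root.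
rewrite -(W_simpleKl w aS); apply: PS => //; first by rewrite W_simpleKl.
by apply: IH => //; rewrite lw ltnS in wn.
Qed.

Lemma aff_simple_W a : @aff_simple D a -> W (aff_refl a).
Proof. by move=> aS; apply: W_aff_refl; apply: aff_simple_root. Qed.

Lemma q_gt0 w : W w -> 0 < q w.
Proof.
move: w; apply: W_simple_ind => [w wW l0|a w aS wW lw IH]; first by rewrite qW_length0.
have sW := aff_simple_W aS.
by rewrite qW_mul // ?mulr_gt0 ?q_simple_gt0 // lw wlength_simple.
Qed.

Lemma qc_neq0 w : W w -> qc w != 0.
Proof. by move=> wW; rewrite fmorph_eq0 gt_eqF ?q_gt0. Qed.

Lemma T_sq a : @aff_simple D a ->
  T (aff_refl a) * T (aff_refl a) = (qc (aff_refl a) - 1) *: T (aff_refl a) + qc (aff_refl a) *: 1.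
Proof.
move=> aS; have /eqP := hT_quad H (S_affP aS).
rewrite mulrDl mulrBr mul1r mulr_algr addrA subr_eq0 => /eqP E.
by rewrite scalerBl scale1r -E [RHS]addrC -addrA [X in _ + X]addrC !subrK.
Qed.

Lemma T_simple_lN a w : @aff_simple D a -> W w -> wlength w = (wlength (aff_refl a \o w)).+1 ->
  T w = T (aff_refl a) * T (aff_refl a \o w).
Proof.
move=> aS wW lw; have sW := aff_simple_W aS; have swW := W_comp sW wW.
by rewrite (hT_mul H) // W_simpleKl // wlength_simple // add1n.
Qed.

Definition Ti (w : X -> X) : H := xget 0 [set h : H | T w * h = 1 /\ h * T w = 1].

Lemma Ti_simple a : @aff_simple D a ->
  let s := aff_refl a in let h := (qc s)^-1 *: (T s - (qc s - 1) *: 1) in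
  T s * h = 1 /\ h * T s = 1.
Proof.
move=> aS s h; have q0 : qc s != 0 by apply: qc_neq0; apply: aff_simple_W.
have E : T s * T s - (qc s - 1) *: T s = qc s *: 1 by rewrite T_sq // addrAC subrr add0r.
rewrite /h -scalerAr -scalerAl mulrBr mulrBl -scalerAr -scalerAl mulr1 mul1r E.
by rewrite scalerA mulVf // scale1r.
Qed.

Lemma Ti_ex w : W w -> exists h, T w * h = 1 /\ h * T w = 1.
Proof.
move: w; apply: W_simple_ind => [w wW l0|a w aS wW lw [h [h1 h2]]].
  have wi := W_winv wW; exists (T (winv w)).
  by rewrite !(hT_mul H) ?W_winvV ?W_winvVr ?wlength_winv ?wlength_id ?l0 // T_id.
have sW := aff_simple_W aS; have [k1 k2] := Ti_simple aS.
set k := _ *: _ in k1 k2; exists (h * k).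
rewrite -(hT_mul H) ?lw ?wlength_simple //; split.
  by rewrite mulrA -(mulrA (T _) (T w)) h1 mulr1.
by rewrite mulrA -(mulrA h k) k2 mulr1.
Qed.

Lemma TTi w : W w -> T w * Ti w = 1.
Proof.
by move=> /Ti_ex[h Hh]; rewrite /Ti; case: xgetP => [k _ []|/(_ h)].
Qed.

Lemma TiT w : W w -> Ti w * T w = 1.
Proof.
by move=> /Ti_ex[h Hh]; rewrite /Ti; case: xgetP => [k _ []|/(_ h)].
Qed.

Lemma TsTi a : @aff_simple D a ->
  Ti (aff_refl a) = (qc (aff_refl a))^-1 *: (T (aff_refl a) - (qc (aff_refl a) - 1) *: 1).
Proof.
move=> aS; have [k1 k2] := Ti_simple aS; have sW := aff_simple_W aS.
by have /= := congr1 (fun z => Ti (aff_refl a) * z) k1; rewrite mulrA TiT // mul1r mulr1.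
Qed.

(** * The trace *)

Lemma W_comp_id u v : W u -> u \o v = id -> v = winv u.
Proof.
move=> uW uv; apply/funext => x; rewrite -[LHS](W_winvK uW).
by congr (winv u _); apply: (congr1 (@^~ x) uv).
Qed.

(** Induction on [v], moving one simple reflection over to [u]. If this shortens [u], the quadratic
    relation leaves an extra term [T_u T_v], whose trace vanishes because the lengths exclude that
    [u] and [v] are inverse. *)
Lemma htau_TT u v : W u -> W v ->
  htau H (T u * T v) = if `[< u \o v = id >] then qc u else 0.
Proof.
move=> uW vW; move: v vW u uW.
apply: W_simple_ind => [v vW l0|a v aS vW lv IH] u uW.
  have uvW := W_comp uW vW; rewrite (hT_mul H) //; last first.
    rewrite l0 addn0; have := len_add uW vW; rewrite l0 addn0; apply.
    move=> b bp bn; have : b \in fset_set (invs v) by rewrite mem_invs ?bp.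
    by move: l0; rewrite wlengthE // => /eqP; rewrite cardfs_eq0 => /eqP ->.
  case: asboolP => [uv|uv]; last by rewrite htau_T.
  rewrite uv T_id -T_id htau_1 qW_length0 //.
  have E := W_comp_id uW uv; rewrite -wlength_winv // -E //.
have sW := aff_simple_W aS; have svW := W_comp sW vW; have usW := W_comp uW sW.
rewrite -(hT_mul H) ?lv ?wlength_simple // mulrA.
have asb : (u \o (aff_refl a \o v) = id) = ((u \o aff_refl a) \o v = id) by [].
have [up|un] := boolP (apos (wact u a)).
  have lus := len_simple_r aS uW up.
  rewrite (hT_mul H) ?lus ?wlength_simple ?addn1 // IH // -asb.
  case: asboolP => // E; have := W_comp_id uW E => /(congr1 (@wlength D)).
  rewrite lv wlength_winv //; move: lus; rewrite asb in E; have := W_comp_id usW E => /(congr1 (@wlength D)).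
  by rewrite wlength_winv // => ->; lia.
have un' : apos (aopp (wact u a)).
  by rewrite apos_aopp // wact_root //; apply: aff_simple_root.
have lus := len_simple_rN aS uW un'.
have uE : T u = T (u \o aff_refl a) * T (aff_refl a).
  by rewrite (hT_mul H) ?W_simpleK // wlength_simple // lus addn1.
have E1 : T u * T (aff_refl a) = (qc (aff_refl a) - 1) *: T u + qc (aff_refl a) *: T (u \o aff_refl a).
  by rewrite {1}uE -mulrA T_sq // mulrDr -!scalerAr mulr1 -uE.
rewrite E1 mulrDl -!scalerAl linearD !linearZ /= !IH // -asb.
have -> : `[< u \o v = id >] = false.
  apply/asboolP => /(W_comp_id uW) vE.
  have := congr1 (@wlength D) vE; rewrite wlength_winv // lus => l1.
  have := lv; rewrite vE.
  have -> : aff_refl a \o winv u = winv (u \o aff_refl a).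
    by rewrite winv_comp // winv_aff_refl //; apply: aff_simple_root.
  by rewrite !wlength_winv // lus => /eqP; rewrite eqn_leq ltnNge leqnSn andbF || lia.
rewrite mulr0 add0r; case: asboolP; rewrite ?mulr0 // => _.
rewrite -rmorphM; congr (_%:C%C).
rewrite mulrC -qW_mul ?W_simpleK // wlength_simple // lus addn1 //.
Qed.

Lemma q_winv u : W u -> q (winv u) = q u.
Proof.
move: u; apply: W_simple_ind => [u uW l0|a u aS uW lu IH].
  by rewrite !qW_length0 // ?wlength_winv //; apply: W_winv.
have sW := aff_simple_W aS; have suW := W_comp sW uW; have ui := W_winv uW.
have E : winv (aff_refl a \o u) = winv u \o aff_refl a.
  by rewrite winv_comp // winv_aff_refl //; apply: aff_simple_root.
rewrite qW_mul //; last by rewrite lu wlength_simple.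
rewrite E qW_mul //; last by rewrite -E !wlength_winv // lu wlength_simple // addn1.
by rewrite IH mulrC.
Qed.

Lemma htauC h h' : htau H (h * h') = htau H (h' * h).
Proof.
elim/hecke_ind: h => [u uW|c h IH|h1 h2 IH1 IH2|]; last by rewrite mul0r mulr0.
- elim/hecke_ind: h' => [v vW|c h IH|h1 h2 IH1 IH2|]; last by rewrite mul0r mulr0.
  + rewrite !htau_TT //; case: asboolP => [uv|uv].
      have E := W_comp_id uW uv.
      by rewrite asboolT E ?W_winvV // q_winv.
    case: asboolP => // vu; case: uv; have E := W_comp_id vW vu.
    by rewrite E W_winvV.
  + by rewrite -scalerAr -scalerAl !linearZ /= IH.
  + by rewrite mulrDr mulrDl !linearD /= IH1 IH2.
- by rewrite -scalerAr -scalerAl !linearZ /= IH.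
- by rewrite mulrDr mulrDl !linearD /= IH1 IH2.
Qed.

(** * The elements [theta_x] *)

Lemma th0 : th 0 = 1. Proof. exact: htheta0. Qed.
Lemma thD x y : th (x + y) = th x * th y. Proof. exact: hthetaD. Qed.
Lemma thC x y : th x * th y = th y * th x. Proof. by rewrite -!thD addrC. Qed.
Lemma thN x : th x * th (- x) = 1. Proof. by rewrite -thD subrr th0. Qed.
Lemma thNr x : th (- x) * th x = 1. Proof. by rewrite -thD addNr th0. Qed.
Lemma th_injl x h h' : th x * h = th x * h' -> h = h'.
Proof. by move=> /(congr1 (fun k => th (- x) * k)); rewrite !mulrA thNr !mul1r. Qed.
Lemma th_injr x h h' : h * th x = h' * th x -> h = h'.
Proof. by move=> /(congr1 (fun k => k * th (- x))); rewrite -!mulrA thN !mulr1. Qed.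

Definition nrm (w : X -> X) : R[i] := (q w `^ (- 2^-1))%:C%C.

Lemma nrm_neq0 w : W w -> nrm w != 0.
Proof. by move=> wW; rewrite fmorph_eq0 gt_eqF // powR_gt0 // q_gt0. Qed.

Lemma nrm_sq w : W w -> nrm w ^+ 2 = (qc w)^-1.
Proof.
move=> wW; rewrite /nrm -rmorphXn -fmorphV; congr (_%:C%C).
rewrite -powR_mulrn ?powR_ge0 // -powRrM mulNr mulVf // powRN powRr1 // ltW // q_gt0 //.
Qed.

Lemma nrm_mul u v : W u -> W v -> wlength (u \o v) = (wlength u + wlength v)%N ->
  nrm (u \o v) = nrm u * nrm v.
Proof.
move=> uW vW luv; rewrite /nrm qW_mul // -rmorphM powRM //; exact/ltW/q_gt0.
Qed.

Lemma th_dom x : dominant x -> th x = nrm (transl x) *: T (transl x).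
Proof. exact: htheta_dom. Qed.

Lemma th_dec x : exists y z, [/\ dominant y, dominant z & x = y - z].
Proof.
have [y [yd xyd]] := dominant_shift x.
by exists (x + y), y; split => //; rewrite addrK.
Qed.

End Hecke.

(** * Bernstein relations *)

Section Bernstein.
Variables (R : realType) (D : rootDatum) (L : labels R D) (H : heckeAlgebra L).
Local Notation X := (latX D).
Local Notation pr := (@pairing D).
Local Notation T := (hT H).
Local Notation Ti := (@Ti R D L H).
Local Notation th := (htheta H).
Local Notation q := (qW L).
Implicit Types (x y a b : X) (w v g u : X -> X) (h : H).

(** For simple [b], [q1] is the parameter of the reflection in [b], and [q0] that of a simple
    reflection conjugate to the affine reflection in [(- b, 1)]. They can differ only if the coroot
    is even. *)
Definition q1 b : R := qlab L (b, 1).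
Definition q0 b : R := qlab L (b, 0).

Lemma qlab_wact w c : W w -> aff_root c -> qlab L (wact w c) = qlab L c.
Proof.
move=> wW cr; have cr' : aff_root (wact w c) by rewrite wact_root.
by apply: (qlab_act L wW cr) => //; apply/aff_actP.
Qed.

Lemma qlab_W0 w b k : W0 w -> b \in roots D -> qlab L (w b, k) = qlab L (b, k).
Proof. by move=> ww br; rewrite -wact_W0 // qlab_wact //; apply: W0_W. Qed.

Lemma qlab_shift x b k : b \in roots D -> qlab L (b, k - pr x (coroot b)) = qlab L (b, k).
Proof. by move=> br; rewrite -wact_transl qlab_wact //; apply: W_transl. Qed.

Lemma q_srefl a : a \in simple D -> q (srefl a) = q1 a.
Proof. by move=> aS; rewrite -aff_refl0 -(qlab_simple L (aff_simple0 aS)). Qed.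

Lemma q_aff_conj (a : X * int) v b : aff_simple a -> W v -> (- b, 1) = wact v a ->
  b \in roots D -> q (aff_refl a) = q0 b.
Proof.
move=> aS vW E br; rewrite -(qlab_simple L aS).
have ar := aff_simple_root aS; have ar' : a.1 \in roots D := ar.
rewrite -(@qlab_wact v (a.1, a.2 + 1)) //.
have -> : wact v (a.1, a.2 + 1) = (- b, 2).
  by move: E; rewrite /wact /= => -[-> E2]; congr (_, _); lia.
have := qlab_shift (- b) 2 (rootN br); rewrite pairing_coroot ?rootN // subrr => <-.
by rewrite -(srefl_self br) qlab_W0 //; apply: W0_srefl.
Qed.

(** A reflection [s_b] that lowers the length by exactly one splits off a conjugate of a generator
    even if it is not simple: left descents are peeled off and collected in [c] until [b] becomes
    simple. The case of interest is [g = t_(2 rho) s_a] and [b = (- a, 1)], where [s_b g] is again a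
    translation. *)
Lemma cover g (b : X * int) : W g -> apos b -> apos (aopp (wact (winv g) b)) ->
  wlength g = (wlength (aff_refl b \o g)).+1 ->
  exists (a : X * int) v (c ci : H), [/\ aff_simple a, W v, b = wact v a,
    c * ci = 1 /\ ci * c = 1 & T g = c * T (aff_refl a) * ci * T (aff_refl b \o g) /\
    q g = q (aff_refl a) * q (aff_refl b \o g)].
Proof.
have [n] := ubnP (wlength g); elim: n g b => // n IH g b gn gW bp bn lg.
have br := apos_root bp; have gi := W_winv gW; have sbW := W_aff_refl br.
have sbgW := W_comp sbW gW.
have l0 : wlength g != 0%N by rewrite lg.
have [a aS an] := left_descent gW l0; have ar := aff_simple_root aS.
have saW := W_aff_refl ar; have la := len_simple_lN aS gW an.
have [ba|ba] := eqVneq b a.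
  exists a, id, 1, 1; rewrite mulr1 !mul1r mulr1; split => //.
  - exact: W_id.
  - by rewrite wact_id.
  - rewrite ba; split; first exact: T_simple_lN.
    rewrite -qW_mul ?W_simpleKl //; first by rewrite -ba.
    by rewrite wlength_simple // add1n.
pose b' := wact (aff_refl a) b; have b'p : apos b' by apply: aff_simple_perm.
have b'r := apos_root b'p; have sgW := W_comp saW gW.
have E : wact (winv (aff_refl a \o g)) b' = wact (winv g) b.
  rewrite winv_comp // winv_aff_refl // wact_comp // /b'.
  by rewrite -(wact_comp saW saW) // aff_refl_inv // wact_id.
have bn' : apos (aopp (wact (winv (aff_refl a \o g)) b')) by rewrite E.
have lt := refl_length_lt sgW b'p bn'.
have E2 : aff_refl b' \o (aff_refl a \o g) = aff_refl a \o (aff_refl b \o g).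
  by apply/funext => x /=; rewrite aff_refl_wact.
have E3 : aff_refl b \o g = aff_refl a \o (aff_refl b' \o (aff_refl a \o g)).
  by rewrite E2 W_simpleKl.
have hW : W (aff_refl b' \o (aff_refl a \o g)) by apply: W_comp => //; apply: W_aff_refl.
have lb : wlength (aff_refl b \o g) = (wlength (aff_refl b' \o (aff_refl a \o g))).+1.
  have [up|un] := boolP (apos (wact (winv (aff_refl b' \o (aff_refl a \o g))) a)).
    by rewrite E3 len_simple_l.
  have un' : apos (aopp (wact (winv (aff_refl b' \o (aff_refl a \o g))) a)).
    by rewrite apos_aopp // wact_root //; apply: W_winv.
  by have := len_simple_lN aS hW un'; rewrite -E3; move: lt; lia.
have lg' : wlength (aff_refl a \o g) = (wlength (aff_refl b' \o (aff_refl a \o g))).+1.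
  by move: lt; lia.
have [|a' [v [c [ci [a'S vW b'E [cc1 cc2] [TE qE]]]]]] := IH _ _ _ sgW b'p bn' lg'.
  by move: gn; rewrite la ltnS.
exists a', (aff_refl a \o v), (T (aff_refl a) * c), (ci * Ti (aff_refl a)); split => //.
- exact: W_comp.
- rewrite wact_comp // -?b'E; last by apply: aff_simple_root.
  by rewrite /b' -(wact_comp saW saW) // aff_refl_inv // wact_id.
- split; first by rewrite mulrA -(mulrA (T _) c) cc1 mulr1 TTi.
  by rewrite mulrA -(mulrA ci) TiT // mulr1 cc2.
- split; last first.
    have -> : q g = q (aff_refl a) * q (aff_refl a \o g).
      by rewrite -qW_mul ?W_simpleKl // wlength_simple // add1n.
    rewrite qE E3 [q (aff_refl a \o _)]qW_mul // ?mulrA; first by rewrite [_ * q (aff_refl a')]mulrC.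
    by rewrite -E3 lb wlength_simple.
  have Tsb : T (aff_refl b \o g) = T (aff_refl a) * T (aff_refl b' \o (aff_refl a \o g)).
    by rewrite (T_simple_lN H aS sbgW) -E2 // lb.
  rewrite (T_simple_lN H aS gW la) TE Tsb !mulrA; congr (_ * _).
  by rewrite -!mulrA TiT // mulr1.
Qed.

Lemma nrmE w : nrm L w = ((Num.sqrt (q w))^-1)%:C%C \/ ~ W w.
Proof.
case: (pselect (W w)) => wW; [left|by right].
by rewrite /nrm powRN powR12_sqrt // ltW // q_gt0.
Qed.

Section Simple.
Variables (a : X) (aS : a \in simple D).
Let ar : a \in roots D := simple_root aS.
Local Notation s := (srefl a).
Local Notation Ts := (T (srefl a)).
Local Notation Tis := (Ti (srefl a)).
Local Notation Q := ((q1 a)%:C%C : R[i]).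
Let sw : W0 s. Proof. exact: W0_srefl. Qed.
Let sW : W s. Proof. exact: W0_W. Qed.
Let aS0 : aff_simple (a, 0). Proof. exact: aff_simple0. Qed.

Lemma q1_gt0 : 0 < q1 a.
Proof. by rewrite -q_srefl // q_gt0. Qed.
Lemma Q_neq0 : Q != 0.
Proof. by rewrite fmorph_eq0 gt_eqF ?q1_gt0. Qed.

Lemma Ts_sq : Ts * Ts = (Q - 1) *: Ts + Q *: 1.
Proof. by have := T_sq H aS0; rewrite aff_refl0 q_srefl. Qed.
Lemma TsTis : Ts * Tis = 1. Proof. exact: TTi. Qed.
Lemma TisTs : Tis * Ts = 1. Proof. exact: TiT. Qed.
Lemma TsE : Ts = Q *: Tis + (Q - 1) *: 1.
Proof.
have := TsTi H aS0; rewrite aff_refl0 q_srefl // => ->.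
by rewrite scalerA mulfV ?Q_neq0 // scale1r subrK.
Qed.
Lemma wlength_s : wlength s = 1%N.
Proof. by have := wlength_simple aS0; rewrite aff_refl0. Qed.

Lemma th_perp_comm x : pr x (coroot a) = 0 -> Ts * th x = th x * Ts.
Proof.
have dom y : dominant y -> pr y (coroot a) = 0 -> Ts * th y = th y * Ts.
  move=> yd ya; rewrite th_dom // -scalerAr -scalerAl; congr (_ *: _).
  have yW := W_transl y.
  have E : s \o transl y = transl y \o s by rewrite W0_transl // /srefl ya mulr0z subr0.
  have lE := len_W0_transl sw yd.
  by rewrite !(hT_mul H) -?E // lE addnC.
move=> xa; have [y [yd xyd ya xya]] := dominant_shift_perp aS xa.
by apply: (th_injr (x := y)); rewrite -!mulrA -thD (dom _ xyd xya) (dom _ yd ya) [in RHS]mulrA -thD.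
Qed.

(** With [g = t_x s], the elements [theta_x] and [theta_(2 x - a)] are multiples of [T_g T_s] and
    [T_g T_g]. Cancelling [T_g] in [theta_x theta_(x - a) = theta_(2 x - a)] leaves the relation. *)
Lemma th_half x : dominant x -> pr x (coroot a) = 1 -> Ts * th (x - a) * Ts = Q *: th x.
Proof.
move=> xd xa; have tW := W_transl x; pose g := transl x \o s.
have gW : W g by apply: W_comp.
have lx : wlength (transl x) = (wlength g).+1 by apply: len_transl_srefl => //; rewrite xa.
have gsE : g \o s = transl x by apply/funext => z; rewrite /g /= sreflK.
have lgs : wlength (g \o s) = (wlength g + wlength s)%N by rewrite gsE lx wlength_s addn1.
have Tx : T (transl x) = T g * Ts by rewrite (hT_mul H) // gsE.
have xsd : dominant (x + (x - a)).
  apply: dominant_simple => b bS; rewrite pairingDl prBl.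
  have [->|ba] := eqVneq b a; first by rewrite pairing_coroot // xa.
  have := xd b (simple_pos bS); have := simple_pr_le0 aS bS.
  by rewrite eq_sym => /(_ ba); lia.
have ggE : g \o g = transl (x + (x - a)).
  apply/funext => z; rewrite /g /transl /= sreflD sreflK // {1}/srefl xa mulr1z.
  by rewrite -addrA [x - a + x]addrC.
have lgg := len_half_square aS xd xa; rewrite -/g in lgg.
have Tgg : T (transl (x + (x - a))) = T g * T g by rewrite (hT_mul H) // ggE.
have nx : nrm L (transl x) = nrm L g * nrm L s by rewrite -gsE nrm_mul.
have nxx : nrm L (transl (x + (x - a))) = nrm L g * nrm L g by rewrite -ggE nrm_mul.
have ng := nrm_neq0 L gW; have ns := nrm_neq0 L sW; have ns2 := nrm_sq L sW.
have Eq : th x * th (x - a) = th (x + (x - a)) by rewrite -thD.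
rewrite th_dom // (th_dom H xsd) nx nxx Tx Tgg -scalerAl -!scalerA in Eq.
have {}Eq := scalerI ng Eq.
have E : nrm L s *: (Ts * th (x - a) * Ts) = nrm L g *: T (transl x).
  have : Ti g * (nrm L s *: (T g * Ts * th (x - a))) * Ts = Ti g * (nrm L g *: (T g * T g)) * Ts.
    by rewrite Eq.
  by rewrite -!scalerAr -!scalerAl !mulrA TiT // !mul1r Tx.
apply: (scalerI ns); rewrite E th_dom // nx !scalerA; congr (_ *: _).
have -> : Q = (nrm L s ^+ 2)^-1 by rewrite ns2 invrK q_srefl.
by field.
Qed.

(** The translation by [2 rho] is [g s], and [cover] splits [T_g] into [Y] and the translation by
    [2 rho - a]. The latter commutes with [T_s], because [2 rho - a] is orthogonal to [a^vee];
    cancelling it exhibits [theta_a] as a multiple of a product of two quadratic elements. *)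
Lemma th_quad : exists Y : H,
  [/\ 0 < q0 a, Y * Y = ((q0 a)%:C%C - 1) *: Y + (q0 a)%:C%C *: 1
  & th a = ((Num.sqrt (q1 a * q0 a))^-1)%:C%C *: (Y * Ts)].
Proof.
pose y := rho2 D - a; pose x := rho2 D; have tyW := W_transl y; have txW := W_transl x.
have yd : dominant y by apply: dominant_perp.
have xd : dominant x by apply: dominant_rho2.
have ya : pr y (coroot a) = 0 by apply: simple_perp0.
have xa : pr x (coroot a) = 2 by apply: rho2_simple.
pose g := transl x \o s; have gW : W g by apply: W_comp.
pose b : X * int := (- a, 1).
have bp : apos b by rewrite /apos /= rootNE ar.
have br := apos_root bp.
have lx : wlength (transl x) = (wlength g).+1 by apply: len_transl_srefl => //; rewrite xa.
have sbE z : aff_refl b z = s z + a.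
  rewrite /aff_refl /aff_eval /b /= corootN // mulNrz opprK mulrzDr mulr1z mulrNz.
  by rewrite /srefl addrA.
have sbg : aff_refl b \o g = transl y.
  apply/funext => z; rewrite /g /transl /= sbE sreflD sreflK // {1}/srefl xa.
  by apply: pr_injl => u; rewrite /y !(pairingDl, prNl, prMzl); ring.
have gsb : g = aff_refl b \o transl y.
  apply/funext => z; rewrite -sbg /=.
  by have /= -> := congr1 (@^~ (g z)) (aff_refl_inv br).
have bn : apos (aopp (wact (winv g) b)).
  rewrite gsb winv_comp ?winv_aff_refl //; last exact: W_aff_refl.
  have -> : winv (transl y) = transl (- y).
    by apply: winv_uniq; apply/funext => z; rewrite /transl /= ?addrK ?subrK.
  have sbW := W_aff_refl br; have tW := W_transl (- y).
  have -> : wact (transl (- y) \o aff_refl b) b = aopp b.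
    by rewrite wact_comp // wact_aff_refl_self // /aopp wact_transl /= opprK prNl ya oppr0 subr0.
  by rewrite aoppK.
have lg : wlength g = (wlength (aff_refl b \o g)).+1.
  rewrite sbg; have := len_transl yd; have := len_transl xd.
  by rewrite /y /x htD htN (ht_simple aS) lx; lia.
have [a' [v [c [ci [a'S vW bE [cc1 cc2] [TE qE]]]]]] := cover gW bp bn lg.
have q0E : q (aff_refl a') = q0 a by apply: (@q_aff_conj a' v).
exists (c * T (aff_refl a') * ci); split.
- by rewrite -q0E q_simple_gt0.
- rewrite -!mulrA (mulrA ci c) cc2 mul1r (mulrA (T _) (T _)) T_sq // q0E.
  by rewrite mulrDl mulrDr -!scalerAl -!scalerAr !mul1r cc1.
have gsE : g \o s = transl x by apply/funext => z; rewrite /g /= sreflK.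
have lgs : wlength (g \o s) = (wlength g + wlength s)%N by rewrite gsE lx wlength_s addn1.
have Tx : T (transl x) = T g * Ts by rewrite (hT_mul H) // gsE.
have qx : q (transl x) = q1 a * q0 a * q (transl y).
  by rewrite -gsE qW_mul // q_srefl // qE q0E sbg mulrC mulrA.
have yC : Ts * T (transl y) = T (transl y) * Ts.
  have := th_perp_comm ya; rewrite th_dom // -scalerAr -scalerAl.
  by move=> /(scalerI (nrm_neq0 L tyW)).
have axy : x = a + y by rewrite /y addrC subrK.
apply: (th_injr (x := y)); rewrite -thD -axy !th_dom // Tx TE sbg -!scalerAr -!scalerAl.
rewrite scalerA -!mulrA yC; congr (_ *: _).
case: (nrmE (transl x)) => // ->; case: (nrmE (transl y)) => // ->.
rewrite qx -!rmorphM; congr (_%:C%C).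
have q0p : 0 < q0 a by rewrite -q0E q_simple_gt0.
have ysq : Num.sqrt (q (transl y)) != 0 by rewrite gt_eqF // sqrtr_gt0 q_gt0.
have -> : Num.sqrt (q1 a * q0 a * q (transl y)) = Num.sqrt (q1 a * q0 a) * Num.sqrt (q (transl y)).
  by rewrite sqrtrM // mulr_ge0 ?(ltW q1_gt0) ?(ltW q0p).
by rewrite invfM mulrC.
Qed.

(* The odd-step coefficient of the Bernstein relation; it differs from [q1 - 1] only if the coroot is even. *)
Definition kap : R[i] := (Num.sqrt (q1 a * q0 a) * (1 - (q0 a)^-1))%:C%C.

(** Both relations come from [theta_a = c^-1 Y T_s], as the quadratic relations make the inverses of
    [Y] and [T_s] linear in them. *)
Lemma th_simple12 :
  Ts * th a = th (- a) * Ts + ((Q - 1) *: th a + kap *: 1) /\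
  Ts * th (- a) = th a * Ts - ((Q - 1) *: th a + kap *: 1).
Proof.
have [Y [q0p YY thE]] := th_quad; set c : R := Num.sqrt _ in thE.
have c0 : c != 0 by rewrite gt_eqF // sqrtr_gt0 mulr_gt0 ?q1_gt0.
have cc0 : c%:C%C != 0 by rewrite fmorph_eq0.
have p0 : (q0 a)%:C%C != 0 :> R[i] by rewrite fmorph_eq0 gt_eqF.
have c2 : c%:C%C * c%:C%C = Q * (q0 a)%:C%C :> R[i].
  rewrite -!rmorphM; congr (_%:C%C); rewrite -expr2 sqr_sqrtr // mulr_ge0 ?ltW ?q1_gt0 //.
have kE : kap = c%:C%C * (1 - ((q0 a)%:C%C)^-1).
  by rewrite /kap rmorphM rmorphB rmorph1 fmorphV.
pose Yi := ((q0 a)%:C%C)^-1 *: (Y - ((q0 a)%:C%C - 1) *: 1).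
have YYi : Y * Yi = 1.
  rewrite /Yi -scalerAr mulrBr YY -scalerAr mulr1 addrAC subrr add0r.
  by rewrite scalerA mulVf // scale1r.
have Y1 : Y = c%:C%C *: (th a * Tis).
  by rewrite thE -scalerAl scalerA -rmorphM mulfV // scale1r -mulrA TsTis mulr1.
have N : th (- a) = c%:C%C *: (Tis * Yi).
  apply: (th_injl (x := a)); rewrite thN thE -scalerAl -scalerAr scalerA -rmorphM mulVf // scale1r.
  by rewrite mulrA -(mulrA Y) TsTis mulr1 YYi.
split.
- rewrite N -scalerAl /Yi -scalerAr -scalerAl scalerA mulrBr mulrBl -!scalerAr -!scalerAl mulr1 TisTs.
  rewrite -mulrA.
  have -> : Y * Ts = c%:C%C *: th a.
    by rewrite thE scalerA -rmorphM mulfV // scale1r.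
  have e1 : c%:C%C / (q0 a)%:C%C * c%:C%C = Q by rewrite mulrAC c2 mulfK.
  have e2 : c%:C%C / (q0 a)%:C%C * ((q0 a)%:C%C - 1) = kap by rewrite kE; field.
  rewrite -scalerAr scalerBr !scalerA e1 e2 {1}TsE mulrDl -!scalerAl mul1r.
  by rewrite [X in _ = _ + X]addrC addrA subrK.
- rewrite N -scalerAr mulrA TsTis mul1r /Yi scalerA scalerBr scalerA.
  have e1 : c%:C%C / (q0 a)%:C%C * c%:C%C = Q by rewrite mulrAC c2 mulfK.
  have e2 : c%:C%C / (q0 a)%:C%C * ((q0 a)%:C%C - 1) = kap by rewrite kE; field.
  have -> : (c%:C%C / (q0 a)%:C%C) *: Y = Q *: (th a * Tis) by rewrite {1}Y1 scalerA e1.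
  rewrite e2 {1}TsE mulrDr -!scalerAr mulr1 opprD addrA addrK //.
Qed.

Lemma kapE : ~~ even_coroot a -> kap = Q - 1.
Proof.
move=> ne; have [x _ xa] := odd_coroot aS ne.
have := qlab_shift x 1 ar; rewrite xa subrr => E.
have q01 : q0 a = q1 a by [].
rewrite /kap q01 -expr2 sqrtr_sqr ger0_norm ?(ltW q1_gt0) // mulrBr mulr1 mulfV ?gt_eqF ?q1_gt0 //.
by rewrite rmorphB rmorph1.
Qed.

Lemma th_half12 x : ~~ even_coroot a -> pr x (coroot a) = 1 ->
  Ts * th x = th (x - a) * Ts + (Q - 1) *: th x /\
  Ts * th (x - a) = th x * Ts - (Q - 1) *: th x.
Proof.
move=> ne xa; have [x0 x0d x0a] := odd_coroot aS ne.
have hE := th_half x0d x0a.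
have h2 : Ts * th (x0 - a) = th x0 * Ts - (Q - 1) *: th x0.
  rewrite {2}TsE mulrDr -!scalerAr mulr1 addrK scalerAl -hE.
  by rewrite -!mulrA TsTis mulr1.
have h1 : Ts * th x0 = th (x0 - a) * Ts + (Q - 1) *: th x0.
  rewrite {1}TsE mulrDl -!scalerAl mul1r; congr (_ + _).
  by rewrite scalerAr -hE !mulrA TisTs mul1r.
have za : pr (x - x0) (coroot a) = 0 by rewrite prBl xa x0a subrr.
have C := th_perp_comm za.
have E y : th (y + (x - x0)) = th (x - x0) * th y by rewrite thD thC.
have -> : x = x0 + (x - x0) by rewrite addrC subrK.
rewrite [x0 + _ - a]addrAC !E !mulrA C -!mulrA h1 h2 !(mulrDr, mulrN) -!scalerAr.
by rewrite !mulrA.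
Qed.

Definition kc (i : nat) : R[i] := if odd i then kap else Q - 1.

(** Induction in steps of two, because multiplication by [theta_a] raises the pairing by 2; this is
    also the origin of the period two of [kc]. *)
Lemma th_bern n x : pr x (coroot a) = n%:Z ->
  Ts * th x = th (x - a *+ n) * Ts + \sum_(i < n) kc i *: th (x - a *+ i).
Proof.
have [m] := ubnP n; elim: m n x => // m IH [|[|n]] x nm xa.
- by rewrite mulr0n subr0 big_ord0 addr0 th_perp_comm.
- have [/asboolP[y yE]|ne] := boolP (even_coroot a).
    by move: xa; rewrite yE prMnr; lia.
  by have [-> _] := th_half12 ne xa; rewrite big_ord1 mulr1n mulr0n subr0.
have x'a : pr (x - a) (coroot a) = n%:Z by rewrite prBl pairing_coroot // xa; lia.
have [t1 _] := th_simple12.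
have {1}-> : x = (x - a) + a by rewrite subrK.
rewrite thD mulrA (IH n) //; last by move: nm; lia.
rewrite mulrDl -mulrA t1 !mulrDr -!scalerAr mulr1 mulrA -!thD.
rewrite (_ : x - a - a *+ n - a = x - a *+ n.+2); last first.
  by apply: pr_injl => u; rewrite !(pairingDl, prNl, prMnl) !mulrS; ring.
rewrite -!addrA; congr (_ + _); rewrite addrA addrC 2!big_ord_recr -[RHS]addrA /=; congr (_ + _).
  rewrite mulr_suml; apply: eq_bigr => i _.
  rewrite -scalerAl -thD; congr (_ *: th _).
  by rewrite addrAC subrK.
(* The two new terms carry [Q - 1] and then [kap]. For odd [n] the coroot is not even, and the two
   constants agree. *)
have [ko1 ko2] : kc n = Q - 1 /\ kc n.+1 = kap.
  rewrite /kc /=; have [/asboolP[y yE]|ne] := boolP (even_coroot a).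
    have -> : odd n = false by move: x'a; rewrite yE prMnr; lia.
    by [].
  by rewrite kapE //; case: odd.
rewrite ko1 ko2; congr (_ *: th _ + _ *: th _).
  by apply: pr_injl => u; rewrite !(pairingDl, prNl, prMnl); ring.
by apply: pr_injl => u; rewrite !(pairingDl, prNl, prMnl) !mulrS; ring.
Qed.

Definition thsym x := th x + th (s x).

Lemma thsym_mul x : thsym x * thsym a = thsym (x + a) + thsym (x - a).
Proof.
rewrite /thsym !sreflD sreflN srefl_self // opprK mulrDl !mulrDr -!thD.
by rewrite [X in _ + X = _]addrC addrACA.
Qed.

(** [thsym_mul] is a recursion of Chebyshev type in the direction of [a]; it reduces the claim to
    the pairings 0, 1 and 2. *)
Lemma thsym_comm x : Ts * thsym x = thsym x * Ts.
Proof.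
have sN y : thsym (s y) = thsym y by rewrite /thsym sreflK // addrC.
have sa y : pr (s y) (coroot a) = - pr y (coroot a).
  by rewrite prBl prMzl pairing_coroot //; ring.
have ca : Ts * thsym a = thsym a * Ts.
  have [t1 t2] := th_simple12; rewrite /thsym srefl_self // mulrDr mulrDl t1 t2.
  by rewrite addrACA subrr addr0 addrC.
have [m] := ubnP `|pr x (coroot a)|%N; elim: m x => // m IH x xm.
wlog: x xm / 0 <= pr x (coroot a).
  move=> G; have [|xn] := leP 0 (pr x (coroot a)); first exact: G.
  by rewrite -sN; apply: G; rewrite sa; [rewrite abszN|lia].
case E: (pr x (coroot a)) => [n|//] _; move: xm; rewrite E => xm.
case: n E xm => [|[|[|n]]] E xm.
- by rewrite /thsym /srefl E mulr0z subr0 mulrDr mulrDl th_perp_comm.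
- have [/asboolP[y yE]|ne] := boolP (even_coroot a).
    by move: E; rewrite yE prMnr; lia.
  have [h1 h2] := th_half12 ne E; rewrite /thsym /srefl E mulr1z mulrDr mulrDl h1 h2.
  by rewrite addrACA subrr addr0 addrC.
- have za : pr (x - a) (coroot a) = 0 by rewrite prBl pairing_coroot // E.
  have -> : thsym x = th (x - a) * thsym a.
    rewrite /thsym mulrDr -!thD subrK srefl_self //; congr (_ + th _).
    by rewrite /srefl E -pmulrn mulr2n opprD addrA.
  by rewrite mulrA th_perp_comm // -!mulrA ca.
have E' : pr (x - a) (coroot a) = n.+1%:Z by rewrite prBl pairing_coroot // E; lia.
have -> : thsym x = thsym (x - a) * thsym a - thsym (x - a - a).
  by rewrite thsym_mul subrK addrK.
have I1 : Ts * thsym (x - a) = thsym (x - a) * Ts by apply: IH; rewrite E'; lia.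
have I2 : Ts * thsym (x - a - a) = thsym (x - a - a) * Ts.
  by apply: IH; rewrite prBl E' pairing_coroot //; lia.
by rewrite mulrBr mulrBl I2 mulrA I1 -!mulrA ca.
Qed.

End Simple.
End Bernstein.

(** * The finite Hecke algebra and vanishing of the trace *)

Section ThetaSubalgebra.
Variables (R : realType) (D : rootDatum) (L : labels R D) (H : heckeAlgebra L).
Local Notation X := (latX D).
Local Notation pr := (@pairing D).
Local Notation T := (hT H).
Local Notation Ti := (@Ti R D L H).
Local Notation th := (htheta H).
Local Notation galg := (galg R[i] X).
Implicit Types (x y z a b : X) (w v g u : X -> X) (h : H) (f : galg).

Lemma W0_simple_ind (P : (X -> X) -> Prop) :
  (forall w, W0 w -> wlength w = 0%N -> P w) ->
  (forall a w, a \in simple D -> W0 w -> winv w a \in pos_roots D ->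
    wlength (srefl a \o w) = (wlength w).+1 -> P w -> P (srefl a \o w)) ->
  forall w, W0 w -> P w.
Proof.
move=> P0 PS w; have [n] := ubnP (wlength w); elim: n w => // n IH w wn ww.
have [/eqP l0|l0] := boolP (wlength w == 0%N); first exact: P0.
have [a aS an] := fin_descent ww l0; have wW := W0_W ww.
have ar := simple_root aS; have wi := W0_winv ww.
have lw := len_simple_lN (aff_simple0 aS) wW an; rewrite aff_refl0 in lw.
have sww := W0_comp (W0_srefl ar) ww.
have E : srefl a \o (srefl a \o w) = w by apply/funext => z /=; rewrite sreflK.
rewrite -E; apply: PS => //; last by apply: IH => //; rewrite lw ltnS in wn.
  rewrite -aff_refl0 winv_comp ?winv_aff_refl //; last by rewrite aff_refl0; exact: W0_W (W0_srefl ar).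
  rewrite aff_refl0 /= srefl_self // W0N //.
  by move: an; rewrite wact_W0 // /aopp /apos /= => /andP[].
by rewrite E.
Qed.

Lemma Ts_simple_mulL a w : a \in simple D -> W0 w ->
  T (srefl a) * T w = T (srefl a \o w) \/
  T (srefl a) * T w = ((q1 L a)%:C%C - 1) *: T w + (q1 L a)%:C%C *: T (srefl a \o w).
Proof.
move=> aS ww; have aS0 := aff_simple0 aS; have wW := W0_W ww; have ar := simple_root aS.
have sW := W0_W (W0_srefl ar).
have [up|un] := boolP (apos (wact (winv w) (a, 0))).
  have := len_simple_l aS0 wW up; rewrite aff_refl0 => E; left.
  by rewrite (hT_mul H) // E wlength_s.
have un' : apos (aopp (wact (winv w) (a, 0))).
  by rewrite apos_aopp // wact_root //; exact: W_winv.
right; have := len_simple_lN aS0 wW un' => lw.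
have := T_simple_lN H aS0 wW lw; rewrite aff_refl0 => E.
by rewrite {1}E mulrA Ts_sq // mulrDl -!scalerAl -E mul1r.
Qed.

(** Membership in the finite Hecke algebra, the span of the [T_w] with [w] in W_0, generated term by
    term to allow induction. *)
Inductive finH : H -> Prop :=
| finH0 : finH 0
| finHT c w h : W0 w -> finH h -> finH (c *: T w + h).

Lemma finHD h h' : finH h -> finH h' -> finH (h + h').
Proof. by elim=> [|c w k ww _ IH] fh'; rewrite ?add0r // -addrA; apply: finHT; auto. Qed.
Lemma finHZ c h : finH h -> finH (c *: h).
Proof.
elim=> [|c' w k ww _ IH]; first by rewrite scaler0; constructor.
by rewrite scalerDr scalerA; apply: finHT.
Qed.
Lemma finH_T w : W0 w -> finH (T w).
Proof. by move=> ww; rewrite -[T w]scale1r -[_ *: _]addr0; apply: finHT => //; constructor. Qed.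

Lemma finH_TsL a h : a \in simple D -> finH h -> finH (T (srefl a) * h).
Proof.
move=> aS; have ar := simple_root aS; elim=> [|c w k ww _ IH]; first by rewrite mulr0; constructor.
rewrite mulrDr; apply: finHD => //; rewrite -scalerAr; apply: finHZ.
have sww := W0_comp (W0_srefl ar) ww.
case: (Ts_simple_mulL aS ww) => ->; first exact: finH_T.
by apply: finHD; apply: finHZ; apply: finH_T.
Qed.

Lemma finH_TisL a h : a \in simple D -> finH h -> finH (Ti (srefl a) * h).
Proof.
move=> aS fh; have := TsTi H (aff_simple0 aS); rewrite aff_refl0 => ->.
rewrite -scalerAl; apply: finHZ; rewrite mulrBl -scalerAl mul1r -scaleNr.
by apply: finHD; [apply: finH_TsL|apply: finHZ].
Qed.

Lemma finH_TsR a h : a \in simple D -> finH h -> finH (h * T (srefl a)).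
Proof.
move=> aS; have ar := simple_root aS; have sw := W0_srefl ar.
elim=> [|c w k ww _ IH]; first by rewrite mul0r; constructor.
rewrite mulrDl; apply: finHD => //; rewrite -scalerAl; apply: finHZ; move: w ww {IH}.
apply: W0_simple_ind => [w ww l0|b w bS ww _ lw IH].
  have wW := W0_W ww; have sW := W0_W sw; have aS0 := aff_simple0 aS.
  rewrite (hT_mul H) //; first by apply: finH_T; apply: W0_comp.
  rewrite l0 wlength_s // -aff_refl0.
  have [up|un] := boolP (apos (wact w (a, 0))); first by rewrite (len_simple_r aS0 wW up) l0.
  have un' : apos (aopp (wact w (a, 0))) by rewrite apos_aopp // wact_root.
  by have := len_simple_rN aS0 wW un'; rewrite l0.
have bw := W0_srefl (simple_root bS).
have wW := W0_W ww; have bW := W0_W bw.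
rewrite -(hT_mul H) //; last by rewrite lw wlength_s.
by rewrite -mulrA; apply: finH_TsL.
Qed.

Lemma ht_le_cform x : ht x <= (size (roots D))%:Z + cform x x.
Proof.
have hx y b : pr y (coroot b) <= 1 + pr y (coroot b) * pr y (coroot b).
  by have : 0 <= (pr y (coroot b) - 1) ^+ 2 := sqr_ge0 _; rewrite expr2; have : 0 <= (pr y (coroot b)) ^+ 2 := sqr_ge0 _; rewrite expr2; lia.
have -> : (size (roots D))%:Z + cform x x = \sum_(b <- roots D) (1 + pr x (coroot b) * pr x (coroot b)).
  by rewrite big_split /= big_const_seq count_predT iter_addr_0 natz.
have P : perm_eq [seq b <- roots D | b \in pos_roots D] (pos_roots D).
  apply: uniq_perm; rewrite ?filter_uniq ?fset_uniq // => b; rewrite mem_filter.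
  by apply/andP/idP => [[]//|bp]; split=> //; exact: pos_root_root.
rewrite /ht -(perm_big _ P) big_filter big_mkcond; apply: ler_sum => b _; case: ifP => // _.
by have : 0 <= (pr x (coroot b)) ^+ 2 := sqr_ge0 _; rewrite expr2; lia.
Qed.

(** For dominant [x] all occurring basis elements differ from the unit. If <x, a^vee> = -m < 0, the
    Bernstein relation at [srefl a x] and cyclicity replace [x] by the points [x + j a] with
    [0 < j <= m]. These are higher and have norm at most that of [x]. As the height is bounded in
    terms of the norm, the process stops. *)
Lemma tau_th_finH x h : 0 < ht x -> finH h -> htau H (th x * h) = 0.
Proof.
move: (lexx (cform x x)); move: {2}(cform x x) => B xB.
have [n] := ubnP (absz ((size (roots D))%:Z + B - ht x)%R); elim: n x xB h => // n IH x xB h xn hx fh.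
have hxB : ht x <= (size (roots D))%:Z + B by apply: le_trans (ht_le_cform x) _; rewrite lerD2l.
have [/dominant_simple xd|] := pselect (forall a, a \in simple D -> 0 <= pr x (coroot a)).
  elim: fh => [|c w k ww _ IHk]; first by rewrite mulr0 linear0.
  rewrite mulrDr linearD /= IHk addr0 -scalerAr linearZ /= htauC th_dom // -scalerAr linearZ /=.
  have tW := W_transl x; have wW := W0_W ww.
  rewrite (hT_mul H) //; last exact: len_W0_transl.
  rewrite htau_T ?mulr0 //; first exact: W_comp.
  move=> /(congr1 (@^~ 0)) /=; rewrite /transl add0r => wx.
  by move: hx; rewrite (W0_inj ww (etrans wx (esym (W0_0 ww)))) ht0.
move=> /existsNP[a /not_implyP[aS /negP]]; rewrite -ltNge => xa.
have ar := simple_root aS; have sw := W0_srefl ar.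
have [m xm] : exists m : nat, pr x (coroot a) = - m%:Z by exists `|pr x (coroot a)|%N; lia.
have m0 : (0 < m)%N by move: xa; rewrite xm; lia.
have sxE : srefl a x = x + a *+ m by rewrite /srefl xm mulrNz opprK -pmulrn.
have E := th_bern H aS (n := m) (x := srefl a x).
have {}E := E _; rewrite pr_srefl /csrefl prBr prMzr (pairing_coroot ar) xm in E.
have {}E := E ltac:(lia).
have -> : th x * h = (T (srefl a) * th (srefl a x) - \sum_(i < m) kc L a i *: th (srefl a x - a *+ i)) * (Ti (srefl a) * h).
  by rewrite E addrK mulrA -(mulrA (th _)) TsTis // mulr1 sxE addrK.
have f1 := finH_TisL aS fh.
have nrmx j : (j <= m)%N -> cform (x + a *+ j) (x + a *+ j) <= B.
  move=> jm; rewrite cformDl !cformDr pmulrn !cformMzr !cformMzl (cformC a x).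
  have := cform_coroot x ar; rewrite xm => cxa; apply: le_trans xB.
  have c0 := cform_root_gt0 ar.
  rewrite -subr_ge0 (_ : _ - _ = (m%:Z - j%:Z) * j%:Z * cform a a); last first.
    transitivity (- (j%:Z * (2 * cform x a)) - j%:Z * j%:Z * cform a a); first by ring.
    by rewrite cxa; ring.
  by apply: mulr_ge0; [apply: mulr_ge0; rewrite // subr_ge0|apply: ltW].
have step j k : (0 < j <= m)%N -> finH k -> htau H (th (x + a *+ j) * k) = 0.
  case/andP=> j0 jm fk; have hj : ht (x + a *+ j) = ht x + 2 * j%:Z.
    by rewrite htD (pmulrn a) htMz (ht_simple aS) mulrC.
  have := ht_le_cform (x + a *+ j); have := nrmx _ jm; move=> b1 b2.
  by apply: IH => //; [move: xn; rewrite hj; lia|rewrite hj; lia].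
rewrite mulrBl linearB /= -mulrA htauC -mulrA sxE step ?m0 ?leqnn // ?sub0r; last exact: finH_TsR.
rewrite mulr_suml linear_sum big1 ?oppr0 // => i _.
rewrite -scalerAl linearZ /= (_ : x + a *+ m - a *+ i = x + a *+ (m - i)); last first.
  by rewrite mulrnBr 1?ltnW // addrA.
by rewrite step ?mulr0 //; have := ltn_ord i; lia.
Qed.

(** * The subalgebra of functions on the torus *)

Definition Th f : H := gev th f.

Lemma ThD f f' : Th (f + f') = Th f + Th f'. Proof. exact: gevD. Qed.
Lemma ThN f : Th (- f) = - Th f. Proof. exact: gevN. Qed.
Lemma ThB f f' : Th (f - f') = Th f - Th f'. Proof. by rewrite ThD ThN. Qed.
Lemma Th_mono c x : Th (gmono c x) = c *: th x. Proof. exact: gev_mono. Qed.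
Lemma Th1 : Th 1 = 1. Proof. by rewrite -gmono1 Th_mono scale1r th0. Qed.
Lemma ThM f f' : Th (f * f') = Th f * Th f'.
Proof.
rewrite /Th gevM /gev mulr_suml; apply: eq_bigr => x _.
rewrite -scalerAl mulr_sumr; congr (_ *: _); apply: eq_bigr => y _.
by rewrite -scalerAr thD.
Qed.
Lemma ThX f n : Th (f ^+ n) = Th f ^+ n.
Proof. by elim: n => [|n IH]; rewrite ?expr0 ?Th1 // !exprS ThM IH. Qed.
Lemma ThC f f' : Th f * Th f' = Th f' * Th f. Proof. by rewrite -!ThM mulrC. Qed.
Lemma Th_C (c : R[i]) : Th (gmono c 0) = c *: 1. Proof. by rewrite Th_mono th0. Qed.
Lemma W0_inv_push w f : W0 w -> W0_inv f -> gpush w f = f.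
Proof.
move=> ww fi; apply/fsfunP => x.
by rewrite (gpush_coef f x (W0_winvK ww) (W0_winvKr ww)) fi //; apply: W0_winv.
Qed.

Lemma Th_len0 w f : W0 w -> wlength w = 0%N -> T w * Th f = Th (gpush w f) * T w.
Proof.
move=> ww l0; have wW := W0_W ww.
have wp b : b \in pos_roots D -> w b \in pos_roots D.
  move=> bp; have br := pos_root_root bp; apply: contraTT isT => wb.
  have : (b, 0 : int) \in fset_set (invs w).
    rewrite mem_invs // wact_W0 // /apos /aopp /= br bp rootNE W0_root // br /=.
    by have := pos_or_neg (_ : w b \in roots D); rewrite W0_root // (negPf wb) => /(_ br).
  by move/eqP: l0; rewrite wlengthE // cardfs_eq0 => /eqP ->.
have wd x : dominant x -> dominant (w x).
  move=> xd b bp; have br := pos_root_root bp.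
  rewrite -(W0_winvKr ww b) W0_pr ?W0_root //; last exact: W0_winv.
  apply: xd; apply: contraTT isT => nb; have br' : winv w b \in roots D by rewrite W0_root //; exact: W0_winv.
  have := pos_or_neg br'; rewrite (negPf nb) /= => /wp.
  by rewrite W0N // W0_winvKr // => /pos_neg; rewrite opprK bp.
have lw g : W g -> wlength (g \o w) = (wlength g + wlength w)%N.
  move=> gW; apply: len_add => // b bp bn; have : b \in fset_set (invs w) by rewrite mem_invs ?bp.
  by move: l0; rewrite wlengthE // => /eqP; rewrite cardfs_eq0 => /eqP ->.
have dom x : dominant x -> T w * th x = th (w x) * T w.
  move=> xd; have tW := W_transl x; have tW' := W_transl (w x).
  have E := W0_transl x ww; have l1 := len_W0_transl ww xd; have l2 := lw _ tW'.
  have n0 := nrm_neq0 L wW.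
  rewrite !th_dom //; last exact: wd.
  rewrite -scalerAr -scalerAl !(hT_mul H) // -E; congr (_ *: _).
  by apply: (mulfI n0); rewrite -(nrm_mul L wW tW l1) E (nrm_mul L tW' wW l2) mulrC.
have domW x : T w * th x = th (w x) * T w.
  have [y [z [yd zd ->]]] := th_dec x.
  apply: (th_injr (x := z)); rewrite -mulrA -thD subrK dom // -mulrA dom // mulrA -thD.
  by rewrite -W0D // subrK.
rewrite /Th gev_push mulr_sumr mulr_suml; apply: eq_bigr => x _ /=.
by rewrite -scalerAr -scalerAl domW.
Qed.

End ThetaSubalgebra.

Section GpushMorph.
Variables (K : comNzRingType) (X : zmodType) (w : X -> X).
Hypotheses (wD : {morph w : x y / x + y}) (w0 : w 0 = 0).
Lemma gpush_prod I (r : seq I) (P : pred I) (F : I -> galg K X) :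
  gpush w (\prod_(i <- r | P i) F i) = \prod_(i <- r | P i) gpush w (F i).
Proof. by elim/big_rec2: _ => [|i y1 y2 _ <-]; rewrite ?gpush1 ?gpushM. Qed.
Lemma gpushB (f g : galg K X) : gpush w (f - g) = gpush w f - gpush w g.
Proof. by rewrite gpushD gpushN. Qed.
End GpushMorph.

Opaque gmul gadd gopp gzero gmono.

(** * Intertwining elements *)

Section Intertwiners.
Variables (R : realType) (D : rootDatum) (L : labels R D) (H : heckeAlgebra L).
Local Notation X := (latX D).
Local Notation pr := (@pairing D).
Local Notation T := (hT H).
Local Notation th := (htheta H).
Local Notation Th := (@Th R D L H).
Local Notation galg := (galg R[i] X).
Local Notation mono := (@gmono R[i] X).
Implicit Types (x y z a b : X) (w v g u : X -> X) (h : H) (f : galg).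

(** In these terms the Bernstein relation reads [Dg a (T_s theta_x - theta_(s x) T_s) = ng a
    (theta_x - theta_(s x))]. *)
Definition Dg b : galg := 1 - mono 1 (- (b *+ 2)).
Definition ng b : galg := mono ((q1 L b)%:C%C - 1) 0 + mono (kap L b) (- b).
(* The usual intertwiner with denominators cleared. *)
Definition rs a : H := Th (Dg a) * T (srefl a) - Th (ng a).

(** [Dg a] is 1 minus the shift by [-2a] and the coefficients have period two, so only the ends of
    the sum survive. *)
Lemma kc_tele a n x :
  Th (Dg a) * (\sum_(i < n) kc L a i *: th (x - a *+ i)) =
  Th (mono (kc L a 0) 0 + mono (kc L a 1) (- a)) * th x -
  Th (mono (kc L a n) 0 + mono (kc L a n.+1) (- a)) * th (x - a *+ n).
Proof.
have P m : Th (mono (kc L a m) 0 + mono (kc L a m.+1) (- a)) * th (x - a *+ m) =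
    kc L a m *: th (x - a *+ m) + kc L a m.+1 *: th (x - a *+ m.+1).
  by rewrite ThD !Th_mono mulrDl -!scalerAl -!thD add0r [- a + _]addrC -addrA -opprD -mulrSr.
have Q y : Th (Dg a) * th y = th y - th (y - a *+ 2).
  by rewrite ThB Th1 Th_mono scale1r mulrBl mul1r -thD [- _ + y]addrC.
elim: n => [|n IH]; first by rewrite big_ord0 mulr0 mulr0n subr0 subrr.
rewrite big_ord_recr /= mulrDr IH -scalerAr Q !P scalerBr.
have -> : x - a *+ n - a *+ 2 = x - a *+ n.+2 by rewrite -addrA -opprD -mulrnDr addn2.
have -> : kc L a n.+2 = kc L a n by rewrite /kc /= negbK.
move: (_ * th x) (kc L a n *: th (x - a *+ n)) (kc L a n.+1 *: _) (kc L a n *: th (x - a *+ n.+2)) => A0 A B C.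
by rewrite [A + B]addrC opprD !addrA subrK opprD addrA.
Qed.

Lemma rs_th a x : a \in simple D -> rs a * th x = th (srefl a x) * rs a.
Proof.
move=> aS; have ar := simple_root aS.
wlog: x / 0 <= pr x (coroot a).
  move=> G; have [|xa] := leP 0 (pr x (coroot a)); first exact: G.
  have := G (- x); rewrite prNl sreflN => /(_ ltac:(lia)) E.
  apply: (th_injl (x := - srefl a x)); apply: (th_injr (x := - x)).
  by rewrite !mulrA thNr mul1r -mulrA -E -mulrA thN mulr1.
case E: (pr x (coroot a)) => [n|//] _.
have sE : srefl a x = x - a *+ n by rewrite /srefl E.
rewrite /rs mulrBl mulrBr -!mulrA (th_bern H aS E) mulrDr kc_tele -sE.
rewrite !mulrA [th _ * Th (Dg a)](_ : _ = Th (Dg a) * th (srefl a x)); last first.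
  by have := ThC H (mono 1 (srefl a x)) (Dg a); rewrite Th_mono scale1r.
rewrite -!addrA; congr (_ + _).
rewrite [th _ * Th (ng a)](_ : _ = Th (ng a) * th (srefl a x)); last first.
  by have := ThC H (mono 1 (srefl a x)) (ng a); rewrite Th_mono scale1r.
have n0 : mono (kc L a 0) 0 + mono (kc L a 1) (- a) = ng a by [].
rewrite n0; have -> : mono (kc L a n) 0 + mono (kc L a n.+1) (- a) = ng a; last first.
  by rewrite addrC subrK.
rewrite -n0 /kc /=; case on: (odd n) => //=.
rewrite (kapE L aS) //; apply/asboolP => -[y yE].
by move: E on; rewrite yE prMnr; lia.
Qed.

Lemma rs_Th a f : a \in simple D -> rs a * Th f = Th (gpush (srefl a) f) * rs a.
Proof.
move=> aS; rewrite /Submission.Th gev_push mulr_sumr mulr_suml; apply: eq_bigr => x _ /=.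
by rewrite -scalerAr -scalerAl rs_th.
Qed.

Lemma q1_W0 w b : W0 w -> b \in roots D -> q1 L (w b) = q1 L b.
Proof. exact: qlab_W0. Qed.
Lemma q0_W0 w b : W0 w -> b \in roots D -> q0 L (w b) = q0 L b.
Proof. exact: qlab_W0. Qed.
Lemma kap_W0 w b : W0 w -> b \in roots D -> kap L (w b) = kap L b.
Proof. by move=> ww br; rewrite /kap q1_W0 // q0_W0. Qed.

Lemma Dg_W0 w b : W0 w -> gpush w (Dg b) = Dg (w b).
Proof.
move=> ww; rewrite /Dg (gpushB w) gpush1 ?W0_0 // gpush_mono W0N // W0Mn //.
Qed.
Lemma ng_W0 w b : W0 w -> b \in roots D -> gpush w (ng b) = ng (w b).
Proof.
by move=> ww br; rewrite /ng gpushD !gpush_mono W0_0 // W0N // q1_W0 // kap_W0.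
Qed.

Lemma q1N b : b \in roots D -> q1 L (- b) = q1 L b.
Proof. by move=> br; rewrite -(srefl_self br) q1_W0 //; apply: W0_srefl. Qed.
Lemma q0N b : b \in roots D -> q0 L (- b) = q0 L b.
Proof. by move=> br; rewrite -(srefl_self br) q0_W0 //; apply: W0_srefl. Qed.

Definition rsq b : galg := mono (q1 L b)%:C%C 0 * Dg b * Dg (- b) + ng b * ng (- b).

Lemma rs_sq_aux (t u c p0 p1 p2 p3 p4 p5 z : H) :
  p0 * u = p5 * t -> p0 * c = p3 -> p5 = p1 + p2 -> z = p3 + p4 ->
  p0 * (u + c) - p1 * t - (p2 * t - p4) = z.
Proof.
move=> E1 E2 E3 ->; rewrite mulrDr E1 E2 E3 mulrDl.
by rewrite -[X in X - _ - _]addrA [p1 * t + _]addrC addrK opprB addrC addrA addrAC addrK addrC.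
Qed.

Lemma rs_sq a : a \in simple D -> rs a * rs a = Th (rsq a).
Proof.
move=> aS; have ar := simple_root aS; have sw := W0_srefl ar; set s := srefl a.
rewrite {2}/rs mulrBr mulrA !rs_Th // -/s Dg_W0 // ng_W0 // (srefl_self ar : s a = - a).
rewrite -mulrA /rs -/s mulrBl mulrBr -mulrA Ts_sq // mulrBr !mulrA -!ThM.
have E : Dg (- a) * Dg a * mono ((q1 L a)%:C%C - 1) 0 = Dg (- a) * ng a + ng (- a) * Dg a.
  rewrite /Dg /ng /kap q1N // q0N // -/(kap L a) !mulNrn !opprK.
  have mZ c y : mono c y = mono c 0 * mono 1 y by rewrite gmonoM mulr1 add0r.
  rewrite (mZ (kap L a) (- a)) (mZ (kap L a) a) !mulr2n opprD.
  have -> : mono 1 (a + a) = mono 1 a * mono 1 a by rewrite gmonoM mulr1.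
  have -> : mono 1 (- a - a) = mono 1 (- a) * mono 1 (- a) by rewrite gmonoM mulr1.
  have uv : mono 1 a * mono 1 (- a) = 1 by rewrite gmonoM mulr1 subrr.
  move: (mono 1 a) (mono 1 (- a)) uv (mono _ 0) (mono _ 0) => U V uv k1 k0.
  apply/eqP; rewrite -subr_eq0; apply/eqP.
  transitivity ((U * V - 1) * (k0 * (U * V + 1) + k1 * U + k1 * V)); first by ring.
  by rewrite uv subrr mul0r.
have E' : Th (Dg (- a) * Dg a) * (((q1 L a)%:C%C - 1) *: T s) =
   Th (Dg (- a) * Dg a * mono ((q1 L a)%:C%C - 1) 0) * T s.
  by rewrite [in RHS](ThM H (_ * _)) Th_C -mulrA -scalerAl mul1r.
have E2 : Th (Dg (- a) * Dg a) * ((q1 L a)%:C%C *: 1) = Th (mono (q1 L a)%:C%C 0 * Dg a * Dg (- a)).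
  by rewrite -mulrA (ThM _ (mono _ 0)) Th_C -scalerAr mulr1 -scalerAl mul1r [Dg a * _]mulrC.
have E3 : Th (rsq a) = Th (mono (q1 L a)%:C%C 0 * Dg a * Dg (- a)) + Th (ng (- a) * ng a).
  by rewrite -ThD (mulrC (ng (- a)) (ng a)).
have E4 : Th (Dg (- a) * Dg a * mono ((q1 L a)%:C%C - 1) 0) = Th (Dg (- a) * ng a) + Th (ng (- a) * Dg a).
  by have := congr1 Th E; rewrite [X in _ = X -> _]ThD.
exact: (rs_sq_aux E' E2 E4 E3).
Qed.

(** Invariant under W_0, so that its image commutes with every [T_w], which a single factor [Dg a]
    does not achieve; [dl a] is the complementary factor. *)
Definition delta : galg := \prod_(b <- roots D) Dg b.
Definition dl a : galg := \prod_(b <- roots D | b != a) Dg b.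

Lemma deltaE a : a \in roots D -> delta = Dg a * dl a.
Proof. by move=> ar; rewrite /delta (bigD1_seq a) //= fset_uniq. Qed.

Lemma big_roots_W0 (V : comPzSemiRingType) w (F : X -> V) : W0 w ->
  \prod_(b <- roots D) F (w b) = \prod_(b <- roots D) F b.
Proof.
move=> ww; rewrite -(big_map w predT F); apply: perm_big.
apply: perm_map_stable; [exact: fset_uniq|exact: W0_inj|by move=> b; rewrite (W0_root b ww)].
Qed.

Lemma delta_W0 w : W0 w -> gpush w delta = delta.
Proof.
move=> ww; rewrite /delta (gpush_prod (W0D ww) (W0_0 ww)) -(big_roots_W0 Dg ww).
by apply: eq_bigr => b _; rewrite Dg_W0.
Qed.

Lemma dl_W0 w b : W0 w -> b \in roots D -> gpush w (dl b) = dl (w b).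
Proof.
move=> ww br; rewrite /dl (gpush_prod (W0D ww) (W0_0 ww)) big_mkcond [RHS]big_mkcond.
rewrite -(big_roots_W0 (fun c => if c != w b then Dg c else 1) ww).
by apply: eq_bigr => c _; rewrite (inj_eq (W0_inj ww)) Dg_W0.
Qed.

(** Twice an invariant element is a combination of the elements [thsym]. *)
Lemma Ts_inv a f : a \in simple D -> gpush (srefl a) f = f -> T (srefl a) * Th f = Th f * T (srefl a).
Proof.
move=> aS fi; have E : Th f + Th f = gev (@thsym R D L H a) f.
  by rewrite -{2}fi /Submission.Th gev_push /gev -big_split; apply: eq_bigr => x _ /=; rewrite -scalerDr.
have E2 : T (srefl a) * (Th f + Th f) = (Th f + Th f) * T (srefl a).
  rewrite E /gev mulr_sumr mulr_suml; apply: eq_bigr => x _.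
  by rewrite -scalerAr -scalerAl thsym_comm.
have two : (2 : R[i]) != 0 by rewrite pnatr_eq0.
by apply: (scalerI two); rewrite !scaler_nat !mulr2n -mulrDr -mulrDl.
Qed.

Lemma T_inv w f : W0 w -> W0_inv f -> T w * Th f = Th f * T w.
Proof.
move=> ww fi; move: w ww; apply: W0_simple_ind => [w ww l0|a w aS ww _ lw IH].
  by rewrite (Th_len0 H f ww l0) W0_inv_push.
have sw := W0_srefl (simple_root aS); have sW := W0_W sw; have wW := W0_W ww.
rewrite -(hT_mul H) //; last by rewrite lw wlength_s.
by rewrite -mulrA IH !mulrA Ts_inv // W0_inv_push.
Qed.

End Intertwiners.

Opaque gmul gadd gopp gzero gmono.

(** * Expansion of T_w in intertwiners *)

Section Expansion.
Variables (R : realType) (D : rootDatum) (L : labels R D) (H : heckeAlgebra L).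
Local Notation X := (latX D).
Local Notation pr := (@pairing D).
Local Notation T := (hT H).
Local Notation Ti := (@Ti R D L H).
Local Notation th := (htheta H).
Local Notation Th := (@Th R D L H).
Local Notation rs := (@rs R D L H).
Local Notation galg := (galg R[i] X).
Local Notation mono := (@gmono R[i] X).
Local Notation finH := (@finH R D L H).
Local Notation Dg := (@Dg R D).
Local Notation ng := (@ng R D L).
Local Notation dl := (@dl R D).
Local Notation delta := (@delta R D).
Local Notation rsq := (@rsq R D L).
Implicit Types (x y z a b : X) (w v g u : X -> X) (h k r : H) (f : galg).

Lemma len0_pos w b : W0 w -> wlength w = 0%N -> b \in pos_roots D -> w b \in pos_roots D.
Proof.
move=> ww l0 bp; have br := pos_root_root bp; have wW := W0_W ww.
apply: contraTT isT => wb.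
have : (b, 0 : int) \in fset_set (invs w).
  rewrite mem_invs // wact_W0 // /apos /aopp /= br bp rootNE W0_root // br /=.
  by have := pos_or_neg (_ : w b \in roots D); rewrite W0_root // (negPf wb) => /(_ br).
by move/eqP: l0; rewrite wlengthE // cardfs_eq0 => /eqP ->.
Qed.

Lemma len_neq0 w : W0 w -> wlength w != 0%N ->
  exists2 b, b \in pos_roots D & w b \notin pos_roots D.
Proof.
move=> ww l0; have wW := W0_W ww; have wi := W0_winv ww.
have li : wlength (winv w) != 0%N by rewrite wlength_winv.
have [a aS] := fin_descent wi li; rewrite winvK // wact_W0 // => /andP[_ /= an].
by exists a; [exact: simple_pos|move: an => /pos_neg; rewrite opprK].
Qed.

Lemma len_sL a g : a \in simple D -> W0 g -> (wlength (srefl a \o g) <= (wlength g).+1)%N.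
Proof.
move=> aS gg; have gW := W0_W gg; have aS0 := aff_simple0 aS; rewrite -aff_refl0.
have [up|un] := boolP (apos (wact (winv g) (a, 0))); first by rewrite (len_simple_l aS0 gW up).
have un' : apos (aopp (wact (winv g) (a, 0))).
  by rewrite apos_aopp // wact_root; [exact: simple_root|exact: W_winv].
by have := len_simple_lN aS0 gW un'; lia.
Qed.

Lemma len_sR a g : a \in simple D -> W0 g -> (wlength (g \o srefl a) <= (wlength g).+1)%N.
Proof.
move=> aS gg; have gW := W0_W gg; have aS0 := aff_simple0 aS; rewrite -aff_refl0.
have [up|un] := boolP (apos (wact g (a, 0))); first by rewrite (len_simple_r aS0 gW up).
have un' : apos (aopp (wact g (a, 0))).
  by rewrite apos_aopp // wact_root //; exact: simple_root.
by have := len_simple_rN aS0 gW un'; lia.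
Qed.

Lemma big_pos_even (F : X -> int) w : W0 w -> (forall b, b \in roots D -> F (- b) = F b) ->
  \sum_(b <- pos_roots D) F (w b) = \sum_(b <- pos_roots D) F b.
Proof.
move=> ww; move: w ww F; apply: W0_simple_ind => [w ww l0|a w aS ww _ _ IH] F FN.
  rewrite -(big_map w predT F); apply: perm_big; apply: perm_map_stable.
  - exact: fset_uniq.
  - exact: W0_inj.
  - by move=> b; apply: len0_pos.
have ar := simple_root aS.
rewrite (IH (F \o srefl a)) /=; last by move=> b br; rewrite sreflN FN // srefl_root.
rewrite (big_pos_simple (fun b => F (srefl a b)) aS) big_pos_srefl // srefl_self // FN //.
by rewrite -big_pos_simple.
Qed.

Lemma rho2_pos_abs b : b \in roots D ->
  `|pr (rho2 D) (coroot b)| = if b \in pos_roots D then pr (rho2 D) (coroot b) else - pr (rho2 D) (coroot b).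
Proof.
move=> br; case: ifP => [bp|bn]; first by rewrite ger0_norm // ltW // rho2_pos.
have := pos_or_neg br; rewrite bn /= => /rho2_pos; rewrite corootN // oppr_gt0 => h0.
by rewrite ler0_norm // ltW.
Qed.

Lemma ht_rho2_abs g : W0 g -> \sum_(b <- pos_roots D) `|pr (g (rho2 D)) (coroot b)| = ht (rho2 D).
Proof.
move=> gg; rewrite /ht; have gi := W0_winv gg.
transitivity (\sum_(b <- pos_roots D) `|pr (rho2 D) (coroot (winv g b))|).
  by rewrite !big_seq; apply: eq_bigr => b /pos_root_root br; rewrite W0_pr_winv // winvK //; exact: W0_W.
rewrite (big_pos_even (F := fun b => `|pr (rho2 D) (coroot b)|) gi); last first.
  by move=> b br; rewrite corootN // normrN.
by rewrite !big_seq; apply: eq_bigr => b bp; rewrite rho2_pos_abs ?bp // pos_root_root.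
Qed.

(** All W_0-images of [rho2] have the same sum of absolute pairings with the positive coroots. For
    [w0] all these pairings are negative, while a shorter element leaves at least one of them
    positive. *)
Lemma ht_w0_rho2 w0 g : longest w0 -> W0 g -> (wlength g < wlength w0)%N ->
  ht (w0 (rho2 D)) < ht (g (rho2 D)).
Proof.
move=> w0l gg lg; have ww := w0l.1; have wi := W0_winv ww; have gi := W0_winv gg.
have prE (v : X -> X) b : W0 v -> b \in roots D ->
    pr (v (rho2 D)) (coroot b) = pr (rho2 D) (coroot (winv v b)).
  by move=> vv br; rewrite [RHS]W0_pr_winv ?winvK //; [exact: W0_W|exact: W0_winv].
have -> : ht (w0 (rho2 D)) = - \sum_(b <- pos_roots D) `|pr (g (rho2 D)) (coroot b)|.
  rewrite ht_rho2_abs // -(ht_rho2_abs ww) -sumrN /ht !big_seq; apply: eq_bigr => b bp.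
  have br := pos_root_root bp; rewrite prE // rho2_pos_abs ?W0_root //.
  case: ifP => [wp|_]; last by rewrite opprK.
  by have := longest_neg w0l wp; rewrite W0_winvKr // bp.
have [b bp gb] : exists2 b, b \in pos_roots D & winv g b \in pos_roots D.
  apply: contrapT => N; have := longest_uniq w0l gi.
  rewrite wlength_winv; last exact: W0_W.
  move=> /(_ _)/eqP; rewrite ltn_eqF // => /(_ _)/notF; apply => c cp.
  by apply/negP => gc; apply: N; exists c.
rewrite -sumrN /ht (big_rem b) //= [X in _ < X](big_rem b) //=.
have p0 : 0 < pr (g (rho2 D)) (coroot b) by rewrite prE ?pos_root_root // rho2_pos.
apply: ltr_leD; first by apply: (lt_trans _ p0); rewrite oppr_lt0 normr_gt0; apply/eqP => p; move: p0; rewrite p ltxx.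
by apply: ler_sum => c _; rewrite lerNl -normrN ler_norm.
Qed.

(** * Elements with a Bernstein expansion *)

Inductive bern : H -> Prop :=
| bern0 : bern 0
| bernA c x k h : finH k -> bern h -> bern (c *: (th x * k) + h).

Lemma bernD h h' : bern h -> bern h' -> bern (h + h').
Proof. by elim=> [|c x k h1 fk _ IH] bh'; rewrite ?add0r // -addrA; apply: bernA; auto. Qed.
Lemma bernZ c h : bern h -> bern (c *: h).
Proof.
elim=> [|c' x k h1 fk _ IH]; first by rewrite scaler0; constructor.
by rewrite scalerDr scalerA; apply: bernA.
Qed.
Lemma bern_thk x k : finH k -> bern (th x * k).
Proof. by move=> fk; rewrite -[th x * k]scale1r -[_ *: _]addr0; apply: bernA => //; constructor. Qed.

(** Stated for multipliers instead of elements, stability under products is immediate; applied to 1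
    it gives back an expansion of [h]. *)
Definition LB h := forall k, bern k -> bern (h * k).

Lemma LBM h h' : LB h -> LB h' -> LB (h * h').
Proof. by move=> l1 l2 k bk; rewrite -mulrA; apply: l1; apply: l2. Qed.
Lemma LBD h h' : LB h -> LB h' -> LB (h + h').
Proof. by move=> l1 l2 k bk; rewrite mulrDl; apply: bernD; auto. Qed.
Lemma LBZ c h : LB h -> LB (c *: h).
Proof. by move=> l1 k bk; rewrite -scalerAl; apply: bernZ; auto. Qed.
Lemma LBN h : LB h -> LB (- h).
Proof. by move=> l; rewrite -scaleN1r; apply: LBZ. Qed.
Lemma LB1 : LB 1.
Proof. by move=> k; rewrite mul1r. Qed.
Lemma LB_th x : LB (th x).
Proof.
move=> k; elim=> [|c y k' h fk _ IH]; first by rewrite mulr0; constructor.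
by rewrite mulrDr -scalerAr mulrA -thD; apply: bernA.
Qed.
Lemma LB_Th f : LB (Th f).
Proof.
rewrite /Submission.Th /gev; elim/big_rec: _ => [k _|x h _ IH]; first by rewrite mul0r; constructor.
by apply: LBD => //; apply: LBZ; apply: LB_th.
Qed.

Lemma bern_sum I (s : seq I) (F : I -> H) : (forall i, bern (F i)) -> bern (\sum_(i <- s) F i).
Proof. by move=> bF; elim/big_rec: _ => [|i h _ bh]; [constructor|apply: bernD]. Qed.

(** The Bernstein relation treats nonnegative pairings. For a negative one, [theta_x] is traded for
    [theta_(s x)], as [T_s] commutes with their sum. *)
Lemma LB_Ts a : a \in simple D -> LB (T (srefl a)).
Proof.
move=> aS; have ar := simple_root aS.
have pos x k : 0 <= pr x (coroot a) -> finH k -> bern (T (srefl a) * (th x * k)).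
  case E: (pr x (coroot a)) => [n|//] _ fk; rewrite mulrA (th_bern H aS E) mulrDl.
  apply: bernD; first by rewrite -mulrA; apply: bern_thk; apply: finH_TsL.
  rewrite mulr_suml; apply: bern_sum => i; rewrite -scalerAl; apply: bernZ; exact: bern_thk.
have all x k : finH k -> bern (T (srefl a) * (th x * k)).
  move=> fk; have [|xa] := leP 0 (pr x (coroot a)); first by move=> h0; apply: pos.
  have := thsym_comm H aS x; rewrite /thsym mulrDr => /(canRL (addrK _)) E.
  rewrite mulrA E mulrBl mulrDl mulrDl -!mulrA; apply: bernD.
    by apply: bernD; apply: bern_thk; apply: finH_TsL.
  rewrite -scaleN1r; apply: bernZ; apply: pos => //.
  by rewrite pr_srefl /csrefl prBr prMzr pairing_coroot //; lia.
move=> k; elim=> [|c x k' h fk _ IH]; first by rewrite mulr0; constructor.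
by rewrite mulrDr -scalerAr; apply: bernD => //; apply: bernZ; apply: all.
Qed.

Lemma LB_T w : W0 w -> LB (T w).
Proof.
move: w; apply: W0_simple_ind => [w ww l0|a w aS ww _ lw IH]; last first.
  have sw := W0_srefl (simple_root aS); have sW := W0_W sw; have wW := W0_W ww.
  rewrite -(hT_mul H) //; last by rewrite lw wlength_s.
  by apply: LBM => //; apply: LB_Ts.
have fT k : finH k -> finH (T w * k).
  elim=> [|c v h vv _ IH]; first by rewrite mulr0; constructor.
  rewrite mulrDr; apply: finHD => //; rewrite -scalerAr; apply: finHZ.
  have wW := W0_W ww; have vW := W0_W vv; rewrite (hT_mul H) //.
    by apply: finH_T; apply: W0_comp.
  apply: len_add => // -[b n] bp; rewrite !wact_W0 //.
  rewrite /aopp /apos /= !rootNE !W0_root // => /andP[-> /orP[->//|/andP[-> np]]] /=.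
  by rewrite -W0N // len0_pos // orbT.
move=> k; elim=> [|c x k' h fk _ IH]; first by rewrite mulr0; constructor.
rewrite mulrDr -scalerAr; apply: bernD => //; apply: bernZ; rewrite mulrA.
have := Th_len0 H (mono 1 x) ww l0; rewrite gpush_mono !Th_mono !scale1r => ->.
by rewrite -mulrA; apply: bern_thk; apply: fT.
Qed.

Lemma Ts_TisE a : a \in simple D ->
  Ti (srefl a) = ((q1 L a)%:C%C)^-1 *: (T (srefl a) - ((q1 L a)%:C%C - 1) *: 1).
Proof. by move=> aS; have := TsTi H (aff_simple0 aS); rewrite aff_refl0 q_srefl. Qed.

Lemma bern_van h : bern h -> exists C : int, forall x, C < ht x -> htau H (th x * h) = 0.
Proof.
elim=> [|c y k h1 fk _ [C IH]]; first by exists 0 => x _; rewrite mulr0 linear0.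
exists (Num.max C (- ht y)) => x; rewrite gt_max => /andP[hC hy].
rewrite mulrDr linearD /= IH // addr0 -scalerAr linearZ /= mulrA -thD.
by rewrite tau_th_finH ?mulr0 // htD -(opprK (ht y)) subr_gt0.
Qed.

Lemma bern1 : bern 1.
Proof. by rewrite -(T_id H) -[T _]mul1r -(th0 H); apply: bern_thk; apply: finH_T; exact: W0_id. Qed.

Lemma LB_van h : LB h -> exists C : int, forall x, C < ht x -> htau H (th x * h) = 0.
Proof. by move=> lb; apply: bern_van; rewrite -[h]mulr1; apply: lb; exact: bern1. Qed.

Definition itw g r := LB r /\ forall x, r * th x = th (g x) * r.

Lemma itw_Th g r f : itw g r -> r * Th f = Th (gpush g f) * r.
Proof.
move=> [_ ir]; rewrite /Submission.Th gev_push mulr_sumr mulr_suml; apply: eq_bigr => x _ /=.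
by rewrite -scalerAr -scalerAl ir.
Qed.

Lemma itw_comp g g' r r' : itw g r -> itw g' r' -> itw (g \o g') (r * r').
Proof.
move=> [l1 i1] [l2 i2]; split; first exact: LBM.
by move=> x; rewrite -mulrA i2 mulrA i1 mulrA.
Qed.

Lemma itw_id f : itw id (Th f).
Proof.
split; first exact: LB_Th.
by move=> x; have := ThC H f (mono 1 x); rewrite Th_mono scale1r.
Qed.

Lemma itwZ c g r : itw g r -> itw g (c *: r).
Proof. by move=> [l i]; split; [exact: LBZ|move=> x; rewrite -scalerAl i scalerAr]. Qed.

(** By cyclicity the trace does not change when [x] is shifted by [b - g b]. If [g] makes [b]
    negative, this shift has positive height, and repeating it reaches the region where the trace
    vanishes. *)
Lemma itw_tau g r x : W0 g -> wlength g != 0%N -> itw g r -> htau H (th x * r) = 0.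
Proof.
move=> gg /(len_neq0 gg)[b bp gb] [lr ir]; have [C CP] := LB_van lr.
have step (p z : X) : htau H (th (p + z) * r) = htau H (th (p + g z) * r).
  by rewrite [p + g z]addrC [p + z]addrC !thD -mulrA htauC -mulrA ir mulrA -thD addrC thD.
have it m : htau H (th x * r) = htau H (th (x + (b - g b) *+ m) * r).
  elim: m => [|m ->]; first by rewrite mulr0n addr0.
  have E y : htau H (th y * r) = htau H (th (y + (b - g b)) * r).
    by rewrite -[in LHS](subrK (g b) y) -step -addrA [- _ + b]addrC.
  by rewrite mulrSr addrA -E.
have hb : 0 < ht (b - g b).
  have gbr : g b \in roots D by rewrite W0_root // pos_root_root.
  have := pos_or_neg gbr; rewrite (negPf gb) /= => /ht_pos; rewrite htN => h1.
  by rewrite htD htN addr_gt0 // ht_pos.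
rewrite (it (absz (C - ht x)).+1) CP // htD pmulrn htMz.
by move: hb; nia.
Qed.

Inductive low n : H -> Prop :=
| low0 : low n 0
| lowA g r h : W0 g -> (wlength g < n)%N -> itw g r -> low n h -> low n (r + h).

Lemma lowD n h h' : low n h -> low n h' -> low n (h + h').
Proof. by elim=> [|g r k gg lg ir _ IH] lh'; rewrite ?add0r // -addrA; apply: (lowA gg lg); auto. Qed.
Lemma low_itw n g r : W0 g -> (wlength g < n)%N -> itw g r -> low n r.
Proof. by move=> gg lg ir; rewrite -[r]addr0; apply: (lowA gg lg ir); constructor. Qed.
Lemma low_mulL n m g r h : (forall v, W0 v -> (wlength v < n)%N -> (wlength (g \o v) < m)%N) -> W0 g ->
  itw g r -> low n h -> low m (r * h).
Proof.
move=> lg gg ir; elim=> [|v r' k vv lv ir' _ IH]; first by rewrite mulr0; constructor.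
rewrite mulrDr; apply: (@lowA _ (g \o v)) => //; [exact: W0_comp|exact: lg|exact: itw_comp].
Qed.
Lemma low_mulR n m g r h : (forall v, W0 v -> (wlength v < n)%N -> (wlength (v \o g) < m)%N) -> W0 g ->
  itw g r -> low n h -> low m (h * r).
Proof.
move=> lg gg ir; elim=> [|v r' k vv lv ir' _ IH]; first by rewrite mul0r; constructor.
rewrite mulrDl; apply: (@lowA _ (v \o g)) => //; [exact: W0_comp|exact: lg|exact: itw_comp].
Qed.
Lemma low_LB n h : low n h -> LB h.
Proof.
elim=> [k _|g r k _ _ [lr _] _ lk]; first by rewrite mul0r; constructor.
exact: LBD.
Qed.

Definition iprod w (F : X -> galg) : galg :=
  \prod_(b <- pos_roots D | winv w b \notin pos_roots D) F b.

Lemma iprod_s a w (F : X -> galg) : a \in simple D -> W0 w -> winv w a \in pos_roots D ->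
  (forall b, b \in roots D -> gpush (srefl a) (F b) = F (srefl a b)) ->
  iprod (srefl a \o w) F = F a * gpush (srefl a) (iprod w F).
Proof.
move=> aS ww wa FE; have ar := simple_root aS; have sw := W0_srefl ar.
have wi := W0_winv ww.
have E b : winv (srefl a \o w) b = winv w (srefl a b).
  by rewrite -aff_refl0 winv_comp ?winv_aff_refl ?aff_refl0 //; exact: W0_W.
rewrite /iprod (gpush_prod (W0D sw) (W0_0 sw)).
under eq_bigl do rewrite E.
rewrite [LHS]big_mkcond [LHS](bigD1_seq a (simple_pos aS) (fset_uniq _)) /=.
rewrite (srefl_self ar) W0N // (pos_neg wa) /=; congr (_ * _).
rewrite -big_mkcondr -big_filter_cond -(perm_big _ (simple_perm_eq aS)) big_map /=.
rewrite big_filter_cond [RHS]big_seq_cond [LHS]big_seq_cond; apply: eq_big => [b|b].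
  rewrite sreflK //; case bp: (b \in _) => //=; have [->|] := eqVneq b a => //=.
  by rewrite wa.
by move=> /andP[/pos_root_root br _]; rewrite FE.
Qed.

Lemma iprod_len0 w (F : X -> galg) : W0 w -> wlength w = 0%N -> iprod w F = 1.
Proof.
move=> ww l0; rewrite /iprod big_seq_cond big_pred0 // => b; apply/negbTE/negP => /andP[bp /negP].
by apply; apply: len0_pos => //; [exact: W0_winv|rewrite wlength_winv //; exact: W0_W].
Qed.

Lemma iprod_w0 w0 (F : X -> galg) : longest w0 -> iprod w0 F = \prod_(b <- pos_roots D) F b.
Proof.
move=> w0l; rewrite /iprod big_seq_cond [RHS]big_seq; apply: eq_bigl => b.
case bp: (b \in _) => //=; apply/negP => /(longest_neg w0l).
by rewrite W0_winvKr ?bp //; exact: w0l.1.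
Qed.

(** What the leading terms of [delta T_s] and [T_s^-1 delta] multiply to: the square of an
    intertwiner with denominators cleared on both sides, and [q1^-1] from the inverse. *)
Definition phi b : galg := mono ((q1 L b)%:C%C)^-1 0 * (dl b * dl (- b)) * rsq b.

Opaque Submission.Dg Submission.ng Submission.dl Submission.delta gpush.
Lemma rsq_W0 w b : W0 w -> b \in roots D -> gpush w (rsq b) = rsq (w b).
Proof.
move=> ww br; have wD := W0D ww.
have bN := rootN br; rewrite /Submission.rsq gpushD (gpushM (_ * Dg b) _ wD) (gpushM _ (Dg b) wD) (gpushM (ng b) _ wD).
by rewrite gpush_mono (W0_0 ww) (Dg_W0 R b ww) (Dg_W0 R (- b) ww) (ng_W0 L ww br) (ng_W0 L ww bN) (q1_W0 L ww br) (W0N b ww).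
Qed.

Lemma phi_W0 w b : W0 w -> b \in roots D -> gpush w (phi b) = phi (w b).
Proof.
move=> ww br; have wD := W0D ww.
have bN := rootN br; rewrite /phi (gpushM _ (rsq b) wD) (gpushM _ (_ * dl (- b)) wD) (gpushM (dl b) _ wD).
by rewrite gpush_mono (W0_0 ww) (dl_W0 R ww br) (dl_W0 R ww bN) (rsq_W0 ww br) (q1_W0 L ww br) (W0N b ww).
Qed.

Definition idelta w := iprod w (fun=> delta).

Lemma idelta_inv v w : W0 v -> gpush v (idelta w) = idelta w.
Proof.
move=> vv; rewrite /idelta /iprod (gpush_prod (W0D vv) (W0_0 vv)).
by apply: eq_bigr => b _; rewrite delta_W0.
Qed.

Lemma Ti_s_inv a f : a \in simple D -> gpush (srefl a) f = f -> Ti (srefl a) * Th f = Th f * Ti (srefl a).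
Proof.
move=> aS fi; rewrite Ts_TisE // -scalerAl -scalerAr mulrBl mulrBr Ts_inv //.
by rewrite -scalerAl -scalerAr mul1r mulr1.
Qed.

Lemma Ti_mul u v : W u -> W v -> wlength (u \o v) = (wlength u + wlength v)%N ->
  Ti (u \o v) = Ti v * Ti u.
Proof.
move=> uW vW l; have uvW := W_comp uW vW.
rewrite -[RHS]mulr1 -(TTi H uvW) -(hT_mul H) // !mulrA -(mulrA (Ti v)) TiT // mulr1 TiT //.
by rewrite mul1r.
Qed.

Lemma expand w : W0 w -> exists r r' lo lo',
  [/\ itw w r, itw (winv w) r', low (wlength w) lo, low (wlength w) lo' &
  [/\ Th (idelta w) * T w = r + lo, Ti w * Th (idelta w) = r' + lo' & r * r' = Th (iprod w phi)]].
Proof.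
move: w; apply: W0_simple_ind => [w ww l0|a w aS ww wa lw [r [r' [lo [lo' [ir ir' llo llo' [E1 E2 E3]]]]]]].
  have wi := W0_winv ww; have wW := W0_W ww.
  have li : wlength (winv w) = 0%N by rewrite wlength_winv.
  have it v : W0 v -> wlength v = 0%N -> itw v (T v).
    move=> vv lv; split; first exact: LB_T.
    by move=> x; have := Th_len0 H (mono 1 x) vv lv; rewrite gpush_mono !Th_mono !scale1r.
  have TiE : Ti w = T (winv w).
    rewrite -[RHS]mul1r -(TiT H wW) -mulrA (hT_mul H) ?W_winvVr // ?(T_id H) ?mulr1 //; first exact: W_winv.
    by rewrite wlength_id li l0.
  exists (T w), (T (winv w)), 0, 0; rewrite !addr0; split; [exact: it|exact: it|constructor|constructor|].
  by rewrite /idelta !iprod_len0 // Th1 mul1r mulr1 -TiE TTi.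
have ar := simple_root aS; have sw := W0_srefl ar; have sW := W0_W sw; have wW := W0_W ww.
have aS0 := aff_simple0 aS.
set s := srefl a in sw sW lw *.
have lsw : wlength (s \o w) = (wlength s + wlength w)%N by rewrite lw wlength_s.
have dE : idelta (s \o w) = delta * idelta w.
  rewrite /idelta iprod_s //; last by move=> b _; rewrite delta_W0.
  by rewrite -/(idelta w) idelta_inv.
pose rs' := Th (dl a) * rs a; pose ls := Th (dl a) * Th (ng a).
have irs : itw s rs'.
  split; last by move=> x; rewrite /rs' -mulrA rs_th // !mulrA; congr (_ * _);
    have := ThC H (dl a) (mono 1 (srefl a x)); rewrite Th_mono scale1r.
  apply: LBM; first exact: LB_Th.
  rewrite /Submission.rs; apply: LBD; last by apply: LBN; apply: LB_Th.
  by apply: LBM; [exact: LB_Th|exact: LB_Ts].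
have dT : Th delta * T s = rs' + ls.
  by rewrite /rs' /ls -mulrDr /Submission.rs subrK mulrA -ThM (deltaE R ar) (mulrC (dl a)).
pose c := ((q1 L a)%:C%C)^-1 : R[i].
have Td : Ti s * Th delta = c *: rs' + (c *: ls - (c * ((q1 L a)%:C%C - 1)) *: Th delta).
  rewrite Ti_s_inv //; last exact: delta_W0.
  by rewrite Ts_TisE // -/c -scalerAr mulrBr dT -scalerAr mulr1 scalerBr scalerDr scalerA addrA.
have swv v : W0 v -> (wlength v < wlength w)%N -> (wlength (s \o v) < wlength (s \o w))%N.
  by move=> vv lv; rewrite lw ltnS; apply: leq_trans (len_sL aS vv) _.
have vsw v : W0 v -> (wlength v < wlength w)%N -> (wlength (v \o s) < wlength (s \o w))%N.
  by move=> vv lv; rewrite lw ltnS; apply: leq_trans (len_sR aS vv) _.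
have lw' : (wlength w < wlength (s \o w))%N by rewrite lw.
have ils : itw id ls by rewrite /ls -ThM; apply: itw_id.
pose ls' := c *: ls - (c * ((q1 L a)%:C%C - 1)) *: Th delta.
have ils' : itw id ls'.
  rewrite /ls' /ls -ThM.
  rewrite (_ : _ - _ = Th (mono c 0 * (dl a * ng a) - mono (c * ((q1 L a)%:C%C - 1)) 0 * delta)).
    exact: itw_id.
  by rewrite ThB !(ThM H (mono _ 0)) !Th_C -!scalerAl !mul1r.
exists (rs' * r), (r' * (c *: rs')), (rs' * lo + (ls * r + ls * lo)), (r' * ls' + (lo' * (c *: rs') + lo' * ls')).
have wsE : winv (s \o w) = winv w \o s.
  by rewrite /s -aff_refl0 winv_comp ?winv_aff_refl //; rewrite aff_refl0.
split.
- exact: itw_comp.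
- by rewrite wsE; apply: itw_comp => //; apply: itwZ.
- apply: lowD; first exact: (low_mulL swv sw irs llo).
  apply: lowD; first by apply: (low_itw ww lw'); apply: (itw_comp ils ir).
  by apply: (low_mulL _ (W0_id D) ils llo) => v vv lv; apply: ltn_trans lw'.
- apply: lowD.
    have wi := W0_winv ww; have li : (wlength (winv w) < wlength (s \o w))%N by rewrite wlength_winv.
    by apply: (low_itw wi li); apply: (itw_comp ir' ils').
  apply: lowD; first exact: (low_mulR vsw sw (itwZ c irs) llo').
  by apply: (low_mulR _ (W0_id D) ils' llo') => v vv lv; apply: ltn_trans lw'.
split.
- rewrite dE ThM -(hT_mul H) // mulrA -(mulrA (Th delta)) -(Ts_inv H aS (idelta_inv w sw)).
  rewrite mulrA dT -mulrA E1 mulrDl !mulrDr !addrA //.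
- rewrite dE ThM Ti_mul // -mulrA (ThC H delta) [Ti s * _]mulrA (Ti_s_inv aS (idelta_inv w sw)).
  by rewrite -/s -(mulrA _ _ (Th delta)) Td -/ls' mulrA E2 mulrDl !mulrDr -addrA.
- have R2 : c *: (rs' * rs') = Th (phi a).
    rewrite /rs' -mulrA (mulrA (rs a)) rs_Th // -/s (dl_W0 R sw ar) (srefl_self ar : s a = - a) -mulrA rs_sq //.
    by rewrite /phi (ThM H (_ * _) (rsq a)) (ThM H (mono _ 0)) Th_C -!scalerAl mul1r ThM mulrA.
  have irs2 := itw_Th _ irs; move: (rs') R2 irs2 => t R2 irs2.
  rewrite -!scalerAr !mulrA -(mulrA t r) E3 irs2 -mulrA scalerAr R2 (iprod_s aS ww wa).
    have -> : phi a * gpush (srefl a) (iprod w phi) = gpush (srefl a) (iprod w phi) * phi a by exact: mulrC.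
    exact: esym (ThM _ _ _).
  by move=> b br; exact: phi_W0.
Qed.

End Expansion.

Opaque gmul gadd gopp gzero gmono gpush.

(** * The trace on the commutative subalgebra *)

Section TraceFormula.
Variables (R : realType) (D : rootDatum) (L : labels R D) (H : heckeAlgebra L).
Local Notation X := (latX D).
Local Notation pr := (@pairing D).
Local Notation T := (hT H).
Local Notation Ti := (@Ti R D L H).
Local Notation th := (htheta H).
Local Notation Th := (@Th R D L H).
Local Notation qc w := ((qW L w)%:C%C).
Local Notation galg := (galg R[i] X).
Local Notation mono := (@gmono R[i] X).
Local Notation Dg := (@Dg R D).
Local Notation ng := (@ng R D L).
Local Notation dl := (@dl R D).
Local Notation delta := (@delta R D).
Local Notation rsq := (@rsq R D L).
Local Notation idelta := (@idelta R D).
Local Notation iprod := (@iprod R D).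
Implicit Types (x y z a b : X) (w v g u : X -> X) (h k r : H) (f : galg).

Lemma root_conj_simple b : b \in roots D -> exists2 w, W0 w & w b \in simple D.
Proof.
have pos c : c \in pos_roots D -> exists2 w, W0 w & w c \in simple D.
  have [n] := ubnP (absz (ht c)); elim: n c => // n IH c cn cp; have cr := pos_root_root cp.
  have [cs|cs] := boolP (c \in simple D); first by exists id => //; exact: W0_id.
  have [a aS ca] : exists2 a, a \in simple D & 0 < pr c (coroot a).
    apply: contrapT => N; have := cform_root_gt0 cr.
    have /pos_rootP[_ [m cE]] := cp.
    rewrite {2}cE cform_sumr ltNge big_seq sumr_le0 // => a aS.
    rewrite pmulrn cformMzr mulr_ge0_le0 //; have ar := simple_root aS.
    have := cform_coroot c ar; have : pr c (coroot a) <= 0.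
      by rewrite leNgt; apply/negP => h; apply: N; exists a.
    move=> h1 h2; have : 2 * cform c a <= 0 by rewrite h2 mulr_le0_ge0 // ltW // cform_root_gt0.
    by rewrite pmulr_rle0.
  have ca' : c != a by apply: contraNneq cs => ->.
  have sp := simple_perm aS cp ca'; have ar := simple_root aS.
  have h1 : ht (srefl a c) = ht c - 2 * pr c (coroot a).
    by rewrite /srefl htD htN htMz (ht_simple aS) mulrC.
  have h2 := ht_pos sp.
  have [|w ww ws] := IH (srefl a c) _ sp; first by move: cn; have := ht_pos cp; lia.
  by exists (w \o srefl a) => //; apply: W0_comp => //; exact: W0_srefl.
move=> br; have /orP[|/pos] := pos_or_neg br; first exact: pos.
case=> w ww ws; exists (w \o srefl b); first by apply: W0_comp => //; exact: W0_srefl.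
by rewrite /= srefl_self.
Qed.

Lemma q1_pos b : b \in roots D -> 0 < q1 L b.
Proof. by move=> br; have [w ww ws] := root_conj_simple br; rewrite -(q1_W0 L ww br) q1_gt0. Qed.

Lemma q0_pos b : b \in roots D -> 0 < q0 L b.
Proof.
move=> br; have [w ww ws] := root_conj_simple br; rewrite -(q0_W0 L ww br).
by have [Y []] := th_quad H ws.
Qed.

(** [hb] is [q_(b^vee/2)^(1/2)] and [cb] is [q_(b^vee/2)^(1/2) q_(b^vee)], the constants in the
    denominator of [mres]; compare [hbE] and [cbE]. *)
Definition hb b : R := Num.sqrt (q1 L b / q0 L b).
Definition cb b : R := Num.sqrt (q1 L b * q0 L b).
Definition gb b : galg := (1 + mono (hb b)%:C%C b) * (1 - mono (cb b)%:C%C b).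

Lemma hbN b : b \in roots D -> hb (- b) = hb b.
Proof. by move=> br; rewrite /hb q1N // q0N. Qed.
Lemma cbN b : b \in roots D -> cb (- b) = cb b.
Proof. by move=> br; rewrite /cb q1N // q0N. Qed.
Lemma hb_W0 w b : W0 w -> b \in roots D -> hb (w b) = hb b.
Proof. by move=> ww br; rewrite /hb q1_W0 // q0_W0. Qed.
Lemma cb_W0 w b : W0 w -> b \in roots D -> cb (w b) = cb b.
Proof. by move=> ww br; rewrite /cb q1_W0 // q0_W0. Qed.

Lemma hb_cb b : b \in roots D -> hb b * cb b = q1 L b /\ cb b * (1 - (q0 L b)^-1) = cb b - hb b.
Proof.
move=> br; have p1 := q1_pos br; have p0 := q0_pos br.
have s1 : Num.sqrt (q1 L b) * Num.sqrt (q1 L b) = q1 L b by rewrite -expr2 sqr_sqrtr // ltW.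
have s0 : Num.sqrt (q0 L b) * Num.sqrt (q0 L b) = q0 L b by rewrite -expr2 sqr_sqrtr // ltW.
have n0 : Num.sqrt (q0 L b) != 0 by rewrite gt_eqF // sqrtr_gt0.
rewrite /hb /cb !sqrtrM ?ltW // sqrtrV ?ltW //; split.
  by rewrite -[RHS]s1 mulrACA mulVf // mulr1.
have -> : (q0 L b)^-1 = (Num.sqrt (q0 L b))^-1 * (Num.sqrt (q0 L b))^-1 by rewrite -invfM s0.
by field.
Qed.

Lemma rsq_aux (A : comRingType) (U V c h : A) : U * V = 1 ->
  h * c * (1 - V * V) * (1 - U * U) + (h * c - 1 + (c - h) * V) * (h * c - 1 + (c - h) * U) =
  (1 + h * U) * (1 - c * U) * ((1 + h * V) * (1 - c * V)).
Proof.
move=> uv; apply/eqP; rewrite -subr_eq0; apply/eqP.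
transitivity ((U * V - 1) * (h * c * (U * V + 1) - h * h * c * c * (U * V + 1) - h * c * (c - h) * (U + V))).
  by ring.
by rewrite uv subrr mul0r.
Qed.

(** With [q1 = hb cb] and [kap = cb - hb] this becomes the polynomial identity [rsq_aux]. *)
Lemma rsqE b : b \in roots D -> rsq b = gb b * gb (- b).
Proof.
move=> br; have [e1 e2] := hb_cb br.
rewrite /Submission.rsq /Submission.Dg /Submission.ng /gb /kap q1N // q0N // hbN // cbN // -/(cb b) e2 -e1 !mulNrn !opprK.
have mZ c y : mono c y = mono c 0 * mono 1 y by rewrite gmonoM mulr1 add0r.
have mD c d : mono (c - d) 0 = mono c 0 - mono d 0.
  have mN : mono (- d) 0 = - mono d 0.
    by apply/eqP; rewrite -subr_eq0 opprK gmonoD addNr; apply/eqP/fsfunP => p; rewrite gmonoE galg0 if_same.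
  by rewrite -mN gmonoD.
rewrite !mulr2n opprD.
have -> : mono 1 (b + b) = mono 1 b * mono 1 b by rewrite gmonoM mulr1.
have -> : mono 1 (- b - b) = mono 1 (- b) * mono 1 (- b) by rewrite gmonoM mulr1.
rewrite (mZ (cb b - hb b)%:C%C b) (mZ (cb b - hb b)%:C%C (- b)) (mZ (hb b)%:C%C b) (mZ (hb b)%:C%C (- b)).
rewrite (mZ (cb b)%:C%C b) (mZ (cb b)%:C%C (- b)) rmorphB rmorphM !mD gmono1.
have -> : mono ((hb b)%:C%C * (cb b)%:C%C) 0 = mono (hb b)%:C%C 0 * mono (cb b)%:C%C 0.
  by rewrite gmonoM addr0.
by apply: rsq_aux; rewrite gmonoM mulr1 subrr.
Qed.

Definition eT (x : X) : R[i] := htau H (th x).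
Definition d0 (x : X) : R[i] := (x == 0)%:R.

Lemma gact_eT f x : gact f eT x = htau H (th x * Th f).
Proof.
rewrite /gact /Submission.Th /gev mulr_sumr linear_sum; apply: eq_bigr => z _.
by rewrite -scalerAr linearZ /= -thD.
Qed.

Lemma T_w0_dom w0 x : longest w0 -> dominant x ->
  T w0 * th x * Ti w0 = nrm L (transl (w0 x)) *: T (transl (w0 x)).
Proof.
move=> w0l xd; have ww := w0l.1; have wW := W0_W ww.
have tx := W_transl x; have twx := W_transl (w0 x).
have l1 := len_W0_transl ww xd; have l2 := len_transl_w0 w0l xd.
have E := W0_transl x ww.
have <- : nrm L (transl x) = nrm L (transl (w0 x)).
  by apply: (mulfI (nrm_neq0 L wW)); rewrite -nrm_mul // E nrm_mul // mulrC.
rewrite th_dom // -scalerAr -scalerAl (hT_mul H) // E -(hT_mul H) //.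
by rewrite -mulrA TTi // mulr1.
Qed.

(** Conjugation by [T_w0] turns [N_w] for a dominant translation into [N_w] for the translation by
    [w0 x]; the rest is orthonormality of the [N_w]. *)
Lemma tau_TT w0 x y : longest w0 -> dominant x -> dominant y ->
  htau H (T w0 * th x * Ti w0 * th y) = (w0 x + y == 0)%:R.
Proof.
move=> w0l xd yd; have ww := w0l.1; have wW := W0_W ww.
have tx := W_transl x; have twx := W_transl (w0 x); have ty := W_transl y.
have Ex := T_w0_dom w0l xd.
rewrite Ex (th_dom H yd) -scalerAl -scalerAr !linearZ /= htau_TT // transl_comp.
have -> : `[< transl (w0 x + y) = id :> (X -> X) >] = (w0 x + y == 0).
  apply/asboolP/eqP => [/(congr1 (@^~ 0))|->]; first by rewrite /transl add0r.
  by apply/funext => z; rewrite /transl addr0.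
case: eqP => [E0|_]; last by rewrite !mulr0.
have tyE : transl y = winv (transl (w0 x)) :> (X -> X).
  by apply: W_comp_id => //; rewrite transl_comp E0; apply/funext => z; rewrite /transl addr0.
rewrite tyE {2}/nrm q_winv // -/(nrm L (transl (w0 x))) mulrA -expr2 nrm_sq // mulVf //.
exact: qc_neq0.
Qed.

(* On [FF] a product of factors [1 - c e^b] acts injectively, so difference equations determine their solution. *)
Definition FF (F : X -> R[i]) := exists C : int, forall x, C < ht x -> F x = 0.

Lemma gactBr f (F G : X -> R[i]) x : gact f (fun x => F x - G x) x = gact f F x - gact f G x.
Proof. by rewrite /gact -sumrB; apply: eq_bigr => z _; rewrite mulrBr. Qed.

Lemma FF_gact f F : FF F -> FF (gact f F).
Proof.
move=> [C CP]; exists (C + \sum_(z <- finsupp f) `|ht z|) => x hx.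
rewrite /gact big_seq big1 // => z zf; rewrite CP ?mulr0 // htD.
have : `|ht z| <= \sum_(z <- finsupp f) `|ht z|.
  by rewrite (big_rem z) //= lerDl sumr_ge0.
by move: hx; lia.
Qed.

Lemma FF_eT : FF eT.
Proof.
exists 0 => x hx; rewrite /eT -[th x]mulr1 -(T_id H).
by apply: tau_th_finH => //; apply: finH_T; exact: W0_id.
Qed.

(** A period of nonzero height carries the vanishing at large height to every point. *)
Lemma FF_shift F y : FF F -> ht y != 0 -> (forall x, F x = F (x + y)) -> forall x, F x = 0.
Proof.
move=> [C CP]; wlog hy : y / 0 < ht y.
  move=> G y0 E; have [hy|hy] := ltP 0 (ht y); first exact: (G y).
  apply: (G (- y)); rewrite ?htN ?oppr_eq0 ?oppr_gt0 ?lt_neqAle ?y0 // => x.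
  by rewrite [RHS]E subrK.
move=> _ E x; have it m : F x = F (x + y *+ m).
  elim: m => [|m ->]; first by rewrite mulr0n addr0.
  by rewrite mulrSr addrA -E.
rewrite (it (absz (C - ht x)%R).+1) CP // htD pmulrn htMz.
by move: hy; nia.
Qed.

Lemma FF_Dg b F : b \in roots D -> FF F -> (forall x, gact (Dg b) F x = 0) -> forall x, F x = 0.
Proof.
move=> br FFF DF; apply: (FF_shift (y := - (b *+ 2)) FFF) => [|x].
  have hb0 : ht b != 0.
    have /orP[|] := pos_or_neg br; move/ht_pos; first by move=> h; rewrite gt_eqF.
    by rewrite htN oppr_gt0 => h; rewrite lt_eqF.
  by rewrite htN oppr_eq0 mulr2n htD; move: hb0; lia.
apply/eqP; rewrite -subr_eq0 -[X in _ == X](DF x) /Submission.Dg gactD gactN gact_mono mul1r.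
by rewrite -[X in X + _](congr1 (@^~ x) (gact1 F)) eqxx.
Qed.

Lemma FF_prod I (s : seq I) (P : pred I) (f : I -> galg) F :
  (forall i, P i -> forall G, FF G -> (forall x, gact (f i) G x = 0) -> forall x, G x = 0) ->
  FF F -> (forall x, gact (\prod_(i <- s | P i) f i) F x = 0) -> forall x, F x = 0.
Proof.
move=> fP; elim: s F => [|i s IH] F FFF; first by rewrite big_nil gact1.
rewrite big_cons; case: ifP => Pi; last exact: IH.
rewrite gactM => E; apply: IH => //; apply: (fP i Pi) E; exact: FF_gact.
Qed.

Lemma FF_delta F : FF F -> (forall x, gact delta F x = 0) -> forall x, F x = 0.
Proof.
move=> FFF; rewrite /Submission.delta big_seq; apply: FF_prod => // b br G; exact: FF_Dg.
Qed.

Lemma FF_idelta w F : FF F -> (forall x, gact (idelta w) F x = 0) -> forall x, F x = 0.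
Proof.
move=> FFF; apply: FF_prod => // b _ G; exact: FF_delta.
Qed.

Lemma eventually_dom w0 x : longest w0 ->
  exists M, forall m, (M <= m)%N -> dominant (x + (- w0 (rho2 D)) *+ m).
Proof.
move=> w0l; have ww := w0l.1; exists (\sum_(b <- roots D) `|pr x (coroot b)|)%N => m Mm b bp.
have br := pos_root_root bp; rewrite pairingDl prMnl prNl.
have h1 : 1 <= - pr (w0 (rho2 D)) (coroot b).
  have wi := W0_winv ww; rewrite -(W0_winvKr ww b) W0_pr ?W0_root // -corootN ?W0_root //.
  have br' : winv w0 b \in roots D by rewrite W0_root.
  have /orP[wp|/rho2_pos h] := pos_or_neg br'; last by lia.
  by have := longest_neg w0l wp; rewrite W0_winvKr // bp.
have h2 : (`|pr x (coroot b)| <= m)%N.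
  by apply: leq_trans Mm; rewrite (big_rem b) //= leq_addr.
have : m%:Z <= - pr (w0 (rho2 D)) (coroot b) *+ m by rewrite -{1}natz ler_wMn2r.
by move: h2; lia.
Qed.

(** A term for [g] moves [theta_(m rho2)] to [theta_(g (m rho2))]. The resulting height contains [m]
    times [ht (g rho2) - ht (w0 rho2)], which is positive for [g] shorter than [w0]. *)
Lemma low_van w0 lo k z : longest w0 -> LB k -> low (wlength w0) lo ->
  exists M, forall m, (M <= m)%N ->
    htau H (lo * th (rho2 D *+ m) * k * th (z + (- w0 (rho2 D)) *+ m)) = 0.
Proof.
move=> w0l lk; elim=> [|g r h gg lg [lr ir] _ [M IH]]; first by exists 0%N => m _; rewrite !mul0r linear0.
have [C CP] := LB_van (LBM lr lk).
exists (maxn M (absz (C - ht z)%R).+1) => m; rewrite geq_max => /andP[Mm Cm].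
rewrite !mulrDl linearD /= IH // addr0 ir htauC !mulrA -thD -mulrA CP //.
rewrite !htD W0Mn // pmulrn htMz pmulrn htMz htN.
by have := ht_w0_rho2 w0l gg lg; move: Cm; nia.
Qed.

(** The product intertwines by [w0 \o g]. This has positive length because [g] is shorter than [w0],
    so [itw_tau] applies. *)
Lemma low_van0 w0 lo r z : longest w0 -> itw w0 r -> low (wlength w0) lo ->
  htau H (th z * r * lo) = 0.
Proof.
move=> w0l ir; elim=> [|g r' h gg lg ir' _ IH]; first by rewrite mulr0 linear0.
rewrite mulrDr linearD /= IH addr0 -mulrA; have ww := w0l.1.
apply: (itw_tau z (W0_comp ww gg) _ (itw_comp ir ir')).
have [b bp gb] : exists2 b, b \in pos_roots D & g b \in pos_roots D.
  apply: contrapT => N; have := longest_uniq w0l gg.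
  move=> /(_ _)/eqP; rewrite ltn_eqF // => /(_ _)/notF; apply => c cp.
  by apply/negP => gc; apply: N; exists c.
apply/negP => /eqP l0; have := len0_pos (W0_comp ww gg) l0 bp.
by apply/negP; exact: (longest_neg w0l gb).
Qed.

(** The trace of [idelta T_w0 theta_x T_w0^-1 idelta theta_y] with [w0 x + y = z] is evaluated
    directly by [tau_TT] and a second time through [expand]. Taking [x] and [y] far inside the
    dominant cone makes the first evaluation valid on the whole support and removes the lower terms
    of the second. *)
Lemma trace_expansion w0 z : longest w0 ->
  gact (idelta w0 * idelta w0) d0 z = gact (iprod w0 (phi L)) eT z.
Proof.
move=> w0l; have ww := w0l.1; set d2 := idelta w0 * idelta w0.
have [r [r' [lo [lo' [ir ir' llo llo' [E1 E2 E3]]]]]] := expand H ww.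
have di : W0_inv (idelta w0).
  move=> w x w1; rewrite -{1}(idelta_inv R w0 w1).
  by rewrite (gpush_coef _ _ (W0_winvK w1) (W0_winvKr w1)) W0_winvK.
have [M1 M1P] := low_van z w0l (LBD ir'.1 (low_LB llo')) llo.
have domE (s : seq X) : exists M, forall m, (M <= m)%N -> forall p : X, p \in s -> dominant (z + p + (- w0 (rho2 D)) *+ m).
  elim: s => [|p s [M MP]]; first by exists 0%N.
  have [M' M'P] := eventually_dom (z + p) w0l; exists (maxn M M') => m.
  rewrite geq_max => /andP[m1 m2] p'; rewrite inE => /orP[/eqP->|]; [exact: M'P|exact: MP].
have [M2 M2P] := domE (finsupp d2).
pose m := maxn M1 M2; pose x := rho2 D *+ m; pose y := z + (- w0 (rho2 D)) *+ m.
have xd : dominant x.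
  by move=> b bp; rewrite prMnl mulrn_wge0 //; apply: dominant_rho2.
have xy : w0 x + y = z by rewrite /y /x W0Mn // mulNrn addrC subrK.
have A : htau H ((r + lo) * th x * (r' + lo') * th y) = gact d2 d0 z.
  have thd p : th p * Th (idelta w0) = Th (idelta w0) * th p.
    by have := ThC H (mono 1 p) (idelta w0); rewrite Th_mono scale1r.
  rewrite -E1 -E2 -!mulrA htauC -!mulrA thd (mulrA (Th _) (Th _)) -ThM -/d2.
  rewrite !mulrA /Submission.Th /gact /gev mulr_sumr mulr_suml linear_sum big_seq [RHS]big_seq.
  apply: eq_bigr => p pf; rewrite -scalerAr -scalerAl linearZ /= -mulrA -thD; congr (_ * _).
  rewrite tau_TT //; last by rewrite addrCA addrA; apply: M2P => //; exact: leq_maxr.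
  by rewrite /d0 addrCA xy addrC.
rewrite -A -!mulrA mulrDl linearD /= [X in _ + X](_ : _ = 0); last first.
  by rewrite !mulrA; apply: M1P; exact: leq_maxl.
rewrite addr0 mulrDl !mulrDr linearD /= [X in _ + X](_ : _ = 0); last first.
  by rewrite !mulrA ir.2 htauC !mulrA -thD (low_van0 _ w0l ir llo').
rewrite addr0 gact_eT -E3 !mulrA ir.2 htauC !mulrA -thD addrC xy //.
Qed.

Lemma prod_roots_pos (F : X -> galg) :
  \prod_(b <- roots D) F b = \prod_(b <- pos_roots D) (F b * F (- b)).
Proof.
have p1 : perm_eq [seq b <- roots D | b \in pos_roots D] (pos_roots D).
  apply: uniq_perm; rewrite ?filter_uniq ?fset_uniq // => b; rewrite mem_filter.
  by apply/andP/idP => [[]//|bp]; split=> //; exact: pos_root_root.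
have p2 : perm_eq [seq b <- roots D | b \notin pos_roots D] [seq - b | b <- pos_roots D].
  apply: uniq_perm; [by rewrite filter_uniq ?fset_uniq|by rewrite map_inj_uniq ?fset_uniq //; exact: oppr_inj|].
  move=> b; rewrite mem_filter; apply/andP/mapP => [[bn br]|[c cp ->]].
    by exists (- b); rewrite ?opprK //; have := pos_or_neg br; rewrite (negPf bn).
  by rewrite (pos_neg cp) rootNE pos_root_root.
rewrite (bigID (mem (pos_roots D))) /= -!(big_filter (roots D)) (perm_big _ p1) (perm_big _ p2) /=.
by rewrite big_map -big_split.
Qed.

Lemma q_iprod w : W0 w -> mono (qc w)^-1 0 = iprod w (fun b => mono (q1 L b)%:C%C^-1 0).
Proof.
move: w; apply: W0_simple_ind => [w ww l0|a w aS ww wa lw IH].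
  by rewrite iprod_len0 // qW_length0 ?invr1 ?gmono1 //; exact: W0_W.
have sw := W0_srefl (simple_root aS); have sW := W0_W sw; have wW := W0_W ww.
rewrite (iprod_s aS ww wa) => [|b br]; last by rewrite gpush_mono (W0_0 sw) (q1_W0 L sw br).
rewrite -IH gpush_mono (W0_0 sw) gmonoM addr0 qW_mul //; last by rewrite lw wlength_s.
by rewrite q_srefl // rmorphM invfM.
Qed.

Lemma iprod_delta w0 : longest w0 ->
  delta * iprod w0 (phi L) = mono (qc w0)^-1 0 * (idelta w0 * idelta w0) * \prod_(b <- roots D) gb b.
Proof.
move=> w0l; rewrite q_iprod; last exact: w0l.1.
have E0 : delta = \prod_(b <- pos_roots D) (Dg b * Dg (- b)) by exact: prod_roots_pos.
have E1 : idelta w0 = \prod_(b <- pos_roots D) delta by exact: iprod_w0.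
rewrite E1 (prod_roots_pos gb) (iprod_w0 _ w0l) (iprod_w0 _ w0l) {1}E0.
rewrite -[LHS]big_split -[X in _ * X * _]big_split -[X in X * _]big_split -[RHS]big_split big_seq [RHS]big_seq /=.
apply: eq_bigr => b /pos_root_root br; have br' := rootN br.
rewrite /phi (rsqE br).
clear E0 E1; have E1 := deltaE R br; have E2 := deltaE R br'.
move: E1 E2; move: (delta) (mono _ 0) (Dg b) (Dg (- b)) (dl b) (dl (- b)) (gb b) (gb (- b)).
move=> d m D1 D2 d1 d2 g1 g2 E1 E2.
rewrite {1}E1 E2; move: d E1 E2 => _ _ _.
have swp (A : comRingType) (p1 p2 p3 p4 p5 p6 p7 : A) :
   p1 * p2 * (p3 * (p4 * p5) * (p6 * p7)) = p3 * (p1 * p4 * (p2 * p5)) * (p6 * p7) by ring.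
exact: swp.
Qed.

(** [trace_expansion] times [delta] has the factor [idelta w0] twice on both sides, by
    [iprod_delta]; it is cancelled by injectivity on [FF]. *)
Lemma trace_formula w0 : longest w0 -> 
  gact (\prod_(b <- roots D) gb b) eT = gact (mono (qc w0) 0 * delta) d0.
Proof.
move=> w0l; pose P := \prod_(b <- roots D) gb b; pose d2 := idelta w0 * idelta w0.
have q0 : qc w0 != 0 :> R[i] by apply: qc_neq0; apply: W0_W; exact: w0l.1.
have E : gact d2 (gact P eT) = gact d2 (gact (mono (qc w0) 0 * delta) d0).
  rewrite -!gactM (_ : d2 * P = mono (qc w0) 0 * (delta * iprod w0 (phi L))); last first.
    have aux (A : comRingType) (a b c d : A) : a * b = 1 -> c * d = a * (b * c * d).
      by move=> ab; rewrite -mulrA mulrA ab mul1r.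
    by rewrite iprod_delta //; apply: aux; rewrite gmonoM mulfV // addr0.
  rewrite (mulrA (mono (qc w0) 0)) [LHS]gactM; have -> : gact (iprod w0 (phi L)) eT = gact d2 d0.
    by apply/funext => x; rewrite trace_expansion.
  by rewrite -gactM mulrC.
apply/funext => x; apply/eqP; rewrite -subr_eq0; apply/eqP; move: x.
pose G x := gact P eT x - gact (mono (qc w0) 0 * delta) d0 x.
have FG : FF G.
  have FFd : FF d0.
    exists 0 => x hx; rewrite /d0; case: eqP hx => // ->; by rewrite ht0.
  have [C1 P1] := FF_gact P FF_eT; have [C2 P2] := FF_gact (mono (qc w0) 0 * delta) FFd.
  by exists (Num.max C1 C2) => x; rewrite gt_max /G => /andP[h1 h2]; rewrite P1 // P2 // subrr.
have E0 x : gact d2 G x = 0.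
  have -> : gact d2 G x = gact d2 (gact P eT) x - gact d2 (gact (mono (qc w0) 0 * delta) d0) x.
    exact: gactBr.
  by rewrite E subrr.
apply: (FF_idelta (w := w0)) => //; apply: (FF_idelta (w := w0)); first exact: FF_gact.
by move=> x; have := E0 x; rewrite /d2 gactM.
Qed.

Lemma hstar0 : hstar (0 : H) = 0.
Proof. by rewrite -(scale0r (1 : H)) hstarZ conjC0 !scale0r. Qed.

Lemma dominant_opp w0 x : longest w0 -> dominant x -> dominant (winv w0 (- x)).
Proof.
move=> w0l xd b bp; have ww := w0l.1; have br := pos_root_root bp; have wi := W0_winv ww.
have E : pr (winv w0 (- x)) (coroot b) = pr (- x) (coroot (w0 b)).
  by rewrite -{1}(W0_winvK ww b) W0_pr ?W0_root.
rewrite E prNl oppr_ge0; apply: dominant_neg => //; first by rewrite W0_root.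
exact: longest_neg.
Qed.

(** For dominant [x] the star of the normalised translation is that of [-x], which [T_w0_dom] writes
    as a conjugate of some theta. Both sides are multiplicative in [x], which gives the general
    case. *)
Lemma hstar_th w0 x : longest w0 -> hstar (th x) = T w0 * th (winv w0 (- x)) * Ti w0.
Proof.
move=> w0l; have ww := w0l.1; have wW := W0_W ww; have wi := W0_winv ww.
pose ph x := T w0 * th (winv w0 (- x)) * Ti w0.
have phD y z : ph (y + z) = ph y * ph z.
  by rewrite /ph opprD W0D // thD !mulrA -(mulrA _ (Ti w0) (T w0)) TiT // mulr1.
have ph0 : ph 0 = 1 by rewrite /ph oppr0 W0_0 // th0 mulr1 TTi.
have dom y : dominant y -> hstar (th y) = ph y.
  move=> yd; rewrite th_dom // hstarZ /ph T_w0_dom //; last exact: dominant_opp.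
  rewrite W0_winvKr //; have ty := W_transl y.
  have tE : transl (- y) = winv (transl y) :> (X -> X).
    by apply: W_comp_id => //; rewrite transl_comp subrr; apply/funext => z; rewrite /transl addr0.
  rewrite (@hstar_T _ _ _ H (transl y) (transl (- y))) //.
  - have cr (c : R) : (c%:C%C)^* = c%:C%C by exact: conjc_real.
    by rewrite tE /nrm q_winv // cr.
  - exact: W_transl.
  - by rewrite tE W_winvVr.
have [y [z [yd zd ->]]] := th_dec x; rewrite -/(ph (y - z)).
have : ph (- z) * (ph z * hstar (th (y - z))) = ph (- z) * (ph z * ph (y - z)).
  by rewrite -phD [z + _]addrC subrK -(dom z) // -hstarM -thD subrK dom.
have pz : ph (- z) * ph z = 1 by rewrite -phD addNr ph0.
by move=> E; rewrite -[LHS]mul1r -pz -mulrA E mulrA pz mul1r.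
Qed.

Definition gstar f : galg := \sum_(x <- finsupp f) mono ((f x)^*) (- x).

Lemma gstarE f x : gstar f x = (f (- x))^*.
Proof.
rewrite /gstar galg_sum.
under eq_bigr => y _ do rewrite gmonoE.
have [xf|xf] := boolP (- x \in finsupp f).
  rewrite (big_rem (- x)) //= opprK eqxx big_seq big1 ?addr0 // => y.
  by rewrite (rem_filter _ (fset_uniq _)) mem_filter /= -eqr_oppLR eq_sym => /andP[/negPf ->].
rewrite (fsfun_dflt xf) conjC0 big_seq big1 // => y yf; case: eqP => // xy.
by move: xf; rewrite xy opprK yf.
Qed.

Lemma gstar_inv f : W0_inv f -> W0_inv (gstar f).
Proof. by move=> fi w x ww; rewrite !gstarE -W0N // fi. Qed.

Lemma hstar_Th f : W0_inv f -> (exists w0, @longest D w0) -> hstar (Th f) = Th (gstar f).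
Proof.
move=> fi [w0 w0l]; have ww := w0l.1; have wW := W0_W ww.
have E : hstar (Th f) = T w0 * Th (gpush (winv w0) (gstar f)) * Ti w0.
  rewrite /Submission.Th gev_push /gstar gev_sum {1}/gev.
  elim/big_rec2: _ => [|x h h' _ IH]; first by rewrite hstar0 mulr0 mul0r.
  by rewrite hstarD hstarZ IH gev_mono mulrDr mulrDl -scalerAr -scalerAl /= -hstar_th.
rewrite E (W0_inv_push (W0_winv ww)); last exact: gstar_inv.
by rewrite (T_inv H ww) -?mulrA ?TTi ?mulr1 //; apply: gstar_inv.
Qed.

End TraceFormula.

(** * Real-valued modulus of complex numbers *)

Section ComplexModulus.
Variable R : realType.
Implicit Types (z : R[i]) (x y : R).
Local Notation "x %:CC" := (x%:C%C : R[i]) (at level 2, format "x %:CC").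

Definition nm z : R := complex.Re `|z|.

Lemma nmE z : `|z| = (nm z)%:CC.
Proof.
have : `|z| \is Num.real by exact: normr_real.
by rewrite /nm => /complex_realP[k ->].
Qed.
Lemma nm_ge0 z : 0 <= nm z.
Proof. by rewrite -lecR -nmE rmorph0 normr_ge0. Qed.
Lemma nmM z w : nm (z * w) = nm z * nm w.
Proof. by apply: (@complexI R); rewrite rmorphM -!nmE normrM. Qed.
Lemma nmV z : nm z^-1 = (nm z)^-1.
Proof. by apply: (@complexI R); rewrite fmorphV -!nmE normfV. Qed.
Lemma nmX z n : nm (z ^+ n) = nm z ^+ n.
Proof. by apply: (@complexI R); rewrite rmorphXn -!nmE normrX. Qed.
Lemma nmN z : nm (- z) = nm z.
Proof. by rewrite /nm normrN. Qed.
Lemma nmD z w : nm (z + w) <= nm z + nm w.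
Proof. by rewrite -lecR rmorphD -!nmE ler_normD. Qed.
Lemma nmB z w : nm (z - w) <= nm z + nm w.
Proof. by rewrite -(nmN w) nmD. Qed.
Lemma nm0 : nm 0 = 0. Proof. by rewrite /nm normr0. Qed.
Lemma nm1 : nm 1 = 1. Proof. by rewrite /nm normr1. Qed.
Lemma nm_eq0 z : (nm z == 0) = (z == 0).
Proof. by rewrite -[RHS]normr_eq0 nmE fmorph_eq0. Qed.
Lemma nm_gt0 z : (0 < nm z) = (z != 0).
Proof. by rewrite lt_neqAle nm_ge0 andbT eq_sym nm_eq0. Qed.
Lemma nm_real x : nm x%:CC = `|x|.
Proof. by apply: (@complexI R); rewrite -nmE normc_def /= expr0n addr0 sqrtr_sqr. Qed.
Lemma nm_conj z : nm z^* = nm z.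
Proof. by rewrite /nm norm_conjC. Qed.
Lemma nm_sum I (r : seq I) (P : pred I) (F : I -> R[i]) :
  nm (\sum_(i <- r | P i) F i) <= \sum_(i <- r | P i) nm (F i).
Proof.
elim/big_rec2: _ => [|i y1 y2 _ h]; first by rewrite nm0.
by apply: le_trans (nmD _ _) _; rewrite lerD2l.
Qed.
Lemma nm_sq z : (nm z ^+ 2)%:CC = z * z^*.
Proof. by rewrite rmorphXn /= -nmE normCK. Qed.
Lemma nm_ReIm z : nm z ^+ 2 = complex.Re z ^+ 2 + complex.Im z ^+ 2.
Proof.
case: z => a b; rewrite /nm normc_def /= sqr_sqrtr //.
by rewrite addr_ge0 // sqr_ge0.
Qed.
Lemma ler_Re z : `|complex.Re z| <= nm z.
Proof.
rewrite -(@ler_sqr R) ?nnegrE ?nm_ge0 // nm_ReIm real_normK ?num_real //.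
by rewrite lerDl sqr_ge0.
Qed.
Lemma ler_Im z : `|complex.Im z| <= nm z.
Proof.
rewrite -(@ler_sqr R) ?nnegrE ?nm_ge0 // nm_ReIm real_normK ?num_real //.
by rewrite lerDr sqr_ge0.
Qed.
End ComplexModulus.

(** * Weights of irreducible representations *)

Section Operators.
Variables (R : realType) (D : rootDatum) (L : labels R D) (H : heckeAlgebra L).
Variables (V : hilbertCompletion H) (A : cstarCompletion V).
Local Notation X := (latX D).
Local Notation th := (htheta H).
Local Notation Th := (@Th R D L H).
Local Notation galg := (galg R[i] X).
Local Notation mono := (@gmono R[i] X).
Local Notation "x %:CC" := (x%:C%C : R[i]) (at level 2, format "x %:CC").
Implicit Types (a b : A) (u v : V) (c d e : R) (f g : galg) (t : torus R D).

Definition rn v : R := complex.Re `|v|.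
Lemma rnE v : `|v| = (rn v)%:CC.
Proof.
have : `|v| \is Num.real by exact: normr_real.
by rewrite /rn => /complex_realP[k ->].
Qed.
Lemma rn_ge0 v : 0 <= rn v.
Proof. by rewrite -lecR -rnE rmorph0 normr_ge0. Qed.
Lemma rnD u v : rn (u + v) <= rn u + rn v.
Proof. by have := ler_normD u v; rewrite !rnE -rmorphD lecR. Qed.
Lemma rnN u : rn (- u) = rn u. Proof. by rewrite /rn normrN. Qed.
Lemma rnZ (z : R[i]) v : rn (z *: v) = nm z * rn v.
Proof. by apply: (@complexI R); rewrite rmorphM /= -nmE -!rnE normrZ. Qed.
Lemma rn_eq0 v : (rn v == 0) = (v == 0).
Proof. by rewrite -[RHS]normr_eq0 rnE fmorph_eq0. Qed.
Lemma rn0 : rn 0 = 0. Proof. by rewrite /rn normr0. Qed.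

Lemma opP (F : V -> V) c : opnorm_le F c <-> forall v, rn (F v) <= c * rn v.
Proof.
by split => h v; have := h v; rewrite !rnE -rmorphM lecR.
Qed.

Lemma cactD a b v : cact (a + b) v = cact a v + cact b v.
Proof. by have := cact_linearl v 1 a b; rewrite !scale1r. Qed.
Lemma cact0 v : cact (0 : A) v = 0.
Proof. by apply: (addrI (cact (0 : A) v)); rewrite -cactD !addr0. Qed.
Lemma cactZ (z : R[i]) a v : cact (z *: a) v = z *: cact a v.
Proof. by have := cact_linearl v z a 0; rewrite cact0 !addr0. Qed.
Lemma cactN a v : cact (- a) v = - cact a v.
Proof. by rewrite -scaleN1r cactZ scaleN1r. Qed.
Lemma cactDr a u v : cact a (u + v) = cact a u + cact a v.
Proof. by have := cact_linearr a 1 u v; rewrite !scale1r. Qed.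
Definition unitv : V := hilb_in V 1.

Lemma hstar1 : hstar (1 : H) = 1.
Proof. by rewrite -(T_id H) (@hstar_T _ _ _ H _ (fun x => x)) //; apply: W_id. Qed.

Lemma rn_sq v : (rn v ^+ 2)%:CC = inner v v.
Proof. by rewrite rmorphXn /= -rnE inner_norm. Qed.

Lemma rn_unitv : rn unitv = 1.
Proof.
have : (rn unitv ^+ 2)%:CC = 1.
  by rewrite rn_sq /unitv inner_in hstar1 mulr1 -(T_id H) htau_1.
move/(@complexI R _ 1)/eqP; rewrite sqrf_eq1 => /orP[/eqP //|/eqP h].
by have := rn_ge0 unitv; rewrite h oppr_ge0 ler10.
Qed.

Lemma op_ge0 a c : opnorm_le (cact a) c -> 0 <= c.
Proof. by move=> /opP/(_ unitv); rewrite rn_unitv mulr1; apply: le_trans; exact: rn_ge0. Qed.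

Lemma op_le a c d : c <= d -> opnorm_le (cact a) c -> opnorm_le (cact a) d.
Proof.
by move=> cd /opP h; apply/opP => v; apply: le_trans (h v) _; rewrite ler_wpM2r ?rn_ge0.
Qed.
Lemma opD a b c d : opnorm_le (cact a) c -> opnorm_le (cact b) d -> opnorm_le (cact (a + b)) (c + d).
Proof.
move=> /opP ha /opP hb; apply/opP => v; rewrite cactD mulrDl.
by apply: le_trans (rnD _ _) _; apply: lerD.
Qed.
Lemma opM a b c d : opnorm_le (cact a) c -> opnorm_le (cact b) d -> opnorm_le (cact (a * b)) (c * d).
Proof.
move=> pa /opP hb; have c0 := op_ge0 pa; move/opP: pa => ha; apply/opP => v; rewrite cactM.
by apply: le_trans (ha _) _; rewrite -mulrA ler_wpM2l.
Qed.
Lemma opZ (z : R[i]) a c : opnorm_le (cact a) c -> opnorm_le (cact (z *: a)) (nm z * c).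
Proof.
move=> /opP ha; apply/opP => v; rewrite cactZ rnZ -mulrA ler_wpM2l ?nm_ge0 //.
Qed.
Lemma opN a c : opnorm_le (cact a) c -> opnorm_le (cact (- a)) c.
Proof. by move=> /opP ha; apply/opP => v; rewrite cactN rnN. Qed.
Lemma op1 : opnorm_le (cact (1 : A)) 1.
Proof. by apply/opP => v; rewrite cact1 mul1r. Qed.
Lemma op0 : opnorm_le (cact (0 : A)) 0.
Proof. by apply/opP => v; rewrite cact0 rn0 mul0r. Qed.
Lemma opX a c n : opnorm_le (cact a) c -> opnorm_le (cact (a ^+ n)) (c ^+ n).
Proof.
move=> ha; elim: n => [|n IH]; first by rewrite !expr0; exact: op1.
by rewrite !exprS; apply: opM.
Qed.
Lemma op_sum I (s : seq I) (F : I -> A) (C : I -> R) :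
  (forall i, opnorm_le (cact (F i)) (C i)) ->
  opnorm_le (cact (\sum_(i <- s) F i)) (\sum_(i <- s) C i).
Proof.
by move=> h; elim/big_rec2: _ => [|i y1 y2 _ IH]; [exact: op0|exact: opD].
Qed.

Lemma op_small a : (forall e, 0 < e -> opnorm_le (cact a) e) -> a = 0.
Proof.
move=> h; apply: cact_faithful => v; apply/eqP; rewrite -rn_eq0.
rewrite eq_le rn_ge0 andbT; apply/ler_addgt0Pr => e e0; rewrite add0r.
pose d := e / (rn v + 1); have p0 : 0 < rn v + 1 by rewrite ltr_wpDl // rn_ge0.
have d0 : 0 < d by rewrite divr_gt0.
have /opP/(_ v) := h d d0; move/le_trans; apply.
rewrite /d -mulrA; apply: ler_piMr; first exact: ltW.
by rewrite mulrC ler_pdivrMr // mul1r lerDl.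
Qed.

Lemma exp_small c e : 0 <= c -> c < 1 -> 0 < e -> exists N, forall n, (N <= n)%N -> c ^+ n < e.
Proof.
move=> c0 c1 e0; have : (fun n => c ^+ n) @ \oo --> (0 : R).
  by apply: cvg_expr; rewrite ger0_norm.
move=> /cvgrPdist_lt/(_ _ e0)[N _ NP]; exists N => n /NP /=.
by rewrite sub0r normrN ger0_norm // exprn_ge0.
Qed.

(** Convergence of the partial sums is part of the conclusion because [center_Kpt] needs the inverse
    to lie in the closure of the centre. *)
Lemma neumann a c : c < 1 -> opnorm_le (cact a) c -> exists b, b * (1 - a) = 1 /\
  forall e, 0 < e -> exists N, forall n, (N <= n)%N -> opnorm_le (cact (\sum_(i < n) a ^+ i - b)) e.
Proof.
move=> c1 ha; have c0 := op_ge0 ha; have c1' : 0 < 1 - c by rewrite subr_gt0.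
pose S n := \sum_(i < n) a ^+ i.
have geo n m : \sum_(n <= i < n + m) c ^+ i <= c ^+ n / (1 - c).
  rewrite ler_pdivlMr // mulrC -[X in _ * X](_ : \sum_(i < m) c ^+ (n + i) = _); last first.
    rewrite [RHS](_ : _ = \sum_(0 + n <= i < n + m) c ^+ i) // big_addn addKn big_mkord.
    by apply: eq_bigr => i _; rewrite addnC.
  under eq_bigr do rewrite exprD; rewrite -mulr_sumr mulrCA.
  have -> : (1 - c) * \sum_(i < m) c ^+ i = 1 - c ^+ m.
    by rewrite -(opprB c 1) mulNr -subrX1 opprB.
  by rewrite ler_piMr ?exprn_ge0 // lerBlDr lerDl exprn_ge0.
have SB n m : opnorm_le (cact (S (n + m)%N - S n)) (c ^+ n / (1 - c)).
  apply: (op_le (geo n m)).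
  have -> : S (n + m)%N - S n = \sum_(n <= i < n + m) a ^+ i.
    rewrite /S -!(big_mkord xpredT (fun i => a ^+ i)) (@big_cat_nat _ _ _ n) //=; last exact: leq_addr.
    by rewrite addrAC subrr add0r.
  by apply: op_sum => i; apply: opX.
have [b bP] : exists b, forall e, 0 < e -> exists N, forall n, (N <= n)%N -> opnorm_le (cact (S n - b)) e.
  apply: (@cstar_complete _ _ _ _ _ A) => e e0.
  have e1 : 0 < e * (1 - c) by rewrite mulr_gt0.
  have [N NP] := exp_small c0 c1 e1; exists N.
  have W n m : (N <= n)%N -> (n <= m)%N -> opnorm_le (cact (S m - S n)) e.
    move=> Nn nm; have := SB n (m - n)%N; rewrite subnKC //; apply: op_le.
    by rewrite ler_pdivrMr // ltW // NP.
  move=> m n Nm Nn; have [mn|/ltnW nm] := leqP m n; last exact: W.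
  by rewrite -opprB; apply: opN; apply: W.
exists b; split => //; apply/eqP; rewrite -subr_eq0; apply/eqP; apply: op_small => e e0.
have q0 : 0 < e / 2 / (1 + c) by rewrite !divr_gt0 // ltr_pwDl.
have [N NP] := bP _ q0; have [N' NP'] := exp_small c0 c1 (divr_gt0 e0 (@ltr0n R 2)).
pose n := maxn N N'.
have Sn : S n * (1 - a) = 1 - a ^+ n.
  rewrite /S mulrBr mulr1 mulr_suml; under [X in _ - X]eq_bigr do rewrite -exprSr.
  move: n => {NP NP'} n; rewrite -sumrB; elim: n => [|n IH]; first by rewrite big_ord0 expr0 subrr.
  by rewrite big_ord_recr /= IH addrA subrK.
have -> : b * (1 - a) - 1 = - ((S n - b) * (1 - a)) + (- a ^+ n).
  by rewrite mulrBl Sn opprB opprB addrA addrAC addrK.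
apply: (@op_le _ (e / 2 + e / 2)); first by rewrite -splitr.
apply: opD; last first.
  apply: opN; apply: (op_le _ (opX n ha)); apply: ltW; apply: NP'; exact: leq_maxr.
apply: opN; have h1 := NP _ (leq_maxl N N'); have h2 := opD op1 (opN ha).
by have := opM h1 h2; apply: op_le; rewrite divfK // gt_eqF // ltr_pwDl.
Qed.

Lemma op_dense a c : (forall h, rn (cact a (hilb_in V h)) <= c * rn (hilb_in V h)) -> opnorm_le (cact a) c.
Proof.
move=> hc; have [C hC] := cact_bounded a; have C0 := op_ge0 hC; move/opP: hC => hC.
have c0 : 0 <= c.
  by have := hc 1; rewrite -/unitv rn_unitv mulr1; apply: le_trans; exact: rn_ge0.
apply/opP => v; apply/ler_addgt0Pr => e e0.
pose d := e / (C + c + 1); have p0 : 0 < C + c + 1 by rewrite ltr_wpDl // addr_ge0.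
have d0 : 0 < d by rewrite divr_gt0.
have dC : (0 : R[i]) < d%:CC by rewrite (_ : 0 = 0%:CC) ?ltcR // rmorph0.
have [w [bh [h _ hE]]] := hilb_in_dense (ex_intro _ v (ballxx v dC)) (ball_open v d%:CC).
have {bh} : rn (v - hilb_in V h) <= d.
  have : (ball v d%:CC : set V) w := bh.
  by rewrite -hE -ball_normE /ball_ /= rnE ltcR => /ltW.
set u := hilb_in V h => vu.
have -> : cact a v = cact a u + cact a (v - u) by rewrite -cactDr addrC subrK.
apply: le_trans (rnD _ _) _.
have h1 := hc h; rewrite -/u in h1; have h2 := hC (v - u).
have h3 : rn u <= rn v + rn (v - u).
  by have := rnD v (u - v); rewrite [v + _]addrC subrK -(rnN (u - v)) opprB.
have h4 : c * rn u <= c * (rn v + d).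
  by rewrite ler_wpM2l //; apply: le_trans h3 _; rewrite lerD2l.
have h5 : C * rn (v - u) <= C * d by rewrite ler_wpM2l.
have h6 : (C + c) * d <= e.
  rewrite /d mulrCA ler_piMr ?(ltW e0) // ler_pdivrMr // mul1r lerDl ler01 //.
by move: h1 h2 h4 h5 h6; rewrite !mulrDr !mulrDl; lra.
Qed.

(* [Kpt] contains the support of [nu] and all weights of the irreducible representations of [A]. *)
Definition Kpt t := forall f c, W0_inv f -> opnorm_le (cact (cin A (Th f))) c -> nm (teval f t) <= c.

Lemma tevE t f : teval f t = gev (fun x => t x : R[i]^o) f. Proof. by []. Qed.
Lemma tevD t f g : teval (f + g) t = teval f t + teval g t.
Proof. by rewrite !tevE gevD. Qed.
Lemma tevN t f : teval (- f) t = - teval f t.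
Proof. by rewrite !tevE gevN. Qed.
Lemma tevB t f g : teval (f - g) t = teval f t - teval g t.
Proof. by rewrite tevD tevN. Qed.
Lemma tev_mono t (c : R[i]) x : teval (mono c x) t = c * t x.
Proof. by rewrite tevE gev_mono. Qed.
Lemma tev1 t : teval (1 : galg) t = 1.
Proof. by rewrite -gmono1 tev_mono tchar0 mulr1. Qed.
Lemma tev0 t : teval (0 : galg) t = 0.
Proof. by rewrite tevE gev0. Qed.
Lemma tevM t f g : teval (f * g) t = teval f t * teval g t.
Proof.
rewrite tevE gevM [teval f t]tevE /gev mulr_suml; apply: eq_bigr => x _.
rewrite -[RHS]mulrA; congr (_ * _); rewrite /teval mulr_sumr; apply: eq_bigr => y _.
by rewrite tcharD mulrCA.
Qed.
Lemma tevX t f n : teval (f ^+ n) t = teval f t ^+ n.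
Proof. by elim: n => [|n IH]; rewrite ?expr0 ?tev1 // !exprS tevM IH. Qed.
Lemma tev_sum t I (r : seq I) (P : pred I) (F : I -> galg) :
  teval (\sum_(i <- r | P i) F i) t = \sum_(i <- r | P i) teval (F i) t.
Proof. by rewrite tevE gev_sum. Qed.
Lemma tev_prod t I (r : seq I) (P : pred I) (F : I -> galg) :
  teval (\prod_(i <- r | P i) F i) t = \prod_(i <- r | P i) teval (F i) t.
Proof. by elim/big_rec2: _ => [|i y1 y2 _ <-]; rewrite ?tev1 ?tevM. Qed.

Lemma W0_invP f : (forall w, W0 w -> gpush w f = f) -> W0_inv f.
Proof.
move=> fi w x ww; rewrite -{1}(fi w ww).
by rewrite (gpush_coef _ _ (W0_winvK ww) (W0_winvKr ww)) W0_winvK.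
Qed.
Lemma inv1 : W0_inv (1 : galg).
Proof. by apply: W0_invP => w ww; rewrite gpush1 // W0_0. Qed.
Lemma inv_mono (c : R[i]) : W0_inv (mono c 0).
Proof. by apply: W0_invP => w ww; rewrite gpush_mono W0_0. Qed.
Lemma invM f g : W0_inv f -> W0_inv g -> W0_inv (f * g).
Proof.
move=> fi gi; apply: W0_invP => w ww.
by rewrite (gpushM f g (W0D ww)) (W0_inv_push ww fi) (W0_inv_push ww gi).
Qed.
Lemma invD f g : W0_inv f -> W0_inv g -> W0_inv (f + g).
Proof. by move=> fi gi w x ww; rewrite !galgD fi // gi. Qed.
Lemma invN f : W0_inv f -> W0_inv (- f).
Proof. by move=> fi w x ww; rewrite !galgN fi. Qed.
Lemma invX f n : W0_inv f -> W0_inv (f ^+ n).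
Proof. by move=> fi; elim: n => [|n IH]; [exact: inv1|rewrite exprS; exact: invM]. Qed.
Lemma inv_sum I (r : seq I) (P : pred I) (F : I -> galg) :
  (forall i, P i -> W0_inv (F i)) -> W0_inv (\sum_(i <- r | P i) F i).
Proof.
move=> Fi; elim/big_rec: _ => [w x _|i f Pi fi]; first by rewrite !galg0.
exact: invD (Fi i Pi) fi.
Qed.
Lemma cinTh_pow f n : cin A (Th f) ^+ n = cin A (Th (f ^+ n)).
Proof. by rewrite ThX rmorphXn. Qed.

Lemma cin_scale (c : R[i]) f : cin A (Th (mono c 0 * f)) = c *: cin A (Th f).
Proof. by rewrite ThM Th_C -scalerAl mul1r linearZ. Qed.

Lemma neumann_Th f c (lam : R[i]) : opnorm_le (cact (cin A (Th f))) c -> c < nm lam ->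
  exists b, b * (1 - cin A (Th (mono lam^-1 0 * f))) = 1 /\
  forall e, 0 < e -> exists N, forall n, (N <= n)%N ->
    opnorm_le (cact (cin A (Th (\sum_(i < n) (mono lam^-1 0 * f) ^+ i)) - b)) e.
Proof.
move=> hc cl; have c0 := op_ge0 hc; have l0 : 0 < nm lam by apply: le_lt_trans cl.
have h1 : nm lam^-1 * c < 1 by rewrite nmV mulrC ltr_pdivrMr // mul1r.
have h2 := opZ lam^-1 hc; rewrite -cin_scale in h2.
have [b [b1 b2]] := neumann h1 h2; exists b; split => // e /b2[N NP]; exists N => n /NP.
congr (opnorm_le (cact (_ - b)) e).
have -> : Th (\sum_(i < n) (mono lam^-1 0 * f) ^+ i) = \sum_(i < n) Th ((mono lam^-1 0 * f) ^+ i) by exact: gev_sum.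
rewrite [RHS](rmorph_sum (cin A)).
by apply: eq_bigr => i _; rewrite cinTh_pow.
Qed.

(** If a character exceeded the norm at [f], then [1 - f / f(t)] would lie in its kernel and yet be
    invertible within the closure of the centre, by a Neumann series. *)
Lemma center_Kpt t : center_spectrum A t -> Kpt t.
Proof.
move=> [ph [[p1 pL pM] pE]] f c fi hc; rewrite leNgt; apply/negP => cl.
have l0 : teval f t != 0 by rewrite -nm_gt0; apply: le_lt_trans cl; exact: op_ge0 hc.
have [b [b1 b2]] := neumann_Th hc cl; set g := mono _ 0 * f in b1 b2.
have gi : W0_inv g by apply: invM => //; exact: inv_mono.
have cb : @center_closure _ _ _ _ _ A b.
  move=> e e0; have [N NP] := b2 e e0; exists (\sum_(i < N) g ^+ i).
    by apply: inv_sum => i _; apply: invX.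
  by rewrite -opprB; apply: opN; apply: NP.
have E1 : 1 - cin A (Th g) = cin A (Th (1 - g)) by rewrite ThB Th1 rmorphB rmorph1.
have i1 : W0_inv (1 - g) by apply: invD; [exact: inv1|exact: invN].
have c1 : @center_closure _ _ _ _ _ A (cin A (Th (1 - g))).
  move=> e e0; exists (1 - g) => //; rewrite subrr; apply: op_le op0; exact: ltW.
have := pM _ _ cb c1; rewrite -E1 b1 p1 E1 pE // tevB tev1 tevM tev_mono tchar0 mulr1 mulVf // subrr mulr0.
by move=> /eqP; rewrite oner_eq0.
Qed.

Lemma lattice_gen : exists (n : nat) (e : 'I_n -> X),
    forall x, exists! c : {ffun 'I_n -> int}, x = \sum_i e i *~ c i.
Proof. by case: (D) => *. Qed.

Lemma lattice_ind (P : X -> Prop) n (e : 'I_n -> X) :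
  (forall x, exists! c : {ffun 'I_n -> int}, x = \sum_i e i *~ c i) ->
  P 0 -> (forall x y, P x -> P y -> P (x + y)) -> (forall i, P (e i)) -> (forall i, P (- e i)) ->
  forall x, P x.
Proof.
move=> eP P0 PD Pe PN x; have [c [-> _]] := eP x.
elim/big_rec: _ => // i y _ Py; apply: (PD _ _ _ Py).
have Pn z m : P z -> P (z *+ m).
  by move=> Pz; elim: m => [|m IH]; rewrite ?mulr0n // mulrS; apply: (PD _ _ Pz).
case: (c i) => m; first exact: Pn.
by rewrite NegzE mulrNz -mulNrz -pmulrn; apply: Pn.
Qed.

Lemma trig_mulE n (M N : 'M[R[i]]_n) : is_trig_mx M -> is_trig_mx N ->
  is_trig_mx (M *m N) /\ forall i, (M *m N) i i = M i i * N i i.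
Proof.
move=> /is_trig_mxP tM /is_trig_mxP tN; split.
  apply/is_trig_mxP => i j ij; rewrite mxE big1 // => k _.
  have [ik|ki] := ltnP i k; first by rewrite tM // mul0r.
  by rewrite tN ?mulr0 //; apply: leq_ltn_trans ij.
move=> i; rewrite mxE (bigD1 i) //= big1 ?addr0 // => k ki.
have [ik|ki'] := ltnP i k; first by rewrite tM // mul0r.
by rewrite tN ?mulr0 // ltn_neqAle ki' andbT.
Qed.

(** The commuting matrices of the [theta_x] are triangularised simultaneously, and the diagonal
    entries are characters of [X]. An eigenvalue larger than the norm would again contradict a
    Neumann series. *)
Lemma weights (n : nat) (rho : {lrmorphism A -> 'M[R[i]]_n.+1}) :
  exists (P : 'M[R[i]]_n.+1) (tt : 'I_n.+1 -> torus R D), [/\ P \in unitmx,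
    forall f, is_trig_mx (P *m rho (cin A (Th f)) *m invmx P),
    forall f i, (P *m rho (cin A (Th f)) *m invmx P) i i = teval f (tt i) &
    forall f i c, opnorm_le (cact (cin A (Th f))) c -> nm (teval f (tt i)) <= c].
Proof.
have [m [e eP]] := lattice_gen; pose M x := rho (cin A (th x)).
have MD x y : M (x + y) = M x *m M y by rewrite /M thD !rmorphM.
have M0 : M 0 = 1%:M by rewrite /M th0 !rmorph1.
pose As := [seq M (e i) | i <- enum 'I_m] ++ [seq M (- e i) | i <- enum 'I_m].
have Asx B : B \in As -> exists x, B = M x.
  by rewrite mem_cat => /orP[]/mapP[i _ ->]; [exists (e i)|exists (- e i)].
have [] := @cotrigonalization _ _ As.
  by move=> B C /Asx[x ->] /Asx[y ->]; rewrite /comm_mx -!MD addrC.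
move=> P PU /allP PT; have Pu := unitarymx_unit PU.
pose N x := P *m M x *m invmx P.
have ND x y : N (x + y) = N x *m N y.
  by rewrite /N MD !mulmxA mulmxKV.
have N0 : N 0 = 1%:M by rewrite /N M0 mulmx1 mulmxV.
have NT x : is_trig_mx (N x).
  have inAs B : B \in As -> is_trig_mx (P *m B *m invmx P).
    by move=> /PT /=; rewrite /similar_to /conjmx pinvmxE.
  apply: (lattice_ind (P := fun x => is_trig_mx (N x)) eP) => [|y z ty tz|i|i].
  - by rewrite N0; apply/is_trig_mxP => i j ij; rewrite mxE; case: eqP ij => // ->; rewrite ltnn.
  - by rewrite ND; have [] := trig_mulE ty tz.
  - by apply: inAs; rewrite mem_cat; apply/orP; left; apply/mapP; exists i; rewrite ?mem_enum.
  - by apply: inAs; rewrite mem_cat; apply/orP; right; apply/mapP; exists i; rewrite ?mem_enum.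
have t0 i : N 0 i i = 1 by rewrite N0 mxE eqxx.
have tD i x y : N (x + y) i i = N x i i * N y i i.
  by rewrite ND; have [_ ->] := trig_mulE (NT x) (NT y).
pose tt i := @TorusPoint R D (fun x => N x i i) (t0 i) (tD i).
have NE f : P *m rho (cin A (Th f)) *m invmx P = \sum_(x <- finsupp f) f x *: N x.
  rewrite /Submission.Th /gev !linear_sum /= mulmx_suml; apply: eq_bigr => x _.
  by rewrite !linearZ /= -scalemxAl.
have trigf f : is_trig_mx (P *m rho (cin A (Th f)) *m invmx P).
  rewrite NE; apply/is_trig_mxP => i j ij; rewrite summxE big1 // => x _.
  by rewrite mxE; have /is_trig_mxP-> := NT x; rewrite ?mulr0.
have diagf f i : (P *m rho (cin A (Th f)) *m invmx P) i i = teval f (tt i).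
  by rewrite NE summxE; apply: eq_bigr => x _; rewrite mxE.
exists P, tt; split => // f i c hc; rewrite leNgt; apply/negP => cl.
have l0 : teval f (tt i) != 0 by rewrite -nm_gt0; apply: le_lt_trans cl; exact: op_ge0 hc.
have [b [b1 _]] := neumann_Th hc cl; set g := mono _ 0 * f in b1.
have E1 : 1 - cin A (Th g) = cin A (Th (1 - g)) by rewrite ThB Th1 rmorphB rmorph1.
have := congr1 rho b1; rewrite E1 rmorphM rmorph1 => /(congr1 (@determinant _ n.+1)).
have dE : \det (rho (cin A (Th (1 - g)))) = 0.
  have -> : \det (rho (cin A (Th (1 - g)))) = \det (P *m rho (cin A (Th (1 - g))) *m invmx P).
    by rewrite !det_mulmx mulrC mulrA -det_mulmx mulVmx // det1 mul1r.
  rewrite det_trig //; apply/eqP; rewrite (bigD1 i) //= mulf_eq0 diagf.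
  by rewrite tevB tev1 tevM tev_mono tchar0 mulr1 mulVf // subrr eqxx.
by rewrite det_mulmx dE mulr0 det1 => /esym/eqP; rewrite oner_eq0.
Qed.

End Operators.

(** * Points of the spectrum of the centre *)

Section KPoints.
Variables (R : realType) (D : rootDatum) (L : labels R D) (H : heckeAlgebra L).
Variables (V : hilbertCompletion H) (A : cstarCompletion V).
Hypothesis w0_ex : exists w0, @longest D w0.
Local Notation X := (latX D).
Local Notation th := (htheta H).
Local Notation Th := (@Th R D L H).
Local Notation galg := (galg R[i] X).
Local Notation mono := (@gmono R[i] X).
Local Notation Kpt := (@Kpt R D L H V A).
Local Notation torus := (torus R D).
Local Notation "x %:CC" := (x%:C%C : R[i]) (at level 2, format "x %:CC").
Implicit Types (c d e : R) (f g : galg) (t s : torus) (w v : X -> X) (x y z : X).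

Lemma torus_ext t s : (forall x, t x = s x) -> t = s.
Proof.
case: t s => [f f0 fD] [g g0 gD] /= E; have {}E : f = g by apply/funext.
by case: _ / E g0 gD => g0 gD; congr TorusPoint; apply: Prop_irrelevance.
Qed.

(** Pullback along [w], made total in [w] by the value [t] outside W_0. *)
Definition tact w t : torus :=
  if pselect (W0 w) is left ww then
    @TorusPoint R D (fun x => t (w x)) (etrans (congr1 t (W0_0 ww)) (tchar0 t))
      (fun x y => etrans (congr1 t (W0D ww x y)) (tcharD t (w x) (w y)))
  else t.
Lemma tactE w t x : W0 w -> tact w t x = t (w x).
Proof. by rewrite /tact; case: pselect. Qed.

Lemma tdag0 t : (t (- 0))^* = 1. Proof. by rewrite oppr0 tchar0 conjC1. Qed.
Lemma tdagD t x y : (t (- (x + y)))^* = (t (- x))^* * (t (- y))^*.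
Proof. by rewrite opprD tcharD rmorphM. Qed.
(** The Hermitian dual of [t], i.e. the inverse of its complex conjugate. *)
Definition tdag t : torus := TorusPoint (tdag0 t) (tdagD t).
Lemma tdagE t x : tdag t x = (t (- x))^*. Proof. by []. Qed.

Lemma tN t x : t x * t (- x) = 1. Proof. by rewrite -tcharD subrr tchar0. Qed.
Lemma t_neq0 t x : t x != 0.
Proof. by apply/eqP => t0; have := tN t x; rewrite t0 mul0r => /esym/eqP; rewrite oner_eq0. Qed.
Lemma tev_push t w f : W0 w -> teval (gpush w f) t = teval f (tact w t).
Proof. by move=> ww; rewrite tevE gev_push; apply: eq_bigr => x _; rewrite /= tactE. Qed.

Lemma tev_inv t w f : W0 w -> W0_inv f -> teval f (tact w t) = teval f t.
Proof. by move=> ww fi; rewrite -tev_push // W0_inv_push. Qed.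

Lemma galgZ (c : R[i]) f x : (mono c 0 * f) x = c * f x.
Proof.
rewrite galg_coef gevM gev_mono; congr (_ * _).
by rewrite [RHS]galg_coef; apply: (@eq_gev _ _ R[i]^o) => y; rewrite add0r.
Qed.

Lemma tev_gstar t f : teval (gstar f) t = (teval f (tdag t))^*.
Proof.
rewrite tevE /gstar gev_sum /teval rmorph_sum /=; apply: eq_bigr => x _.
by rewrite gev_mono rmorphM /= conjCK.
Qed.

Definition W0s : seq (X -> X) := fset_set [set w | @W0 D w].
Lemma mem_W0s w : (w \in W0s) <-> W0 w.
Proof. by rewrite /W0s in_fset_set; [split => [/set_mem//|/mem_set//]|exact: W0_finite]. Qed.
Lemma uniq_W0s : uniq W0s. Proof. exact: fset_uniq. Qed.

Lemma W0s_perm w : W0 w -> perm_eq [seq w \o v | v <- W0s] W0s.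
Proof.
move=> ww; apply: perm_map_stable; first exact: uniq_W0s.
  move=> u v E; apply/funext => x; apply: (W0_inj ww); exact: (congr1 (@^~ x) E).
by move=> v /mem_W0s vv; apply/mem_W0s; exact: W0_comp.
Qed.

Lemma inv_prodW (F : (X -> X) -> galg) : (forall w v, W0 w -> W0 v -> gpush w (F v) = F (w \o v)) ->
  W0_inv (\prod_(v <- W0s) F v).
Proof.
move=> FE; apply: W0_invP => w ww; rewrite (gpush_prod (W0D ww) (W0_0 ww)).
rewrite -[RHS](perm_big _ (W0s_perm ww)) big_map !big_seq.
by apply: eq_bigr => v /mem_W0s vv; apply: FE.
Qed.

(** If [s] is not in the orbit of [t], some [f] vanishes on that finite orbit but not at [s]. The
    invariant product of the [1 - v f / f(s)] then takes the value 0 at [s] and 1 at [t]. *)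
Lemma separation t s : (forall f, W0_inv f -> teval f s = teval f t) ->
  exists2 w, W0 w & s = tact w t.
Proof.
move=> E; apply: contrapT => N.
have ne w : exists x, W0 w -> s x != t (w x).
  have [ww|nw] := pselect (W0 w); last by exists 0.
  apply: contrapT => N2; apply: N; exists w => //; apply: torus_ext => x.
  rewrite tactE //; apply/eqP; apply: contrapT => /negP ne; apply: N2; exists x => //.
have [xw xwP] := choice ne.
pose f := \prod_(w <- W0s) (mono 1 (xw w) - mono (t (w (xw w))) 0).
have f0 w : W0 w -> teval f (tact w t) = 0.
  move=> ww; rewrite /f tev_prod; apply/eqP; rewrite prodf_seq_eq0; apply/hasP; exists w.
    exact/mem_W0s.
  by rewrite tevB !tev_mono tchar0 mul1r mulr1 tactE // subrr eqxx.
have fs : teval f s != 0.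
  rewrite /f tev_prod prodf_seq_neq0; apply/allP => w /mem_W0s ww.
  by rewrite tevB !tev_mono tchar0 mul1r mulr1 subr_eq0 xwP.
pose c := (teval f s)^-1.
pose y := \prod_(v <- W0s) (1 - mono c 0 * gpush v f).
have yi : W0_inv y.
  apply: inv_prodW => w v ww vv.
  by rewrite (gpushB w) (gpush1 _ (W0_0 ww)) (gpushM _ _ (W0D ww)) gpush_mono (W0_0 ww) gpush_comp.
have ys : teval y s = 0.
  rewrite /y tev_prod; apply/eqP; rewrite prodf_seq_eq0; apply/hasP; exists id.
    by apply/mem_W0s; exact: W0_id.
  by rewrite gpush_id tevB tev1 tevM tev_mono tchar0 mulr1 /c mulVf // subrr eqxx.
have := E y yi; rewrite ys /y tev_prod big_seq big1 => [/eqP|w /mem_W0s ww].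
  by rewrite eq_sym oner_eq0.
by rewrite tevB tev1 tevM tev_push // f0 // mulr0 subr0.
Qed.

(** The argument of Arens: for self-adjoint [f], the squared norm of [f + i b] is at most the
    squared norm of [f] plus [b^2]. A nonzero imaginary part of [f(t)] violates this for suitable
    real [b]. *)
Lemma Kpt_real t f : Kpt t -> W0_inv f -> gstar f = f -> complex.Im (teval f t) = 0.
Proof.
move=> Kt fi fs; have [C hC] := cact_bounded (cin A (Th f)); have C0 := op_ge0 hC.
have key (b : R) : nm (teval f t + 'i * b%:CC) <= Num.sqrt (C ^+ 2 + b ^+ 2).
  pose g := f + mono ('i * b%:CC) 0.
  have gi : W0_inv g by apply: invD => //; exact: inv_mono.
  have -> : teval f t + 'i * b%:CC = teval g t by rewrite tevD tev_mono tchar0 mulr1.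
  apply: Kt => //; apply: op_dense => h.
  rewrite -(@ler_sqr R) ?nnegrE ?rn_ge0 ?mulr_ge0 ?sqrtr_ge0 ?rn_ge0 //.
  rewrite exprMn sqr_sqrtr ?addr_ge0 ?sqr_ge0 // mulrDl.
  have E : rn (cact (cin A (Th g)) (hilb_in V h)) ^+ 2 =
    rn (cact (cin A (Th f)) (hilb_in V h)) ^+ 2 + b ^+ 2 * rn (hilb_in V h) ^+ 2.
    have r2 (x y : R) : (x + b ^+ 2 * y)%:CC = x%:CC + (b ^+ 2)%:CC * y%:CC by rewrite rmorphD rmorphM.
    apply: (@complexI R); rewrite r2 !rn_sq !cact_in !inner_in !hstarM.
    have -> : hstar (Th g) = Th (gstar g) by apply: hstar_Th.
    have -> : hstar (Th f) = Th f by rewrite hstar_Th // fs.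
    have -> : Th (gstar g) = Th f - ('i * b%:CC) *: 1.
      rewrite -Th_C -ThB; congr Th; apply/fsfunP => x.
      rewrite gstarE /g !galgD galgN rmorphD /= -gstarE fs; congr (_ + _).
      rewrite !gmonoE oppr_eq0; case: eqP => _; last by rewrite conjC0 oppr0.
      rewrite rmorphM /= conjCi mulNr; congr (- (_ * _)); exact: conjc_real.
    have -> : Th g = Th f + ('i * b%:CC) *: 1 by rewrite /g ThD Th_C.
    have P : (Th f - ('i * b%:CC) *: 1) * (Th f + ('i * b%:CC) *: 1) = Th f * Th f + (b ^+ 2)%:CC *: 1.
      rewrite mulrDr !mulrBl -!scalerAl -!scalerAr !mul1r mulr1 scalerA addrA subrK -scaleNr.
      congr (_ + _ *: _); rewrite mulrACA -expr2 sqrCi mulN1r opprK -rmorphM expr2 //.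
    rewrite -!mulrA (mulrA (_ - _) (_ + _)) P mulrDl mulrDr linearD /= -scalerAl -scalerAr linearZ /= mul1r.
    by rewrite !mulrA.
  rewrite E lerD2r -exprMn ler_sqr ?nnegrE ?mulr_ge0 ?rn_ge0 //.
  by move/opP: hC; apply.
set z := teval f t in key *; apply: contrapT => /eqP z0.
(* Chosen so that twice the product of [b] with the imaginary part is [C ^+ 2 + 1], which exceeds
   the bound. *)
pose b := (C ^+ 2 + 1) / (2 * complex.Im z).
have := key b; rewrite -(@ler_sqr R) ?nnegrE ?nm_ge0 ?sqrtr_ge0 // sqr_sqrtr ?addr_ge0 ?sqr_ge0 //.
rewrite nm_ReIm.
have ib (u : R[i]) (k : R) : u + 'i * k%:CC = Complex (complex.Re u) (complex.Im u + k).
  by rewrite -complexiE; case: u => p q; apply/eqP; rewrite eq_complex /= !(mul0r, mulr0, mul1r, subr0, addr0, add0r) !eqxx.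
rewrite ib /=.
move=> h1; have : complex.Im z ^+ 2 + 2 * complex.Im z * b <= C ^+ 2.
  by move: h1 (sqr_ge0 (complex.Re z)); rewrite sqrrD mulr2n; nra.
rewrite /b mulrC divfK ?mulf_neq0 ?pnatr_eq0 // => h2.
by have := sqr_ge0 (complex.Im z); move: h2; lra.
Qed.

Lemma Kpt_herm t f : Kpt t -> W0_inv f -> teval f (tdag t) = teval f t.
Proof.
move=> Kt; have sa g : W0_inv g -> gstar g = g -> teval g (tdag t) = teval g t.
  move=> gi gs; have := tev_gstar t g; rewrite gs => E.
  have := Kpt_real Kt gi gs => im; rewrite -[LHS]conjCK -E.
  by rewrite (_ : teval g t = (complex.Re (teval g t))%:CC); [exact: conjc_real|case: (teval g t) im => p q /= ->].
move=> fi; have fsi := gstar_inv fi.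
have gsK : gstar (gstar f) = f by apply/fsfunP => x; rewrite !gstarE opprK conjCK.
have gsD g g' : gstar (g + g') = gstar g + gstar g'.
  by apply/fsfunP => x; rewrite !(gstarE, galgD) rmorphD.
have gsN g : gstar (- g) = - gstar g.
  by apply/fsfunP => x; rewrite !(gstarE, galgN) rmorphN.
have gsZ (c : R[i]) g : gstar (mono c 0 * g) = mono c^* 0 * gstar g.
  by apply/fsfunP => x; rewrite !(gstarE, galgZ) rmorphM.
have E1 : teval (f + gstar f) (tdag t) = teval (f + gstar f) t.
  by apply: sa; [exact: invD|rewrite gsD gsK addrC].
have E2 : teval (mono 'i 0 * (f - gstar f)) (tdag t) = teval (mono 'i 0 * (f - gstar f)) t.
  apply: sa; first by apply: invM; [exact: inv_mono|apply: invD => //; exact: invN].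
  rewrite gsZ gsD gsN gsK conjCi; apply/fsfunP => x; rewrite !galgZ !galgD !galgN; ring.
have {}E2 : teval (f - gstar f) (tdag t) = teval (f - gstar f) t.
  by move: E2; rewrite !tevM !tev_mono !tchar0 => /mulfI; apply; rewrite mulr1 neq0Ci.
have := congr2 (fun a b => a + b) E1 E2; rewrite -!tevD addrACA subrr addr0 !tevD -!mulr2n.
by move/eqP; rewrite eqrMn2r // => /eqP.
Qed.

Lemma Kpt_dag t : Kpt t -> exists2 w, W0 w & tdag t = tact w t.
Proof. by move=> Kt; apply: separation => f fi; apply: Kpt_herm. Qed.

Lemma prod_close (I : eqType) (r : seq I) (eta : R) : 0 < eta -> exists2 e, 0 < e &
  forall F : I -> A, (forall i, i \in r -> opnorm_le (cact (F i - 1)) e) ->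
    opnorm_le (cact (\prod_(i <- r) F i - 1)) eta.
Proof.
elim: r eta => [|i r IH] eta eta0.
  by exists 1 => // F _; rewrite big_nil subrr; apply: op_le (op0 A); exact: ltW.
have m0 : 0 < Num.min (eta / 2) 1 by rewrite lt_min ltr01 divr_gt0.
have [e e0 eP] := IH _ m0; exists (Num.min e (eta / 4)); first by rewrite lt_min e0 divr_gt0.
move=> F hF; rewrite big_cons; set b := \prod_(j <- r) F j.
have hb : opnorm_le (cact (b - 1)) (Num.min (eta / 2) 1).
  apply: eP => j jr; have := hF j; rewrite inE jr orbT => /(_ isT); apply: op_le.
  by rewrite ge_min lexx.
have hi := hF i; rewrite inE eqxx in hi; have {}hi := hi isT.
have -> : F i * b - 1 = (F i - 1) * b + (b - 1) by rewrite mulrBl mul1r addrA subrK.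
apply: (@op_le _ _ _ _ _ A _ (eta / 4 * (1 + 1) + eta / 2)).
  by rewrite -[leRHS](@mulfVK _ 2) ?pnatr_eq0 //; lra.
apply: opD; last by apply: op_le hb; rewrite ge_min lexx.
apply: opM; first by apply: op_le hi; rewrite ge_min lexx orbT.
rewrite -(subrK 1 b) addrC; apply: opD; first exact: op1.
by apply: op_le hb; rewrite ge_min lexx orbT.
Qed.

(** A point of [Kpt] is controlled only through invariant elements. If |t(x)| exceeded the norms of
    all [theta_(w x)], the invariant product of the [1 - (theta_(w x) / t(x))^N] would be close to 1
    in norm for large [N], and yet vanish at [t]. *)
Lemma Kpt_bounded x : exists B, forall t, Kpt t -> nm (t x) <= B.
Proof.
have bx y : exists C, opnorm_le (cact (cin A (th y))) C by exact: cact_bounded.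
have [C CP] := choice bx; pose B := 1 + \sum_(w <- W0s) C (w x).
have C0 y : 0 <= C y := op_ge0 (CP y).
have B0 : 0 < B by rewrite ltr_pwDl // sumr_ge0.
have CB w : w \in W0s -> C (w x) <= B.
  move=> ww; rewrite /B (big_rem w) //= addrCA lerDl addr_ge0 // sumr_ge0 //.
exists B => t Kt; rewrite leNgt; apply/negP => Bl; set lam := t x in Bl.
have l0 : 0 < nm lam by apply: lt_trans Bl.
have r1 : B / nm lam < 1 by rewrite ltr_pdivrMr // mul1r.
have r0 : 0 <= B / nm lam by rewrite divr_ge0 // ltW.
have h2 : 0 < 2^-1 :> R by rewrite invr_gt0.
have [e e0 eP] := prod_close W0s h2.
have [N NP] := exp_small r0 r1 e0; have {}NP := NP N (leqnn N).
pose F w := 1 - mono (lam^-1 ^+ N) (w (x *+ N)).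
pose y := \prod_(w <- W0s) F w.
have yi : W0_inv y.
  apply: inv_prodW => w v ww vv; by rewrite /F (gpushB w) (gpush1 _ (W0_0 ww)) gpush_mono.
have yt : teval y t = 0.
  rewrite /y tev_prod; apply/eqP; rewrite prodf_seq_eq0; apply/hasP; exists id.
    by apply/mem_W0s; exact: W0_id.
  have tX m : t (x *+ m) = lam ^+ m.
    by elim: m => [|m IH]; rewrite ?mulr0n ?tchar0 // mulrS exprS tcharD IH.
  rewrite /= tevB tev1 tev_mono tX -exprMn mulVf ?expr1n ?subrr ?eqxx //.
  by rewrite -nm_gt0.
have hy : opnorm_le (cact (cin A (Th (y - 1)))) 2^-1.
  rewrite ThB Th1 rmorphB rmorph1.
  rewrite [X in cact (X - 1)](_ : _ = \prod_(w <- W0s) cin A (Th (F w))); last first.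
    by rewrite /y; elim/big_rec2: _ => [|w y1 y2 _ <-]; rewrite ?Th1 ?rmorph1 // ThM rmorphM.
  apply: eP => w ww; rewrite /F ThB Th1 rmorphB rmorph1 addrAC subrr sub0r /=.
  rewrite (_ : cin A (Th _) = lam^-1 ^+ N *: cin A (th (w (x *+ N)))); last first.
    by rewrite Th_mono linearZ.
  apply: opN.
  have -> : th (w (x *+ N)) = th (w x) ^+ N.
    rewrite W0Mn; last exact/mem_W0s.
    by elim: (N) => [|m IH]; rewrite ?mulr0n ?th0 // mulrS exprS thD IH.
  rewrite rmorphXn; apply: op_le (opZ _ (opX N (CP (w x)))).
  rewrite nmX nmV -exprMn; apply: le_trans (ltW NP).
  rewrite lerXn2r ?nnegrE // ?mulr_ge0 ?invr_ge0 ?nm_ge0 //.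
  by rewrite mulrC ler_wpM2r ?invr_ge0 ?nm_ge0 // CB.
have y1i : W0_inv (y - 1) by apply: invD => //; apply: invN; exact: inv1.
have := Kt _ _ y1i hy; rewrite tevB tev1 yt sub0r nmN nm1.
by lra.
Qed.

(** * Compactness *)

Local Close Scope fset_scope.

Lemma disc_compact (B : R) : exists S : set (R[i]^o), compact S /\ forall z : R[i], nm z <= B -> S z.
Proof.
pose sq := [set x : R | - B <= x <= B].
have sqE : sq = `[(- B), B]%classic by apply/seteqP; split => x; rewrite /sq /= in_itv.
pose F (p : R * R) : R[i]^o := Complex p.1 p.2.
exists (F @` (sq `*` sq)); split; last first.
  move=> z zB; exists (complex.Re z, complex.Im z); last by case: z {zB}.
  split; rewrite /sq /= -ler_norml; apply: le_trans zB; [exact: ler_Re|exact: ler_Im].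
apply: continuous_compact; last first.
  by apply: compact_setX; rewrite sqE; exact: segment_compact.
apply: continuous_subspaceT => -[a b].
apply/cvgrPdist_lt => e e0.
have [r er] : exists r : R, e = r%:CC.
  by have /complex_realP[k ->] : e \is Num.real := gtr0_real e0; exists k.
have r0 : 0 < r by move: e0; rewrite er (_ : 0 = 0%:CC) ?ltcR // rmorph0.
have r2 : 0 < r / 2 by rewrite divr_gt0.
exists (ball a (r / 2), ball b (r / 2)); first by split; apply: nbhsx_ballx.
move=> [p q] [/= pa qb]; rewrite er nmE ltcR.
have -> : F (a, b) - F (p, q) = Complex (a - p) (b - q) by [].
have -> : Complex (a - p) (b - q) = (a - p)%:CC + 'i * (b - q)%:CC.
  by rewrite -complexiE; apply/eqP; rewrite eq_complex /= !(mul0r, mulr0, mul1r, subr0, addr0, add0r) !eqxx.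
apply: le_lt_trans (nmD _ _) _; rewrite nmM !nm_real.
have -> : nm ('i : R[i]) = 1 by apply: (@complexI R); rewrite -nmE normCi.
rewrite mul1r [ltRHS]splitr; apply: ltrD.
  by move: pa; rewrite -ball_normE.
by move: qb; rewrite -ball_normE.
Qed.

(** Each of the conditions that define a point of [Kpt] involves finitely many coordinates, so they
    pass to pointwise limits. *)
Lemma approx_Kpt (p : X -> R[i]) :
  (forall (F : {fset X}) e, 0 < e -> exists2 t, Kpt t & forall x, x \in F -> nm (t x - p x) < e) ->
  exists2 t, Kpt t & forall x, t x = p x.
Proof.
move=> ap; have small (z : R[i]) : (forall e, 0 < e -> nm z <= e) -> z = 0.
  move=> h; apply/eqP; rewrite -nm_eq0 eq_le nm_ge0 andbT; apply/ler_addgt0Pr => e e0.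
  by rewrite add0r h.
have p0 : p 0 = 1.
  apply/eqP; rewrite eq_sym -subr_eq0; apply/eqP; apply: small => e e0.
  have [t _ tP] := ap [fset 0]%fset e e0; have := tP 0; rewrite inE eqxx tchar0 => /(_ isT) /ltW //.
have pD x y : p (x + y) = p x * p y.
  apply/eqP; rewrite -subr_eq0; apply/eqP; apply: small => e e0.
  pose M := nm (p x) + nm (p y) + 3; have M0 : 0 < M.
    by rewrite ltr_wpDl // addr_ge0 ?nm_ge0.
  pose d := Num.min 1 (e / M); have d0 : 0 < d by rewrite lt_min ltr01 divr_gt0.
  have [t _ tP] := ap [fset (x + y)%R; x; y]%fset d d0.
  have h1 := tP (x + y); have h2 := tP x; have h3 := tP y.
  rewrite !inE !eqxx ?orbT in h1 h2 h3.
  have {}h1 := h1 isT; have {}h2 := h2 isT; have {}h3 := h3 isT.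
  rewrite tcharD in h1.
  have -> : p (x + y) - p x * p y = - (t x * t y - p (x + y)) + (t x - p x) * (t y - p y) + (t x - p x) * p y + p x * (t y - p y).
    by ring.
  have dM : d * M <= e by rewrite -ler_pdivlMr // ge_min lexx orbT.
  have d1 : d <= 1 by rewrite ge_min lexx.
  apply: le_trans (nmD _ _) _; apply: le_trans (lerD (nmD _ _) (lexx _)) _.
  apply: le_trans (lerD (lerD (nmD _ _) (lexx _)) (lexx _)) _.
  rewrite nmN !nmM; have := nm_ge0 (p x); have := nm_ge0 (p y); have := nm_ge0 (t x - p x); have := nm_ge0 (t y - p y).
  by move: h1 h2 h3 dM; rewrite /M; nra.
exists (TorusPoint p0 pD) => // f c fi hc.
apply/ler_addgt0Pr => e e0.
pose M := 1 + \sum_(x <- finsupp f) nm (f x).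
have M0 : 0 < M by rewrite ltr_pwDl // sumr_ge0 // => x _; exact: nm_ge0.
have [t Kt tP] := ap (finsupp f) (e / M) (divr_gt0 e0 M0).
have := Kt f c fi hc; rewrite /teval /= => h1.
have -> : \sum_(x <- finsupp f) f x * p x = \sum_(x <- finsupp f) f x * t x - \sum_(x <- finsupp f) f x * (t x - p x).
  by rewrite -sumrB; apply: eq_bigr => x _; ring.
apply: le_trans (nmB _ _) _; apply: lerD => //; apply: le_trans (nm_sum _ _ _) _.
have : \sum_(x <- finsupp f) nm (f x * (t x - p x)) <= \sum_(x <- finsupp f) nm (f x) * (e / M).
  rewrite !big_seq; apply: ler_sum => x xf; rewrite nmM ler_wpM2l ?nm_ge0 //.
  by apply: ltW; apply: tP.
move/le_trans; apply; rewrite -mulr_suml mulrCA ler_piMr ?(ltW e0) // ler_pdivrMr // mul1r.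
by rewrite /M lerDr.
Qed.

(** Compactness as an induction principle: a property inherited by subsets and finite unions that
    holds near each point holds for all of [Kpt]. If it failed, the sets whose complement in [Kpt]
    has the property would form a proper filter on a product of discs, and Tychonoff's theorem would
    give a cluster point, which lies in [Kpt]. *)
Lemma K_ind (Q : set (set torus)) :
  (forall S S', S `<=` S' -> Q S' -> Q S) -> (forall S S', Q S -> Q S' -> Q (S `|` S')) ->
  Q set0 ->
  (forall t, Kpt t -> exists (F : {fset X}) (e : R), 0 < e /\
     Q [set s | Kpt s /\ forall x, x \in F -> nm (s x - t x) < e]) ->
  Q Kpt.
Proof.
move=> Qs QU Q0 loc; apply: contrapT => nQ.
have [B BP] := choice Kpt_bounded.
have [S SP] := choice (fun x => disc_compact (B x)).
pose T := prod_topology (fun _ : X => R[i]^o).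
pose AA : set T := [set f | forall x, S x (f x)].
have cA : compact AA by apply: (@tychonoff X (fun=> R[i]^o) S) => x; have [] := SP x.
pose co (N : set T) := [set t | Kpt t /\ ~ N (tchar t)].
pose FF : set (set T) := [set N | Q (co N)].
have FFF : ProperFilter FF.
  apply: Build_ProperFilter_ex.
    move=> N QN; apply: contrapT => NE; apply: nQ; apply: Qs QN => t Kt; split => // Nt.
    by apply: NE; exists (tchar t).
  split.
  - by apply: Qs Q0 => t [_ /(_ I)].
  - move=> N N' h h'; apply: Qs (QU _ _ h h') => t [Kt nN].
    have [Nt|Nt] := pselect (N (tchar t)); [right|left] => //.
    by split => // N't; apply: nN.
  - by move=> N N' sub h; apply: Qs h => t [Kt nt]; split => // /sub.
have FA : FF AA.
  by apply: Qs Q0 => t [Kt]; apply => x; have [_] := SP x; apply; exact: BP.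
have [p [_ clp]] := cA FF FFF FA.
have nb (q : T) (F : {fset X}) e : 0 < e -> nbhs q [set f : T | forall x, x \in F -> nm (f x - q x) < e].
  move=> e0; have e0' : (0 : R[i]) < e%:CC by rewrite (_ : 0 = 0%:CC) ?ltcR // rmorph0.
  have one x : nbhs q [set f : T | nm (f x - q x) < e].
    have := @proj_continuous X (fun=> R[i]^o) x q.
    move=> /(_ [set z | nm (z - q x) < e]); apply.
    exists e%:CC => //= z; rewrite /ball_ /= distrC nmE ltcR //.
  have -> : [set f : T | forall x, x \in F -> nm (f x - q x) < e] =
      \bigcap_(x in [set` F]) [set f : T | nm (f x - q x) < e].
    by apply/seteqP; split => f h x; apply: h.
  by apply: filter_bigI => x _; exact: one.
have KF : FF [set f | exists2 t, Kpt t & f = tchar t].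
  by apply: Qs Q0 => t [Kt]; apply; exists t.
have [t Kt tE] : exists2 t, Kpt t & forall x, t x = p x.
  apply: approx_Kpt => F e e0; have [f [[t Kt ->] h]] := clp _ _ KF (nb p F e e0).
  by exists t.
have [F [e [e0 Qe]]] := loc t Kt.
have := clp (~` [set f : T | forall x, x \in F -> nm (f x - p x) < e]) _ _ (nb p F e e0).
case; last by move=> f [].
apply: Qs Qe => s [Ks /contrapT h]; split => // x xF; rewrite tE; exact: h.
Qed.

End KPoints.

Local Close Scope fset_scope.

(** * Complex sequences and dominated convergence *)

Section ComplexConvergence.
Variables (R : realType) (dd : measure_display) (T : measurableType dd).
Variable mu : {measure set T -> \bar R}.
Implicit Types (f g : T -> R[i]) (u v : nat -> R[i]) (l : R[i]) (N : set T) (e : R).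
Local Notation "x %:CC" := (x%:C%C : R[i]) (at level 2, format "x %:CC").

Definition ccvg u l := forall e, 0 < e -> exists N : nat, forall n, (N <= n)%N -> nm (u n - l) < e.

Lemma ccvg_cst l : ccvg (fun=> l) l.
Proof. by move=> e e0; exists 0%N => n _; rewrite subrr nm0. Qed.

Lemma ccvgD u v l m : ccvg u l -> ccvg v m -> ccvg (fun n => u n + v n) (l + m).
Proof.
move=> hu hv e e0; have [N1 h1] := hu _ (divr_gt0 e0 (ltr0Sn R 1)).
have [N2 h2] := hv _ (divr_gt0 e0 (ltr0Sn R 1)).
exists (maxn N1 N2) => n; rewrite geq_max => /andP[/h1 a1 /h2 a2].
rewrite opprD addrACA; apply: le_lt_trans (nmD _ _) _; lra.
Qed.

Lemma nm_small a b e : 0 <= a -> 0 < e -> b < e / (a + 1) -> 0 <= b -> a * b < e.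
Proof.
move=> a0 e0 h b0; apply: le_lt_trans (_ : (a + 1) * b < e).
  by apply: ler_wpM2r => //; rewrite lerDl.
by rewrite mulrC -ltr_pdivlMr // ltr_wpDl.
Qed.

Lemma ccvg_bounded u l : ccvg u l -> exists N : nat, forall n, (N <= n)%N -> nm (u n) <= nm l + 1.
Proof.
move=> h; have [N hN] := h 1 ltr01; exists N => n /hN a.
by have := nmD (u n - l) l; rewrite subrK; lra.
Qed.

Lemma ccvgM u v l m : ccvg u l -> ccvg v m -> ccvg (fun n => u n * v n) (l * m).
Proof.
move=> hu hv e e0; have e2 : 0 < e / 2 by rewrite divr_gt0.
have [N0 h0] := ccvg_bounded hu.
have a0 : 0 <= nm l + 1 by rewrite addr_ge0 ?nm_ge0.
have [N1 h1] := hv _ (divr_gt0 e2 (ltr_wpDl a0 ltr01)).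
have [N2 h2] := hu _ (divr_gt0 e2 (ltr_wpDl (nm_ge0 m) ltr01)).
exists (maxn N0 (maxn N1 N2)) => n; rewrite !geq_max => /and3P[/h0 b0 /h1 b1 /h2 b2].
have -> : u n * v n - l * m = u n * (v n - m) + m * (u n - l) by ring.
apply: le_lt_trans (nmD _ _) _; rewrite !nmM.
have c1 := nm_small a0 e2 b1 (nm_ge0 _); have c2 := nm_small (nm_ge0 m) e2 b2 (nm_ge0 _).
apply: le_lt_trans (_ : (nm l + 1) * nm (v n - m) + nm m * nm (u n - l) < e); last by lra.
by rewrite lerD2r; apply: ler_wpM2r => //; exact: nm_ge0.
Qed.

Lemma ccvg_sum (I : eqType) (r : seq I) (u : I -> nat -> R[i]) (l : I -> R[i]) :
  (forall i, i \in r -> ccvg (u i) (l i)) -> ccvg (fun n => \sum_(i <- r) u i n) (\sum_(i <- r) l i).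
Proof.
elim: r => [|i r IH] h; first by move=> e e0; exists 0%N => n _; rewrite !big_nil subrr nm0.
move=> e e0; have hr j : j \in r -> ccvg (u j) (l j) by move=> jr; apply: h; rewrite inE jr orbT.
have [N hN] := ccvgD (h i (mem_head _ _)) (IH hr) e0; exists N => n Nn.
by rewrite !big_cons; apply: hN.
Qed.

Lemma ccvg_uniq u l m : ccvg u l -> ccvg u m -> l = m.
Proof.
move=> hl hm; apply/eqP; rewrite -subr_eq0 -nm_eq0 eq_le nm_ge0 andbT.
rewrite leNgt; apply/negP => e0; have e2 : 0 < nm (l - m) / 2 by rewrite divr_gt0.
have [N1 h1] := hl _ e2; have [N2 h2] := hm _ e2.
have := h1 (maxn N1 N2) (leq_maxl _ _); have := h2 (maxn N1 N2) (leq_maxr _ _).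
set z := u _ => a b; have := nmD (l - z) (z - m); rewrite subrKA -(nmN (l - z)) opprB; lra.
Qed.

Lemma ccvg_le u l c : ccvg u l -> (forall n, nm (u n) <= c) -> nm l <= c.
Proof.
move=> h hc; rewrite leNgt; apply/negP => cl.
have [N hN] : exists N : nat, forall n, (N <= n)%N -> nm (u n - l) < nm l - c by apply: h; rewrite subr_gt0.
have := hN N (leqnn _); have := nmD (l - u N) (u N); rewrite subrK -(nmN (l - u N)) opprB; have := hc N; set z := u N => p q s; lra.
Qed.

Lemma ccvg_ext u v l : u =1 v -> ccvg u l -> ccvg v l.
Proof. by move=> /funext->. Qed.

Lemma ccvg_Re u l : ccvg u l -> (fun n => complex.Re (u n)) @ \oo --> complex.Re l.
Proof.
move=> h; apply/cvgrPdist_lt => e e0; have [N hN] := h e e0.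
exists N => // n /= Nn; apply: le_lt_trans (hN n Nn); rewrite distrC -raddfB; exact: ler_Re.
Qed.

Lemma ccvg_Im u l : ccvg u l -> (fun n => complex.Im (u n)) @ \oo --> complex.Im l.
Proof.
move=> h; apply/cvgrPdist_lt => e e0; have [N hN] := h e e0.
exists N => // n /= Nn; apply: le_lt_trans (hN n Nn); rewrite distrC -raddfB; exact: ler_Im.
Qed.

Lemma nm_ReIm_le l : nm l <= `|complex.Re l| + `|complex.Im l|.
Proof.
case: l => a b /=; have -> : Complex a b = a%:CC + Complex 0 1 * b%:CC.
  by apply/eqP; rewrite eq_complex /=; apply/andP; split; apply/eqP; ring.
apply: le_trans (nmD _ _) _; rewrite nmM !nm_real (_ : nm (Complex 0 1 : R[i]) = 1) ?mul1r //.
by apply/eqP; rewrite -sqrp_eq1 ?nm_ge0 // nm_ReIm /= expr0n expr1n add0r.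
Qed.

Lemma ccvg_ReIm u l : (fun n => complex.Re (u n)) @ \oo --> complex.Re l ->
  (fun n => complex.Im (u n)) @ \oo --> complex.Im l -> ccvg u l.
Proof.
move=> /cvgrPdist_lt h /cvgrPdist_lt k e e0; have e2 : 0 < e / 2 by rewrite divr_gt0.
have [N1 _ h1] := h _ e2; have [N2 _ h2] := k _ e2.
exists (maxn N1 N2) => n; rewrite geq_max => /andP[/h1 a /h2 b]; move: a b => /= a b.
apply: le_lt_trans (nm_ReIm_le _) _; rewrite !raddfB /= distrC (distrC (complex.Im _)); lra.
Qed.

Definition cmeas f := measurable_fun setT (fun x => complex.Re (f x)) /\
  measurable_fun setT (fun x => complex.Im (f x)).

Lemma cmeas_lim (u : nat -> T -> R[i]) f : (forall n, cmeas (u n)) ->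
  (forall x, ccvg (u^~ x) (f x)) -> cmeas f.
Proof.
move=> mu_ h; split.
  by apply: (@measurable_fun_cvg _ _ _ _ (fun n x => complex.Re (u n x))) => [n|x _];
    [have [] := mu_ n|exact: ccvg_Re].
by apply: (@measurable_fun_cvg _ _ _ _ (fun n x => complex.Im (u n x))) => [n|x _];
    [have [] := mu_ n|exact: ccvg_Im].
Qed.

Lemma cmeasM f g : cmeas f -> cmeas g -> cmeas (fun x => f x * g x).
Proof.
move=> [a b] [c d]; split.
  have -> : (fun x => complex.Re (f x * g x)) = (fun x => complex.Re (f x) * complex.Re (g x)) \-
      (fun x => complex.Im (f x) * complex.Im (g x)).
    by apply/funext => x /=; case: (f x) (g x) => ? ? [].
  by apply: measurable_funB; apply: measurable_funM.
have -> : (fun x => complex.Im (f x * g x)) = (fun x => complex.Re (f x) * complex.Im (g x)) \+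
      (fun x => complex.Im (f x) * complex.Re (g x)).
  by apply/funext => x /=; case: (f x) (g x) => ? ? [].
by apply: measurable_funD; apply: measurable_funM.
Qed.

Lemma cintegrable_meas f : cintegrable mu f -> cmeas f.
Proof. by move=> [/measurable_int/measurable_EFinP a /measurable_int/measurable_EFinP b]. Qed.

Variable G : T -> R.
Hypothesis intG : mu.-integrable setT (EFin \o G).

Lemma real_dct (u : nat -> T -> R) (f : T -> R) N : (forall n, measurable_fun setT (u n)) ->
  measurable_fun setT f -> mu.-negligible N ->
  (forall x, ~ N x -> u^~ x @ \oo --> f x) -> (forall x n, ~ N x -> `|u n x| <= G x) ->
  [/\ mu.-integrable setT (EFin \o f), forall n, mu.-integrable setT (EFin \o u n) &
    (fun n => \int[mu]_x u n x) @ \oo --> (\int[mu]_x f x)].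
Proof.
move=> mu_ mf nN cv bd.
have ae (P : T -> Prop) : (forall x, ~ N x -> P x) -> {ae mu, forall x, P x}.
  by move=> h; apply: negligibleS nN => x /= nP; apply: contrapT => /h.
have I1 n : mu.-integrable setT (EFin \o u n).
  have [] := @dominated_convergence _ _ _ mu setT measurableT (fun=> EFin \o u n) (EFin \o u n) (EFin \o G).
  - by move=> _; apply/measurable_EFinP.
  - by apply/measurable_EFinP.
  - by apply: ae => x _ _; exact: cvg_cst.
  - by [].
  - by apply: ae => x Nx m _; rewrite /= lee_fin; exact: bd.
  - by [].
have cvE x : ~ N x -> (fun n => (u n x)%:E) @ \oo --> (f x)%:E.
  by move=> Nx; apply/fine_cvgP; split; [exact: nearW|exact: cv].
have [If _ cvI] := @dominated_convergence _ _ _ mu setT measurableT (fun n => EFin \o u n) (EFin \o f) (EFin \o G)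
  (fun n => proj2 (measurable_EFinP _ _) (mu_ n)) (proj2 (measurable_EFinP _ _) mf)
  (ae _ (fun x Nx _ => cvE x Nx))
  intG (ae _ (fun x Nx n _ => (bd x n Nx))).
split => //; apply: fine_cvg; rewrite fineK //; exact: integrable_fin_num.
Qed.

Lemma complex_dct (u : nat -> T -> R[i]) f N : (forall n, cmeas (u n)) ->
  cmeas f -> mu.-negligible N ->
  (forall x, ~ N x -> ccvg (u^~ x) (f x)) -> (forall x n, ~ N x -> nm (u n x) <= G x) ->
  [/\ cintegrable mu f, forall n, cintegrable mu (u n) &
    ccvg (fun n => cintegral mu (u n)) (cintegral mu f)].
Proof.
move=> mu_ [mR mI] nN cv bd.
have [R1 R2 R3] := real_dct (fun n => proj1 (mu_ n)) mR nN (fun x Nx => ccvg_Re (cv x Nx))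
  (fun x n Nx => le_trans (ler_Re _) (bd x n Nx)).
have [I1 I2 I3] := real_dct (fun n => proj2 (mu_ n)) mI nN (fun x Nx => ccvg_Im (cv x Nx))
  (fun x n Nx => le_trans (ler_Im _) (bd x n Nx)).
by split; [split; [exact: R1|exact: I1]|move=> n; split; [exact: R2|exact: I2]|exact: ccvg_ReIm].
Qed.

Lemma cintegrable_bound f N : cmeas f -> mu.-negligible N -> (forall x, ~ N x -> nm (f x) <= G x) ->
  cintegrable mu f.
Proof.
by move=> mf nN h; have [] := @complex_dct (fun=> f) f N (fun=> mf) mf nN
  (fun x _ => ccvg_cst (f x)) (fun x _ Nx => h x Nx).
Qed.

Lemma cintegrableD f g : cintegrable mu f -> cintegrable mu g -> cintegrable mu (fun x => f x + g x).
Proof.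
move=> [a b] [c d]; split; under eq_fun do rewrite raddfD EFinD; exact: integrableD.
Qed.

Lemma cintegralD f g : cintegrable mu f -> cintegrable mu g ->
  cintegral mu (fun x => f x + g x) = cintegral mu f + cintegral mu g.
Proof.
move=> [a b] [c d]; apply/eqP; rewrite eq_complex /=; apply/andP; split; apply/eqP.
  by rewrite -RintegralD //; apply: eq_Rintegral => x _; rewrite raddfD.
by rewrite -RintegralD //; apply: eq_Rintegral => x _; rewrite raddfD.
Qed.

Lemma cintegrableZ l f : cintegrable mu f -> cintegrable mu (fun x => l * f x).
Proof.
move=> [a b]; split.
  have -> : (fun x => (complex.Re (l * f x))%:E) = (fun x => (complex.Re l)%:E * (complex.Re (f x))%:E +
      (- complex.Im l)%:E * (complex.Im (f x))%:E)%E.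
    by apply/funext => x; rewrite -!EFinM -EFinD; congr EFin; case: l (f x) => ? ? [? ?] /=; ring.
  by apply: integrableD => //; apply: integrableZl.
have -> : (fun x => (complex.Im (l * f x))%:E) = (fun x => (complex.Re l)%:E * (complex.Im (f x))%:E +
      (complex.Im l)%:E * (complex.Re (f x))%:E)%E.
  by apply/funext => x; rewrite -!EFinM -EFinD; congr EFin; case: l (f x) => ? ? [? ?] /=; ring.
by apply: integrableD => //; apply: integrableZl.
Qed.

Lemma cintegralZ l f : cintegrable mu f -> cintegral mu (fun x => l * f x) = l * cintegral mu f.
Proof.
move=> [a b]; have Z k h : mu.-integrable setT (EFin \o h) ->
    mu.-integrable setT (EFin \o (fun x => k * h x)).
  by move=> ih; rewrite (_ : _ \o _ = (fun x => k%:E * (h x)%:E)%E); [apply: integrableZl|apply/funext => x].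
apply/eqP; rewrite eq_complex /=; case: l => p q /=; apply/andP; split; apply/eqP.
  rewrite -!RintegralZl // -RintegralB; [|by []|exact: Z|exact: Z].
  by apply: eq_Rintegral => x _; case: (f x).
rewrite -!RintegralZl // -RintegralD; [|by []|exact: Z|exact: Z].
by apply: eq_Rintegral => x _; case: (f x).
Qed.

End ComplexConvergence.

(** * Generators of the Hecke algebra and its centre *)

Section HeckeGeneration.
Variables (R : realType) (D : rootDatum) (L : labels R D) (H : heckeAlgebra L).
Local Notation X := (latX D).
Local Notation T := (hT H).
Local Notation Ti := (Ti H).
Local Notation th := (htheta H).
Local Notation Th := (@Th R D L H).
Local Notation galg := (galg R[i] X).
Implicit Types (f : galg) (g u w : X -> X) (x y z : X).

Lemma Ti_uniq u h : W u -> T u * h = 1 -> Ti u = h.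
Proof. by move=> uW E; rewrite -[LHS]mulr1 -E mulrA TiT // mul1r. Qed.

Lemma len_add0 g (h : X -> X) : W g -> W h -> wlength g = 0%N -> wlength (g \o h) = (wlength g + wlength h)%N.
Proof.
move=> gW hW l0; apply: len_add => // a ap an; have ar := apos_root ap.
have nr : aff_root (aopp (wact h a)) by apply/aopp_root; apply/wact_root.
rewrite -wact_aopp //; last by apply/wact_root.
apply: contraTT isT => gn.
have : aopp (wact h a) \in fset_set (invs g).
  by rewrite mem_invs // an apos_aopp // wact_root.
by move/eqP: l0; rewrite wlengthE // cardfs_eq0 => /eqP ->.
Qed.

(** An element of length zero or an affine simple reflection, followed on the right by a suitable
    dominant translation, has the form [u t_(z + x)] with [u] in W_0 and [z + x] dominant.
    Additivity of lengths then expresses its basis element through W_0, dominant translations and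
    their inverses. *)
Lemma hecke_gen (P : H -> Prop) : (forall x, P (th x)) -> (forall w, W0 w -> P (T w)) ->
  (forall w, W0 w -> P (Ti w)) -> (forall h h', P h -> P h' -> P (h * h')) ->
  (forall c h, P h -> P (c *: h)) -> (forall h h', P h -> P h' -> P (h + h')) -> forall h, P h.
Proof.
move=> Pth PT PTi PM PZ PD.
have Pt x : dominant x -> P (T (transl x)).
  move=> xd; have n0 := nrm_neq0 L (W_transl x).
  have -> : T (transl x) = (nrm L (transl x))^-1 *: th x by rewrite th_dom // scalerA mulVf // scale1r.
  exact: PZ.
have Pti x : dominant x -> P (Ti (transl x)).
  move=> xd; have tW := W_transl x; rewrite (Ti_uniq (h := nrm L (transl x) *: th (- x)) tW).
    exact: PZ.
  by rewrite -scalerAr scalerAl -th_dom // -thD subrr th0.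
have Pg g u z : g = u \o transl z -> W0 u -> W g -> exists x,
    [/\ dominant x, dominant (z + x) & g \o transl x = u \o transl (z + x)].
  move=> -> uu gW; have [x [xd zxd]] := dominant_shift z; exists x; split => //.
  by rewrite -compA transl_comp.
have Ps g u z : g = u \o transl z -> W0 u -> W g ->
    (forall x, dominant x -> wlength (g \o transl x) = (wlength g + wlength (transl x))%N \/
       g \o (g \o transl x) = transl x /\ wlength (transl x) = (wlength g + wlength (g \o transl x))%N) -> P (T g).
  move=> gE uu gW lg; have [x [xd zxd E]] := Pg g u z gE uu gW.
  have uW := W0_W uu; have tW := W_transl x; have t2W := W_transl (z + x).
  have lu := len_W0_transl uu zxd.
  case: (lg x xd) => [l|[gg l]].
    have E2 : T g * T (transl x) = T u * T (transl (z + x)) by rewrite !(hT_mul H) // E.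
    rewrite -[T g]mulr1 -(TTi H tW) mulrA E2.
    by apply: (PM _ _ (PM _ _ (PT _ uu) (Pt _ zxd)) (Pti _ xd)).
  have gtW : W (g \o transl x) by apply: W_comp.
  have E2 : T (transl x) = T g * T (g \o transl x) by rewrite (hT_mul H) ?gg.
  rewrite -[T g]mulr1 -(TTi H gtW) mulrA -E2; apply: (PM _ _ (Pt _ xd)).
  by rewrite E Ti_mul //; apply: (PM _ _ (Pti _ zxd) (PTi _ uu)).
apply: hecke_ind => //; last by rewrite -(scale0r (th 0)); apply: PZ.
apply: W_simple_ind => [w wW l0|a w aS wW lw IH].
  have [u [x [uu E]]] := wW; have iu := W0_winv uu.
  apply: (Ps w u (winv u x)) => //.
    rewrite W0_transl // E; congr (transl _ \o _).
    exact/esym/(congr1 (@^~ x) (W_winvVr (W0_W uu))).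
  move=> x0 x0d; left; rewrite l0 add0n; by have := len_add0 wW (W_transl x0) l0; rewrite l0 add0n.
have sW := aff_simple_W aS; rewrite -(hT_mul H) //; last by rewrite lw wlength_simple.
apply: (PM _ _ _ IH); have ar := aff_simple_root aS.
apply: (Ps _ (srefl a.1) (a.1 *~ a.2)) => //.
- apply/funext => x; rewrite /aff_refl /aff_eval /srefl /transl /= pairingDl prMzl pairing_coroot //.
  by rewrite -addrA -mulrzBr -mulrNz; congr (_ + _ *~ _); lia.
- exact: W0_srefl.
- move=> x xd; have tW := W_transl x.
  have [l|l] := boolP (apos (wact (winv (transl x)) a)); [left|right].
    by rewrite len_simple_l // wlength_simple.
  have r1 : aff_root (wact (winv (transl x)) a) by rewrite wact_root //; apply: W_winv.
  rewrite W_simpleKl // wlength_simple //; split => //; rewrite add1n.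
  by apply: len_simple_lN => //; rewrite apos_aopp.
Qed.

Lemma Ti_inv w f : W0 w -> W0_inv f -> Ti w * Th f = Th f * Ti w.
Proof.
move=> ww fi; have wW := W0_W ww.
rewrite -[Ti w * Th f]mulr1 -(TTi H wW) -!mulrA (mulrA (Th f)) -T_inv //.
by rewrite !mulrA TiT // mul1r.
Qed.

Lemma Th_central f h : W0_inv f -> h * Th f = Th f * h.
Proof.
move=> fi; move: h; apply: hecke_gen => [x|w ww|w ww|h h' E E'|c h E|h h' E E'].
- by rewrite -[th x]scale1r -(Th_mono H 1 x) ThC.
- exact: T_inv.
- exact: Ti_inv.
- by rewrite -mulrA E' !mulrA E.
- by rewrite -scalerAl E scalerAr.
- by rewrite mulrDl mulrDr E E'.
Qed.

(** The generators preserve expansions under left multiplication, hence so does every element;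
    applied to 1, this expands the element. *)
Lemma bern_all (h : H) : bern h.
Proof.
have LBTi a : a \in simple D -> LB (Ti (srefl a)).
  move=> aS; rewrite Ts_TisE //; apply: LBZ; apply: LBD; first exact: LB_Ts.
  by apply: LBN; apply: LBZ; apply: LB1.
have LBTiw w : W0 w -> LB (Ti w).
  move: w; apply: W0_simple_ind => [w ww l0|a w aS ww _ lw IH].
    have wW := W0_W ww; have iW := W_winv wW.
    rewrite (Ti_uniq (h := T (winv w)) wW); first by apply: LB_T; apply: W0_winv.
    by rewrite (hT_mul H) ?W_winvV ?W_winvVr ?wlength_winv ?wlength_id ?l0 // T_id.
  have sw := W0_srefl (simple_root aS).
  by rewrite Ti_mul ?wlength_s ?lw //; [apply: LBM => //; apply: LBTi|exact: W0_W|exact: W0_W].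
have LBall : LB h.
  move: h; apply: hecke_gen => [x|w ww|w ww|h h' E E'|c h E|h h' E E'].
  - exact: LB_th.
  - exact: LB_T.
  - exact: LBTiw.
  - exact: LBM.
  - exact: LBZ.
  - exact: LBD.
by rewrite -[h]mulr1; apply: LBall; exact: bern1.
Qed.

End HeckeGeneration.

(** * Central characters and Schur's lemma *)

Section Weights.
Variables (R : realType) (D : rootDatum) (L : labels R D) (H : heckeAlgebra L).
Variables (V : hilbertCompletion H) (A : cstarCompletion V).
Local Notation X := (latX D).
Local Notation Th := (@Th R D L H).
Local Notation galg := (galg R[i] X).
Local Notation Kpt := (@Kpt R D L H V A).
Local Notation torus := (torus R D).
Implicit Types (f : galg) (t : torus) (p : irrep A).

Lemma cin_central f (a : A) : W0_inv f -> a * cin A (Th f) = cin A (Th f) * a.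
Proof.
move=> fi; apply/eqP; rewrite -subr_eq0; apply/eqP/op_small => e e0.
have [c hc] := cact_bounded (cin A (Th f)); have c0 := op_ge0 hc.
have d0 : 0 < e / (2 * (c + 1)) by rewrite divr_gt0 // mulr_gt0 // ltr_wpDl.
have [h hh] := cin_dense a d0.
have -> : a * cin A (Th f) - cin A (Th f) * a =
    (a - cin A h) * cin A (Th f) + - (cin A (Th f) * (a - cin A h)).
  have E : cin A h * cin A (Th f) = cin A (Th f) * cin A h by rewrite -!rmorphM (Th_central h fi).
  by rewrite mulrBl mulrBr E opprB -addrA (addrA (- (_ * _))) addNr add0r.
apply: op_le (opD (opM hh hc) (opN (opM hc hh))).
have E : e / (2 * (c + 1)) * (2 * (c + 1)) = e by rewrite divfK //; apply/eqP; lra.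
set d := e / _ in d0 E *; lra.
Qed.

Lemma schur0 p (N : 'M[R[i]]_((irrep_dim p).+1)) : (forall a, N *m p a = p a *m N) -> \det N = 0 -> N = 0.
Proof.
move=> NC; pose U := lker (linfun (mulmx N : 'cV[R[i]]_(irrep_dim p).+1 -> _)).
have UE v : (v \in U) = (N *m v == 0) by rewrite memv_ker lfunE.
have [] := irrep_irr (i := p) (U := U).
- by move=> a v; rewrite !UE mulmxA NC -mulmxA => /eqP->; rewrite mulmx0.
- move=> U0 /eqP; rewrite -det_tr => /det0P[v v0 vN].
  have : v^T \in U by rewrite UE -trmx_eq0 trmx_mul trmxK vN.
  by rewrite U0 memv0 trmx_eq0 (negPf v0).
- move=> Uf _; apply/matrixP => j k; have : delta_mx k 0 \in U by rewrite Uf memvf.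
  by rewrite UE -colE => /eqP/matrixP/(_ j 0); rewrite !mxE.
Qed.

Lemma irrep_weights p : exists s : seq torus, [/\ size s = (irrep_dim p).+1,
  forall t, t \in s -> Kpt t,
  forall f, \tr (p (cin A (Th f))) = \sum_(t <- s) teval f t &
  forall f t, t \in s -> W0_inv f -> p (cin A (Th f)) = (teval f t)%:M].
Proof.
have [P [tt [PU trig diag bd]]] := weights (irrep_rho p).
exists [seq tt i | i <- enum 'I_(irrep_dim p).+1]; split.
- by rewrite size_map size_enum_ord.
- by move=> _ /mapP[i _ ->] f c _ hc; apply: bd hc.
- move=> f; rewrite big_map big_enum /=; have := mxtrace_mulC (P *m p (cin A (Th f))) (invmx P).
  rewrite mulmxA mulVmx // mul1mx => <-.
  by apply: eq_bigr => i _; rewrite diag.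
- move=> f _ /mapP[i _ ->] fi; set M := p _; set l := teval f _.
  pose N := M - l%:M; suff N0 : N = 0 by rewrite -[M](subrK l%:M) -/N N0 add0r.
  apply: schur0 => [a|].
    rewrite mulmxBl mulmxBr scalar_mxC; congr (_ - _).
    by rewrite /M -[_ *m _]rmorphM -[p a *m _]rmorphM -cin_central.
  have -> : \det N = \det (P *m N *m invmx P).
    by rewrite !det_mulmx mulrC mulrA -det_mulmx mulVmx // det1 mul1r.
  have NE : P *m N *m invmx P = P *m p (cin A (Th (f - gmono l 0))) *m invmx P.
    by rewrite ThB Th_C rmorphB /= linearZ /= rmorph1 rmorphB /= linearZ /= rmorph1 scalemx1.
  rewrite NE det_trig //; apply/eqP; rewrite (bigD1 i) //= mulf_eq0 diag.
  by rewrite tevB tev_mono tchar0 mulr1 subrr eqxx.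
Qed.

End Weights.

(** * Elementary real limits *)

Section RealLimits.
Variable R : realType.
Implicit Types (v y e c : R).

Lemma bernoulli v n : -1 <= v -> 1 + n%:R * v <= (1 + v) ^+ n.
Proof.
move=> v1; elim: n => [|n IH]; first by rewrite mul0r addr0 expr0.
rewrite exprS; have h : 0 <= 1 + v by lra.
apply: le_trans (ler_wpM2l h IH); rewrite -natr1.
have := sqr_ge0 v; have := ler0n R n; move: (n%:R : R) => m m0 v2.
have : 0 <= m * v ^+ 2 by exact: mulr_ge0.
rewrite expr2; lra.
Qed.

Lemma pow_decay v n : 0 <= v <= 1 -> (1 - v) ^+ n * (1 + n%:R * v) <= 1.
Proof.
move=> /andP[v0 v1]; have h := @bernoulli v n (ltac:(lra)).
apply: le_trans (_ : (1 - v) ^+ n * (1 + v) ^+ n <= 1).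
  by apply: ler_wpM2l => //; apply: exprn_ge0; lra.
by rewrite -exprMn; apply: exprn_ile1; nra.
Qed.

Lemma pow_half M : (0 < M)%N -> (1 - (M%:R : R)^-1) ^+ M <= 2^-1.
Proof.
move=> M0; have m0 : (0 : R) < M%:R by rewrite ltr0n.
have m1 : (M%:R : R)^-1 <= 1 by rewrite invf_le1 // ler1n.
have := @pow_decay (M%:R^-1) M; rewrite mulfV ?gt_eqF // invr_ge0 ltW // => /(_ m1).
lra.
Qed.

Lemma n_exp_small y e : 0 <= y -> y < 1 -> 0 < e ->
  exists N : nat, forall n, (N <= n)%N -> n%:R * y ^+ n < e.
Proof.
move=> y0 y1 e0; pose s := (1 + y) / 2; have [s0 s1 ys] : [/\ 0 < s, s < 1 & y < s] by rewrite /s; split; lra.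
have ge k : k%:R * s ^+ k <= (1 - s)^-1.
  rewrite -[leRHS]mul1r ler_pdivlMr ?subr_gt0 //.
  have h := @pow_decay (1 - s) k; rewrite subKr in h.
  have /h{}h : 0 <= 1 - s <= 1 by apply/andP; split; lra.
  have : 0 <= s ^+ k by apply: exprn_ge0; lra.
  move: h; set p := s ^+ k; lra.
have c0 : 0 < (1 - s)^-1 by rewrite invr_gt0 subr_gt0.
have r1 : y / s < 1 by rewrite ltr_pdivrMr // mul1r.
have r0 : 0 <= y / s by rewrite divr_ge0 // ltW.
have [N hN] := exp_small r0 r1 (divr_gt0 e0 c0); exists N => n /hN.
rewrite ltr_pdivlMr // => h; apply: le_lt_trans h.
have sn : s != 0 by rewrite gt_eqF.
rewrite -{1}(divfK sn y) exprMn mulrCA.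
by apply: ler_wpM2l; [exact: exprn_ge0|exact: ge].
Qed.

(** Polynomials in [v] that tend to the indicator of [v < 1/m] on [0, 1]. Below [1/m] the Bernoulli
    bound [k (m v)^k] tends to 0. From [1/m] on, the base raised to [m^k] is at most 1/2, and the
    remaining exponent [k] sends it to 0. *)
Definition thr (m k : nat) (v : R[i]) : R[i] := (1 - v ^+ k) ^+ (k * m ^ k).

Lemma thrE m k v : thr m k v%:C%C = ((1 - v ^+ k) ^+ (k * m ^ k))%:C%C.
Proof. by rewrite /thr -rmorphXn -(rmorph1 (real_complex R)) -rmorphB -rmorphXn. Qed.

Lemma thr_bd m k v : 0 <= v <= 1 -> nm (thr m k v%:C%C) <= 1.
Proof.
move=> /andP[v0 v1]; rewrite thrE nm_real.
have a : 0 <= v ^+ k <= 1 by rewrite exprn_ge0 //= exprn_ile1.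
rewrite ger0_norm; first by apply: exprn_ile1; lra.
by apply: exprn_ge0; lra.
Qed.

Lemma thr_lim m v : (0 < m)%N -> 0 <= v <= 1 -> ccvg (fun k => thr m k v%:C%C) ((v < (m%:R : R)^-1)%R%:R : R[i]).
Proof.
move=> m0 /andP[v0 v1] e e0; have mp : (0 : R) < m%:R by rewrite ltr0n.
have [vm|vm] := ltP v m%:R^-1.
  have y1 : v * m%:R < 1 by rewrite -ltr_pdivlMr // mul1r.
  have [N hN] := n_exp_small (mulr_ge0 v0 (ltW mp)) y1 e0.
  exists N => k /hN; rewrite exprMn => h.
  rewrite thrE -(rmorph1 (real_complex R)) -rmorphB nm_real distrC.
  have a : 0 <= v ^+ k <= 1 by rewrite exprn_ge0 //= exprn_ile1.
  have b := @bernoulli (- v ^+ k) (k * m ^ k) (ltac:(lra)).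
  have c : (1 - v ^+ k) ^+ (k * m ^ k) <= 1 by apply: exprn_ile1; lra.
  rewrite ger0_norm; last by rewrite subr_ge0.
  move: b; rewrite natrM natrX; lra.
have h2 : (0 : R) <= 2^-1 by rewrite invr_ge0.
have h21 : (2^-1 : R) < 1 by rewrite invf_lt1 // ltr1n.
have [N hN] := exp_small h2 h21 e0.
exists N => k /hN h; rewrite subr0 thrE nm_real.
have a : 0 <= v ^+ k <= 1 by rewrite exprn_ge0 //= exprn_ile1.
have u0 : 0 <= 1 - v ^+ k by lra.
rewrite ger0_norm ?exprn_ge0 //; apply: le_lt_trans h.
rewrite mulnC exprM lerXn2r ?nnegrE ?exprn_ge0 // ?invr_ge0 //.
apply: le_trans (pow_half (_ : (0 < m ^ k)%N)); last by rewrite expn_gt0 m0.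
rewrite lerXn2r ?nnegrE //; last first.
  by rewrite lerD2l lerN2 natrX -exprVn lerXn2r // nnegrE invr_ge0 ltW.
by rewrite subr_ge0 invf_le1 ?ltr0n ?ler1n expn_gt0 m0.
Qed.

End RealLimits.

(** * Spectral integrals *)

Section SpectralIntegral.
Variables (R : realType) (D : rootDatum) (L : labels R D) (H : heckeAlgebra L).
Variables (V : hilbertCompletion H) (A : cstarCompletion V).
Hypothesis w0_ex : exists w0, @longest D w0.
Variables (p0 : irrep A) (mu : {measure set (spectrumB p0) -> \bar R}).
Hypothesis muP : is_plancherel mu.
Local Notation X := (latX D).
Local Notation Th := (@Th R D L H).
Local Notation galg := (galg R[i] X).
Local Notation mono := (@gmono R[i] X).
Local Notation Kpt := (@Kpt R D L H V A).
Local Notation torus := (torus R D).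
Local Notation "x %:CC" := (x%:C%C : R[i]) (at level 2, format "x %:CC").
Implicit Types (a b : galg) (t s : torus) (d : spectrumB p0) (f g : torus -> R[i]) (P : galg -> Prop).

Local Notation rep_of := (@rep_of R D L H V A p0).
Local Notation irrep_char := (@irrep_char R D L H V A p0).

Definition wts d : seq torus := sval (cid (irrep_weights (rep_of d))).

Lemma wts_spec d : [/\ size (wts d) = (irrep_dim (rep_of d)).+1,
  forall t, t \in wts d -> Kpt t,
  forall a, irrep_char d (cin A (Th a)) = \sum_(t <- wts d) teval a t &
  forall a t, t \in wts d -> W0_inv a -> rep_of d (cin A (Th a)) = (teval a t)%:M].
Proof. exact: (svalP (cid (irrep_weights (rep_of d)))). Qed.
Lemma wts_size d : size (wts d) = (irrep_dim (rep_of d)).+1.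
Proof. by have [] := wts_spec d. Qed.
Lemma wts_Kpt d t : t \in wts d -> Kpt t.
Proof. by have [_ + _ _] := wts_spec d; apply. Qed.
Lemma wts_char d a : irrep_char d (cin A (Th a)) = \sum_(t <- wts d) teval a t.
Proof. by have [_ _ + _] := wts_spec d; apply. Qed.
Lemma wts_scalar d a t : t \in wts d -> W0_inv a -> rep_of d (cin A (Th a)) = (teval a t)%:M.
Proof. by have [_ _ _] := wts_spec d; apply. Qed.

Definition dimf d : R := (size (wts d))%:R.
Definition Sf f d : R[i] := \sum_(t <- wts d) f t.
(** On evaluations of elements of A this is the trace ([Ispec_tev]), which it extends to more
    general functions of the weights. *)
Definition Ispec f : R[i] := cintegral mu (Sf f).

Lemma Sf_ext f g d : (forall t, Kpt t -> f t = g t) -> Sf f d = Sf g d.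
Proof. by move=> E; rewrite /Sf !big_seq; apply: eq_bigr => t /wts_Kpt/E. Qed.

Lemma Ispec_ext f g : (forall t, Kpt t -> f t = g t) -> Ispec f = Ispec g.
Proof. by move=> E; congr cintegral; apply/funext => d; apply: Sf_ext. Qed.

Lemma Sf_bound f d B : (forall t, Kpt t -> nm (f t) <= B) -> nm (Sf f d) <= B * dimf d.
Proof.
move=> h; apply: le_trans (nm_sum _ _ _) _; rewrite /dimf.
apply: le_trans (_ : \sum_(t <- wts d) B <= _).
  by rewrite !big_seq; apply: ler_sum => t /wts_Kpt/h.
by rewrite big_const_seq count_predT iter_addr_0 mulr_natr.
Qed.

(** The dimension is the character at 1, so this is the Plancherel formula for the unit. It provides
    the dominating function for all bounded integrands. *)
Lemma dimf_int : mu.-integrable setT (EFin \o dimf).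
Proof.
have [[h _] _] := muP 1; apply: eq_integrable h => // d _ /=.
by rewrite /irrep_char rmorph1 rmorph1 mxtrace1 -wts_size /dimf -(rmorph_nat (real_complex R)).
Qed.

Lemma dimf_intZ B : mu.-integrable setT (EFin \o (fun d => B * dimf d)).
Proof.
rewrite (_ : _ \o _ = (fun d => B%:E * (dimf d)%:E)%E); first exact: (integrableZl _ _ dimf_int).
by apply/funext.
Qed.

(* The closure of [P] under bounded pointwise limits on [Kpt] stands in for the bounded Borel functions: the
   spectral integral passes to these limits by dominated convergence. *)
Inductive Bor P : (torus -> R[i]) -> Prop :=
| Bor_base a f : P a -> (forall t, Kpt t -> f t = teval a t) -> Bor P f
| Bor_lim (u : nat -> torus -> R[i]) f B : (forall n, Bor P (u n)) ->
    (forall n t, Kpt t -> nm (u n t) <= B) -> (forall t, Kpt t -> ccvg (u^~ t) (f t)) -> Bor P f.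

Lemma Bor_ext P f g : (forall t, Kpt t -> f t = g t) -> Bor P f -> Bor P g.
Proof.
move=> E h; case: h E => [a f' Pa E'|u f' B hu hB hc] E.
  by apply: (Bor_base Pa) => t Kt; rewrite -E // E'.
by apply: (Bor_lim hu hB) => t Kt; rewrite -E //; exact: hc.
Qed.

Lemma Bor_mono P P' f : (forall a, P a -> P' a) -> Bor P f -> Bor P' f.
Proof.
move=> h; elim=> [a g /h Pa E|u g B _ IH hB hc]; first exact: (Bor_base Pa).
exact: (Bor_lim IH hB).
Qed.

Lemma tev_bounded a : exists B, forall t, Kpt t -> nm (teval a t) <= B.
Proof.
have [B BP] := choice (@Kpt_bounded R D L H V A).
exists (\sum_(x <- finsupp a) nm (a x) * B x) => t Kt.
apply: le_trans (nm_sum _ _ _) _; apply: ler_sum => x _; rewrite nmM.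
by apply: ler_wpM2l; [exact: nm_ge0|exact: BP].
Qed.

Lemma Bor_bounded P f : Bor P f -> exists B, forall t, Kpt t -> nm (f t) <= B.
Proof.
case=> [a g _ E|u g B _ hB hc].
  by have [B BP] := tev_bounded a; exists B => t Kt; rewrite E //; exact: BP.
by exists B => t Kt; apply: ccvg_le (hc t Kt) _ => n; exact: hB.
Qed.

Lemma Ispec_tev a : cintegrable mu (Sf (teval a)) /\ Ispec (teval a) = htau H (Th a).
Proof.
have [h1 h2] := muP (Th a).
have E : Sf (teval a) = (fun d => irrep_char d (cin A (Th a))) by apply/funext => d; rewrite wts_char.
by rewrite /Ispec E; split.
Qed.

Lemma Bor_meas P f : Bor P f -> cmeas (Sf f).
Proof.
elim=> [a g _ E|u g B _ IH hB hc].
  have [/cintegrable_meas h _] := Ispec_tev a; have -> // : Sf g = Sf (teval a).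
  by apply/funext => d; apply: Sf_ext.
apply: (cmeas_lim IH) => d e e0.
have h : ccvg (fun n => Sf (u n) d) (Sf g d) by apply: ccvg_sum => t /wts_Kpt/hc.
exact: h.
Qed.

Lemma Bor_int P f : Bor P f -> cintegrable mu (Sf f).
Proof.
move=> h; have [B BP] := Bor_bounded h.
apply: (cintegrable_bound (dimf_intZ B) (Bor_meas h) (negligible_set0 mu)) => d _; exact: Sf_bound.
Qed.

Lemma Bor_dct P (u : nat -> torus -> R[i]) f B : (forall n, Bor P (u n)) ->
  (forall n t, Kpt t -> nm (u n t) <= B) -> (forall t, Kpt t -> ccvg (u^~ t) (f t)) ->
  ccvg (fun n => Ispec (u n)) (Ispec f).
Proof.
move=> hu hB hc; have hf := Bor_lim hu hB hc.
have [|||//] := complex_dct (dimf_intZ B) (u := fun n => Sf (u n)) (f := Sf f) _ (Bor_meas hf) (negligible_set0 mu).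
- by move=> n; exact: Bor_meas (hu n).
- by move=> d _; apply: ccvg_sum => t /wts_Kpt/hc.
- by move=> d n _; apply: Sf_bound => t; exact: hB.
Qed.

Lemma Bor_D P f g : (forall a b, P a -> P b -> P (a + b)) -> Bor P f -> Bor P g -> Bor P (fun t => f t + g t).
Proof.
move=> PD bf; elim: bf g => [a {}f Pa E g bg|u {}f B hu IH hB hc g bg].
  elim: bg => [b {}g Pb E'|v {}g B hv IH hB hc].
    by apply: (Bor_base (PD _ _ Pa Pb)) => t Kt; rewrite tevD E // E'.
  have [C hC] := tev_bounded a.
  apply: (Bor_lim (B := C + B) IH) => [n t Kt|t Kt].
    by apply: le_trans (nmD _ _) _; apply: lerD; [rewrite E // hC|exact: hB].
  by apply: ccvgD; [exact: ccvg_cst|exact: hc].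
have [C hC] := Bor_bounded bg.
apply: (Bor_lim (B := B + C) (fun n => IH n _ bg)) => [n t Kt|t Kt].
  by apply: le_trans (nmD _ _) _; apply: lerD; [exact: hB|exact: hC].
by apply: ccvgD; [exact: hc|exact: ccvg_cst].
Qed.

Lemma Bor_M P f g : (forall a b, P a -> P b -> P (a * b)) -> Bor P f -> Bor P g -> Bor P (fun t => f t * g t).
Proof.
move=> PM bf; elim: bf g => [a {}f Pa E g bg|u {}f B hu IH hB hc g bg].
  elim: bg => [b {}g Pb E'|v {}g B hv IH hB hc].
    by apply: (Bor_base (PM _ _ Pa Pb)) => t Kt; rewrite tevM E // E'.
  have [C hC] := tev_bounded a.
  apply: (Bor_lim (B := C * B) IH) => [n t Kt|t Kt].
    by rewrite nmM; apply: ler_pM; rewrite ?nm_ge0 //; [rewrite E // hC|exact: hB].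
  by apply: ccvgM; [exact: ccvg_cst|exact: hc].
have [C hC] := Bor_bounded bg.
apply: (Bor_lim (B := B * C) (fun n => IH n _ bg)) => [n t Kt|t Kt].
  by rewrite nmM; apply: ler_pM; rewrite ?nm_ge0 //; [exact: hB|exact: hC].
by apply: ccvgM; [exact: hc|exact: ccvg_cst].
Qed.

Lemma IspecD P f g : Bor P f -> Bor P g -> Ispec (fun t => f t + g t) = Ispec f + Ispec g.
Proof.
move=> hf hg; rewrite /Ispec -cintegralD; [|exact: Bor_int hf|exact: Bor_int hg].
by congr cintegral; apply/funext => d; rewrite /Sf big_split.
Qed.

Lemma IspecZ P (c : R[i]) f : Bor P f -> Ispec (fun t => c * f t) = c * Ispec f.
Proof.
move=> hf; rewrite /Ispec -cintegralZ; last exact: Bor_int hf.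
by congr cintegral; apply/funext => d; rewrite /Sf mulr_sumr.
Qed.

Lemma Bor_X P f n : P 1 -> (forall a b, P a -> P b -> P (a * b)) -> Bor P f -> Bor P (fun t => f t ^+ n).
Proof.
move=> P1 PM hf; elim: n => [|n IH].
  by apply: (Bor_base P1) => t _; rewrite tev1 expr0.
by apply: Bor_ext (Bor_M PM hf IH) => t _; rewrite exprS.
Qed.

Lemma Bor_cst P (c : R[i]) : P (mono c 0) -> Bor P (fun=> c).
Proof. by move=> Pc; apply: (Bor_base Pc) => t _; rewrite tev_mono tchar0 mulr1. Qed.

Definition BorZ := Bor (@W0_inv R D).
Definition BorA := Bor (fun=> True).

Lemma BorZA f : BorZ f -> BorA f. Proof. exact: Bor_mono. Qed.
Lemma BorZ_cst c : BorZ (fun=> c). Proof. by apply: Bor_cst; exact: inv_mono. Qed.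
Lemma BorA_cst c : BorA (fun=> c). Proof. exact: Bor_cst. Qed.
Lemma BorZ_tev a : W0_inv a -> BorZ (teval a). Proof. by move=> ai; apply: (Bor_base ai). Qed.
Lemma BorA_tev a : BorA (teval a). Proof. exact: (@Bor_base (fun=> True) a). Qed.
Lemma BorZD f g : BorZ f -> BorZ g -> BorZ (fun t => f t + g t).
Proof. by apply: Bor_D => a b; exact: invD. Qed.
Lemma BorZM f g : BorZ f -> BorZ g -> BorZ (fun t => f t * g t).
Proof. by apply: Bor_M => a b; exact: invM. Qed.
Lemma BorAD f g : BorA f -> BorA g -> BorA (fun t => f t + g t). Proof. exact: Bor_D. Qed.
Lemma BorAM f g : BorA f -> BorA g -> BorA (fun t => f t * g t). Proof. exact: Bor_M. Qed.
Lemma BorZX f n : BorZ f -> BorZ (fun t => f t ^+ n).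
Proof. by apply: Bor_X; [exact: inv1|move=> a b; exact: invM]. Qed.
Lemma BorZ_C1 f : BorZ f -> BorZ (fun t => 1 - f t).
Proof.
move=> hf; apply: Bor_ext (BorZD (BorZ_cst 1) (BorZM (BorZ_cst (-1)) hf)) => t _.
by rewrite mulN1r.
Qed.

Lemma IspecB f g : BorA f -> BorA g -> Ispec (fun t => f t - g t) = Ispec f - Ispec g.
Proof.
move=> hf hg; have hN := BorAM (BorA_cst (-1)) hg.
rewrite -[RHS]/(_ + _) -mulN1r -(IspecZ _ hg) -(IspecD hf hN); apply: Ispec_ext => t _.
by rewrite mulN1r.
Qed.

(* [thr] turns a nonnegative element of the centre into a sublevel indicator. *)
Lemma BorZ_level f C m : (0 < m)%N -> 0 < C -> BorZ f ->
  (forall t, Kpt t -> exists2 v : R, f t = v%:CC & 0 <= v <= C) ->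
  BorZ (fun t => ((complex.Re (f t) < C / m%:R)%R%:R : R[i])).
Proof.
move=> m0 C0 hf fC.
have bk k : BorZ (fun t => thr m k (f t * (C^-1)%:CC)).
  apply: BorZX; apply: BorZ_C1; apply: BorZX; exact: (BorZM hf (BorZ_cst _)).
have vk t : Kpt t -> exists2 v : R, f t * (C^-1)%:CC = v%:CC & 0 <= v <= 1 /\ (complex.Re (f t) < C / m%:R) = (v < m%:R^-1).
  move=> Kt; have [v -> /andP[v0 vC]] := fC t Kt; exists (v / C); first by rewrite rmorphM.
  split; last by rewrite /= ltr_pdivrMr // mulrC.
  by apply/andP; split; [exact: divr_ge0 v0 (ltW C0)|rewrite ler_pdivrMr // mul1r].
apply: (Bor_lim (B := 1) bk) => [k t Kt|t Kt]; have [v -> [v01 E]] := vk t Kt.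
  exact: thr_bd.
by rewrite E; exact: thr_lim.
Qed.

End SpectralIntegral.

(** * Peaking elements and complex conjugation *)

Section Conjugation.
Variables (R : realType) (D : rootDatum) (L : labels R D) (H : heckeAlgebra L).
Variables (V : hilbertCompletion H) (A : cstarCompletion V).
Hypothesis w0_ex : exists w0, @longest D w0.
Local Notation X := (latX D).
Local Notation galg := (galg R[i] X).
Local Notation mono := (@gmono R[i] X).
Local Notation Kpt := (@Kpt R D L H V A).
Local Notation BorZ := (@BorZ R D L H V A).
Local Notation BorA := (@BorA R D L H V A).
Local Notation torus := (torus R D).
Local Notation "x %:CC" := (x%:C%C : R[i]) (at level 2, format "x %:CC").
Implicit Types (a b z : galg) (t s r : torus) (f g : torus -> R[i]) (e : R) (w v : X -> X) (x : X).

Definition nsq z := z * gstar z.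

Lemma nsq_inv z : W0_inv z -> W0_inv (nsq z).
Proof. by move=> zi; apply: invM => //; exact: gstar_inv. Qed.

Lemma tev_gstarK t z : Kpt t -> W0_inv z -> teval (gstar z) t = (teval z t)^*.
Proof. by move=> Kt zi; rewrite tev_gstar (Kpt_herm w0_ex Kt zi). Qed.

Lemma tev_nsq t z : Kpt t -> W0_inv z -> teval (nsq z) t = (nm (teval z t) ^+ 2)%:CC.
Proof. by move=> Kt zi; rewrite tevM tev_gstarK // nm_sq. Qed.

Lemma latX_enum : exists u : nat -> X, forall x, exists k, u k = x.
Proof.
have [n [e eP]] := lattice_gen D.
exists (fun k => \sum_i e i *~ (odflt [ffun=> 0] (choice.unpickle k : option {ffun 'I_n -> int})) i) => x.
by have [c [-> _]] := eP x; exists (choice.pickle c); rewrite choice.pickleK.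
Qed.

Definition msum x : galg := \sum_(w <- W0s D) mono 1 (w x).

Lemma msum_inv x : W0_inv (msum x).
Proof.
apply: W0_invP => v vv; rewrite /msum.
have gD : {morph @gpush R[i] X v : f f' / f + f' >-> f + f'} by move=> f f'; exact: gpushD.
rewrite (big_morph _ gD (gpush0 _ v)).
under eq_bigr => w _ do rewrite gpush_mono.
by rewrite -(big_map (fun w => v \o w) predT (fun w => mono 1 (w x))); apply: perm_big; exact: W0s_perm.
Qed.

Lemma separation_msum t s : (forall x, teval (msum x) s = teval (msum x) t) ->
  exists2 w, W0 w & s = tact w t.
Proof.
move=> h; apply: separation => f fi.
have key u : teval f u *+ size (W0s D) = \sum_(x <- finsupp f) f x * teval (msum x) u.
  transitivity (\sum_(w <- W0s D) teval f (tact w u)).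
    rewrite big_seq (eq_bigr (fun=> teval f u)) => [|w /mem_W0s ww]; last by rewrite tev_inv.
    by rewrite -big_seq big_const_seq count_predT iter_addr_0.
  rewrite /teval exchange_big /=; apply: eq_bigr => x _; rewrite -mulr_sumr; congr (_ * _).
  rewrite -/(teval (msum x) u) tev_sum big_seq [RHS]big_seq; apply: eq_bigr => w /mem_W0s ww.
  by rewrite tactE // tev_mono mul1r.
have n0 : ((size (W0s D))%:R : R[i]) != 0.
  rewrite pnatr_eq0 size_eq0; apply/eqP => E; have : id \in W0s D by apply/mem_W0s; constructor.
  by rewrite E.
apply: (mulIf n0); rewrite !mulr_natr !key; apply: eq_bigr => x _; by rewrite h.
Qed.

Lemma orbitP r t : torus_orbit r t <-> exists2 w, W0 w & t = tact w r.
Proof.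
split=> [[w ww E]|[w ww ->]]; exists w => //; last by move=> x; rewrite tactE.
by apply: torus_ext => x; rewrite tactE.
Qed.

Lemma peak r : exists z : nat -> galg, [/\ forall j, W0_inv (z j),
  forall j t, Kpt t -> exists2 u : R, teval (z j) t = u%:CC & 0 <= u <= 1,
  forall j t, torus_orbit r t -> teval (z j) t = 1 &
  forall t, Kpt t -> ~ torus_orbit r t -> ccvg (fun j => teval (z j) t) 0].
Proof.
have [u uP] := latX_enum.
pose g i := msum (u i) - mono (teval (msum (u i)) r) 0.
have gi i : W0_inv (g i).
  by apply: invD; [exact: msum_inv|apply: invN; exact: inv_mono].
have gE i t : teval (g i) t = teval (msum (u i)) t - teval (msum (u i)) r.
  by rewrite tevB tev_mono tchar0 mulr1.
pose P j := \sum_(i < j) nsq (g i).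
have Pi j : W0_inv (P j) by apply: inv_sum => i _; exact: nsq_inv.
pose p j t := \sum_(i < j) nm (teval (g i) t) ^+ 2.
have PE j t : Kpt t -> teval (P j) t = (p j t)%:CC.
  move=> Kt; rewrite tev_sum rmorph_sum; apply: eq_bigr => i _; exact: tev_nsq.
have p_ge0 j t : 0 <= p j t by apply: sumr_ge0 => i _; exact: sqr_ge0.
have [B BP] := choice (fun j => tev_bounded A (P j)).
pose C j := `|B j| + 1; have C1 j : 1 <= C j by rewrite lerDr.
have C0 j : 0 < C j by apply: lt_le_trans (C1 j).
have pC j t : Kpt t -> p j t <= C j.
  move=> Kt; apply: le_trans (_ : B j <= _); last first.
    by apply: le_trans (ler_norm _) _; rewrite lerDl.
  by have := BP j t Kt; rewrite PE // nm_real ger0_norm.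
(* At least [j C j], so that off the orbit the exponent times [P j / C j] grows like [j] and
   [pow_decay] forces the power to 0. *)
pose N j := (j * (Num.truncn (C j)).+1)%N.
pose z j := (1 - mono (C j)^-1%:CC 0 * P j) ^+ N j.
have zE j t : teval (z j) t = (1 - (C j)^-1%:CC * teval (P j) t) ^+ N j.
  by rewrite tevX tevB tev1 tevM tev_mono tchar0 mulr1.
have zK j t : Kpt t -> teval (z j) t = ((1 - p j t / C j) ^+ N j)%:CC.
  by move=> Kt; rewrite zE PE // -rmorphM -(rmorph1 (real_complex R)) -rmorphB -rmorphXn mulrC.
have p01 j t : Kpt t -> 0 <= p j t / C j <= 1.
  by move=> Kt; rewrite divr_ge0 ?p_ge0 ?(ltW (C0 j)) //= ler_pdivrMr // mul1r pC.
exists z; split.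
- move=> j; apply: invX; apply: invD; [exact: inv1|apply: invN].
  by apply: invM; [exact: inv_mono|exact: Pi].
- move=> j t Kt; exists ((1 - p j t / C j) ^+ N j); first exact: zK.
  have /andP[a0 a1] := p01 j t Kt.
  by rewrite exprn_ge0 ?subr_ge0 //= exprn_ile1 ?subr_ge0 // lerBlDr lerDl.
- move=> j t /orbitP[w ww ->]; have P0 : teval (P j) (tact w r) = 0.
    rewrite tev_inv // tev_sum big1 // => i _.
    by rewrite tevM gE subrr mul0r.
  by rewrite zE P0 mulr0 subr0 expr1n.
- move=> t Kt tr.
  have [i gi0] : exists i, 0 < nm (teval (g i) t) ^+ 2.
    apply: contrapT => no; apply: tr; apply/orbitP; apply: separation_msum => x.
    have [k <-] := uP x; apply/eqP; rewrite -subr_eq0 -gE; apply: contrapT => /negP n0.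
    by apply: no; exists k; rewrite exprn_gt0 // nm_gt0.
  set c := nm _ ^+ 2 in gi0 => e e0.
  have [M hM] : exists M : nat, (c * e)^-1 < M%:R.
    exists (Num.truncn (c * e)^-1).+1; apply: truncnS_gt.
  exists (maxn M i.+1) => j; rewrite geq_max => /andP[Mj ij].
  have cp : c <= p j t.
    rewrite /p (bigD1 (Ordinal ij)) //= lerDl; apply: sumr_ge0 => k _; exact: sqr_ge0.
  rewrite subr0 zK // nm_real ger0_norm; last first.
    by apply: exprn_ge0; rewrite subr_ge0; have /andP[] := p01 j t Kt.
  have h := pow_decay (N j) (p01 j t Kt); set q := (1 - _) ^+ _ in h *.
  have q0 : 0 <= q by apply: exprn_ge0; rewrite subr_ge0; have /andP[] := p01 j t Kt.
  have Nu : M%:R * c <= (N j)%:R * (p j t / C j).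
    rewrite /N natrM -mulrA; apply: ler_pM => //; first exact: ltW.
      by rewrite ler_nat.
    apply: le_trans cp _; rewrite mulrA ler_pdivlMr // mulrC ler_wpM2r //.
    exact/ltW/truncnS_gt.
  have Mc : 1 < M%:R * c * e.
    have ce : 0 < c * e by exact: mulr_gt0.
    have hh : (c * e)^-1 * (c * e) < M%:R * (c * e) by rewrite ltr_pM2r.
    by move: hh; rewrite mulVf ?lt0r_neq0 // mulrA.
  have : q * (1 + M%:R * c) <= 1.
    by apply: le_trans h; apply: ler_wpM2l => //; rewrite lerD2l.
  rewrite ltNge => h1; apply/negP => eq.
  have : e * (1 + M%:R * c) <= q * (1 + M%:R * c).
    by apply: ler_wpM2r => //; rewrite addr_ge0 // mulr_ge0 // ltW.
  by move: h1 Mc e0; rewrite mulrDr mulr1 (mulrC e); lra.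
Qed.

Definition orb r t : R[i] := (`[< torus_orbit r t >])%:R.

Lemma BorZ_orb r : BorZ (orb r).
Proof.
have [z [zi z01 z1 z0]] := peak r.
apply: (Bor_lim (B := 1) (fun j => BorZ_tev _ (zi j))) => [j t Kt|t Kt].
  by have [u -> /andP[u0 u1]] := z01 j t Kt; rewrite nm_real ger0_norm.
rewrite /orb; case: asboolP => tr; last exact: z0.
by apply: (ccvg_ext (u := fun=> 1)); [move=> j; rewrite z1|exact: ccvg_cst].
Qed.

Lemma interpolate1 (l : seq torus) r : r \notin l ->
  exists a, teval a r = 1 /\ forall t, t \in l -> teval a t = 0.
Proof.
elim: l => [|s l IH]; first by exists 1; rewrite tev1.
rewrite inE negb_or => /andP[rs /IH[a [a1 a0]]].
have [x xn] : exists x, r x != s x.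
  apply: contrapT => no; move/eqP: rs; apply; apply: torus_ext => x.
  by apply/eqP/negPn/negP => n; apply: no; exists x.
have n0 : r x - s x != 0 by rewrite subr_eq0.
exists (mono (r x - s x)^-1 0 * (mono 1 x - mono (s x) 0) * a).
have E t : teval (mono (r x - s x)^-1 0 * (mono 1 x - mono (s x) 0) * a) t =
    (r x - s x)^-1 * (t x - s x) * teval a t.
  by rewrite !tevM tevB !tev_mono !tchar0 !mulr1 mul1r.
split=> [|t]; rewrite E; first by rewrite a1 mulVf // mul1r.
by rewrite inE => /orP[/eqP->|/a0->]; rewrite ?subrr ?mulr0 ?mul0r.
Qed.

Lemma interpolate (l : seq torus) (phi : torus -> R[i]) :
  exists a, forall t, t \in l -> teval a t = phi t.
Proof.
have nt t : t \notin rem t (undup l) by rewrite mem_rem_uniq ?undup_uniq // !inE eqxx.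
pose b t := sval (cid (interpolate1 (nt t))).
have hb t : teval (b t) t = 1 /\ forall s, s \in rem t (undup l) -> teval (b t) s = 0.
  exact: (svalP (cid (interpolate1 (nt t)))).
exists (\sum_(s <- undup l) mono (phi s) 0 * b s) => t tl.
rewrite tev_sum (big_rem t) ?mem_undup //= big_seq big1 ?addr0 => [|s].
  by rewrite tevM tev_mono tchar0 mulr1 (hb t).1 mulr1.
rewrite mem_rem_uniq ?undup_uniq // !inE mem_undup => /andP[st sl].
rewrite tevM (hb s).2 ?mulr0 // mem_rem_uniq ?undup_uniq // !inE mem_undup tl.
by rewrite eq_sym st.
Qed.

Lemma tev_cont a s e : 0 < e -> exists (F : {fset X}) (e' : R), 0 < e' /\
  forall t, (forall x, x \in F -> nm (t x - s x) < e') -> nm (teval a t - teval a s) < e.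
Proof.
move=> e0; pose c := \sum_(x <- finsupp a) nm (a x).
have c0 : 0 <= c by apply: sumr_ge0 => x _; exact: nm_ge0.
exists (finsupp a), (e / (c + 1)); split; first by rewrite divr_gt0 // ltr_wpDl.
move=> t h; rewrite /teval -sumrB; apply: le_lt_trans (nm_sum _ _ _) _.
apply: le_lt_trans (_ : c * (e / (c + 1)) < e).
  rewrite mulr_suml !big_seq; apply: ler_sum => x xa; rewrite -mulrBr nmM.
  by apply: ler_wpM2l; [exact: nm_ge0|exact/ltW/h].
by rewrite mulrA ltr_pdivrMr ?ltr_wpDl //; lra.
Qed.

Section Approximation.
Variables (b : galg) (eps : R).
Hypothesis eps0 : 0 < eps.
Let cb t := (teval b t)^*.

Definition nonneg a := forall t, Kpt t -> exists2 u : R, teval a t = u%:CC & 0 <= u.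

Lemma nsq_nonneg z : W0_inv z -> nonneg (nsq z).
Proof. by move=> zi t Kt; exists (nm (teval z t) ^+ 2); [exact: tev_nsq|exact: sqr_ge0]. Qed.

Lemma nonnegD a a' : nonneg a -> nonneg a' -> nonneg (a + a').
Proof.
move=> h h' t Kt; have [u E u0] := h t Kt; have [u' E' u0'] := h' t Kt.
by exists (u + u'); [rewrite tevD E E' rmorphD|exact: addr_ge0].
Qed.

Lemma nm_conjB (y y' : R[i]) : nm (y^* - y'^*) = nm (y - y').
Proof. by rewrite -rmorphB nm_conj. Qed.

(** The interpolant equals the conjugate on the finite orbit of [t0], and approximates it nearby by
    continuity. Elsewhere some invariant orbit sum differs from its value at [t0]; adding its
    squared distance to [P] excludes a neighbourhood from the sublevel set. By compactness finitely
    many such terms suffice. *)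
Lemma local_approx t0 : Kpt t0 -> exists (P : galg) a (x : R), [/\ W0_inv P, nonneg P, teval P t0 = 0, 0 < x &
  forall t, Kpt t -> complex.Re (teval P t) < x -> nm (teval a t - cb t) < eps].
Proof.
move=> Kt0.
have [a aP] := interpolate [seq tact w t0 | w <- W0s D] cb.
pose Q (E : set torus) := exists (P : galg) (x : R), [/\ W0_inv P, nonneg P, teval P t0 = 0, 0 < x &
    forall t, E t -> Kpt t -> complex.Re (teval P t) < x -> nm (teval a t - cb t) < eps].
suff : Q Kpt.
  by move=> [P [x [Pi P0 Pt x0 h]]]; exists P, a, x; split => // t Kt; exact: h.
apply: (@K_ind R D L H V A Q) => [E E' sub [P [x [Pi P0 Pt x0 h]]]|E E' [P [x [Pi P0 Pt x0 h]]] [P' [x' [Pi' P0' Pt' x0' h']]]||s Ks].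
- by exists P, x; split => // t /sub; exact: h.
- exists (P + P'), (Num.min x x'); split; [exact: invD|exact: nonnegD|by rewrite tevD Pt Pt' addr0|by rewrite lt_min x0|].
  move=> t Et Kt; have [u Eu u0] := P0 t Kt; have [u' Eu' u0'] := P0' t Kt.
  rewrite tevD Eu Eu' -rmorphD /= lt_min => /andP[lx lx'].
  by case: Et => Et; [apply: h|apply: h'] => //; rewrite ?Eu ?Eu' /=; lra.
- exists 0, 1; split => //; [by apply: W0_invP => w ww; exact: gpush0|by move=> t _; exists 0; rewrite ?tev0|by rewrite tev0].
- have [so|so] := pselect (torus_orbit t0 s).
    have e2 : 0 < eps / 2 by rewrite divr_gt0.
    have [F1 [e1 [e10 h1]]] := tev_cont a s e2; have [F2 [e2' [e20 h2]]] := tev_cont b s e2.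
    exists (F1 `|` F2)%fset, (Num.min e1 e2'); split; first by rewrite lt_min e10.
    exists 0, 1; split => //; [by apply: W0_invP => w ww; exact: gpush0|by move=> t _; exists 0; rewrite ?tev0|by rewrite tev0|].
    move=> t [_ hF] Kt _; have as0 : teval a s = cb s.
      apply: aP; have /orbitP[w ww ->] := so; by apply: map_f; apply/mem_W0s.
    have -> : teval a t - cb t = (teval a t - teval a s) + (cb s - cb t) by rewrite as0 subrKA.
    apply: le_lt_trans (nmD _ _) _; rewrite nm_conjB -(nmN (teval b s - _)) opprB.
    have p1 : nm (teval a t - teval a s) < eps / 2.
      by apply: h1 => x xF; have := hF x; rewrite inE xF lt_min => /(_ isT)/andP[].
    have p2 : nm (teval b t - teval b s) < eps / 2.
      by apply: h2 => x xF; have := hF x; rewrite inE xF orbT lt_min => /(_ isT)/andP[].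
    lra.
  have [x xn] : exists x, teval (msum x) s != teval (msum x) t0.
    apply: contrapT => no; apply: so; apply/orbitP; apply: separation_msum => x.
    by apply/eqP/negPn/negP => n; apply: no; exists x.
  pose z := msum x - mono (teval (msum x) t0) 0.
  have zi : W0_inv z by apply: invD; [exact: msum_inv|apply: invN; exact: inv_mono].
  have zE t : teval z t = teval (msum x) t - teval (msum x) t0 by rewrite tevB tev_mono tchar0 mulr1.
  pose c := nm (teval z s) ^+ 2; have c0 : 0 < c by rewrite exprn_gt0 // nm_gt0 zE subr_eq0.
  have c2 : 0 < c / 2 by rewrite divr_gt0.
  have [F [e [e0 h]]] := tev_cont (nsq z) s c2; exists F, e; split => //.
  exists (nsq z), (c / 2); split => //; [exact: nsq_inv|exact: nsq_nonneg|by rewrite tevM zE subrr mul0r|].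
  move=> t [_ hF] Kt; have := h t hF; rewrite (tev_nsq Ks) // -/c => h1 h2.
  have := ler_Re (teval (nsq z) t - c%:CC); rewrite raddfB /= => h3.
  by have := le_lt_trans h3 h1; rewrite ltr_norml => /andP[]; lra.
Qed.

(** The star does not preserve A, so the conjugate of an evaluation is not itself given by an
    element of A; the local interpolants are glued with invariant indicators. *)
Lemma conj_approx : exists g, BorA g /\ forall t, Kpt t -> nm (g t - cb t) < eps.
Proof.
(* [chi] is an invariant indicator that covers [E], and the approximation holds wherever [chi] is 1;
   on a union the first indicator takes precedence. *)
pose Q (E : set torus) := exists chi g, [/\ BorZ chi, BorA g, forall t, Kpt t -> chi t = 0 \/ chi t = 1 &
    forall t, Kpt t -> (E t -> chi t = 1) /\ (chi t = 1 -> nm (g t - cb t) < eps)].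
suff : Q Kpt.
  by move=> [chi [g [_ bg _ h]]]; exists g; split => // t Kt; have [h1 h2] := h t Kt; apply/h2/h1.
apply: (@K_ind R D L H V A Q) => [E E' sub [chi [g [bc bg c01 h]]]|E E' [chi [g [bc bg c01 h]]] [chi' [g' [bc' bg' c01' h']]]||s Ks].
- by exists chi, g; split => // t Kt; have [h1 h2] := h t Kt; split => // /sub.
- exists (fun t => chi t + (1 - chi t) * chi' t), (fun t => chi t * g t + (1 - chi t) * g' t); split.
  + by apply: BorZD => //; apply: BorZM => //; exact: BorZ_C1.
  + by apply: BorAD; apply: BorAM => //; apply: BorZA => //; exact: BorZ_C1.
  + move=> t Kt; have [->|->] := c01 t Kt; last by right; rewrite subrr mul0r addr0.
    by rewrite subr0 mul1r add0r; exact: c01'.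
  + move=> t Kt; have [h1 h2] := h t Kt; have [h1' h2'] := h' t Kt.
    have [E0|E1] := c01 t Kt; last first.
      by rewrite E1 !(subrr, mul0r, mul1r, addr0); split => // _; exact: h2.
    rewrite E0 !(subr0, mul0r, mul1r, add0r); split => // -[Et|]; last exact: h1'.
    by have /eqP := h1 Et; rewrite E0 eq_sym oner_eq0.
- exists (fun=> 0), (fun=> 0); split; [exact: BorZ_cst|exact: BorA_cst|by left|].
  by move=> t Kt; split => // /eqP; rewrite eq_sym oner_eq0.
- have [P [a [x [Pi P0 Ps x0 h]]]] := local_approx Ks.
  have [B BP] := tev_bounded A P.
  pose m := (Num.truncn (B / x)).+1; have mB : B <= m%:R * x by rewrite -ler_pdivrMr // ltW // truncnS_gt.
  have m0 : (0 : R) < m%:R by rewrite ltr0n.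
  have C0 : 0 < m%:R * x by rewrite mulr_gt0.
  have Cm : m%:R * x / m%:R = x by rewrite mulrC mulKf ?gt_eqF.
  have [F [e [e0 hF]]] := tev_cont P s x0; exists F, e; split => //.
  exists (fun t => ((complex.Re (teval P t) < x)%R%:R : R[i])), (teval a); split.
  + rewrite -Cm; apply: (BorZ_level (A := A)) => //; first exact: BorZ_tev.
    move=> t Kt; have [u E u0] := P0 t Kt; exists u => //; rewrite u0 (le_trans _ mB) //.
    by have := BP t Kt; rewrite E nm_real ger0_norm.
  + exact: BorA_tev.
  + by move=> t Kt; case: ltP; [right|left].
  + move=> t Kt; split => [[_ /hF]|].
      rewrite Ps subr0 => h1; have [u E u0] := P0 t Kt.
      by move: h1; rewrite E nm_real ger0_norm //= => ->.
    by case: ltP => [lx _|_ /eqP]; [exact: h|rewrite eq_sym oner_eq0].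
Qed.

End Approximation.

Lemma BorA_conj_tev b : BorA (fun t => (teval b t)^*).
Proof.
have hn n : (0 : R) < n.+1%:R^-1 by rewrite invr_gt0 ltr0n.
pose g n := sval (cid (conj_approx b (hn n))).
have [gB gE] : (forall n, BorA (g n)) /\ forall n t, Kpt t -> nm (g n t - (teval b t)^*) < n.+1%:R^-1.
  by split => n; have [] := svalP (cid (conj_approx b (hn n))).
have [B BP] := tev_bounded A b.
apply: (Bor_lim (B := B + 1) gB) => [n t Kt|t Kt e e0].
  rewrite -[g n t](subrK (teval b t)^*) addrC; apply: le_trans (nmD _ _) _.
  apply: lerD; first by rewrite nm_conj; exact: BP.
  by apply: le_trans (ltW (gE n t Kt)) _; rewrite invf_le1 ?ltr0n // ler1n.
have [N hN] : exists N : nat, e^-1 < N%:R by exists (Num.truncn e^-1).+1; exact: truncnS_gt.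
exists N => n Nn; apply: lt_trans (gE n t Kt) _.
rewrite invf_plt ?posrE ?ltr0n //; apply: lt_le_trans hN _; rewrite ler_nat.
exact: leq_trans Nn _.
Qed.

End Conjugation.

(** * Partition functions *)

Section PartitionFunctions.
Variables (R : realType) (D : rootDatum).
Local Notation X := (latX D).
Local Notation galg := (galg R[i] X).
Local Notation mono := (@gmono R[i] X).
Local Notation FF := (@FF R D).
Local Notation d0 := (@d0 R D).
Implicit Types (F G : X -> R[i]) (b x z : X) (f g : galg) (Q : seq X) (e : R).

Definition nb b : galg := 1 - mono 1 b.

Lemma gact_nb b F x : gact (nb b) F x = F x - F (x + b).
Proof. by rewrite /nb gactD gactN gact_mono mul1r; congr (_ - _); rewrite gact1. Qed.

(** Subexponential growth in the height; it is preserved by solving difference equations, unlike any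
    fixed polynomial bound. *)
Definition EG F := forall e, 1 < e -> exists K, forall x, nm (F x) <= K * e ^+ absz (ht x).
Definition IG F := forall x, exists m : int, F x = m%:~R.
Definition SG (U : X -> Prop) F := forall x, F x != 0 -> U x.

Lemma ht_root_neq0 b : b \in roots D -> ht b != 0.
Proof.
move=> br; have /orP[|] := pos_or_neg br; move/ht_pos; first by move=> h; rewrite gt_eqF.
by rewrite htN oppr_gt0 => h; rewrite lt_eqF.
Qed.

Lemma FF_nb b F : b \in roots D -> FF F -> (forall x, gact (nb b) F x = 0) -> forall x, F x = 0.
Proof.
move=> br FFF h; apply: (FF_shift FFF (ht_root_neq0 br)) => x.
by have /eqP := h x; rewrite gact_nb subr_eq0 => /eqP.
Qed.

(** For [ht b > 0] the solution is the sum of [G (x + j b)] over [j >= 0], finite because [G]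
    vanishes at large height. The case of negative height is reduced to it by
    [1 - e^b = - e^b (1 - e^(-b))]. *)
Lemma solve b G : b \in roots D -> FF G -> exists F, [/\ FF F, gact (nb b) F = G, EG G -> EG F,
  IG G -> IG F & forall U : X -> Prop, (forall x, U x -> U (x + b)) -> (forall x, U x -> U (x - b)) ->
    SG U G -> SG U F].
Proof.
move=> br FG; wlog hb : b br / 0 < ht b => [W|].
  have [h|h] := ltP 0 (ht b); first exact: W.
  have hN : 0 < ht (- b) by rewrite htN oppr_gt0 lt_neqAle ht_root_neq0.
  have [||F [FF1 E eg ig sg]] := W (- b); rewrite ?rootNE //.
  exists (fun x => - F (x - b)); split.
  - have [C CP] := FF1; exists (C + ht b) => x hx; rewrite CP ?oppr0 // htD htN.
    by move: hx; rewrite ltrBrDr.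
  - apply/funext => x; rewrite gact_nb addrK -E gact_nb; ring.
  - move=> /eg h' e e1; have [K KP] := h' e e1; exists (K * e ^+ absz (ht b)) => x.
    rewrite nmN; apply: le_trans (KP _) _; rewrite -mulrA -exprD.
    have K0 : 0 <= K by have := KP 0; rewrite ht0 expr0 mulr1; apply: le_trans; exact: nm_ge0.
    apply: ler_wpM2l => //; rewrite ler_weXn2l ?(ltW e1) // htD htN; lia.
  - by move=> /ig h' x; have [m ->] := h' (x - b); exists (- m); rewrite rmorphN.
  - move=> U U1 U2 UG x; rewrite oppr_eq0 => /(sg U) hx; rewrite -(subrK b x); apply: (U1 _ _).
    by apply: hx => [y|y|]; [exact: U2|rewrite opprK; exact: U1|].
have [C CP] := FG.
pose N x := (absz (C - ht x)%R).+1.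
pose F x := \sum_(j < N x) G (x + b *+ j).
have far x j : (N x <= j)%N -> G (x + b *+ j) = 0.
  move=> h; apply: CP; rewrite htD pmulrn htMz; move: h hb; rewrite /N; nia.
have FE x M : (N x <= M)%N -> F x = \sum_(j < M) G (x + b *+ j).
  move=> h; rewrite -(subnKC h) big_split_ord /= [X in _ = _ + X]big1 ?addr0 // => j _.
  by apply: far; rewrite leq_addr.
exists F; split.
- exists C => x hx; rewrite /F big1 // => j _; apply: CP; rewrite htD pmulrn htMz; move: hx hb; nia.
- apply/funext => x; rewrite gact_nb; pose M := maxn (N x) (N (x + b)).
  rewrite (FE x M.+1) ?(FE (x + b) M) ?leq_maxr //; last by rewrite leqW // leq_maxl.
  rewrite big_ord_recl mulr0n addr0 -[RHS]addr0 -addrA; congr (_ + _); apply/eqP; rewrite subr_eq0; apply/eqP.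
  by apply: eq_bigr => j _; rewrite /= mulrS addrA.
(* One factor [s] of [e] absorbs the growth of [G], the other the number of terms, which is linear
   in the height. *)
- move=> eg e e1; pose s := Num.sqrt e; have s1 : 1 < s by rewrite -sqrtr1 ltr_sqrt // (lt_trans ltr01).
  have ss : s * s = e by rewrite -expr2 sqr_sqrtr // ltW // (lt_trans ltr01).
  have [K KP] := eg s s1; have K0 : 0 <= K by have := KP 0; rewrite ht0 expr0 mulr1; apply: le_trans; exact: nm_ge0.
  pose c := absz C; exists (K * s ^+ c * (c.+1%:R + (s - 1)^-1)) => x; pose n := absz (ht x).
  have s0 : 0 < s - 1 by rewrite subr_gt0.
  have sn (m : nat) : 0 <= s ^+ m by apply: exprn_ge0; apply: ltW; apply: lt_trans s1.
  have b1 : nm (F x) <= (N x)%:R * (K * s ^+ (c + n)).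
    apply: le_trans (nm_sum _ _ _) _.
    have -> : (N x)%:R * (K * s ^+ (c + n)) = \sum_(j < N x) K * s ^+ (c + n).
      by rewrite sumr_const card_ord mulr_natl.
    apply: ler_sum => j _.
    have [h|h] := leP (ht (x + b *+ j)) C.
      apply: le_trans (KP _) _; apply: ler_wpM2l => //; rewrite ler_weXn2l ?(ltW s1) //.
      move: h; rewrite htD pmulrn htMz /c /n; have : 0 <= j%:Z * ht b by rewrite mulr_ge0 // ltW.
      move: (j%:Z * ht b) => u; lia.
    by rewrite CP // nm0 mulr_ge0.
  have b2 : (N x)%:R <= (c.+1%:R + (s - 1)^-1) * s ^+ n.
    have h1 : (N x)%:R <= (c.+1%:R + n%:R : R) by rewrite -natrD ler_nat /N /c /n; lia.
    have h2 : 1 + n%:R * (s - 1) <= s ^+ n.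
      by have := @bernoulli _ (s - 1) n; rewrite subrKC; apply; lra.
    have sn1 : 1 <= s ^+ n by rewrite exprn_ege1 // ltW.
    apply: le_trans h1 _; rewrite mulrDl; apply: lerD; first by rewrite ler_peMr.
    by rewrite mulrC ler_pdivlMr //; apply: le_trans h2; rewrite lerDr.
  apply: le_trans b1 _; rewrite exprD -ss exprMn.
  apply: le_trans (ler_wpM2r _ b2) _; first by rewrite !mulr_ge0.
  rewrite -/n; move: (s ^+ n) (s ^+ c) (c.+1%:R + _) => sN sc cs; by rewrite le_eqVlt; apply/orP; left; apply/eqP; ring.
- move=> ig x; rewrite /F; elim/big_rec: _ => [|j z _ [m ->]]; first by exists 0.
  by have [m' ->] := ig (x + b *+ j); exists (m' + m); rewrite rmorphD.
- move=> U U1 U2 UG x; apply: contra_neqP => nU; rewrite /F big1 // => j _.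
  apply: contra_notP nU => /eqP/UG; elim: (j : nat) => [|i IH]; first by rewrite mulr0n addr0.
  by rewrite mulrSr addrA => /U2; rewrite addrK; exact: IH.
Qed.

Lemma EG_gact f F : EG F -> EG (gact f F).
Proof.
move=> eg e e1; have [K KP] := eg e e1.
have K0 : 0 <= K by have := KP 0; rewrite ht0 expr0 mulr1; apply: le_trans; exact: nm_ge0.
exists (\sum_(z <- finsupp f) nm (f z) * (K * e ^+ absz (ht z))) => x.
rewrite /gact mulr_suml; apply: le_trans (nm_sum _ _ _) _; apply: ler_sum => z _.
rewrite nmM -mulrA; apply: ler_wpM2l; first exact: nm_ge0.
apply: le_trans (KP _) _; rewrite -mulrA -exprD; apply: ler_wpM2l => //.
by rewrite ler_weXn2l ?(ltW e1) // htD; lia.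
Qed.

Lemma d0_FF : FF d0.
Proof. by exists 0 => x hx; rewrite /d0; case: eqP hx => // ->; rewrite ht0. Qed.

Definition nbs Q : galg := \prod_(b <- Q) nb b.

Lemma FF_nbs Q F : {subset Q <= roots D} -> FF F -> (forall x, gact (nbs Q) F x = 0) -> forall x, F x = 0.
Proof. by move=> Qr FFF; rewrite /nbs big_seq; apply: FF_prod => // b /Qr br G; exact: FF_nb. Qed.

Lemma FF_nbs_inj Q F G : {subset Q <= roots D} -> FF F -> FF G -> gact (nbs Q) F = gact (nbs Q) G -> F = G.
Proof.
move=> Qr [C1 P1] [C2 P2] E; apply/funext => x; apply/eqP; rewrite -subr_eq0; apply/eqP; move: x.
apply: (FF_nbs Qr) => [|x]; last by rewrite gactBr E subrr.
by exists (Num.max C1 C2) => x; rewrite gt_max => /andP[h1 h2]; rewrite P1 // P2 // subrr.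
Qed.

(** The partition function of the multiset [Q], solved for one root at a time. Its integrality and
    its support in the lattice spanned by [Q] are carried along. *)
Lemma part_ex Q : {subset Q <= roots D} -> exists F, [/\ FF F, gact (nbs Q) F = d0, EG F,
  IG F & forall U : X -> Prop, U 0 -> (forall b x, b \in Q -> U x -> U (x + b) /\ U (x - b)) -> SG U F].
Proof.
elim: Q => [|b Q IH] Qr.
  exists d0; split.
  - exact: d0_FF.
  - by rewrite /nbs big_nil gact1.
  - move=> e e1; exists 1 => x; rewrite mul1r /d0; case: eqP => [->|_].
      by rewrite ht0 expr0 nm1.
    by rewrite nm0; apply: exprn_ge0; apply: ltW; apply: lt_trans e1.
  - by move=> x; rewrite /d0; case: eqP => _; [exists 1|exists 0].
  - by move=> U U0 _ x; rewrite /d0; have [->//|xn] := eqVneq x 0; rewrite eqxx.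
have [c cQ|F [F1 F2 F3 F4 F5]] := IH; first by apply: Qr; rewrite inE cQ orbT.
have br : b \in roots D by apply: Qr; exact: mem_head.
have [G [G1 G2 G3 G4 G5]] := solve br F1; exists G; split; [by []| |exact: G3|exact: G4|].
  by rewrite /nbs big_cons mulrC gactM G2.
move=> U U0 UQ; apply: G5 => [x Ux|x Ux|].
- by have [] := UQ b x (mem_head _ _) Ux.
- by have [] := UQ b x (mem_head _ _) Ux.
- by apply: F5 => // c x cQ; apply: UQ; rewrite inE cQ orbT.
Qed.

(** The substitution [e^x -> r(x) e^x], which moves the point [r] to the unit of the torus; [twist]
    is the matching operation on functions. *)
Definition gtw (r : torus R D) f : galg := \sum_(x <- finsupp f) mono (f x * r x) x.

Lemma gtwE r f x : gtw r f x = f x * r x.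
Proof.
rewrite /gtw galg_sum; under eq_bigr => y _ do rewrite gmonoE.
have [xf|xf] := boolP (x \in finsupp f).
  by rewrite (big_rem x) //= eqxx big_seq big1 ?addr0 // => y; rewrite mem_rem_uniq ?fset_uniq // !inE eq_sym => /andP[/negPf->].
rewrite big_seq big1 => [|y yf]; first by rewrite (fsfun_dflt xf) mul0r.
by case: eqP => // E; rewrite -E (negPf xf) in yf.
Qed.

Lemma gtwD r f g : gtw r (f + g) = gtw r f + gtw r g.
Proof. by apply/fsfunP => x; rewrite gtwE !galgD !gtwE mulrDl. Qed.

Lemma gtwN r f : gtw r (- f) = - gtw r f.
Proof. by apply/fsfunP => x; rewrite gtwE !galgN gtwE mulNr. Qed.

Lemma gtw_mono r c x : gtw r (mono c x) = mono (c * r x) x.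
Proof. by apply/fsfunP => y; rewrite gtwE !gmonoE; case: eqP => [->|_] //; rewrite mul0r. Qed.

Lemma gtw1 r : gtw r 1 = 1.
Proof. by rewrite -gmono1 gtw_mono tchar0 mul1r. Qed.

Lemma gtw0 r : gtw r 0 = 0.
Proof. by apply: (addrI (gtw r 0)); rewrite -gtwD !addr0. Qed.

Lemma gtwM r f g : gtw r (f * g) = gtw r f * gtw r g.
Proof.
move: f; apply: gind => [|c x|f1 f2 E1 E2]; first by rewrite !(mul0r, gtw0).
  move: g; apply: gind => [|c' x'|g1 g2 E1 E2]; first by rewrite !(mulr0, gtw0).
    by rewrite gmonoM !gtw_mono gmonoM tcharD mulrACA.
  by rewrite !(mulrDr, gtwD) E1 E2.
by rewrite !(mulrDl, gtwD) E1 E2.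
Qed.

Lemma gtw_prod r I (s : seq I) (P : pred I) (F : I -> galg) :
  gtw r (\prod_(i <- s | P i) F i) = \prod_(i <- s | P i) gtw r (F i).
Proof. exact: (big_morph _ (gtwM r) (gtw1 r)). Qed.

Definition twist (r : torus R D) F x := (r x)^-1 * F x.

Lemma twist_gact r f F : twist r (gact f F) = gact (gtw r f) (twist r F).
Proof.
apply/funext => x; rewrite /twist; move: f.
apply: gind => [|c z|f1 f2 E1 E2].
- have gact0 G y : gact 0 G y = 0 by apply: (addrI (gact 0 G y)); rewrite -gactD !addr0.
  by rewrite gtw0 !gact0 mulr0.
- have E : (r x)^-1 = r z * (r (x + z))^-1 by rewrite tcharD invfM mulrCA mulfV ?t_neq0 // mulr1.
  by rewrite gtw_mono !gact_mono E; ring.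
- by rewrite gtwD !gactD mulrDr E1 E2.
Qed.

Lemma twist_FF r F : FF F -> FF (twist r F).
Proof. by move=> [C CP]; exists C => x hx; rewrite /twist CP // mulr0. Qed.

Section WeightedNorm.
Variable Wt : X -> R.
Hypothesis Wt0 : forall x, 0 <= Wt x.
Hypothesis WtM : forall x y, Wt (x + y) <= Wt x * Wt y.
Hypothesis Wt1 : Wt 0 = 1.

(** The norm of a Beurling algebra: weighted l^1 with a submultiplicative weight. *)
Definition gnorm f := \sum_(x <- finsupp f) nm (f x) * Wt x.

Lemma gnorm_ge0 f : 0 <= gnorm f.
Proof. by apply: sumr_ge0 => x _; rewrite mulr_ge0 ?nm_ge0. Qed.

Lemma gnorm_sup f (S : {fset X}) : (finsupp f `<=` S)%fset -> gnorm f = \sum_(x <- S) nm (f x) * Wt x.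
Proof.
move=> sub; rewrite /gnorm; apply: big_fset_incl => // x _ xf.
by rewrite (fsfun_dflt xf) nm0 mul0r.
Qed.

Lemma gnormD f g : gnorm (f + g) <= gnorm f + gnorm g.
Proof.
pose S := (finsupp f `|` finsupp g)%fset.
have sfg : (finsupp (f + g)%R `<=` S)%fset.
  apply/fsubsetP => x; rewrite inE !mem_finsupp galgD; apply: contraR; rewrite negb_or !negbK.
  by move=> /andP[/eqP-> /eqP->]; rewrite addr0.
rewrite (gnorm_sup sfg) (gnorm_sup (fsubsetUl _ _ : (finsupp f `<=` S)%fset)).
rewrite (gnorm_sup (fsubsetUr _ _ : (finsupp g `<=` S)%fset)) -big_split /=.
by apply: ler_sum => x _; rewrite galgD -mulrDl; apply: ler_wpM2r => //; exact: nmD.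
Qed.

Lemma gnormN f : gnorm (- f) = gnorm f.
Proof.
have E : (finsupp (- f)%R `<=` finsupp f)%fset.
  by apply/fsubsetP => x; rewrite !mem_finsupp galgN oppr_eq0.
by rewrite (gnorm_sup E) /gnorm; apply: eq_bigr => x _; rewrite galgN nmN.
Qed.

Lemma gnorm_mono c x : gnorm (mono c x) = nm c * Wt x.
Proof.
have E : (finsupp (mono c x) `<=` [fset x])%fset.
  by apply/fsubsetP => y; rewrite mem_finsupp gmonoE inE; case: (y == x) => //; rewrite eqxx.
by rewrite (gnorm_sup E) big_seq_fset1 gmonoE eqxx.
Qed.

Lemma gnorm1 : gnorm 1 = 1.
Proof. by rewrite -gmono1 gnorm_mono Wt1 nm1 mul1r. Qed.

Lemma gnorm0 : gnorm 0 = 0.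
Proof. by rewrite /gnorm big_seq big1 // => x; rewrite mem_finsupp galg0 eqxx. Qed.

Lemma gnorm_sum I (s : seq I) (F : I -> galg) : gnorm (\sum_(i <- s) F i) <= \sum_(i <- s) gnorm (F i).
Proof.
elim: s => [|i s IH]; first by rewrite !big_nil gnorm0.
by rewrite !big_cons; apply: le_trans (gnormD _ _) _; rewrite lerD2l.
Qed.

Lemma gnormM f g : gnorm (f * g) <= gnorm f * gnorm g.
Proof.
have E : f * g = \sum_(x <- finsupp f) \sum_(y <- finsupp g) mono (f x * g y) (x + y).
  rewrite {1}(galgE f) {1}(galgE g) mulr_suml; apply: eq_bigr => x _.
  by rewrite mulr_sumr; apply: eq_bigr => y _; rewrite gmonoM.
rewrite E; apply: le_trans (gnorm_sum _ _) _.
rewrite /gnorm mulr_suml; apply: ler_sum => x _.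
apply: le_trans (gnorm_sum _ _) _; rewrite mulr_sumr; apply: ler_sum => y _.
rewrite gnorm_mono nmM mulrACA; apply: ler_wpM2l; last exact: WtM.
by rewrite mulr_ge0 ?nm_ge0.
Qed.

Lemma gnormX f n : gnorm (f ^+ n) <= gnorm f ^+ n.
Proof.
elim: n => [|n IH]; first by rewrite !expr0 gnorm1.
rewrite !exprS; apply: le_trans (gnormM _ _) _; apply: ler_wpM2l => //; exact: gnorm_ge0.
Qed.

Lemma gnorm_prod1 (I : eqType) (s : seq I) (F : I -> galg) c : 0 <= c -> (forall i, i \in s -> gnorm (F i) <= c) ->
  gnorm (\prod_(i <- s) (1 - F i) - 1) <= (1 + c) ^+ size s - 1.
Proof.
move=> c0; elim: s => [|i s IH] h; first by rewrite big_nil !subrr gnorm0.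
have hs j : j \in s -> gnorm (F j) <= c by move=> js; apply: h; rewrite inE js orbT.
have {}IH := IH hs; have hi := h i (mem_head _ _).
rewrite big_cons exprS; set P := \prod_(j <- s) _ in IH *; set C := _ ^+ _ in IH *.
have -> : (1 - F i) * P - 1 = (P - 1) - (F i * (P - 1) + F i) by ring.
apply: le_trans (gnormD _ _) _; rewrite gnormN.
have h1 := gnormD (F i * (P - 1)) (F i); have h2 := gnormM (F i) (P - 1).
have h3 : gnorm (F i) * gnorm (P - 1) <= c * (C - 1).
  by apply: ler_pM => //; exact: gnorm_ge0.
lra.
Qed.

End WeightedNorm.

End PartitionFunctions.

(** * Support of the spectral measure *)

Section Support.
Variables (R : realType) (D : rootDatum) (L : labels R D) (H : heckeAlgebra L).
Variables (V : hilbertCompletion H) (A : cstarCompletion V).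
Hypothesis w0_ex : exists w0, @longest D w0.
Variables (p0 : irrep A) (mu : {measure set (spectrumB p0) -> \bar R}).
Hypothesis muP : is_plancherel mu.
Local Notation X := (latX D).
Local Notation th := (htheta H).
Local Notation Th := (@Th R D L H).
Local Notation qc w := ((qW L w)%:C%C).
Local Notation galg := (galg R[i] X).
Local Notation mono := (@gmono R[i] X).
Local Notation Kpt := (@Kpt R D L H V A).
Local Notation BorZ := (@BorZ R D L H V A).
Local Notation BorA := (@BorA R D L H V A).
Local Notation torus := (torus R D).
Local Notation FF := (@FF R D).
Local Notation d0 := (@d0 R D).
Local Notation eT := (@eT R D L H).
Local Notation delta := (@delta R D).
Local Notation Ispec := (Ispec mu).
Local Notation "x %:CC" := (x%:C%C : R[i]) (at level 2, format "x %:CC").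
Implicit Types (a z f : galg) (t s r : torus) (e kap : R) (w v : X -> X) (x y : X) (d : spectrumB p0).

Definition facs : seq (R[i] * X) :=
  flatten [seq [:: (- (hb L b)%:CC, b); ((cb L b)%:CC, b)] | b <- roots D].
Definition fac (k : R[i] * X) : galg := 1 - mono k.1 k.2.
Definition polar r (k : R[i] * X) := k.1 * r k.2 == 1.
Definition bpol r : galg := \prod_(k <- facs | ~~ polar r k) fac k.
Definition Qr r : seq X := [seq k.2 | k <- facs & polar r k].
Definition Fr r : X -> R[i] := twist r (gact (bpol r) eT).

Lemma facs_root k : k \in facs -> k.2 \in roots D.
Proof. by move=> /flatten_mapP[b br]; rewrite !inE => /orP[]/eqP->. Qed.

Lemma Qr_root r : {subset Qr r <= roots D}.
Proof. by move=> b /mapP[k]; rewrite mem_filter => /andP[_ /facs_root h] ->. Qed.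

Lemma facsE : \prod_(b <- roots D) gb L b = \prod_(k <- facs) fac k.
Proof.
rewrite /facs big_flatten big_map; apply: eq_bigr => b _.
have gN (c : R[i]) x : mono (- c) x = - mono c x.
  by apply/fsfunP => y; rewrite galgN !gmonoE; case: eqP => _; rewrite ?oppr0.
by rewrite !big_cons big_nil /= mulr1 /fac /gb /= gN opprK.
Qed.

(** The twist turns the factors that vanish at [r] into [1 - e^b]; the other factors are absorbed in
    [bpol r], and the delta function is fixed by the twist. *)
Lemma Fr_nbs w0 r : longest w0 ->
  gact (nbs R (Qr r)) (Fr r) = gact (mono (qc w0) 0 * gtw r delta) d0.
Proof.
move=> w0l; have E : gtw r (\prod_(k <- facs | polar r k) fac k) = nbs R (Qr r).
  rewrite gtw_prod /nbs /Qr big_map big_filter; apply: eq_bigr => k /eqP kp.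
  by rewrite /fac gtwD gtwN gtw1 gtw_mono kp.
rewrite -E /Fr -twist_gact -gactM.
have -> : (\prod_(k <- facs | polar r k) fac k) * bpol r = \prod_(b <- roots D) gb L b.
  by rewrite facsE /bpol [RHS](bigID (polar r)).
rewrite (trace_formula H w0l) twist_gact gtwM gtw_mono tchar0 mulr1; congr gact.
apply/funext => x; rewrite /twist /d0; case: eqP => [->|_]; last by rewrite mulr0.
by rewrite tchar0 invr1 mul1r.
Qed.

Lemma FrE w0 r p : longest w0 -> FF p -> gact (nbs R (Qr r)) p = d0 ->
  Fr r = gact (mono (qc w0) 0 * gtw r delta) p.
Proof.
move=> w0l fp E; apply: (FF_nbs_inj (@Qr_root r)).
- by apply/twist_FF/FF_gact/FF_eT.
- exact: FF_gact.
- by rewrite (Fr_nbs _ w0l) -gactM (mulrC (nbs R (Qr r))) [RHS]gactM E.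
Qed.

Lemma Fr_EG r : EG (Fr r).
Proof.
have [w0 w0l] := w0_ex; have [p [p1 p2 p3 _ _]] := part_ex R (@Qr_root r).
by rewrite (FrE w0l p1 p2); exact: EG_gact.
Qed.

Lemma tau_Fr r x : htau H (th x * Th (bpol r)) = r x * Fr r x.
Proof. by rewrite /Fr /twist mulrA mulfV ?t_neq0 // mul1r gact_eT. Qed.

Lemma Ispec_bpol r a : Ispec (teval (a * bpol r)) = \sum_(x <- finsupp a) a x * (r x * Fr r x).
Proof.
have [_ ->] := Ispec_tev muP (a * bpol r); rewrite ThM {1}/Submission.Th /gev mulr_suml linear_sum /=.
by apply: eq_bigr => x _; rewrite -scalerAl linearZ /= tau_Fr.
Qed.

Definition Wt r e x : R := nm (r x) * e ^+ absz (ht x).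

Section Weight.
Variables (r : torus) (e : R).
Hypothesis e1 : 1 <= e.

Lemma Wt_ge0 x : 0 <= Wt r e x.
Proof. by rewrite mulr_ge0 ?nm_ge0 // exprn_ge0 // (le_trans ler01). Qed.
Lemma Wt_M x y : Wt r e (x + y) <= Wt r e x * Wt r e y.
Proof.
rewrite /Wt tcharD nmM mulrACA -exprD; apply: ler_wpM2l; first by rewrite mulr_ge0 ?nm_ge0.
by rewrite ler_weXn2l // htD; lia.
Qed.
Lemma Wt_1 : Wt r e 0 = 1.
Proof. by rewrite /Wt ht0 tchar0 nm1 expr0 mulr1. Qed.
End Weight.

Local Notation gn r e := (gnorm (Wt r e)).

(** [Fr] is a finite combination of translates of a partition function, so it grows
    subexponentially. Undoing the twist contributes the weight |r(x)|. *)
Lemma Ispec_growth r e : 1 < e -> exists2 K, 0 <= K & forall a, nm (Ispec (teval (a * bpol r))) <= K * gn r e a.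
Proof.
move=> e1; have [K KP] := Fr_EG r e1.
exists K; first by have := KP 0; rewrite ht0 expr0 mulr1; apply: le_trans; exact: nm_ge0.
move=> a; rewrite Ispec_bpol; apply: le_trans (nm_sum _ _ _) _.
rewrite /gnorm mulr_sumr; apply: ler_sum => x _; rewrite nmM (nmM (r x)) /Wt.
rewrite [leRHS]mulrCA; apply: ler_wpM2l; first exact: nm_ge0.
by rewrite [leRHS]mulrCA; apply: ler_wpM2l; [exact: nm_ge0|exact: KP].
Qed.

(** On the finite support of [z] the heights are bounded by [M], so the norm changes at most by
    [e'^M], which is close to 1 for [e'] close to 1. *)
Lemma gn_perturb r z kap : gn r 1 z < kap -> exists2 e, 1 < e & forall e', 1 <= e' <= e -> gn r e' z < kap.
Proof.
move=> hk; have e11 : 1 <= 1 :> R by [].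
have aux (p' q' g' k' : R) : 1 <= p' -> q' <= p' * g' -> g' < k' -> p' * (g' + 1) <= k' + 1 -> q' < k'.
  rewrite mulrDr mulr1; have [h|h] := ltrP 1 p'; first by lra.
  move=> h1 h2 h3 h4; have e1 : p' = 1 by lra.
  by rewrite e1 mul1r in h2; lra.
pose M := (\sum_(x <- finsupp z) absz (ht x))%N; set g := gn r 1 z in hk.
have g0 : 0 <= g := gnorm_ge0 (Wt_ge0 _ e11) z.
pose v := (1 - (g + 1) / (kap + 1)) / (M.+1)%:R.
have kp : 0 < kap + 1 by lra.
have q1 : (g + 1) / (kap + 1) < 1 by rewrite ltr_pdivrMr // mul1r ltrD2r.
have q0 : 0 < (g + 1) / (kap + 1) by rewrite divr_gt0 // ltr_wpDl.
have v0 : 0 < v by rewrite divr_gt0 ?ltr0n // subr_gt0.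
have v1 : v < 1.
  rewrite /v ltr_pdivrMr ?ltr0n // mul1r; apply: lt_le_trans (_ : 1 <= _); last by rewrite ler1n.
  lra.
have Mv : (1 - v) ^+ M >= (g + 1) / (kap + 1).
  apply: le_trans (_ : 1 + M%:R * - v <= _); last by apply: bernoulli; lra.
  have : M%:R * v <= 1 - (g + 1) / (kap + 1).
    rewrite /v mulrA ler_pdivrMr ?ltr0n // mulrC; apply: ler_wpM2l; first by rewrite subr_ge0 ltW.
    by rewrite ler_nat.
  lra.
have v2 : 0 < 1 - v by rewrite subr_gt0.
exists (1 - v)^-1; first by rewrite invf_gt1 // gtrBl.
move=> e' /andP[e1 ee]; have e'0 : 0 <= e' := le_trans ler01 e1.
have eM : e' ^+ M * ((g + 1) / (kap + 1)) <= 1.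
  have h : e' ^+ M * (1 - v) ^+ M <= 1.
    rewrite -exprMn; apply: exprn_ile1; first exact: mulr_ge0 e'0 (ltW v2).
    by rewrite -ler_pdivlMr // div1r.
  by apply: le_trans h; apply: ler_wpM2l => //; exact: exprn_ge0.
have gM : gn r e' z <= e' ^+ M * g.
  rewrite /g /gnorm mulr_sumr big_seq [leRHS]big_seq; apply: ler_sum => x xz.
  rewrite /Wt expr1n mulr1.
  have -> : e' ^+ M * (nm (z x) * nm (r x)) = nm (z x) * nm (r x) * e' ^+ M by rewrite mulrC.
  rewrite mulrA; apply: ler_wpM2l.
    by rewrite mulr_ge0 ?nm_ge0.
  by rewrite ler_weXn2l // /M (big_rem x) //= leq_addr.
have e1M : 1 <= e' ^+ M by exact: exprn_ege1.
have : e' ^+ M * (g + 1) <= kap + 1 by move: eM; rewrite mulrA ler_pdivrMr // mul1r.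
exact: (aux _ _ _ _ e1M gM hk).
Qed.

(** The Hermitian dual of [r] lies in its W_0-orbit, so the weight at [-x] is the weight at [u x],
    and [z] is invariant. *)
Lemma gn_gstar r z : Kpt r -> W0_inv z -> gn r 1 (gstar z) <= gn r 1 z.
Proof.
move=> Kr zi; have [u uu E] := Kpt_dag w0_ex Kr; have e11 : 1 <= 1 :> R by [].
have W1 x : Wt r 1 x = nm (r x) by rewrite /Wt expr1n mulr1.
have WN x : Wt r 1 (- x) = Wt r 1 (u x).
  by rewrite !W1 -(tactE r x uu) -E tdagE nm_conj.
apply: le_trans (_ : \sum_(x <- finsupp z) nm (z x) * Wt r 1 (u x) <= _).
  apply: le_trans (gnorm_sum (Wt_ge0 _ e11) _ _) _; apply: ler_sum => x _.
  by rewrite gnorm_mono nm_conj WN.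
have iu := W0_winv uu.
rewrite -[X in X <= _]/(gnorm (fun x => Wt r 1 (u x)) z) -{1}(W0_inv_push iu zi).
apply: le_trans (gnorm_sum (fun x => Wt_ge0 _ e11 (u x)) _ _) _; apply: ler_sum => x _.
by rewrite gnorm_mono W0_winvKr.
Qed.

Lemma pow_grow (y : R) N : 0 <= y -> N%:R * y <= 2^-1 -> (1 + y) ^+ N - 1 <= 2 * (N%:R * y).
Proof.
move=> y0 Ny; case: N Ny => [|N] Ny; first by rewrite expr0 subrr mul0r mulr0.
have y1 : y <= 2^-1.
  by apply: le_trans Ny; rewrite ler_peMl // ler1n.
have h1 := @bernoulli _ (- y) N.+1; rewrite mulrN in h1.
have {h1}h1 : 1 - N.+1%:R * y <= (1 - y) ^+ N.+1 by apply: h1; lra.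
have pp : 0 <= (1 + y) ^+ N.+1 by apply: exprn_ge0; lra.
have h2 : (1 + y) ^+ N.+1 * (1 - y) ^+ N.+1 <= 1 by rewrite -exprMn; apply: exprn_ile1; nra.
have h3 : (1 + y) ^+ N.+1 * (1 - N.+1%:R * y) <= 1 by apply: le_trans h2; apply: ler_wpM2l.
have n0 : 0 <= N.+1%:R * y by rewrite mulr_ge0.
move: pp h3 n0 Ny; move: ((1 + y) ^+ _) (_ * y) => p n pp h3 n0 Ny.
have h4 : p * 2^-1 <= p * (1 - n) by apply: ler_wpM2l => //; lra.
have h5 : p * n <= 2 * n by apply: ler_wpM2r => //; lra.
lra.
Qed.

Definition chi kap z t : R[i] := ((complex.Re (teval (nsq z) t) < kap)%R)%:R.

Section Cutoff.
Variables (r : torus) (z : galg) (kap : R).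
Hypotheses (Kr : Kpt r) (zi : W0_inv z) (zk : gn r 1 z ^+ 2 < kap).

Lemma kap_gt0 : 0 < kap. Proof. by apply: le_lt_trans zk; exact: sqr_ge0. Qed.

Lemma cutoff_seq : exists (m : nat) (C : R), [/\ (0 < m)%N, 0 < C, C / m%:R = kap &
  forall t, Kpt t -> exists2 v : R, teval (nsq z) t = v%:CC & 0 <= v <= C].
Proof.
have [B BP] := tev_bounded A (nsq z); have k0 := kap_gt0.
pose m := (Num.truncn (B / kap)).+1; have m0 : (0 : R) < m%:R by rewrite ltr0n.
have mB : B <= m%:R * kap by rewrite -ler_pdivrMr // ltW // truncnS_gt.
exists m, (m%:R * kap); split; [by []|exact: mulr_gt0|by rewrite mulrC mulKf ?gt_eqF|].
move=> t Kt; exists (nm (teval z t) ^+ 2); first exact: (tev_nsq w0_ex Kt zi).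
rewrite sqr_ge0 (le_trans _ mB) //; have := BP t Kt.
by rewrite (tev_nsq w0_ex Kt zi) nm_real ger0_norm // sqr_ge0.
Qed.

Lemma BorZ_chi : BorZ (chi kap z).
Proof.
have [m [C [m0 C0 <- h]]] := cutoff_seq.
by apply: BorZ_level => //; apply: BorZ_tev; exact: nsq_inv.
Qed.

(** The elements [zz k], polynomials in [z] times its star, tend to [chi] pointwise on [Kpt], but to
    1 in the weighted norm for some [e > 1]. As [a -> Ispec (a b_r)] is continuous for that norm,
    the part outside the cutoff integrates to zero. *)
Lemma chi_orth a : Ispec (fun t => teval (a * bpol r) t * (1 - chi kap z t)) = 0.
Proof.
have [m [C [m0 C0 Cm hC]]] := cutoff_seq; have k0 := kap_gt0.
have e11 : 1 <= 1 :> R by [].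
have g0 f := gnorm_ge0 (Wt_ge0 r e11) f.
have gs : gn r 1 z < Num.sqrt kap.
  rewrite -ltr_sqr ?nnegrE ?sqrtr_ge0 ?g0 // sqr_sqrtr // ltW //.
have [e1 e11' h1] := gn_perturb gs.
have [e2 e22' h2] := gn_perturb (le_lt_trans (gn_gstar Kr zi) gs).
pose e := Num.min e1 e2; have e1' : 1 < e by rewrite lt_min e11'.
have e1l := ltW e1'; have W0 := Wt_ge0 r e1l; have WM := Wt_M r e1l; have W1 := Wt_1 r e.
have {}g0 f : 0 <= gn r e f := gnorm_ge0 W0 f.
set G := gn r e (nsq z); have Gk : G < kap.
  apply: le_lt_trans (gnormM W0 WM _ _) _; rewrite -[kap]sqr_sqrtr ?(ltW k0) // expr2.
  by apply: ltr_pM => //; [apply: h1|apply: h2]; rewrite e1l ge_min lexx ?orbT.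
pose u := mono (C^-1)%:CC 0 * nsq z.
have uG : gn r e u <= G / C.
  apply: le_trans (gnormM W0 WM _ _) _; rewrite gnorm_mono W1 mulr1 nm_real ger0_norm ?invr_ge0 ?(ltW C0) //.
  by rewrite mulrC.
pose zz k := (1 - u ^+ k) ^+ (k * m ^ k).
have zzE k t : teval (zz k) t = thr m k (teval (nsq z) t * (C^-1)%:CC).
  by rewrite tevX tevB tev1 tevX tevM tev_mono tchar0 mulr1 mulrC.
pose N k := (k * m ^ k)%N.
have gz k : gn r e (1 - zz k) <= (1 + (G / C) ^+ k) ^+ (N k) - 1.
  have -> : zz k = \prod_(i <- iota 0 (N k)) (1 - u ^+ k) by rewrite big_const_seq count_predT size_iota iter_mulr_1.
  rewrite -gnormN opprB -[X in _ <= _ ^+ X - 1](size_iota 0).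
  have c0 : 0 <= (G / C) ^+ k by rewrite exprn_ge0 // divr_ge0 // ?(ltW C0) //; exact: g0.
  apply: (gnorm_prod1 W0 WM (s := iota 0 (N k)) (F := fun=> u ^+ k) c0) => i _.
  apply: le_trans (gnormX W0 WM W1 _ _) _; rewrite lerXn2r ?nnegrE //.
  by rewrite divr_ge0 // ?(ltW C0) //; exact: g0.
have Nk k : (N k)%:R * (G / C) ^+ k = k%:R * (G / kap) ^+ k.
  rewrite /N natrM natrX -mulrA -exprMn; congr (_ * _ ^+ _); rewrite -Cm; field.
  by rewrite pnatr_eq0 -lt0n m0 gt_eqF.
have small e' : 0 < e' -> exists n0 : nat, forall k, (n0 <= k)%N -> gn r e (1 - zz k) < e'.
  move=> e0; pose e3 := Num.min (2^-1) (e' / 4); have e30 : 0 < e3 by rewrite lt_min invr_gt0 //= divr_gt0 // ltr0n.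
  have r0 : 0 <= G / kap by rewrite divr_ge0 // ?(ltW k0) //; exact: g0.
  have r1 : G / kap < 1 by rewrite ltr_pdivrMr // mul1r.
  have [n0 h] := n_exp_small r0 r1 e30; exists n0 => k /h; rewrite -Nk lt_min => /andP[b1 b2].
  have c0 : 0 <= (G / C) ^+ k by rewrite exprn_ge0 // divr_ge0 // ?(ltW C0) //; exact: g0.
  have := pow_grow c0 (ltW b1); have := gz k; move: b2 e0; clear; lra.
have [K K0 KP] := Ispec_growth r e1'.
have lim0 : ccvg (fun k => Ispec (teval (a * (1 - zz k) * bpol r))) 0.
  move=> e' e0; have a0 : 0 <= K * gn r e a by rewrite mulr_ge0.
  have [n0 h] := small (e' / (K * gn r e a + 1)) (divr_gt0 e0 (ltr_wpDl a0 ltr01)).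
  exists n0 => k /h hk; rewrite subr0; apply: le_lt_trans (KP _) _.
  apply: le_lt_trans (ler_wpM2l K0 (gnormM W0 WM _ _)) _; rewrite mulrA.
  by apply: (nm_small a0 e0 hk); exact: g0.
apply: ccvg_uniq lim0.
have [B BP] := tev_bounded A (a * bpol r).
pose U k t := teval (a * (1 - zz k) * bpol r) t.
have UE k t : U k t = teval (a * bpol r) t * (1 - thr m k (teval (nsq z) t * (C^-1)%:CC)).
  by rewrite /U [LHS]tevM [X in X * _]tevM tevM tevB tev1 zzE [LHS]mulrAC.
have vE t : Kpt t -> exists2 v : R, teval (nsq z) t * (C^-1)%:CC = v%:CC & 0 <= v <= 1 /\
    (complex.Re (teval (nsq z) t) < kap) = (v < m%:R^-1).
  move=> Kt; have [v -> /andP[v0 vC]] := hC t Kt; exists (v / C); first by rewrite rmorphM.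
  split; last by rewrite /= ltr_pdivrMr // mulrC Cm.
  by apply/andP; split; [exact: divr_ge0 v0 (ltW C0)|rewrite ler_pdivrMr // mul1r].
apply: (Bor_dct muP (P := fun=> True) (B := B * 2) (u := U) (f := fun t => teval (a * bpol r) t * (1 - chi kap z t))).
- by move=> k; exact: BorA_tev.
- move=> k t Kt; rewrite UE nmM; apply: ler_pM; rewrite ?nm_ge0 //; first exact: BP.
  have [v -> [v01 _]] := vE t Kt; apply: le_trans (nmB _ _) _; rewrite nm1.
  by have := thr_bd m k v01; lra.
- move=> t Kt; apply: (ccvg_ext (u := fun k => teval (a * bpol r) t * (1 - thr m k (teval (nsq z) t * (C^-1)%:CC)))).
    by move=> k; rewrite UE.
  apply: ccvgM; first exact: ccvg_cst.
  have [v -> [v01 E]] := vE t Kt; rewrite /chi E.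
  move=> e' e0; have [n0 h] := thr_lim m0 v01 e0; exists n0 => k /h.
  rewrite -nmN => hh; apply: le_lt_trans hh; rewrite le_eqVlt; apply/orP; left; apply/eqP; congr nm; ring.
Qed.

Lemma Ispec_orth (g : torus -> R[i]) : BorA g -> (forall a, Ispec (fun t => teval a t * g t) = 0) ->
  forall f : torus -> R[i], BorA f -> Ispec (fun t => f t * g t) = 0.
Proof.
move=> bg h f; elim=> [a {}f _ E|u {}f B hu IH hB hc].
  by rewrite -[RHS](h a); apply: Ispec_ext => t Kt; rewrite E.
have [C CP] := Bor_bounded bg.
apply: (ccvg_uniq (l := Ispec (fun t => f t * g t)) (u := fun n => Ispec (fun t => u n t * g t))).
  apply: (Bor_dct muP (P := fun=> True) (B := B * C) (u := fun n t => u n t * g t) (f := fun t => f t * g t)) => [n|n t Kt|t Kt].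
  - by apply: BorAM => //; exact: hu.
  - by rewrite nmM; apply: ler_pM; rewrite ?nm_ge0 //; [exact: hB|exact: CP].
  - by apply: ccvgM; [exact: hc|exact: ccvg_cst].
by move=> e e0; exists 0%N => n _; rewrite IH subrr nm0.
Qed.

(** Orthogonality to A extends to limits, in particular to the conjugate of [bpol r]; the integrand
    becomes nonnegative, so that its vanishing integral gives a statement about the support. *)
Lemma chi_null : Ispec (fun t => (nm (teval (bpol r) t) ^+ 2)%:CC * (1 - chi kap z t)) = 0.
Proof.
have bchi := BorZA (BorZ_C1 BorZ_chi); have bb := BorA_tev A (bpol r).
have bg : BorA (fun t => teval (bpol r) t * (1 - chi kap z t)) by exact: BorAM.
rewrite -[RHS](Ispec_orth bg _ (BorA_conj_tev A w0_ex (bpol r))).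
  by apply: Ispec_ext => t _; rewrite nm_sq mulrA (mulrC (_^*)).
by move=> a; rewrite -[RHS](chi_orth a); apply: Ispec_ext => t _; rewrite tevM mulrA.
Qed.

Lemma supp_negl : mu.-negligible [set d : spectrumB p0 | exists2 t, t \in wts d &
  teval (bpol r) t != 0 /\ kap <= nm (teval z t) ^+ 2].
Proof.
pose g t := (nm (teval (bpol r) t) ^+ 2)%:CC * (1 - chi kap z t).
pose gr t : R := nm (teval (bpol r) t) ^+ 2 * (1 - (complex.Re (teval (nsq z) t) < kap)%R%:R).
have gE t : g t = (gr t)%:CC.
  by rewrite /g /gr /chi; case: (_ < _)%R; rewrite /= ?subrr ?mulr0 ?subr0 ?mulr1 // rmorph0.
have gr0 t : 0 <= gr t by rewrite mulr_ge0 ?sqr_ge0 // subr_ge0 lern1 leq_b1.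
have SE d : Sf g d = (\sum_(t <- wts d) gr t)%:CC by rewrite /Sf rmorph_sum; apply: eq_bigr.
have bg : BorA g.
  apply: BorAM; last exact: BorZA (BorZ_C1 BorZ_chi).
  apply: Bor_ext (BorAM (BorA_tev A (bpol r)) (BorA_conj_tev A w0_ex (bpol r))) => t _.
  by rewrite nm_sq.
have [iR _] := Bor_int muP bg; pose f d := complex.Re (Sf g d).
have f0 d : 0 <= f d by rewrite /f SE; apply: sumr_ge0.
have I0 : (\int[mu]_d `|(f d)%:E| = 0)%E.
  under eq_integral do rewrite gee0_abs ?lee_fin //.
  have := congr1 (fun y : R[i] => complex.Re y) chi_null; rewrite /= -/f => h.
  rewrite -(@fineK _ (\int[mu]_d (f d)%:E)%E); first by congr EFin.
  exact: integrable_fin_num.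
have mf : measurable_fun setT (EFin \o f) by exact: measurable_int iR.
have := proj1 (ae_eq_integral_abs mu measurableT mf) I0.
apply: negligibleS => d [t tw [bt kt]] /(_ I) [fd0].
have Kt := wts_Kpt tw.
have : gr t <= f d.
  by rewrite /f SE /= (big_rem t) //= lerDl; apply: sumr_ge0.
rewrite fd0 /gr (tev_nsq w0_ex Kt zi) /= ltNge kt subr0 mulr1 leNgt => /negP; apply.
by rewrite exprn_gt0 // nm_gt0.
Qed.

End Cutoff.

(** Chosen so that [(1 + 1/Csup)^n - 1 <= 1/2] for [n] the order of W_0, as used in [support]. *)
Definition Csup : R := 4 * (size (W0s D))%:R.

Lemma W0s_gt0 : (0 < size (W0s D))%N.
Proof.
case E : (W0s D) => [|w s] //; have : id \in W0s D by apply/mem_W0s; constructor.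
by rewrite E.
Qed.

(* With [c = 1 / t y], the invariant element [prod_w (1 - c theta_{w y}) - 1] is [-1] at [t] and small at [r]. *)
Lemma support r y : Kpt r -> (forall w, W0 w -> nm (r (w y)) <= nm (r y)) ->
  mu.-negligible [set d : spectrumB p0 | exists2 t, t \in wts d &
    teval (bpol r) t != 0 /\ Csup * nm (r y) < nm (t y)].
Proof.
move=> Kr ry; have e11 : 1 <= 1 :> R by [].
have n0 : (0 : R) < (size (W0s D))%:R by rewrite ltr0n W0s_gt0.
have C0 : 0 < Csup by rewrite mulr_gt0.
pose Q (E : set torus) := mu.-negligible [set d : spectrumB p0 | exists2 t, t \in wts d &
    E t /\ teval (bpol r) t != 0 /\ Csup * nm (r y) < nm (t y)].
suff : Q Kpt by apply: negligibleS => d [t tw h]; exists t => //; split => //; exact: wts_Kpt tw.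
apply: (@K_ind R D L H V A Q) => [E E' sub|E E' h h'||t0 Kt0].
- by apply: negligibleS => d [t tw [/sub Et h]]; exists t.
- by apply: negligibleS (negligibleU h h') => d [t tw [[Et|Et] hh]]; [left|right]; exists t.
- by apply: negligibleS (negligible_set0 mu) => d [t tw []].
have [lt|le] := ltP (nm (t0 y)) (Csup * nm (r y)).
  exists [fset y]%fset, (Csup * nm (r y) - nm (t0 y)); split; first by rewrite subr_gt0.
  apply: negligibleS (negligible_set0 mu) => d [t tw [[_ h] [_ h2]]].
  have := h y; rewrite inE => /(_ (eqxx _)) h1; have := nmD (t y - t0 y) (t0 y); rewrite subrK; lra.
pose F w := mono (t0 y)^-1 (w y).
pose z := \prod_(w <- W0s D) (1 - F w) - 1.
have zi : W0_inv z.
  apply: invD; last by apply: invN; exact: inv1.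
  apply: inv_prodW => w v ww vv; by rewrite /F (gpushB w) (gpush1 _ (W0_0 ww)) gpush_mono.
have zt : teval z t0 = -1.
  rewrite tevB tev1 (_ : teval _ t0 = 0) ?sub0r // tev_prod.
  apply/eqP; rewrite prodf_seq_eq0; apply/hasP; exists id; first by apply/mem_W0s; exact: W0_id.
  by rewrite /= tevB tev1 tev_mono mulVf ?t_neq0 // subrr.
have zg : gn r 1 z <= 2^-1.
  have c0 : 0 <= Csup^-1 by rewrite invr_ge0 ltW.
  have nC : (size (W0s D))%:R * Csup^-1 = 4^-1.
    by rewrite /Csup invfM mulrCA mulfV ?mulr1 // gt_eqF.
  apply: le_trans (gnorm_prod1 (Wt_ge0 r e11) (Wt_M r e11) (s := W0s D) (F := F) c0 _) _.
    move=> w /mem_W0s ww; rewrite gnorm_mono /Wt expr1n mulr1 nmV.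
    rewrite mulrC ler_pdivrMr ?nm_gt0 ?t_neq0 // mulrC ler_pdivlMr // mulrC.
    by apply: le_trans le; apply: ler_wpM2l; [exact: ltW|exact: ry].
  have := @pow_grow (Csup^-1) (size (W0s D)) c0; rewrite nC => h; have := h _; lra.
(* The threshold 1/3 separates 1/4, the bound for the squared norm at [r], from 9/16, the lower
   bound for |z|^2 near [t0]. *)
have zk : gn r 1 z ^+ 2 < 3^-1.
  have := gnorm_ge0 (Wt_ge0 r e11) z; move: (gn r 1 z) zg => g g1 g0.
  apply: le_lt_trans (_ : 2^-1 ^+ 2 < _); last by rewrite expr2; lra.
  by rewrite ler_sqr ?nnegrE // invr_ge0.
have q0 : (0 : R) < 4^-1 by rewrite invr_gt0.
have [S [e [e0 h]]] := tev_cont z t0 q0; exists S, e; split => //.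
apply: negligibleS (supp_negl Kr zi zk) => d [t tw [[_ /h ht] [bt _]]]; exists t => //; split => //.
have : 3 / 4 <= nm (teval z t).
  have := nmD (teval z t0 - teval z t) (teval z t); rewrite subrK zt nmN nm1 -zt -(nmN (_ - _)) opprB; lra.
move=> h3; apply: le_trans (_ : (3 / 4) ^+ 2 <= _); first by rewrite expr2; lra.
by rewrite ler_sqr // nnegrE ?nm_ge0 //; lra.
Qed.

End Support.

(** * Asymptotics along a ray *)

Section Asymptotics.
Variables (R : realType) (D : rootDatum).
Local Notation X := (latX D).
Local Notation galg := (galg R[i] X).
Local Notation mono := (@gmono R[i] X).
Local Notation FF := (@FF R D).
Local Notation d0 := (@d0 R D).
Local Notation nb := (@nb R D).
Implicit Types (F G : X -> R[i]) (b x y z v : X) (f g : galg) (Q : seq X) (c : R[i]).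

Lemma gact0 F x : gact (0 : galg) F x = 0.
Proof. by apply: (addrI (gact 0 F x)); rewrite -gactD !addr0. Qed.

Lemma gactDr f F G x : gact f (fun y => F y + G y) x = gact f F x + gact f G x.
Proof. by rewrite /gact -big_split; apply: eq_bigr => z _; rewrite mulrDr. Qed.

Lemma nb0 : nb 0 = 0. Proof. by rewrite /nb gmono1 subrr. Qed.

Lemma nbD x y : nb (x + y) = nb x + mono 1 x * nb y.
Proof. by rewrite /nb mulrBr mulr1 gmonoM mulr1 addrA subrK. Qed.

Lemma nbN x : nb (- x) = - (mono 1 (- x) * nb x).
Proof. by rewrite /nb mulrBr mulr1 gmonoM mulr1 addNr gmono1 opprB. Qed.

Definition aug f : R[i] := gev (fun=> 1 : R[i]^o) f.

Lemma augM f g : aug (f * g) = aug f * aug g.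
Proof.
rewrite /aug gevM /gev -[RHS]/(_ * _) mulr_suml; apply: eq_bigr => x _.
exact/esym/mulr_algl.
Qed.
Lemma aug_mono c x : aug (mono c x) = c.
Proof. by rewrite /aug gev_mono -[LHS]/(_ * _) mulr1. Qed.
Lemma aug1 : aug 1 = 1. Proof. by rewrite -gmono1 aug_mono. Qed.
Lemma augB f g : aug (f - g) = aug f - aug g. Proof. by rewrite /aug gevD gevN. Qed.
Lemma aug_sum I (s : seq I) (h : I -> galg) : aug (\sum_(i <- s) h i) = \sum_(i <- s) aug (h i).
Proof. exact: gev_sum. Qed.
Lemma aug_prod I (s : seq I) (P : pred I) (h : I -> galg) :
  aug (\prod_(i <- s | P i) h i) = \prod_(i <- s | P i) aug (h i).
Proof. exact: (big_morph _ augM aug1). Qed.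
Lemma augX f n : aug (f ^+ n) = aug f ^+ n.
Proof. by elim: n => [|n IH]; rewrite ?aug1 // !exprS augM IH. Qed.
Lemma aug_nb x : aug (nb x) = 0. Proof. by rewrite augB aug1 aug_mono subrr. Qed.
Lemma aug_gtw (r : torus R D) f : aug (gtw r f) = teval f r.
Proof.
rewrite /gtw aug_sum /teval; apply: eq_bigr => x _; exact: aug_mono.
Qed.

(** Submodules over the group algebra. For such [K] and given [F], the [z] for which [K] contains
    the difference of [F] along [z] are closed under sums and negatives. *)
Definition stable (K : (X -> R[i]) -> Prop) :=
  (forall F G, K F -> K G -> K (fun x => F x + G x)) /\ (forall f F, K F -> K (gact f F)).

Section Stable.
Variable K : (X -> R[i]) -> Prop.
Hypothesis sK : stable K.

Lemma stable0 F : K F -> K (fun=> 0).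
Proof.
move=> KF; have := sK.2 0 F KF; congr K; apply/funext => x; exact: gact0.
Qed.

Lemma stable_D F x y : K (gact (nb x) F) -> K (gact (nb y) F) -> K (gact (nb (x + y)) F).
Proof.
move=> h h'; have := sK.1 _ _ h (sK.2 (mono 1 x) _ h'); congr K; apply/funext => z.
by rewrite nbD gactD [in RHS]gactM.
Qed.

Lemma stable_N F x : K (gact (nb x) F) -> K (gact (nb (- x)) F).
Proof.
move=> h; have := sK.2 (- mono 1 (- x)) _ h; congr K; apply/funext => z.
by rewrite nbN -mulNr [in RHS]gactM.
Qed.

Lemma stable_span F (S : seq X) (c : X -> int) : K (gact (nb 0) F) ->
  (forall b, b \in S -> K (gact (nb b) F)) -> K (gact (nb (\sum_(b <- S) b *~ c b)) F).
Proof.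
move=> K0; elim: S => [|b S IH] h; first by rewrite big_nil.
rewrite big_cons; apply: stable_D; last by apply: IH => d dS; apply: h; rewrite inE dS orbT.
have hb := h b (mem_head _ _).
have Kn n : K (gact (nb (b *+ n)) F).
  by elim: n => [|n IHn]; rewrite ?mulr0n // mulrS; apply: stable_D.
by case: (c b) => n; [exact: Kn|rewrite NegzE mulrNz; apply: stable_N; exact: Kn].
Qed.

End Stable.

Variable Y : X.

Definition null F := forall v, ccvg (fun k => F (Y *+ k + v)) 0.

Lemma null_stable : stable null.
Proof.
split=> [F G hF hG v|f F hF]; first by rewrite -[0]addr0; apply: ccvgD.
move: f; apply: gind => [v|c x v|f g hf hg v].
- by apply: (ccvg_ext (u := fun=> 0)) (ccvg_cst 0) => k; rewrite gact0.
- rewrite -(mulr0 c); apply: (ccvg_ext (u := fun k => c * F (Y *+ k + (v + x)))).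
    by move=> k; rewrite gact_mono addrA.
  by apply: ccvgM; [exact: ccvg_cst|exact: hF].
- rewrite -[0]addr0; apply: (ccvg_ext (u := fun k => gact f F (Y *+ k + v) + gact g F (Y *+ k + v))).
    by move=> k; rewrite gactD.
  by apply: ccvgD; [exact: hf|exact: hg].
Qed.

(* Modulo null functions a translation invariant function is an eigenvector of every [gact f]. *)
Lemma null_aug f F : (forall z, null (gact (nb z) F)) -> null (fun x => gact f F x - aug f * F x).
Proof.
move=> h; move: f; apply: gind => [v|c z v|f g hf hg v].
- apply: (ccvg_ext (u := fun=> 0)) (ccvg_cst 0) => k.
  by rewrite gact0 /aug gev0 mul0r subrr.
- rewrite -(mulr0 (- c)); apply: (ccvg_ext (u := fun k => (- c) * gact (nb z) F (Y *+ k + v))).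
    by move=> k; rewrite gact_nb gact_mono aug_mono; ring.
  by apply: ccvgM; [exact: ccvg_cst|exact: h].
- rewrite -[0]addr0; apply: ccvg_ext (ccvgD (hf v) (hg v)) => k.
  by rewrite gactD /aug gevD; ring.
Qed.

Variable M : nat.
Hypothesis M0 : (0 < M)%N.

(** Annihilated, up to null functions, by any [n] successive differences along multiples of [M]: the
    analogue of a quasi-polynomial of period [M] and degree less than [n]. *)
Fixpoint KN n F : Prop := if n is n'.+1 then forall v, KN n' (gact (nb (v *+ M)) F) else null F.

Lemma KN_stable n : stable (KN n).
Proof.
elim: n => [|n IH]; first exact: null_stable.
split=> [F G hF hG v|f F hF v] /=.
  have := IH.1 _ _ (hF v) (hG v); congr KN; apply/funext => x; by rewrite gactDr.
by rewrite -gactM mulrC gactM; apply: IH.2.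
Qed.

Lemma null_KN n F : null F -> KN n F.
Proof.
elim: n F => [//|n IH] F h v; apply: IH; exact: null_stable.2.
Qed.

Definition Zspan (S : {fset X}) x := exists c : X -> int, x = \sum_(b <- S) b *~ c b.

(* The partition function of [Q]. *)
Definition pQ Q : X -> R[i] :=
  if pselect ({subset Q <= roots D}) is left h then sval (cid (part_ex R h)) else fun=> 0.

Lemma pQP Q : {subset Q <= roots D} -> [/\ FF (pQ Q), gact (nbs R Q) (pQ Q) = d0, EG (pQ Q),
  IG (pQ Q) & forall U : X -> Prop, U 0 -> (forall b x, b \in Q -> U x -> U (x + b) /\ U (x - b)) -> SG U (pQ Q)].
Proof. by move=> h; rewrite /pQ; case: pselect => // h'; exact: (svalP (cid (part_ex R h'))). Qed.

Lemma pQ_rem Q b : {subset Q <= roots D} -> b \in Q -> gact (nb b) (pQ Q) = pQ (rem b Q).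
Proof.
move=> Qr bQ; have Rr : {subset rem b Q <= roots D} by move=> c /mem_rem/Qr.
have [f1 e1 _ _ _] := pQP Qr; have [f2 e2 _ _ _] := pQP Rr.
apply: (FF_nbs_inj Rr) => //; first exact: FF_gact.
rewrite -gactM e2 -e1; congr gact; rewrite /nbs [RHS](big_rem b) //= mulrC //.
Qed.

Definition fseq Q : {fset X} := [fset x in Q]%fset.

(** A difference along a root of [Q] removes it from the partition function. If [Q] spans all
    multiples of [M], any difference along these is a combination of such, and induction on the size
    applies. *)
Lemma kill Q : {subset Q <= roots D} ->
  (forall Q', {subset Q' <= roots D} -> null (pQ Q') \/ forall v, Zspan (fseq Q') (v *+ M)) ->
  KN (size Q).+1 (pQ Q).
Proof.
move=> Qr dich; elim: {Q}(size Q) {-2}Q (erefl (size Q)) Qr => [|n IH] Q sQ Qr.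
  have [h|sp] := dich Q Qr; first exact: null_KN.
  move=> v /=; have [c ->] := sp v; rewrite (size0nil sQ).
  have -> : fseq [::] = fset0 by apply/fsetP => x; rewrite !inE.
  by rewrite big_seq_fset0 nb0 => u; apply: (ccvg_ext (u := fun=> 0)) (ccvg_cst 0) => k; rewrite gact0.
have [h|sp] := dich Q Qr; first exact: null_KN.
rewrite sQ => v; have [c ->] := sp v; apply: (stable_span (KN_stable n.+1)).
  have := stable0 (KN_stable n.+1) (null_KN n.+1 (F := fun=> 0) _); rewrite nb0.
  move=> h; have -> : gact 0 (pQ Q) = fun=> 0 by apply/funext => x; exact: gact0.
  by apply: h => u; exact: ccvg_cst.
move=> b; rewrite !inE /= => bQ; rewrite pQ_rem //.
have sr : size (rem b Q) = n by rewrite size_rem // sQ.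
have rr : {subset rem b Q <= roots D} by move=> x /mem_rem/Qr.
by have := IH _ sr rr; rewrite sr.
Qed.

Lemma Zspan0 (S : {fset X}) : Zspan S 0.
Proof. by exists (fun=> 0); rewrite big1. Qed.

Lemma ZspanB (S : {fset X}) x y : Zspan S x -> Zspan S y -> Zspan S (x - y).
Proof.
move=> [c ->] [c' ->]; exists (fun b => c b - c' b); rewrite -sumrB.
by apply: eq_bigr => b _; rewrite mulrzBr.
Qed.

Lemma ZspanN (S : {fset X}) x : Zspan S x -> Zspan S (- x).
Proof. by move=> h; rewrite -sub0r; apply: ZspanB => //; exact: Zspan0. Qed.

Lemma ZspanD (S : {fset X}) x y : Zspan S x -> Zspan S y -> Zspan S (x + y).
Proof. by move=> h h'; rewrite -(opprK y); apply: ZspanB => //; exact: ZspanN. Qed.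

Lemma ZspanMn (S : {fset X}) x n : Zspan S x -> Zspan S (x *+ n).
Proof. by move=> h; elim: n => [|n IH]; [exact: Zspan0|rewrite mulrS; exact: ZspanD]. Qed.

Lemma ZspanMz (S : {fset X}) x (n : int) : Zspan S x -> Zspan S (x *~ n).
Proof.
move=> h; case: n => n; first exact: ZspanMn.
by rewrite NegzE mulrNz; apply: ZspanN; exact: ZspanMn.
Qed.

Lemma Zspan_mem (S : {fset X}) b : b \in S -> Zspan S b.
Proof.
move=> bS; exists (fun y => Posz (y == b)); rewrite (big_rem b) //= eqxx mulr1z big_seq big1 ?addr0 // => y.
by rewrite mem_rem_uniq ?fset_uniq // !inE => /andP[/negPf->].
Qed.

Definition Qspan (S : {fset X}) x := exists2 m : nat, (0 < m)%N & Zspan S (x *+ m).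

(** The partition function lives on the lattice spanned by [Q]. Two points of the ray in it would
    differ by a multiple of [Y], so the ray meets it at most once. *)
Lemma pQ_null Q : {subset Q <= roots D} -> ~ Qspan (fseq Q) Y -> null (pQ Q).
Proof.
move=> Qr nY v; have [_ _ _ _ su] := pQP Qr.
have {}su x : pQ Q x != 0 -> Zspan (fseq Q) x.
  apply: (su (Zspan (fseq Q))); first exact: Zspan0.
  move=> b y bQ h; have bS : Zspan (fseq Q) b by apply: Zspan_mem; rewrite !inE.
  by split; [exact: ZspanD|exact: ZspanB].
have [B hB] : exists B, forall k, (B <= k)%N -> pQ Q (Y *+ k + v) = 0.
  have [[k0 h0]|no] := pselect (exists k, pQ Q (Y *+ k + v) != 0); last first.
    by exists 0%N => k _; apply/eqP/negPn/negP => n; apply: no; exists k.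
  exists k0.+1 => k kk; apply/eqP/negPn/negP => h1; apply: nY; exists (k - k0)%N; first by rewrite subn_gt0.
  rewrite mulrnBr ?(ltnW kk) // (_ : _ - _ = (Y *+ k + v) - (Y *+ k0 + v)); first by apply: ZspanB; exact: su.
  by rewrite opprD addrACA subrr addr0.
by move=> e e0; exists B => k /hB->; rewrite subrr nm0.
Qed.

End Asymptotics.

(** * Generic directions *)

Section Generic.
Variables (R : realType) (D : rootDatum).
Local Notation X := (latX D).
Implicit Types (x y u : X) (S : {fset X}).

Definition pureG (G : X -> Prop) := [/\ G 0, forall x y, G x -> G y -> G (x - y) &
  forall x m, (0 < m)%N -> G (x *+ m) -> G x].

Lemma bounds (P : nat -> nat -> Prop) n : (forall i, (i < n)%N -> exists B, forall m, (B <= m)%N -> P i m) ->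
  exists B, forall i m, (i < n)%N -> (B <= m)%N -> P i m.
Proof.
elim: n => [|n IH] h; first by exists 0%N.
have [i ni|B hB] := IH; first by apply: h; rewrite ltnS ltnW.
have [B' hB'] := h n (leqnn _); exists (maxn B B') => i m.
rewrite geq_max ltnS leq_eqVlt => /orP[/eqP->|ni] /andP[b b']; [exact: hB'|exact: hB].
Qed.

(** A good point for the first groups is moved along some [u] outside the last one. A proper group
    contains [Y + m u] for at most one [m], since two of them would put [u], and then [Y], into
    it. *)
Lemma avoid (G : nat -> X -> Prop) n : (forall i, (i < n)%N -> pureG (G i)) ->
  exists Y, forall i, (i < n)%N -> (exists u, ~ G i u) -> ~ G i Y.
Proof.
elim: n => [|n IH] h; first by exists 0.
have [i ni|Y hY] := IH; first by apply: h; rewrite ltnS ltnW.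
have [[u nu]|no] := pselect (exists u, ~ G n u); last first.
  exists Y => i; rewrite ltnS leq_eqVlt => /orP[/eqP->|ni]; [by move=> /no|exact: hY].
have diff i m m' : pureG (G i) -> (m < m')%N -> G i (Y + u *+ m) -> G i (Y + u *+ m') -> G i u.
  move=> [_ GB GM] mm g g'; apply: (GM _ (m' - m)%N); first by rewrite subn_gt0.
  by have := GB _ _ g' g; rewrite mulrnBr ?(ltnW mm) // opprD addrACA subrr add0r.
have [B hB] : exists B, forall i m, (i < n.+1)%N -> (B <= m)%N -> (exists v, ~ G i v) -> ~ G i (Y + u *+ m).
  apply: bounds => i ni; have pG := h i ni.
  have [[m0 g0]|none] := pselect (exists m, G i (Y + u *+ m)); last by exists 0%N => m _ _ g; apply: none; exists m.
  exists m0.+1 => m mm ex g; have gu := diff i m0 m pG mm g0 g.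
  move: ni; rewrite ltnS leq_eqVlt => /orP[/eqP E|ni]; first by rewrite E in gu.
  apply: (hY i ni ex); case: pG => G0 GB _.
  have gm : G i (u *+ m0).
    elim: (m0) => [//|k gk]; rewrite mulrS -(opprK (u *+ k)); apply: (GB _ _ gu).
    by rewrite -sub0r; apply: (GB _ _ G0).
  by have := GB _ _ g0 gm; rewrite addrK.
by exists (Y + u *+ B) => i ni ex; apply: hB.
Qed.

Lemma Qspan_pure S w : W0 w -> pureG (fun x => Qspan S (w x)).
Proof.
move=> ww; split.
- by exists 1%N => //; rewrite W0_0 // mulr1n; exact: Zspan0.
- move=> x y [m m0 hx] [m' m0' hy]; exists (m * m')%N; first by rewrite muln_gt0 m0.
  rewrite W0B // mulrnBl; apply: ZspanB; first by rewrite mulrnA; exact: ZspanMn.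
  by rewrite mulnC mulrnA; exact: ZspanMn.
- move=> x m m0 [m' m0' h]; exists (m * m')%N; first by rewrite muln_gt0 m0.
  by move: h; rewrite W0Mn // mulrnA.
Qed.

Lemma Qspan_common S : (forall x, Qspan S x) -> exists2 M, (0 < M)%N & forall x, Zspan S (x *+ M).
Proof.
move=> h; have [n [e eP]] := lattice_gen D.
have mP i := h (e i); pose m i := s2val (cid2 (mP i)).
have m0 i : (0 < m i)%N := s2valP (cid2 (mP i)).
have mS i : Zspan S (e i *+ m i) := s2valP' (cid2 (mP i)).
have [P P0 mP'] : exists2 P, (0 < P)%N & forall i, (m i %| P)%N.
  exists (\prod_i m i)%N; first by apply/prodn_gt0.
  by move=> i; rewrite (bigD1 i) //= dvdn_mulr.
exists P => // x; have [c [-> _]] := eP x; rewrite -sumrMnl.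
elim/big_rec: _ => [|i y _ IH]; first exact: Zspan0.
apply: ZspanD IH; rewrite pmulrn mulrzAC -pmulrn; apply: ZspanMz.
by have /dvdnP[k ->] := mP' i; rewrite mulnC mulrnA; apply: ZspanMn.
Qed.

Lemma Qspan_common_seq (l : seq {fset X}) : exists2 M, (0 < M)%N &
  forall S, S \in l -> (forall x, Qspan S x) -> forall x, Zspan S (x *+ M).
Proof.
elim: l => [|S l [M M0 hM]]; first by exists 1%N.
have [full|nfull] := pselect (forall x, Qspan S x).
  have [M' M0' hM'] := Qspan_common full; exists (M * M')%N; first by rewrite muln_gt0 M0.
  move=> S'; rewrite inE => /orP[/eqP->|S'l] fS' x; first by rewrite mulnC mulrnA; apply: ZspanMn.
  by rewrite mulrnA; apply: ZspanMn; exact: hM.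
by exists M => // S'; rewrite inE => /orP[/eqP->//|]; exact: hM.
Qed.

(** Genericity is imposed with respect to all W_0-images at once, so it survives the passage to the
    image of the direction that maximises |r|. *)
Lemma good_direction (r : torus R D) : exists (Y : X) (M : nat), [/\ (0 < M)%N,
  forall w, W0 w -> nm (r (w Y)) <= nm (r Y) &
  forall Q, {subset Q <= roots D} -> null Y (pQ R Q) \/ forall v, Zspan (fseq Q) (v *+ M)].
Proof.
pose l := allpairs pair (enum_fset (fpowerset (roots D))) (W0s D).
have [|Y0 hY0] := @avoid (fun i x => Qspan (nth ((fset0 : {fset X}), id) l i).1 ((nth ((fset0 : {fset X}), id) l i).2 x)) (size l).
  move=> i il; apply: Qspan_pure; have : nth ((fset0 : {fset X}), id) l i \in l by apply: mem_nth.
  by move=> /allpairsP[[S w] /= [_ /mem_W0s ww ->]].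
have [M M0 hM] := Qspan_common_seq (enum_fset (fpowerset (roots D))).
have [w [ww wmax]] : exists w, W0 w /\ forall v, W0 v -> nm (r (v Y0)) <= nm (r (w Y0)).
  have key (s : seq (X -> X)) : (forall v, v \in s -> W0 v) -> exists w, W0 w /\ forall v, v \in s -> nm (r (v Y0)) <= nm (r (w Y0)).
    elim: s => [|u s IH] hs; first by exists id; split => //; constructor.
    have [v vs|w [ww wm]] := IH; first by apply: hs; rewrite inE vs orbT.
    have [h|h] := leP (nm (r (w Y0))) (nm (r (u Y0))).
      exists u; split=> [|v]; first by apply: hs; exact: mem_head.
      by rewrite inE => /orP[/eqP->//|/wm h']; apply: le_trans h.
    by exists w; split=> // v; rewrite inE => /orP[/eqP->|/wm //]; exact: ltW.
  have [v /mem_W0s//|w [ww wm]] := key (W0s D); exists w; split => // v /mem_W0s; exact: wm.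
exists (w Y0), M; split => // [v vv|Q Qr].
  by apply: (wmax (v \o w)); exact: W0_comp.
have SP : fseq Q \in enum_fset (fpowerset (roots D)).
  by rewrite -[_ \in _]/(fseq Q \in fpowerset (roots D)) fpowersetE; apply/fsubsetP => x; rewrite !inE; exact: Qr.
have [full|nfull] := pselect (forall x, Qspan (fseq Q) x); first by right; exact: hM.
left; apply: pQ_null => //.
have pl : (fseq Q, w) \in l by apply/allpairsP; exists (fseq Q, w); split => //; apply/mem_W0s.
have := hY0 (index (fseq Q, w) l); rewrite index_mem nth_index //= => /(_ pl); apply.
apply: contrapT => no; apply: nfull => x; apply: contrapT => nx; apply: no.
by exists (winv w x); have /= -> := congr1 (@^~ x) (W_winvVr (W0_W ww)).
Qed.

End Generic.

Section AlmostEverywhere.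
Variables (R : realType) (dd : measure_display) (T : measurableType dd).
Variable mu : {measure set T -> \bar R}.

Lemma cintegral_norm_ae (f : T -> R[i]) (G : T -> R) (N : set T) : cintegrable mu f ->
  mu.-integrable setT (EFin \o G) -> (forall x, 0 <= G x) -> mu.-negligible N ->
  (forall x, ~ N x -> nm (f x) <= G x) -> nm (cintegral mu f) <= 2 * \int[mu]_x G x.
Proof.
move=> [a b] iG G0 nN h; apply: le_trans (nm_ReIm_le _) _ => /=; rewrite mulr_natl mulr2n.
have one k : mu.-integrable setT (EFin \o k) -> (forall x, ~ N x -> `|k x| <= G x) ->
    `|\int[mu]_x k x| <= \int[mu]_x G x.
  move=> ik hk; apply: le_trans (le_normr_Rintegral _ _) _ => //.
  have ik' := integrable_norm ik.
  apply: fine_le; [exact: integrable_fin_num|exact: integrable_fin_num|].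
  apply: ae_ge0_le_integral => //.
  - exact: measurable_int ik'.
  - by move=> x _; rewrite lee_fin.
  - exact: measurable_int iG.
  - apply: negligibleS nN => x /= nP; apply: contrapT => Nx; apply: nP => _.
    by rewrite lee_fin; exact: hk.
apply: lerD; apply: one => // x Nx; apply: le_trans (h x Nx); [exact: ler_Re|exact: ler_Im].
Qed.

End AlmostEverywhere.

(** * Atoms *)

Section Atoms.
Variables (R : realType) (D : rootDatum) (L : labels R D) (H : heckeAlgebra L).
Variables (V : hilbertCompletion H) (A : cstarCompletion V).
Variable w0 : latX D -> latX D.
Hypothesis w0l : @longest D w0.
Variables (p0 : irrep A) (mu : {measure set (spectrumB p0) -> \bar R}).
Hypothesis muP : is_plancherel mu.
Variable r : torus R D.
Hypothesis Kr : Kpt A r.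
Local Notation X := (latX D).
Local Notation qc w := ((qW L w)%:C%C).
Local Notation galg := (galg R[i] X).
Local Notation mono := (@gmono R[i] X).
Local Notation Kpt := (@Kpt R D L H V A).
Local Notation BorZ := (@BorZ R D L H V A).
Local Notation BorA := (@BorA R D L H V A).
Local Notation torus := (torus R D).
Local Notation nb := (@nb R D).
Local Notation delta := (@delta R D).
Local Notation Ispec := (Ispec mu).
Local Notation Fr := (@Fr R D L H r).
Local Notation b := (bpol L r).
Local Notation Csup := (@Csup R D).
Local Notation "x %:CC" := (x%:C%C : R[i]) (at level 2, format "x %:CC").
Implicit Types (a f z : galg) (t s : torus) (e : R) (w : X -> X) (x y v : X) (d : spectrumB p0).
Let w0_ex : exists w, @longest D w. Proof. by exists w0. Qed.

Definition pt s t : R[i] := (t == s)%:R.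

Lemma atom_interp s : exists a, [/\ teval a s = 1 & forall t, torus_orbit s t -> t != s -> teval a t = 0].
Proof.
pose l := [seq t <- [seq tact w s | w <- W0s D] | t != s].
have [|a [a1 a0]] := @interpolate1 R D l s; first by rewrite mem_filter eqxx.
exists a; split => // t /orbitP[w ww ->] ts; apply: a0.
by rewrite mem_filter ts; apply: map_f; apply/mem_W0s.
Qed.

Lemma orb_self s : torus_orbit s s.
Proof. by apply/orbitP; exists id; [constructor|apply: torus_ext => x; rewrite tactE //; constructor]. Qed.

Lemma BorA_pt s : BorA (pt s).
Proof.
have [a [a1 a0]] := atom_interp s.
apply: Bor_ext (BorAM (BorA_tev A a) (BorZA (BorZ_orb A w0_ex s))) => t _.
rewrite /pt /orb; case: asboolP => so.
  by rewrite mulr1; have [->|ts] := eqVneq t s; [rewrite a1|rewrite a0].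
rewrite mulr0; case: eqP => // E; case: so; rewrite E; exact: orb_self.
Qed.

(** An invariant peak is 1 on the whole orbit, and an interpolant cuts out the single point [r]. The
    function [h j] is the modulus of the invariant peak off the orbit, where the integrals tend to
    0. *)
Lemma peaks : exists (a : nat -> galg) (h : nat -> torus -> R) (C : R), [/\ forall j, teval (a j) r = 1,
  forall j t, 0 <= h j t /\ (Kpt t -> t != r -> nm (teval (a j) t) <= C * h j t),
  forall j, BorZ (fun t => (h j t)%:CC) & ccvg (fun j => Ispec (fun t => (h j t)%:CC)) 0].
Proof.
have [z [zi z01 z1 z0]] := peak A w0_ex r.
have [a [a1 a0]] := atom_interp r; have [C CP] := tev_bounded A a.
pose h j t : R := if `[< Kpt t /\ ~ torus_orbit r t >] then nm (teval (z j) t) else 0.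
have hE j t : Kpt t -> (h j t)%:CC = teval (z j) t * (1 - orb r t).
  move=> Kt; rewrite /h /orb; have [u E /andP[u0 u1]] := z01 j t Kt.
  have [so|so] := pselect (torus_orbit r t).
    by rewrite asboolF ?(asboolT so) ?subrr ?mulr0 // => -[].
  by rewrite asboolT // (asboolF so) subr0 mulr1 E nm_real ger0_norm.
have hB j : BorZ (fun t => (h j t)%:CC).
  apply: Bor_ext (BorZM (BorZ_tev A (zi j)) (BorZ_C1 (BorZ_orb A w0_ex r))) => t Kt.
  by rewrite hE.
have zle j t : Kpt t -> nm (teval (z j) t) <= 1.
  by move=> Kt; have [u -> /andP[u0 u1]] := z01 j t Kt; rewrite nm_real ger0_norm.
exists (fun j => z j * a), h, C; split.
- by move=> j; rewrite tevM a1 mulr1 z1 //; exact: orb_self.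
- move=> j t; split=> [|Kt tr]; first by rewrite /h; case: asboolP => _ //; exact: nm_ge0.
  rewrite tevM nmM /h; have [so|so] := pselect (torus_orbit r t).
    by rewrite a0 // nm0 mulr0 asboolF ?mulr0 // => -[].
  by rewrite asboolT // mulrC; apply: ler_wpM2r; [exact: nm_ge0|exact: CP].
- exact: hB.
- have E0 : Ispec (fun=> 0) = 0.
    rewrite -[RHS](mul0r (Ispec (fun=> 1))) -(IspecZ muP 0 (BorA_cst A 1)).
    by apply: Ispec_ext => t _; rewrite mul0r.
  rewrite -E0; apply: (Bor_dct muP (P := @W0_inv R D) (B := 1) (u := fun j t => (h j t)%:CC) (f := fun=> 0)).
  + exact: hB.
  + move=> j t Kt; rewrite nm_real /h; case: asboolP => _; rewrite ?normr0 // ger0_norm ?nm_ge0 //; exact: zle.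
  + move=> t Kt; rewrite /h; case: asboolP => [[_ so]|_]; last by rewrite rmorph0; exact: ccvg_cst.
    move=> e e0; have [N hN] := z0 t Kt so e e0; exists N => n /hN.
    by rewrite !subr0 nm_real ger0_norm ?nm_ge0.
Qed.

(** [support] for every multiple of [Y], with the countably many null sets united; the constant is
    the same for all [k]. *)
Lemma supp_null Y : (forall w, W0 w -> nm (r (w Y)) <= nm (r Y)) ->
  exists2 N : set (spectrumB p0), mu.-negligible N & forall d, ~ N d -> forall t, t \in wts d ->
    teval b t != 0 -> forall k, nm (t (Y *+ k)) <= Csup * nm (r (Y *+ k)).
Proof.
move=> rY; pose E k := [set d : spectrumB p0 | exists2 t, t \in wts d &
    teval b t != 0 /\ Csup * nm (r (Y *+ k)) < nm (t (Y *+ k))].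
have tX t x k : nm (t (x *+ k)) = nm (t x) ^+ k.
  rewrite -nmX; congr nm; elim: k => [|k IH]; first by rewrite mulr0n tchar0.
  by rewrite mulrS tcharD IH exprS.
exists (\bigcup_k E k).
  apply: negligible_bigcup => k; apply: (support w0_ex muP Kr) => w ww.
  by rewrite W0Mn // !tX lerXn2r ?nnegrE ?nm_ge0 // rY.
move=> d nd t tw bt k; rewrite leNgt; apply/negP => lt; apply: nd; exists k => //.
by exists t.
Qed.

Definition beta := teval b r * Ispec (pt r).

Lemma Fr_gtw a x : gact (gtw r a) Fr x = (r x)^-1 * Ispec (teval (mono 1 x * (a * b))).
Proof.
rewrite /Submission.Fr -twist_gact -gactM /twist gact_eT; congr (_ * _).
by have [_ ->] := Ispec_tev muP (mono 1 x * (a * b)); rewrite [in RHS]ThM Th_mono scale1r.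
Qed.

Section Sequence.
Variables (Y : X) (M : nat).
Hypotheses (M0 : (0 < M)%N) (rY : forall w, W0 w -> nm (r (w Y)) <= nm (r Y)).
Hypothesis dich : forall Q, {subset Q <= roots D} -> null Y (pQ R Q) \/ forall v, Zspan (fseq Q) (v *+ M).

(** The left term is [r(x)^-1] times the integral of [t(x) a_j(t) b(t)]. The factor
    [t(Y k) / r(Y k)] is bounded on the relevant weights, so the contribution of the points other
    than [r] is at most a multiple of the integral of [h j], uniformly in [k]. *)
Lemma estimate : exists (a : nat -> galg) (eps : nat -> R), [/\ forall j, teval (a j) r = 1,
  ccvg (fun j => (eps j)%:CC) 0, forall j, 0 <= eps j &
  forall v, exists2 K, 0 <= K & forall j k, nm (gact (gtw r (a j)) Fr (Y *+ k + v) - beta) <= K * eps j].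
Proof.
have [N nN hN] := supp_null rY; have [a [h [C [a1 ah hB hI]]]] := peaks.
pose SR j d : R := \sum_(t <- wts d) h j t.
have SE j d : Sf (fun t => (h j t)%:CC) d = (SR j d)%:CC by rewrite /Sf /SR rmorph_sum.
have SR0 j d : 0 <= SR j d by apply: sumr_ge0 => t _; have [] := ah j t.
have iS j : mu.-integrable setT (EFin \o SR j).
  by have [i1 _] := Bor_int muP (hB j); apply: eq_integrable i1 => // d _; rewrite /= SE.
pose eps j := \int[mu]_d SR j d.
have eE j : Ispec (fun t => (h j t)%:CC) = (eps j)%:CC.
  rewrite /Submission.Ispec /cintegral; apply/eqP; rewrite eq_complex /=; apply/andP; split; apply/eqP.
    by rewrite /eps; apply: eq_Rintegral => d _; rewrite SE.
  by under eq_Rintegral do rewrite SE /=; rewrite Rintegral_cst // mul0r.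
exists a, eps; split => //.
- by apply: ccvg_ext hI => j; rewrite eE.
- by move=> j; apply: Rintegral_ge0 => d _.
move=> v; have [Bb hBb] := tev_bounded A b; have [Bv hBv] := Kpt_bounded A v.
have Cs0 : 0 <= Csup by rewrite mulr_ge0.
pose K := Csup * (`|Bv| / nm (r v)) * `|C| * `|Bb|.
have K0 : 0 <= K by rewrite !mulr_ge0 // ?invr_ge0 nm_ge0.
exists (2 * K); first by rewrite mulr_ge0.
move=> j k; set x := Y *+ k + v.
pose g t := (r x)^-1 * teval (mono 1 x * (a j * b)) t - teval b r * pt r t.
have b1 : BorA (fun t => (r x)^-1 * teval (mono 1 x * (a j * b)) t).
  by apply: BorAM; [exact: BorA_cst|exact: BorA_tev].
have b2 : BorA (fun t => teval b r * pt r t) by apply: BorAM; [exact: BorA_cst|exact: BorA_pt].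
have bg : BorA g.
  apply: Bor_ext (BorAD b1 (BorAM (BorA_cst A (-1)) b2)) => t _.
  by rewrite /g mulN1r.
have -> : gact (gtw r (a j)) Fr x - beta = Ispec g.
  rewrite Fr_gtw /beta -(IspecZ muP _ (BorA_tev A _)) -(IspecZ muP _ (BorA_pt r)).
  by rewrite -(IspecB muP b1 b2).
have iG : mu.-integrable setT (EFin \o (fun d => K * SR j d)).
  rewrite (_ : _ \o _ = (fun d => K%:E * (SR j d)%:E)%E); first exact: (integrableZl _ _ (iS j)).
  by apply/funext.
have -> : 2 * K * eps j = 2 * \int[mu]_d (K * SR j d) by rewrite RintegralZl // -mulrA.
apply: (cintegral_norm_ae (Bor_int muP bg) iG _ nN) => [d|d Nd]; first exact: mulr_ge0.
apply: le_trans (nm_sum _ _ _) _; rewrite /SR mulr_sumr big_seq [leRHS]big_seq.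
apply: ler_sum => t tw; have Kt := wts_Kpt tw; have [h0 ha] := ah j t.
have gE t' : teval (mono 1 x * (a j * b)) t' = t' x * (teval (a j) t' * teval b t').
  by rewrite !tevM tev_mono mul1r.
rewrite /g /pt; have [->|tr] := eqVneq t r.
  rewrite gE a1 mul1r mulr1 mulKf ?t_neq0 // subrr nm0.
  by rewrite mulr_ge0 //; have [] := ah j r.
rewrite mulr0 subr0 gE; have [->|bt] := eqVneq (teval b t) 0.
  by rewrite !mulr0 nm0 mulr_ge0.
rewrite !nmM nmV /x !tcharD !nmM.
have p1 : nm (t (Y *+ k)) <= Csup * nm (r (Y *+ k)) by exact: (hN d Nd t tw bt k).
have p2 : nm (t v) <= `|Bv| by apply: le_trans (hBv t Kt) (ler_norm _).
have p3 : nm (teval b t) <= `|Bb| by apply: le_trans (hBb t Kt) (ler_norm _).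
have p4 : nm (teval (a j) t) <= `|C| * h j t.
  by apply: le_trans (ha Kt tr) _; apply: ler_wpM2r => //; exact: ler_norm.
have q1 : 0 < nm (r (Y *+ k)) by rewrite nm_gt0 t_neq0.
have q2 : 0 < nm (r v) by rewrite nm_gt0 t_neq0.
have -> : K * h j t = (nm (r (Y *+ k)) * nm (r v))^-1 *
    (Csup * nm (r (Y *+ k)) * `|Bv| * (`|C| * h j t * `|Bb|)).
  by rewrite /K; field; rewrite !gt_eqF.
apply: ler_wpM2l; first by rewrite invr_ge0 mulr_ge0 // ltW.
by apply: ler_pM; rewrite ?mulr_ge0 ?nm_ge0 //; apply: ler_pM; rewrite ?nm_ge0.
Qed.

Definition dz (x : X) := r (- (x *+ 2)).
(** The factors of the twisted [delta] that vanish at the unit, i.e. those of [delta] that vanish at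
    [r]. [Cr] collects the others, and [resC] is their value there times [q(w0)]. *)
Definition Zr : galg := \prod_(x <- roots D | dz x == 1) nb (- (x *+ 2)).
Definition Cr : galg := \prod_(x <- roots D | dz x != 1) (1 - mono (dz x) (- (x *+ 2))).
Definition resC : R[i] := qc w0 * \prod_(x <- roots D | dz x != 1) (1 - dz x).

Lemma gtw_delta : gtw r delta = Zr * Cr.
Proof.
have E x : gtw r (Submission.Dg R x) = 1 - mono (dz x) (- (x *+ 2)).
  by rewrite /Submission.Dg gtwD gtwN gtw1 gtw_mono mul1r.
rewrite gtw_prod (bigID (fun x => dz x == 1)) /=; congr (_ * _); apply: eq_bigr => x h; rewrite E //.
by rewrite (eqP h).
Qed.

Lemma aug_Cr : aug (mono (qc w0) 0 * Cr) = resC.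
Proof.
rewrite augM aug_mono; congr (_ * _); rewrite aug_prod; apply: eq_bigr => x _.
by rewrite augB aug1 aug_mono.
Qed.

Lemma cst_neq0 : resC != 0.
Proof.
apply: mulf_neq0; first by apply: qc_neq0; apply: W0_W; exact: w0l.1.
by rewrite prodf_seq_neq0; apply/allP => x _; apply/implyP; rewrite subr_eq0 eq_sym.
Qed.

Variables (n : nat) (e : 'I_n -> X).
Hypothesis eP : forall x, exists! c : {ffun 'I_n -> int}, x = \sum_i e i *~ c i.

(** Summation over a box of side [M]. Combined with a difference along [e i] it becomes a difference
    along [e i *+ M], which removes the period [M]. *)
Definition Av : galg := \prod_(i < n) \sum_(l < M) mono 1 (e i *+ l).
Definition Dl (l : seq 'I_n) : galg := \prod_(i <- l) nb (e i).

Lemma nb_geom x m : nb x * \sum_(l < m) mono 1 (x *+ l) = nb (x *+ m).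
Proof.
elim: m => [|m IH]; first by rewrite big_ord0 mulr0 mulr0n nb0.
rewrite big_ord_recr /= mulrDr IH /nb mulrBl mul1r gmonoM mulr1 -mulrS.
by rewrite addrA subrK.
Qed.

Lemma nb_Av i : exists f, nb (e i) * Av = f * nb (e i *+ M).
Proof.
rewrite /Av (bigD1 i) //= mulrA nb_geom; eexists; rewrite mulrC; reflexivity.
Qed.

Lemma kill_avg m F : KN Y M m F -> forall l, size l = m -> null Y (gact (Dl l * Av ^+ m) F).
Proof.
elim: m F => [|m IH] F hF [|i l] // sl; first exact: (null_stable R Y).2.
have [f fE] := nb_Av i.
have -> : Dl (i :: l) * Av ^+ m.+1 = (Dl l * Av ^+ m) * (f * nb (e i *+ M)).
  by rewrite -fE /Dl big_cons exprS; ring.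
rewrite gactM; apply: IH; last by case: sl.
by rewrite gactM; apply: (KN_stable R Y M m).2; exact: hF.
Qed.

Local Notation QQ := (Qr L r).
Definition NN := (size QQ).+1.
(** The twisting constants stay in [Cr] and [resC], so this function is integer valued. *)
Definition f0 := gact (Av ^+ NN * Zr) (pQ R QQ).

Lemma f0_kill l : size l = NN -> null Y (gact (Dl l) f0).
Proof.
move=> sl; have hk := kill (@Qr_root R D L r) dich.
have := kill_avg ((KN_stable R Y M _).2 Zr _ hk) sl.
by rewrite /f0 -!gactM mulrA.
Qed.

Lemma Fr_f0 : gact (Av ^+ NN) Fr = gact (mono (qc w0) 0 * Cr) f0.
Proof.
have [p1 p2 _ _ _] := pQP R (@Qr_root R D L r).
have aux (B : comRingType) (a q z c : B) : a * (q * (z * c)) = q * c * (a * z) by ring.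
rewrite (FrE H w0l p1 p2) gtw_delta /f0 -(gactM (Av ^+ NN)) -(gactM (mono (qc w0) 0 * Cr)).
by move: (Av ^+ NN) (gmono _ _) Zr Cr => a q z c; rewrite aux.
Qed.

Lemma gact_swap (f1 f2 f3 f4 : galg) (F G : X -> R[i]) : gact f2 F = gact f4 G ->
  gact (f4 * f3) (gact f1 G) = gact (f1 * f2 * f3) F.
Proof.
have aux (B : comRingType) (q1 q3 q4 : B) : q4 * q3 * q1 = q1 * q3 * q4 by ring.
move=> E; have e1 : f1 * f2 * f3 = f1 * f3 * f2 by exact: mulrAC.
by rewrite e1 (gactM (f1 * f3)) E -(gactM (f4 * f3)) -(gactM (f1 * f3)); congr gact; exact: aux.
Qed.

(** Up to null functions [q(w0) Cr] and the twist of [a j] act on an invariant function by their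
    augmentations [resC] and 1. By [Fr_f0] the same expression comes from [Fr], where [estimate]
    evaluates it. As that estimate is uniform in [k], [j] can be fixed before [k]. *)
Lemma flim l : (forall i, null Y (gact (nb (e i)) (gact (Dl l) f0))) ->
  forall v, ccvg (fun k => resC * gact (Dl l) f0 (Y *+ k + v)) (aug (Dl l * Av ^+ NN) * beta).
Proof.
move=> h v; have [a [eps [a1 e0 epos est]]] := estimate.
have nz (y : X) : null Y (gact (nb y) (gact (Dl l) f0)).
  have sN := null_stable R Y; move: y; apply: (lattice_ind eP).
  - rewrite nb0; have -> : gact 0 (gact (Dl l) f0) = fun=> 0 by apply/funext => x; exact: gact0.
    by move=> u; exact: ccvg_cst.
  - by move=> x y; exact: (stable_D sN).
  - exact: h.
  - by move=> i; apply: (stable_N sN).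
have est2 f u : exists2 K, 0 <= K &
    forall j k, nm (gact (f * gtw r (a j)) Fr (Y *+ k + u) - aug f * beta) <= K * eps j.
  move: f u; apply: gind => [u|c x u|f g hf hg u].
  - by exists 0 => // j k; rewrite mul0r gact0 /aug gev0 !mul0r subrr nm0.
  - have [K K0 hK] := est (u + x); exists (nm c * K); first by rewrite mulr_ge0 ?nm_ge0.
    move=> j k; rewrite gactM gact_mono aug_mono -mulrBr nmM -mulrA -addrA.
    by apply: ler_wpM2l; [exact: nm_ge0|exact: hK].
  - have [K K0 hK] := hf u; have [K' K0' hK'] := hg u; exists (K + K'); first exact: addr_ge0.
    move=> j k; rewrite mulrDl gactD (_ : aug (f + g) = aug f + aug g); last by rewrite /aug gevD.
    by rewrite mulrDl opprD addrACA mulrDl; apply: le_trans (nmD _ _) _; apply: lerD.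
have [K K0 hK] := est2 (Dl l * Av ^+ NN) v => ep ep0.
have ep2 : 0 < ep / 2 by rewrite divr_gt0.
have [J hJ] := e0 _ (divr_gt0 ep2 (ltr_wpDl K0 ltr01)).
have := hJ J (leqnn _); rewrite subr0 nm_real ger0_norm // => epJ.
have hh := null_aug (mono (qc w0) 0 * Cr * gtw r (a J)) nz v.
have [N hN] := hh _ ep2; exists N => k /hN; rewrite subr0.
have -> : gact (mono (qc w0) 0 * Cr * gtw r (a J)) (gact (Dl l) f0) =
    gact (Dl l * Av ^+ NN * gtw r (a J)) Fr.
  exact: gact_swap Fr_f0.
rewrite augM aug_Cr aug_gtw a1 mulr1 => h1; have h2 := hK J k.
have h3 : K * eps J < ep / 2 by exact: nm_small.
set u := gact _ Fr _ in h1 h2; set w := resC * _ in h1 *; set bb := aug _ * beta in h2 *.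
have -> : w - bb = - (u - w) + (u - bb) by ring.
by apply: le_lt_trans (nmD _ _) _; rewrite nmN; lra.
Qed.

(** A nonempty product of differences has augmentation zero, so the limit in [flim] vanishes. This
    is where boundedness lowers the degree. *)
Lemma descend m : (forall l, size l = m.+2 -> null Y (gact (Dl l) f0)) ->
  forall l, size l = m.+1 -> null Y (gact (Dl l) f0).
Proof.
move=> h l sl; have hl i : null Y (gact (nb (e i)) (gact (Dl l) f0)).
  have := h (i :: l); rewrite /= sl => /(_ erefl); rewrite -gactM.
  by rewrite [Dl (_ :: _)]/Dl big_cons.
move=> v; have := flim hl v.
rewrite augM (_ : aug (Dl l) = 0) ?mul0r => [lim|]; last first.
  case: l sl {h hl} => // i l _; rewrite /Dl big_cons augM aug_nb mul0r //.
rewrite -(mulr0 resC^-1); apply: ccvg_ext (ccvgM (ccvg_cst resC^-1) lim) => k.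
by rewrite mulKf // cst_neq0.
Qed.

Lemma f0_inv i : null Y (gact (nb (e i)) f0).
Proof.
have key m : (m <= size QQ)%N -> forall l, size l = (size QQ - m).+1 -> null Y (gact (Dl l) f0).
  elim: m => [_ l|m IH mQ]; first by rewrite subn0; exact: f0_kill.
  by apply: descend => l sl; apply: IH; rewrite ?(ltnW mQ) // sl -subSn // subSS.
have := key (size QQ) (leqnn _) [:: i]; rewrite subnn => /(_ erefl).
by rewrite /Dl big_seq1.
Qed.

Lemma IG_nb x F : IG F -> IG (gact (nb x) F).
Proof.
move=> h z; have [m1 E1] := h z; have [m2 E2] := h (z + x).
by exists (m1 - m2); rewrite gact_nb E1 E2 rmorphB.
Qed.

Lemma IG_f0 : IG f0.
Proof.
have [_ _ _ h _] := pQP R (@Qr_root R D L r).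
have hP I (s : seq I) (P : pred I) (f : I -> galg) :
    (forall i, P i -> forall F : X -> R[i], IG F -> IG (gact (f i) F)) -> forall F, IG F -> IG (gact (\prod_(i <- s | P i) f i) F).
  move=> hf; elim/big_rec: _ => [F|i g Pi IH F hF]; first by rewrite gact1.
  by rewrite gactM; apply: hf => //; exact: IH.
rewrite /f0 gactM.
have hZ : IG (gact Zr (pQ R QQ)) by apply: hP => // x _ F; exact: IG_nb.
move: hZ; move: (gact Zr _) => F; elim: NN F => [|m IH] F hF; first by rewrite expr0 gact1.
rewrite exprS gactM; apply: hP; last exact: IH.
move=> i _ G hG; elim/big_rec: _ => [x|l g _ IH' x]; first by exists 0; rewrite gact0.
have [m1 E1] := hG (x + e i *+ l); have [m2 E2] := IH' x.
by exists (m1 + m2); rewrite gactD gact_mono mul1r E1 E2 rmorphD.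
Qed.

(** Distinct integer multiples of [c] are at distance at least |c|, so a convergent sequence of them
    is eventually constant. *)
Lemma int_limit (u : nat -> R[i]) (c l : R[i]) : c != 0 -> (forall k, exists m : int, u k = m%:~R) ->
  ccvg (fun k => c * u k) l -> exists m : int, l = c * m%:~R.
Proof.
move=> c0 hu h; have hc : 0 < nm c by rewrite nm_gt0.
have h2 : 0 < nm c / 2 by rewrite divr_gt0.
have [N hN] := h _ h2; have [m E] := hu N; exists m.
have con k : (N <= k)%N -> u k = m%:~R.
  move=> Nk; have [m' E'] := hu k; rewrite E'; congr _%:~R; apply/eqP; rewrite -subr_eq0 -absz_eq0 -leqn0 leqNgt; apply/negP => mm.
  have : nm c <= nm (c * u k - c * u N).
    rewrite E E' -mulrBr -rmorphB nmM /= ler_peMr ?nm_ge0 //.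
    have -> : nm ((m' - m)%:~R : R[i]) = (absz (m' - m))%:R.
      by rewrite -(rmorph_int (real_complex R)) nm_real -intr_norm -natr_absz.
    by rewrite ler1n.
  have := hN k Nk; have := hN N (leqnn _); set p := c * u N; set q := c * u k => a b.
  have := nmD (q - l) (l - p); rewrite subrKA -(nmN (l - p)) opprB; lra.
apply: (ccvg_uniq h) => ep ep0; have [N' hN'] := ccvg_cst (c * m%:~R) ep0; exists N => k /con->.
by rewrite subrr nm0.
Qed.

Lemma atom_rational_seq : exists rho : rat, Ispec (pt r) * teval b r = ratr rho * resC.
Proof.
have hl i : null Y (gact (nb (e i)) (gact (Dl [::]) f0)) by rewrite /Dl big_nil gact1; exact: f0_inv.
have := flim hl 0; rewrite /Dl big_nil gact1 mul1r augX.
(* The number of points of the box, whose powers are the only denominators that enter. *)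
have -> : aug Av = (M ^ n)%:R.
  rewrite aug_prod (eq_bigr (fun=> M%:R)) ?prodr_const ?card_ord ?natrX // => i _.
  by rewrite aug_sum (eq_bigr (fun=> 1)) ?sumr_const ?card_ord // => l _; rewrite aug_mono.
move=> lim; have [m mE] := int_limit cst_neq0 (fun k => IG_f0 (Y *+ k + 0)) lim.
have q0 : ((M ^ n)%:R ^+ NN : R[i]) != 0 by rewrite expf_neq0 // pnatr_eq0 -lt0n expn_gt0 M0.
exists (m%:~R / (M ^ n)%:R ^+ NN); rewrite fmorph_div rmorph_int rmorphXn rmorph_nat.
apply: (mulfI q0); rewrite /beta in mE; by rewrite [Ispec _ * _]mulrC mE; field.
Qed.

End Sequence.

(* In a direction [Y] where [r] dominates, the averaged and twisted trace function converges to the atom at [r],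
   while its values lie in a fixed lattice of rank one. *)
Lemma atom_rational : exists rho : rat, Ispec (pt r) * teval b r = ratr rho * resC.
Proof.
have [Y [M [M0 rY dich]]] := good_direction r; have [n [e eP]] := lattice_gen D.
exact: (atom_rational_seq M0 rY dich eP).
Qed.

End Atoms.

(** * Separation of irreducible representations *)

Section Irreducible.
Variables (R : realType) (D : rootDatum) (L : labels R D) (H : heckeAlgebra L).
Variables (V : hilbertCompletion H) (A : cstarCompletion V).
Local Notation "x %:CC" := (x%:C%C : R[i]) (at level 2, format "x %:CC").
Implicit Types (p : irrep A) (a b x y : A).

Lemma irM p a b : p (a * b) = p a *m p b. Proof. exact: (rmorphM (irrep_rho p)). Qed.
Lemma irD p a b : p (a + b) = p a + p b. Proof. exact: (raddfD (irrep_rho p)). Qed.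
Lemma irZ p (z : R[i]) a : p (z *: a) = z *: p a. Proof. by rewrite linearZ. Qed.
Lemma ir1 p : p 1 = 1%:M. Proof. exact: (rmorph1 (irrep_rho p)). Qed.

Lemma irS p (s : seq A) : p (\sum_(x <- s) cadj x * x) = \sum_(x <- s) adjmx (p x) *m p x.
Proof.
rewrite (linear_sum (irrep_rho p)); apply: eq_bigr => x _; rewrite -irrep_star; exact: irM.
Qed.

(** The triangle inequality is part of the normed structure; expanding the square of the norm of
    [u + v] turns it into the Cauchy-Schwarz bound for the real part. *)
Lemma Re_inner_le (u v : V) : complex.Re (inner u v) <= rn u * rn v.
Proof.
have h : rn (u + v) ^+ 2 <= (rn u + rn v) ^+ 2.
  by rewrite lerXn2r ?nnegrE ?addr_ge0 ?rn_ge0 // rnD.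
have E : (rn (u + v) ^+ 2)%:CC = (rn u ^+ 2)%:CC + (rn v ^+ 2)%:CC + (inner u v + (inner u v)^*).
  have Dl (x y z : V) : inner (x + y) z = inner x z + inner y z.
    by rewrite inner_conj innerD rmorphD /= -!inner_conj.
  by rewrite !rn_sq innerD !Dl -(inner_conj u v); ring.
have {}E := congr1 (fun z : R[i] => complex.Re z) E.
have R2 (z : R[i]) : complex.Re (z + z^*) = 2 * complex.Re z.
  by case: z => zr zi /=; lra.
rewrite raddfD raddfD /= in E; rewrite -/(complex.Re (inner u v + (inner u v)^*)) in E.
by rewrite R2 in E; move: h; rewrite E; lra.
Qed.

Lemma op_adj a (c : R) : opnorm_le (cact a) c -> opnorm_le (cact (cadj a)) c.
Proof.
move=> /opP ha; apply/opP => v; set w := cact (cadj a) v.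
have E : (rn w ^+ 2)%:CC = inner (cact a w) v by rewrite cadjP rn_sq.
have := Re_inner_le (cact a w) v; rewrite -E /= => h.
have [w0|w0] := eqVneq (rn w) 0.
  rewrite w0; apply: mulr_ge0 (rn_ge0 _); apply: (op_ge0 (a := a)); exact/opP.
have wp : 0 < rn w by rewrite lt_neqAle eq_sym w0 rn_ge0.
rewrite -(ler_pM2r wp) -expr2; apply: le_trans h _.
by have := ler_wpM2r (rn_ge0 v) (ha w); rewrite mulrAC.
Qed.

(** Each eigenvalue is bounded by the operator norm, by the Neumann series; the trace is their sum
    in triangular form. *)
Lemma tr_le p a (c : R) : opnorm_le (cact a) c -> nm (\tr (p a)) <= (irrep_dim p).+1%:R * c.
Proof.
move=> hc; have [] := @cotrigonalization _ _ [:: p a].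
  by move=> B C; rewrite !inE => /eqP-> /eqP->.
move=> P PU /andP[+ _]; have Pu := unitarymx_unit PU.
rewrite /similar_to /conjmx pinvmxE // => PT.
rewrite inE in PT; set N := P *m _ *m _ in PT.
have -> : \tr (p a) = \tr N by rewrite mxtrace_mulC mulmxA mulVmx // mul1mx.
apply: le_trans (nm_sum _ _ _) _.
apply: le_trans (_ : \sum_(i < (irrep_dim p).+1) c <= _); last by rewrite sumr_const card_ord mulr_natl.
apply: ler_sum => i _; rewrite leNgt; apply/negP => cl; set l := N i i in cl.
have c0 := op_ge0 hc; have l0 : 0 < nm l by apply: le_lt_trans cl.
have l0' : l != 0 by rewrite -nm_gt0.
have h1 : nm l^-1 * c < 1 by rewrite nmV mulrC ltr_pdivrMr // mul1r.
have [b [b1 _]] := neumann h1 (opZ l^-1 hc).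
have := congr1 p b1; rewrite rmorphM rmorph1 => /(congr1 (@determinant _ _)).
have dE : \det (p (1 - l^-1 *: a)) = 0.
  have -> : \det (p (1 - l^-1 *: a)) = \det (P *m p (1 - l^-1 *: a) *m invmx P).
    by rewrite !det_mulmx mulrC mulrA -det_mulmx mulVmx // det1 mul1r.
  have -> : P *m p (1 - l^-1 *: a) *m invmx P = 1%:M - l^-1 *: N.
    rewrite rmorphB rmorph1 /= linearZ /= mulmxBr mulmxBl mulmx1 mulmxV //.
    by rewrite -scalemxAr -scalemxAl.
  rewrite det_trig.
    have e1 (M : 'M[R[i]]_((irrep_dim p).+1)) : M i i != 0 -> (1%:M - (M i i)^-1 *: M) i i = 0.
      by move=> M0; rewrite !mxE eqxx mulVf // subrr.
    by apply/eqP; rewrite (bigD1 i) //= mulf_eq0 e1 // eqxx.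
  apply/is_trig_mxP => j k jk; have E := is_trig_mxP PT _ _ jk.
  have e2 (M : 'M[R[i]]_((irrep_dim p).+1)) (z : R[i]) : M j k = 0 -> (1%:M - z *: M) j k = 0.
    by move=> M0; rewrite !mxE M0 mulr0 subr0; case: eqP jk => // ->; rewrite ltnn.
  exact: e2.
by rewrite det_mulmx dE mulr0 det1 => /esym/eqP; rewrite oner_eq0.
Qed.

Lemma adjmx_mul_diag (m n : nat) (M : 'M[R[i]]_(m, n)) i : (adjmx M *m M) i i = (\sum_k nm (M k i) ^+ 2)%:CC.
Proof.
by rewrite mxE rmorph_sum; apply: eq_bigr => k _; rewrite !mxE mulrC -nm_sq.
Qed.

Lemma entry_le p a (c : R) i j : opnorm_le (cact a) c -> nm (p a i j) <= (irrep_dim p).+1%:R * c.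
Proof.
move=> hc; have c0 := op_ge0 hc; have := tr_le p (opM (op_adj hc) hc).
have -> : \tr (p (cadj a * a)) = (\sum_k \sum_l nm (p a l k) ^+ 2)%:CC.
  rewrite irM irrep_star rmorph_sum.
  by apply: eq_bigr => k _; exact: adjmx_mul_diag.
rewrite nm_real ger0_norm; last by apply: sumr_ge0 => k _; apply: sumr_ge0 => l _; exact: sqr_ge0.
set n := _.+1%:R => h; have n1 : 1 <= n by rewrite ler1n.
have h2 : nm (p a i j) ^+ 2 <= n * (c * c).
  apply: le_trans h; rewrite (bigD1 j) //= (bigD1 i) //= -addrA lerDl; apply: addr_ge0.
    by apply: sumr_ge0 => l _; exact: sqr_ge0.
  by apply: sumr_ge0 => k _; apply: sumr_ge0 => l _; exact: sqr_ge0.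
rewrite -(@ler_pXn2r _ 2) ?nnegrE ?nm_ge0 ?mulr_ge0 // ?ler0n //; apply: le_trans h2 _.
by rewrite exprMn expr2 -expr2; apply: ler_wpM2r; [exact: sqr_ge0|nra].
Qed.

Definition bounded (phi : A -> R[i]) := exists C : R, forall a (c : R), opnorm_le (cact a) c -> nm (phi a) <= C * c.

(** Lets an identity known only on the image of the Hecke algebra be evaluated at elements of the
    completion that separate representations. *)
Lemma bounded_ext (phi : A -> R[i]) : bounded phi -> (forall a b, phi (a - b) = phi a - phi b) ->
  (forall h, phi (cin A h) = 0) -> forall a, phi a = 0.
Proof.
move=> [C hC] phiB ph a; apply/eqP; rewrite -nm_eq0 eq_le nm_ge0 andbT leNgt; apply/negP => n0.
have C0 : 0 <= C by have := hC _ _ (op1 A); rewrite mulr1; apply: le_trans; exact: nm_ge0.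
have e0 : 0 < nm (phi a) / (C + 1) by rewrite divr_gt0 // ltr_wpDl.
have [h hh] := cin_dense a e0; have := hC _ _ hh; rewrite phiB ph subr0.
set q := _ / _ in e0 *; have E : q * (C + 1) = nm (phi a) by rewrite divfK // gt_eqF // ltr_wpDl.
rewrite -E; lra.
Qed.

Lemma bounded_form p (u : 'rV_(irrep_dim p).+1) (k : 'cV_(irrep_dim p).+1) :
  bounded (fun a => (u *m p a *m k) 0 0).
Proof.
exists (\sum_j \sum_i nm (u 0 i) * (irrep_dim p).+1%:R * nm (k j 0)) => a c hc.
rewrite mxE; apply: le_trans (nm_sum _ _ _) _; rewrite mulr_suml; apply: ler_sum => j _.
rewrite nmM mxE; apply: le_trans (_ : (\sum_i nm (u 0 i) * nm (p a i j)) * nm (k j 0) <= _).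
  apply: ler_wpM2r; first exact: nm_ge0.
  by apply: le_trans (nm_sum _ _ _) _; apply: ler_sum => i _; rewrite nmM.
rewrite !mulr_suml; apply: ler_sum => i _; rewrite [leRHS]mulrAC; apply: ler_wpM2r; first exact: nm_ge0.
by rewrite -mulrA; apply: ler_wpM2l; [exact: nm_ge0|exact: entry_le].
Qed.

Lemma bounded_sum I (s : seq I) (F : I -> A -> R[i]) : (forall i, bounded (F i)) ->
  bounded (fun a => \sum_(i <- s) F i a).
Proof.
move=> /choice[C hC]; exists (\sum_(i <- s) C i) => a c hc.
by apply: le_trans (nm_sum _ _ _) _; rewrite mulr_suml; apply: ler_sum => i _; apply: hC.
Qed.

Lemma boundedZ (z : R[i]) (F : A -> R[i]) : bounded F -> bounded (fun a => z * F a).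
Proof.
move=> [C hC]; exists (nm z * C) => a c hc; rewrite nmM -mulrA.
by apply: ler_wpM2l; [exact: nm_ge0|exact: hC].
Qed.

Lemma bounded_tr p : bounded (fun a => \tr (p a)).
Proof. by exists (irrep_dim p).+1%:R => a c; exact: tr_le. Qed.

Lemma schur p (N : 'M[R[i]]_((irrep_dim p).+1)) : (forall a, N *m p a = p a *m N) -> N = (N 0 0)%:M.
Proof.
move=> NC; have /closed_rootP[l] : size (char_poly N) != 1 by rewrite size_char_poly.
rewrite -eigenvalue_root_char => /eigenvalueP[v vN v0].
have : N - l%:M = 0.
  apply: schur0 => [a|]; first by rewrite mulmxBl mulmxBr NC scalar_mxC.
  by apply/eqP/det0P; exists v => //; rewrite mulmxBr vN mul_mx_scalar subrr.
by move=> /eqP; rewrite subr_eq0 => /eqP E; rewrite {1}E E mxE eqxx.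
Qed.

(** The products of [T] and its adjoint in both orders commute with the representations, hence are
    scalars, and the scalars agree; division by the square root makes [T] unitary. *)
Lemma intertwiner p p' (T : 'M[R[i]]_((irrep_dim p).+1, (irrep_dim p').+1)) : T != 0 ->
  (forall a, T *m p' a = p a *m T) -> irrep_equiv p' p.
Proof.
move=> T0 TC; have TC' a : adjmx T *m p a = p' a *m adjmx T.
  have := congr1 (@adjmx R _ _) (TC (cadj a)).
  by rewrite !irrep_star !adjmxM !adjmxK.
have E1 := schur (p := p') (N := adjmx T *m T) _; have E2 := schur (p := p) (N := T *m adjmx T) _.
have {}E1 := E1 (fun a => ltac:(by rewrite -mulmxA TC mulmxA TC' mulmxA)).
have {}E2 := E2 (fun a => ltac:(by rewrite -mulmxA TC' mulmxA TC mulmxA)).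
have [i [j Tij]] : exists i j, T i j != 0.
  apply: contrapT => no; move/eqP: T0; apply; apply/matrixP => i j; rewrite mxE.
  by apply/eqP; apply: contrapT => /negP n0; apply: no; exists i, j.
set l := (adjmx T *m T) 0 0 in E1; set l' := (T *m adjmx T) 0 0 in E2.
pose s : R := \sum_k nm (T k j) ^+ 2.
have s0 : 0 < s by rewrite /s (bigD1 i) //= ltr_wpDr ?exprn_gt0 ?nm_gt0 //; apply: sumr_ge0 => k _; exact: sqr_ge0.
have ls : l = s%:CC by rewrite -adjmx_mul_diag E1 mxE eqxx.
have ll : l = l'.
  have : T *m (adjmx T *m T) = T *m adjmx T *m T by rewrite mulmxA.
  rewrite E1 E2 mul_mx_scalar mul_scalar_mx => /matrixP/(_ i j); rewrite !mxE => /eqP.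
  by rewrite -subr_eq0 -mulrBl mulf_eq0 (negPf Tij) orbF subr_eq0 => /eqP.
pose z := (Num.sqrt s)^-1%:CC.
have zc : z^* = z by exact: conjc_real.
have zz : z * z * l = 1.
  rewrite ls -!rmorphM /= -invfM -expr2 sqr_sqrtr ?mulVf ?rmorph1 // ?gt_eqF //; exact: ltW.
have aZ : adjmx (z *: T) = z *: adjmx T by apply/matrixP => k k'; rewrite !mxE rmorphM /= zc.
apply/asboolP; exists (z *: T); split => [||a].
- by rewrite aZ -scalemxAl -scalemxAr scalerA E1 scale_scalar_mx zz.
- by rewrite aZ -scalemxAl -scalemxAr scalerA E2 scale_scalar_mx -ll zz.
- by rewrite -scalemxAl TC -scalemxAr.
Qed.

(** Enlarges a subspace by one vector at a time until the dimension is exhausted, so that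
    irreducibility, stated for subspaces, applies to predicates. *)
Lemma predicate_vspace (n : nat) (S : 'cV[R[i]]_n -> Prop) : S 0 -> (forall c u v, S u -> S v -> S (c *: u + v)) ->
  exists U : {vspace 'cV[R[i]]_n}, forall v, v \in U <-> S v.
Proof.
move=> S0 SL; suff key k (U : {vspace 'cV[R[i]]_n}) : (\dim {:'cV[R[i]]_n} - \dim U <= k)%N ->
    (forall v, v \in U -> S v) -> exists U' : {vspace 'cV[R[i]]_n}, forall v, v \in U' <-> S v.
  by apply: (key (\dim {:'cV[R[i]]_n}) 0%VS) => [|v]; [exact: leq_subr|rewrite memv0 => /eqP->].
elim: k U => [|k IH] U hd US.
  exists U => v; split=> [/US//|_]; have /eqP-> : U == fullv; last exact: memvf.
  by rewrite eqEdim subvf /= -subn_eq0 -leqn0.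
have [all|] := pselect (forall v, S v -> v \in U); first by exists U => v; split; [exact: US|exact: all].
move=> no; have [v [Sv vU]] : exists v, S v /\ v \notin U.
  by apply: contrapT => n'; apply: no => v Sv; apply: contrapT => /negP vU; apply: n'; exists v.
apply: (IH (U + <[v]>)%VS) => [|u].
  have : (\dim U < \dim (U + <[v]>))%N.
    rewrite ltn_neqAle dimvS ?addvSl // andbT; apply: contra vU => /eqP dE.
    have /eqP -> : U == (U + <[v]>)%VS by rewrite eqEdim addvSl dE leqnn.
    by apply: (subvP (addvSr _ _)); exact: memv_line.
  by lia.
by case/memv_addP => u1 /US Su1 [_ /vlineP[c ->] ->]; rewrite addrC; apply: SL.
Qed.

Lemma cyclic p (v w : 'cV[R[i]]_(irrep_dim p).+1) : v != 0 -> exists a, p a *m v = w.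
Proof.
move=> v0; pose S u := exists a, p a *m v = u.
have [|c _ _ [a <-] [b <-]|U UE] := @predicate_vspace _ S.
- by exists 0; rewrite rmorph0 mul0mx.
- by exists (c *: a + b); rewrite linearP mulmxDl scalemxAl.
have [a u /UE[b <-]|U0|Uf] := irrep_irr (i := p) (U := U).
- by apply/UE; exists (a * b); rewrite irM -mulmxA.
- have : v \in U by apply/UE; exists 1; rewrite ir1 mul1mx.
  by rewrite U0 memv0 (negPf v0).
- by apply/UE; rewrite Uf memvf.
Qed.

Lemma col_sum (n : nat) (v : 'cV[R[i]]_n) : v = \sum_k v k 0 *: delta_mx k 0.
Proof.
apply/matrixP => i j; rewrite ord1 summxE (bigD1 i) //= !mxE !eqxx mulr1 big1 ?addr0 // => k ki.
by rewrite !mxE eq_sym (negPf ki) mulr0.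
Qed.

(** The hypothesis makes the map from [p' x v'] to [p x v] well defined. Its matrix [T] is read off
    from elements that carry [v'] to the basis vectors. *)
Lemma annihilator_equiv p p' (v : 'cV[R[i]]_(irrep_dim p).+1) (v' : 'cV[R[i]]_(irrep_dim p').+1) :
  v != 0 -> v' != 0 -> (forall x, p' x *m v' = 0 -> p x *m v = 0) ->
  irrep_equiv p' p.
Proof.
move=> v0 v'0 h; have [a aE] := choice (fun k => cyclic (delta_mx k 0) v'0).
pose T := \matrix_(i, k) (p (a k) *m v) i 0.
have TE x : T *m (p' x *m v') = p x *m v.
  set w := p' x *m v'; pose y := x - \sum_k w k 0 *: a k.
  have /h : p' y *m v' = 0.
    rewrite rmorphB rmorph_sum /= mulmxBl mulmx_suml {1}[p' x *m v']col_sum -sumrB big1 // => k _.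
    by rewrite linearZ /= -scalemxAl aE subrr.
  rewrite rmorphB rmorph_sum /= mulmxBl => /eqP; rewrite subr_eq0 => /eqP->.
  rewrite mulmx_suml; apply/matrixP => i j; rewrite ord1 mxE summxE; apply: eq_bigr => k _.
  by rewrite linearZ /= -scalemxAl !mxE mulrC.
have TC b : T *m p' b = p b *m T.
  apply/matrixP => i j; rewrite -[LHS]/((T *m p' b) i j) -[RHS]/((p b *m T) i j).
  have [c cE] := cyclic (delta_mx j 0) v'0.
  have := TE (b * c); rewrite !irM -!mulmxA -(TE c) cE !mulmxA -!colE => /matrixP/(_ i 0).
  by rewrite !mxE.
apply: (intertwiner _ TC); apply: contra_neq v0 => T0.
by have := TE 1; rewrite T0 mul0mx ir1 mul1mx.
Qed.

(* If the annihilator of [v'] is contained in that of some [v], there is an intertwiner; otherwise a sum of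
   elements [x^* x] with [x v' = 0] acts invertibly in [p]. *)
Lemma kill_vector p p' (v' : 'cV[R[i]]_(irrep_dim p').+1) :
  ~ irrep_equiv p' p -> exists a, p a = 1%:M /\ p' a *m v' = 0.
Proof.
move=> ne; have [v'0|v'0] := eqVneq v' 0.
  by exists 1; rewrite v'0 mulmx0 ir1.
have sep (v : 'cV[R[i]]_(irrep_dim p).+1) : v != 0 -> exists x, p' x *m v' = 0 /\ p x *m v != 0.
  move=> v0; apply: contrapT => no; apply: ne; apply: (annihilator_equiv v0 v'0) => x h.
  by apply/eqP; apply: contrapT => /negP n0; apply: no; exists x.
have key n (U : {vspace 'cV_(irrep_dim p).+1}) : (\dim U <= n)%N -> exists xs : seq A,
    (forall x, x \in xs -> p' x *m v' = 0) /\
    forall v, v \in U -> (forall x, x \in xs -> p x *m v = 0) -> v = 0.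
  elim: n U => [|n IH] U dU.
    exists [::]; split=> // v; move: dU; rewrite leqn0 dimv_eq0 => /eqP->.
    by rewrite memv0 => /eqP.
  have [U0|/eqP U0] := pselect (U = 0%VS).
    by exists [::]; split=> // v; rewrite U0 memv0 => /eqP.
  have [x [x' xv]] := sep (vpick U) (ltac:(by rewrite vpick0)).
  pose K := lker (linfun (mulmx (p x) : 'cV[R[i]]_(irrep_dim p).+1 -> _)).
  have KE v : (v \in K) = (p x *m v == 0) by rewrite memv_ker lfunE.
  have [|xs [xs' xsU]] := IH (U :&: K)%VS.
    rewrite -ltnS; apply: leq_trans dU; rewrite ltn_neqAle dimvS ?capvSl // andbT.
    apply: contra xv => /eqP dE; rewrite -KE.
    have /eqP UK : (U :&: K)%VS == U by rewrite eqEdim capvSl dE leqnn.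
    by have := memv_pick U; rewrite -{2}UK memv_cap => /andP[].
  exists (x :: xs); split=> [y|v vU xv0]; first by rewrite inE => /orP[/eqP->|/xs'].
  apply: xsU; last by move=> y yx; apply: xv0; rewrite inE yx orbT.
  by rewrite memv_cap vU KE xv0 ?inE ?eqxx.
have [xs [xs' xsU]] := key _ fullv (leqnn _).
pose y := \sum_(x <- xs) cadj x * x.
have y' : p' y *m v' = 0.
  rewrite irS mulmx_suml big_seq big1 // => x /xs' E.
  by rewrite -mulmxA E mulmx0.
have yinj (v : 'cV[R[i]]_((irrep_dim p).+1)) : p y *m v = 0 -> v = 0.
  move=> yv; apply: xsU; first exact: memvf.
  have : \sum_(x <- xs) \sum_k nm ((p x *m v) k 0) ^+ 2 = 0.
    apply: (@complexI R); rewrite rmorph_sum rmorph0.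
    transitivity ((adjmx v *m (p y *m v)) 0 0); last by rewrite yv mulmx0 mxE.
    rewrite irS mulmx_suml mulmx_sumr summxE; apply: eq_bigr => x _.
    by apply: etrans (esym (adjmx_mul_diag _ _)) _; rewrite adjmxM -!mulmxA.
  move=> S0 x xx; apply/matrixP => k j; rewrite ord1 [RHS]mxE; apply/eqP; rewrite -nm_eq0.
  have := S0; rewrite big_seq => /eqP.
  rewrite psumr_eq0 => [|z _]; last by apply: sumr_ge0 => l _; exact: sqr_ge0.
  move=> /allP/(_ x xx); rewrite xx implyTb psumr_eq0 => [|l _]; last exact: sqr_ge0.
  by move=> /allP/(_ k); rewrite mem_index_enum sqrf_eq0 => /(_ erefl).
have yU : p y \in unitmx.
  rewrite -unitmx_tr -row_free_unit -kermx_eq0; apply/eqP/row_matrixP => i; rewrite row0.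
  have : (row i (kermx (p y)^T)) *m (p y)^T = 0 by rewrite -row_mul mulmx_ker row0.
  move=> /(congr1 trmx); rewrite trmx_mul trmxK trmx0 => /yinj/(congr1 trmx).
  by rewrite trmxK trmx0.
have pol (q : {poly R[i]}) : exists b, p b = horner_mx (p y) q.
  elim/poly_ind: q => [|q c [b bE]]; first by exists 0; rewrite !rmorph0.
  exists (b * y + c%:A); rewrite irD irM irZ ir1 bE rmorphD rmorphM /= horner_mx_X horner_mx_C.
  by rewrite scalemx1.
(* By Cayley-Hamilton the inverse of [p y] is a polynomial in [p y], hence again in the image of
   [p]. *)
have [b bE] : exists b, p b *m p y = 1%:M.
  have := Cayley_Hamilton (p y); set q := char_poly _ => CH.
  have q0 : q`_0 != 0.
    rewrite char_poly_det mulf_eq0 signr_eq0 /= -unitfE; move: yU; rewrite unitmxE.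
    by [].
  have [q' qE] : exists q', q = q' * 'X + (q`_0)%:P.
    elim/poly_ind: (q) => [|q' c _]; first by exists 0; rewrite mul0r coef0 add0r.
    by exists q'; rewrite coefD coefMX coefC add0r.
  have [c cE] := pol q'; exists (- (q`_0)^-1 *: c).
  have := CH; rewrite {1}qE rmorphD rmorphM /= horner_mx_X horner_mx_C => /eqP.
  rewrite addr_eq0 -cE => /eqP E; rewrite linearZ /= -scalemxAl [p c *m p y]E scaleNr scalerN opprK.
  by rewrite scale_scalar_mx mulVf.
exists (b * y); split; first by rewrite irM.
by rewrite irM -mulmxA y' mulmx0.
Qed.

Lemma kill_irrep p p' : ~ irrep_equiv p' p -> exists a, p a = 1%:M /\ p' a = 0.
Proof.
move=> ne; have key (vs : seq 'cV_(irrep_dim p').+1) : exists a, p a = 1%:M /\ forall v, v \in vs -> p' a *m v = 0.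
  elim: vs => [|v vs [a [a1 a0]]]; first by exists 1; rewrite ir1.
  have [b [b1 b0]] := kill_vector (p' a *m v) ne; exists (b * a); split; first by rewrite irM a1 b1 mulmx1.
  move=> u; rewrite inE irM -mulmxA => /orP[/eqP->//|/a0->]; exact: mulmx0.
have [a [a1 a0]] := key [seq delta_mx k 0 | k <- enum 'I_(irrep_dim p').+1].
exists a; split=> //; apply/matrixP => i j; have := a0 (delta_mx j 0); rewrite -colE => /(_ _)/matrixP h.
by have := h (map_f _ (mem_enum _ j)) i 0; rewrite !mxE.
Qed.

Variable p0 : irrep A.
Implicit Types d : spectrum p0.

Lemma rep_of_inj d d' : irrep_equiv (rep_of d) (rep_of d') -> d = d'.
Proof.
move=> e; rewrite -[d]reprK -[d']reprK; exact/eqmodP.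
Qed.

Lemma separate d (s : seq (spectrum p0)) : exists a, rep_of d a = 1%:M /\
  forall d', d' \in s -> d' != d -> rep_of d' a = 0.
Proof.
elim: s => [|d' s [a [a1 a0]]]; first by exists 1; rewrite ir1.
have [->|/eqP ne] := eqVneq d' d.
  by exists a; split=> // d2; rewrite inE => /orP[/eqP->|]; [rewrite eqxx|exact: a0].
have [b [b1 b0]] := @kill_irrep (rep_of d) (rep_of d') (fun e => ne (rep_of_inj e)).
exists (a * b); split=> [|d2]; first by rewrite irM a1 b1 mulmx1.
by rewrite irM inE => /orP[/eqP->|s2] n2; [rewrite b0 mulmx0|rewrite a0 // mul0mx].
Qed.

(** The point is the hull of its own kernel: any other irreducible is nonzero on some element of
    that kernel, by [separate]. *)
Lemma measurable_point d : measurable ([set d] : set (spectrumB p0)).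
Proof.
pose K := [set a : A | rep_of d a = 0].
have E : [set d] = ~` ~` [set d' : spectrum p0 | forall a, K a -> rep_of d' a = 0].
  rewrite setCK; apply/seteqP; split=> [_ ->//|d' h] /=.
  apply: contrapT => /eqP ne; have [a [a1 a0]] := separate d' [:: d].
  have := h a (a0 d (mem_head _ _) _); rewrite eq_sym => /(_ ne); rewrite a1.
  by move=> /eqP; rewrite oner_eq0.
have -> : ([set d] : set (spectrumB p0)) = ~` ~` [set d' : spectrum p0 | forall a, K a -> rep_of d' a = 0] by exact: E.
by apply: measurableC; apply: sub_sigma_algebra; exists K.
Qed.

End Irreducible.

Section Indicators.
Variables (R : realType) (dd : measure_display) (T : measurableType dd).
Variable mu : {measure set T -> \bar R}.
Local Notation "x %:CC" := (x%:C%C : R[i]) (at level 2, format "x %:CC").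

Definition cind (B : set T) (x : T) : R[i] := (`[< B x >])%:R.

Lemma cind_integral (B : set T) : measurable B -> (mu B < +oo)%E ->
  cintegrable mu (cind B) /\ cintegral mu (cind B) = (fine (mu B))%:CC.
Proof.
move=> mB fB.
have ReE : (fun x => complex.Re (cind B x)) = \1_B :> (T -> R).
  apply/funext => x; rewrite /cind indicE; case: asboolP => Bx; first by rewrite mem_set.
  by rewrite memNset.
have ImE : (fun x => complex.Im (cind B x)) = (fun=> 0) :> (T -> R).
  by apply/funext => x; rewrite /cind; case: asboolP.
have i0 : mu.-integrable setT (EFin \o (\1_B : T -> R)).
  apply/integrableP; split; first by apply/measurable_EFinP; exact: measurable_indic.
  rewrite (eq_integral (fun x => (\1_B x : R)%:E)) ?integral_indic ?setIT //.
  by move=> x _ /=; rewrite indicE ger0_norm.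
rewrite /cintegrable /cintegral; split.
  split; first by apply: eq_integrable i0 => // x _ /=; rewrite -ReE.
  have -> : (fun x => (complex.Im (cind B x))%:E) = (cst 0 : T -> \bar R).
    by apply/funext => x /=; rewrite (congr1 (@^~ x) ImE).
  exact: integrable0.
rewrite ReE ImE; congr Complex.
  by rewrite /Rintegral integral_indic // setIT.
by rewrite /Rintegral integral0.
Qed.

End Indicators.

(** * Formal degrees *)

Section FormalDegree.
Variables (R : realType) (D : rootDatum) (L : labels R D) (H : heckeAlgebra L).
Variables (V : hilbertCompletion H) (A : cstarCompletion V).
Hypothesis w0_ex : exists w0, @longest D w0.
Variables (p0 : irrep A) (mu : {measure set (spectrumB p0) -> \bar R}).
Hypothesis muP : is_plancherel mu.
Variable nu : probability (torusB R D) R.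
Hypothesis nuP : is_nu A nu.
Local Notation X := (latX D).
Local Notation T := (hT H).
Local Notation th := (htheta H).
Local Notation Th := (@Th R D L H).
Local Notation galg := (galg R[i] X).
Local Notation Kpt := (@Kpt R D L H V A).
Local Notation torus := (torus R D).
Local Notation "x %:CC" := (x%:C%C : R[i]) (at level 2, format "x %:CC").
Local Notation rep_of := (@rep_of R D L H V A p0).
Local Notation irrep_char := (@irrep_char R D L H V A p0).
Implicit Types (d : spectrum p0) (r s t : torus).

Lemma measurable_torus_point t : measurable ([set t] : set (torusB R D)).
Proof.
rewrite -[X in measurable X]setCK; apply: measurableC; apply: sub_sigma_algebra.
exists (~` [set (tchar t : X -> R[i]^o)]).
  apply: closed_openC; apply: accessible_closed_set1; apply: hausdorff_accessible.
  by apply: hausdorff_product => x; exact: norm_hausdorff.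
apply/seteqP; split=> s /= h; first by move=> E; apply: h; rewrite E.
by move=> E; apply: h; apply: torus_ext => x; rewrite E.
Qed.

Lemma torus_orbitE r : torus_orbit r = [set` [seq tact w r | w <- W0s D]].
Proof.
apply/seteqP; split=> t /=; first by move=> /orbitP[w /mem_W0s ww ->]; exact: map_f.
by move=> /mapP[w /mem_W0s ww ->]; apply/orbitP; exists w.
Qed.

Lemma torus_orbit_finite r : finite_set (torus_orbit r).
Proof. by rewrite torus_orbitE; exact: finite_seq. Qed.

Lemma measurable_orbit r : measurable (torus_orbit r : set (torusB R D)).
Proof.
have -> : (torus_orbit r : set (torusB R D)) = (\bigcup_(t in torus_orbit r) [set t])%classic.
  by apply/seteqP; split=> [t rt|t [s rs ->//]]; exists t.
apply: fin_bigcup_measurable; first exact: torus_orbit_finite.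
by move=> t _; exact: measurable_torus_point.
Qed.

Lemma orb_cind r : orb r = cind R (torus_orbit r : set (torusB R D)).
Proof. by []. Qed.

Lemma orb_integral r : cintegrable nu (orb r : torusB R D -> _) /\
  cintegral nu (orb r : torusB R D -> _) = (fine (nu (torus_orbit r)))%:CC.
Proof.
rewrite orb_cind; apply: cind_integral; first exact: measurable_orbit.
by apply: le_lt_trans (probability_le1 _ (measurable_orbit r)) _; rewrite ltry.
Qed.

(** [nu] is carried by [Kpt], where the peaks are bounded by 1 and tend to the indicator of the
    orbit, so dominated convergence applies. *)
Lemma nu_peak r (z : nat -> galg) (g : torus -> R[i]) :
  (forall j t, Kpt t -> exists2 u : R, teval (z j) t = u%:CC & 0 <= u <= 1) ->
  (forall j t, torus_orbit r t -> teval (z j) t = 1) ->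
  (forall t, Kpt t -> ~ torus_orbit r t -> ccvg (fun j => teval (z j) t) 0) ->
  (forall j, W0_inv (z j)) -> cintegrable nu (g : torusB R D -> _) ->
  (forall t, torus_orbit r t -> g t = g r) ->
  ccvg (fun j => cintegral nu (fun t : torusB R D => teval (z j) t * g t))
    (g r * (fine (nu (torus_orbit r)))%:CC).
Proof.
move=> z01 z1 z0 zi gI gr; have [nu1 nu2 nu3] := nuP.
have [oI oE] := orb_integral r.
have -> : g r * (fine (nu (torus_orbit r)))%:CC = cintegral nu (fun t : torusB R D => orb r t * g t).
  rewrite -oE -cintegralZ //; congr cintegral; apply/funext => t; rewrite /orb.
  by case: asboolP => [rt|_]; rewrite ?mulr0 ?mul0r // mulr1 mul1r gr.
have iG : nu.-integrable setT (EFin \o (fun t : torusB R D => `|complex.Re (g t)| + `|complex.Im (g t)|)).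
  by have [a b] := gI; apply: eq_integrable (integrableD _ (integrable_norm a) (integrable_norm b)).
have nK : nu.-negligible (~` [set t : torusB R D | Kpt t]).
  by apply: negligibleS nu2; apply: subsetC => t; exact: center_Kpt.
have gm := cintegrable_meas gI.
have [||||_ _ c2] := @complex_dct _ _ _ _ _ iG (fun j t => teval (z j) t * g t) (fun t => orb r t * g t) _ _ _ nK.
- by move=> j; have [/cintegrable_meas hz _] := nu3 _ (zi j); exact: cmeasM hz gm.
- exact: cmeasM (cintegrable_meas oI) gm.
- move=> t /contrapT Kt; apply: ccvgM; last exact: ccvg_cst.
  rewrite /orb; case: asboolP => rt; last exact: z0.
  by apply: (ccvg_ext (u := fun=> 1)); [move=> j; rewrite z1|exact: ccvg_cst].
- move=> t j /contrapT Kt; apply: le_trans (nm_ReIm_le _); rewrite nmM.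
  have [u -> /andP[u0 u1]] := z01 j t Kt; rewrite nm_real ger0_norm //.
  by apply: ler_piMl => //; exact: nm_ge0.
- exact: c2.
Qed.

(** Both sides are limits of the trace of the same peaking central elements. *)
Lemma Ispec_orb r : Ispec mu (orb r) = (fine (nu (torus_orbit r)))%:CC.
Proof.
have [z [zi z01 z1 z0]] := peak A w0_ex r.
have [nu1 nu2 nu3] := nuP.
have i1 : cintegrable nu (fun _ : torusB R D => 1 : R[i]).
  have [+ _] := nu3 _ (@inv1 R D); congr (cintegrable nu _).
  by apply/funext => t; rewrite tev1.
have c1 := nu_peak z01 z1 z0 zi i1 (fun _ _ => erefl); rewrite mul1r in c1.
have c2 : ccvg (fun j => Ispec mu (teval (z j))) (Ispec mu (orb r)).
  apply: (Bor_dct muP (P := @W0_inv R D) (B := 1)) => [j|j t Kt|t Kt].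
  - exact: BorZ_tev.
  - by have [u -> /andP[u0 u1]] := z01 j t Kt; rewrite nm_real ger0_norm.
  - rewrite /orb; case: asboolP => rt; last exact: z0.
    by apply: (ccvg_ext (u := fun=> 1)); [move=> j; rewrite z1|exact: ccvg_cst].
apply: (ccvg_uniq c2); apply: ccvg_ext c1 => j.
have [_ ->] := Ispec_tev muP (z j); have [_ E] := nu3 _ (zi j).
rewrite -[LHS]/(cintegral nu (fun t : torusB R D => teval (z j) t * 1)) (_ : (fun t => _) = teval (z j)).
  by rewrite -E.
by apply/funext => t; rewrite mulr1.
Qed.

Variable r : torus.

Definition central d := forall z, W0_inv z -> rep_of d (cin A (Th z)) = (teval z r)%:M.

Definition wt d : torus := head (torus1 R D) (wts d).

Lemma wt_in d : wt d \in wts d.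
Proof. by rewrite /wt; have := wts_size d; case: (wts d) => //= t l _; rewrite mem_head. Qed.

Lemma scalar_inj (n : nat) (x y : R[i]) : x%:M = y%:M :> 'M[R[i]]_(n.+1) -> x = y.
Proof. by move=> /matrixP/(_ ord0 ord0); rewrite !mxE eqxx. Qed.

Lemma centralP d : central d <-> torus_orbit r (wt d).
Proof.
split=> [h|/orbitP[w ww E] z zi]; last by rewrite (wts_scalar (wt_in d) zi) E tev_inv.
apply/orbitP; apply: separation => z zi; apply: (@scalar_inj (irrep_dim (rep_of d))).
by rewrite -h // -(wts_scalar (wt_in d) zi).
Qed.

Definition eigenrow t d := exists2 u : 'rV_(irrep_dim (rep_of d)).+1, u != 0 &
  forall x, u *m rep_of d (cin A (th x)) = t x *: u.

(** The first row of a triangularising matrix is a common left eigenvector, whose weight lies in the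
    orbit of [r] by separation. *)
Lemma central_eigenrow d : central d -> exists2 w, W0 w & eigenrow (tact w r) d.
Proof.
move=> cd; have [P [tt [PU trig diag _]]] := weights (irrep_rho (rep_of d)).
have [w ww tE] : exists2 w, W0 w & tt ord0 = tact w r.
  apply: separation => z zi; rewrite -diag -/(rep_of d) (cd z zi).
  by rewrite mul_mx_scalar -scalemxAl mulmxV // mxE mxE eqxx mulr1.
exists w => //; exists (row 0 P).
  apply: contraTneq PU => r0; rewrite -row_free_unit; apply/negP => /row_freeP[B PB].
  have := congr1 (row 0) PB; rewrite row_mul r0 mul0mx => /rowP/(_ 0); rewrite !mxE eqxx.
  by move=> /esym/eqP; rewrite oner_eq0.
move=> x; have -> : th x = Th (gmono 1 x) by rewrite Th_mono scale1r.
rewrite -tE -row_mul.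
set M := rep_of d _; pose N := P *m M *m invmx P.
have -> : P *m M = N *m P by rewrite mulmxKV.
have NE j : N 0 j = if j == 0 then tt ord0 x else 0.
  case: eqP => [->|/eqP j0]; first by rewrite diag tev_mono mul1r.
  by apply: (is_trig_mxP (trig _)); rewrite lt0n.
apply/rowP => j; rewrite !mxE (bigD1 0) //= NE eqxx big1 ?addr0 // => k k0.
by rewrite NE (negPf k0) mul0r.
Qed.

Lemma eigenrow_functional t d : eigenrow t d -> exists phi : A -> R[i],
  [/\ bounded phi, forall c a b, phi (c *: a + b) = c * phi a + phi b,
   forall x h, phi (cin A (th x * h)) = t x * phi (cin A h),
   forall a, rep_of d a = 1%:M -> phi a = 1 & forall a, rep_of d a = 0 -> phi a = 0].
Proof.
move=> [u u0 uE]; have [j uj] : exists j, u 0 j != 0.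
  apply: contrapT => no; move/eqP: u0; apply; apply/rowP => j; rewrite mxE.
  by apply/eqP; apply: contrapT => /negP n0; apply: no; exists j.
have [k uk] : exists k : 'cV_(irrep_dim (rep_of d)).+1, (u *m k) 0 0 = 1.
  by exists ((u 0 j)^-1 *: delta_mx j 0); rewrite -scalemxAr -colE !mxE mulVf.
exists (fun a => (u *m rep_of d a *m k) 0 0); split.
- exact: bounded_form.
- move=> c a b; rewrite irD irZ mulmxDr mulmxDl -scalemxAr -scalemxAl.
  by rewrite [LHS]mxE [X in X + _]mxE.
- move=> x h; rewrite rmorphM irM mulmxA uE -!scalemxAl.
  by rewrite [LHS]mxE.
- by move=> a ->; rewrite mulmx1.
- by move=> a ->; rewrite mulmx0 mul0mx mxE.
Qed.

(* By the Bernstein basis, such representations are quotients of one module of dimension [#|W_0|]. *)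
Lemma eigenrow_few t (s : seq (spectrum p0)) : uniq s -> (forall d, d \in s -> eigenrow t d) ->
  (size s <= size (W0s D))%N.
Proof.
move=> us h; rewrite leqNgt; apply/negP => big; pose dd i := tnth (in_tuple s) i.
have [phi phiP] := choice (fun i => eigenrow_functional (h (dd i) (mem_tnth i _))).
pose M := \matrix_(i < size s, j < size (W0s D)) phi i (cin A (T (nth id (W0s D) j))).
have : kermx M != 0.
  rewrite -mxrank_eq0 mxrank_ker subn_eq0 -ltnNge; exact: leq_ltn_trans (rank_leq_col _) big.
move=> /rowV0Pn[l /sub_kermxP lM l0].
have [i li] : exists i, l 0 i != 0.
  apply: contrapT => no; move/eqP: l0; apply; apply/rowP => i; rewrite mxE.
  by apply/eqP; apply: contrapT => /negP n0; apply: no; exists i.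
pose psi a := \sum_i l 0 i * phi i a.
have psiL c a b : psi (c *: a + b) = c * psi a + psi b.
  rewrite mulr_sumr -big_split; apply: eq_bigr => k _; have [_ -> _ _ _] := phiP k.
  by rewrite mulrDr mulrCA.
have psiB a b : psi (a - b) = psi a - psi b by rewrite -[a - b]addrC -scaleN1r psiL mulN1r addrC.
have psi0 : psi 0 = 0.
  by have := psiL (-1) 0 0; rewrite scaler0 addr0 mulN1r addNr.
have psit x k : psi (cin A (th x * k)) = t x * psi (cin A k).
  by rewrite mulr_sumr; apply: eq_bigr => j _; have [_ _ -> _ _] := phiP j; rewrite mulrCA.
have psif k : finH k -> psi (cin A k) = 0.
  elim=> [|c w k' ww _ IH]; first by rewrite rmorph0 psi0.
  rewrite rmorphD /= linearZ psiL IH addr0; move: (ww) => /mem_W0s wi.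
  have jl : (index w (W0s D) < size (W0s D))%N by rewrite index_mem.
  have := congr1 (fun N : 'rV_(size (W0s D)) => N 0 (Ordinal jl)) lM; rewrite mxE mxE => E.
  rewrite (_ : psi _ = 0) ?mulr0 // -[RHS]E; apply: eq_bigr => j _.
  by rewrite mxE /= nth_index.
have psiH k : psi (cin A k) = 0.
  elim: (bern_all k) => [|c x k' k2 fk _ IH]; first by rewrite rmorph0 psi0.
  by rewrite rmorphD /= linearZ psiL IH psit psif // !mulr0 addr0.
have psi_bd : bounded psi by apply: bounded_sum => j; apply: boundedZ; have [] := phiP j.
have [a [a1 a0]] := separate (dd i) s.
have := bounded_ext psi_bd psiB psiH a; rewrite /psi (bigD1 i) //= big1 => [|j ji].
  by have [_ _ _ -> // _] := phiP i; rewrite mulr1 addr0 => /eqP; rewrite (negPf li).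
have [_ _ _ _ ->] := phiP j; rewrite ?mulr0 // a0 ?mem_tnth //.
apply: contra_neq ji => /eqP; rewrite /dd !(tnth_nth (dd i)) /= nth_uniq // => /eqP E.
exact: val_inj.
Qed.

Lemma central_finite : finite_set [set d | central d].
Proof.
apply: (@sub_finite_set _ _ (\bigcup_(w in [set` W0s D]) [set d | eigenrow (tact w r) d])%classic).
  by move=> d /central_eigenrow[w ww dw]; exists w => //; exact/mem_W0s.
apply: bigcup_finite => [|w _]; first exact: finite_seq.
apply: contrapT => /(infinite_set_fset (size (W0s D)).+1)[B Bh].
by apply/negP; rewrite -leqNgt; apply: (eigenrow_few (t := tact w r)) => [|d /Bh//]; exact: fset_uniq.
Qed.

(** Dimensions are at least 1 and their integral is finite, so even the total mass is finite. *)
Lemma mu_finite d : (mu [set d] < +oo)%E.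
Proof.
have iD := dimf_int muP; have mT := measurableT : measurable (setT : set (spectrumB p0)).
apply: (@le_lt_trans _ _ (mu setT)); first by apply: le_measure; rewrite ?inE //; exact: measurable_point.
apply: (@le_lt_trans _ _ (\int[mu]_d (dimf d)%:E)%E); last first.
  have /integrableP[_] := iD; apply: le_lt_trans; apply: ge0_le_integral => //.
  - by move=> x _; rewrite lee_fin ler0n.
  - exact: measurable_int iD.
  - by apply: measurableT_comp => //; exact: measurable_int iD.
  - by move=> x _; rewrite abse_EFin lee_fin ler_norm || rewrite lee_fin ler_norm.
rewrite -[leLHS]mul1e -integral_cst //; apply: ge0_le_integral => //.
- exact: measurable_int iD.
- by move=> x _; rewrite lee_fin ler1n wts_size.
Qed.

Definition Ed := fset_set [set d | central d].

Lemma mem_Ed d : (d \in Ed) <-> central d.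
Proof. by rewrite /Ed in_fset_set; [split=> [/set_mem//|/mem_set//]|exact: central_finite]. Qed.

Variable chi : torus -> H -> R[i].
Hypothesis chiP : is_local_trace nu chi.

(* Both sides are the limit of [tau (z_j h)] along peaking central elements [z_j]. *)
Lemma local_trace_spectral h : chi r h * (fine (nu (torus_orbit r)))%:CC =
  \sum_(d <- Ed) (fine (mu [set d]))%:CC * irrep_char d (cin A h).
Proof.
have [z [zi z01 z1 z0]] := peak A w0_ex r.
have [chi1 chi2 chi3] := chiP.
have orbchi t : torus_orbit r t -> chi t h = chi r h.
  by move=> /orbitP[w ww ->]; apply: (chi2 w) => // x; rewrite tactE.
have c1 := nu_peak z01 z1 z0 zi (chi1 h) orbchi.
pose f (d : spectrumB p0) := cind R ([set d | central d] : set (spectrumB p0)) d * irrep_char d (cin A h).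
have [hI _] := muP h; have hm := cintegrable_meas hI.
pose u j d := irrep_char d (cin A (Th (z j) * h)).
have uE j d : u j d = teval (z j) (wt d) * irrep_char d (cin A h).
  by rewrite /u /irrep_char rmorphM irM (wts_scalar (wt_in d) (zi j)) mul_scalar_mx mxtraceZ.
have um j : cmeas (u j : spectrumB p0 -> _) by have [/cintegrable_meas] := muP (Th (z j) * h).
have ul d : ccvg (u^~ d) (f d).
  apply: (ccvg_ext (u := fun j => teval (z j) (wt d) * irrep_char d (cin A h))) => [j|]; first by rewrite uE.
  apply: ccvgM (ccvg_cst _); rewrite /cind; case: asboolP => /= [/centralP cd|cd].
    by apply: (ccvg_ext (u := fun=> 1)); [move=> j; rewrite z1|exact: ccvg_cst].
  by apply: z0; [exact: wts_Kpt (wt_in d)|move/centralP].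
have iG : mu.-integrable setT (EFin \o (fun d : spectrumB p0 =>
    `|complex.Re (irrep_char d (cin A h))| + `|complex.Im (irrep_char d (cin A h))|)).
  by have [a b] := hI; apply: eq_integrable (integrableD _ (integrable_norm a) (integrable_norm b)).
have [||||_ _ c2] := @complex_dct _ _ _ mu _ iG (fun j d => u j d) f set0 um _ _ _ _.
- exact: cmeas_lim um ul.
- exact: negligible_set0.
- by move=> d _; exact: ul.
- move=> d j _; apply: le_trans (nm_ReIm_le _); rewrite uE nmM.
  have [v -> /andP[v0 v1]] := z01 j _ (wts_Kpt (wt_in d)); rewrite nm_real ger0_norm //.
  by apply: ler_piMl => //; exact: nm_ge0.
have E : cintegral mu f = \sum_(d <- Ed) (fine (mu [set d]))%:CC * irrep_char d (cin A h).
  pose F d0 (d : spectrumB p0) := irrep_char d0 (cin A h) * cind R ([set d0] : set (spectrumB p0)) d.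
  have fE : f = fun d => \sum_(d0 <- Ed) F d0 d.
    apply/funext => d; rewrite /f /cind; case: asboolP => cd.
      rewrite mul1r (big_rem d) /=; last exact/mem_Ed.
      rewrite /F /cind asboolT // mulr1 big_seq big1 ?addr0 // => d'.
      rewrite mem_rem_uniq ?fset_uniq // !inE => /andP[/eqP n _].
      by rewrite asboolF ?mulr0 // => E; apply: n; rewrite E.
    rewrite mul0r big_seq big1 // => d' /mem_Ed cd'; rewrite /F /cind asboolF ?mulr0 //.
    by move=> /= E; apply: cd; rewrite /= E.
  have FI d0 := cind_integral (measurable_point d0) (mu_finite d0).
  have {}FI d0 : cintegrable mu (F d0) /\ cintegral mu (F d0) = (fine (mu [set d0]))%:CC * irrep_char d0 (cin A h).
    have [a b] := FI d0; split; first exact: cintegrableZ.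
    by rewrite cintegralZ // b mulrC.
  have key (s : seq (spectrum p0)) : cintegrable mu (fun d => \sum_(d0 <- s) F d0 d) /\
      cintegral mu (fun d => \sum_(d0 <- s) F d0 d) = \sum_(d0 <- s) cintegral mu (F d0).
    elim: s => [|d0 s [IH1 IH2]].
      have -> : (fun d => \sum_(d0 <- [::]) F d0 d) = fun d => 0 * F (\pi_{eq_quot (irrep_equiv_rel A)} p0)%qT d.
        by apply/funext => d; rewrite big_nil mul0r.
      have [a b] := FI (\pi_{eq_quot (irrep_equiv_rel A)} p0)%qT.
      by split; [exact: cintegrableZ|rewrite cintegralZ // mul0r big_nil].
    have -> : (fun d => \sum_(d1 <- d0 :: s) F d1 d) = fun d => F d0 d + \sum_(d1 <- s) F d1 d.
      by apply/funext => d; rewrite big_cons.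
    have [a b] := FI d0; split; first exact: cintegrableD.
    by rewrite cintegralD // IH2 big_cons.
  rewrite fE; have [_ ->] := key Ed; apply: eq_bigr => d _; by have [] := FI d.
rewrite -E; apply: (ccvg_uniq c1); apply: ccvg_ext c2 => j.
by rewrite -(chi3 _ _ (zi j)); have [_ ->] := muP (Th (z j) * h).
Qed.

Variable deg : spectrum p0 -> R.
Hypothesis degP : residual_degree chi r deg.

(** Two expansions of one functional in characters agree on the Hecke algebra, hence on the
    completion by continuity. An element acting as 1 in [delta] and as 0 in the finitely many other
    representations involved compares the coefficients. *)
Lemma formal_degree delta : Delta r delta ->
  mu [set delta] = ((deg delta)%:E * nu (torus_orbit r))%E.
Proof.
move=> dD; have nuf : nu (torus_orbit r) \is a fin_num.
  by rewrite ge0_fin_numE //; apply: le_lt_trans (probability_le1 _ (measurable_orbit r)) _; rewrite ltry.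
have muf : mu [set delta] \is a fin_num by rewrite ge0_fin_numE // mu_finite.
rewrite -(fineK nuf) -(fineK muf) -EFinM; congr EFin.
have DE : Delta r `<=` [set d | central d] by move=> d [_].
have DF := sub_finite_set DE central_finite.
pose F := fset_set (@Delta R D L H V A p0 r).
set N := fine (nu _); have [_ chiE] := degP.
pose psi a := \sum_(d <- Ed) (fine (mu [set d]))%:CC * irrep_char d a
  - N%:CC * \sum_(d <- F) (deg d)%:CC * irrep_char d a.
have comb_bd (s : seq (spectrum p0)) (c : spectrum p0 -> R[i]) : bounded (fun a => \sum_(d <- s) c d * irrep_char d a).
  by apply: bounded_sum => d; apply: boundedZ; exact: bounded_tr.
have psi_bd : bounded psi.
  have [C hC] := comb_bd Ed (fun d => (fine (mu [set d]))%:CC).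
  have [C' hC'] := boundedZ N%:CC (comb_bd F (fun d => (deg d)%:CC)).
  exists (C + C') => a c hc; apply: le_trans (nmB _ _) _; rewrite mulrDl.
  by apply: lerD; [exact: hC|exact: hC'].
have combB (s : seq (spectrum p0)) (c : spectrum p0 -> R[i]) a b :
    \sum_(d <- s) c d * irrep_char d (a - b) = \sum_(d <- s) c d * irrep_char d a - \sum_(d <- s) c d * irrep_char d b.
  by rewrite -sumrB; apply: eq_bigr => d _; rewrite /irrep_char raddfB raddfB mulrBr.
have psiB a b : psi (a - b) = psi a - psi b.
  by rewrite /psi !combB mulrBr !opprD !opprK !addrA; ring.
have psiH h : psi (cin A h) = 0.
  rewrite /psi -local_trace_spectral chiE fsbig_finite //= mulrC -/N.
  exact: subrr.
have [a [a1 a0]] := separate delta (Ed ++ F).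
have comb1 (s : seq (spectrum p0)) (c : spectrum p0 -> R[i]) : uniq s -> delta \in s -> {subset s <= Ed ++ F} ->
    \sum_(d <- s) c d * irrep_char d a = c delta * (irrep_dim (rep_of delta)).+1%:R.
  move=> us ds sub; rewrite (big_rem delta) //= big_seq big1 ?addr0 => [|d].
    by rewrite /irrep_char a1 mxtrace1.
  rewrite mem_rem_uniq // !inE => /andP[n ds']; rewrite /irrep_char a0 ?mxtrace0 ?mulr0 //.
  exact: sub.
have := bounded_ext psi_bd psiB psiH a; rewrite /psi comb1 ?fset_uniq //; last first.
- by move=> d dE; rewrite mem_cat dE.
- by apply/mem_Ed; exact: DE.
rewrite comb1 ?fset_uniq //; last first.
- by move=> d dE; rewrite mem_cat dE orbT.
- by rewrite /F in_fset_set //; apply/mem_set.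
rewrite mulrA -mulrBl => /eqP; rewrite mulf_eq0 pnatr_eq0 orbF subr_eq0 => /eqP.
by rewrite -rmorphM => /complexI ->; rewrite mulrC.
Qed.

End FormalDegree.

(** * The roots of R_1 *)

Section NonreducedRoots.
Variable D : rootDatum.
Local Notation X := (latX D).
Implicit Types (a b : X).

Lemma even_W0 w b : W0 w -> b \in roots D -> even_coroot (w b) = even_coroot b.
Proof.
move=> ww br; apply/idP/idP => /evenP ev; apply/evenP => x.
  by rewrite -(W0_pr x ww br); exact: ev.
by rewrite -(W0_winvKr ww x) (W0_pr _ ww br); exact: ev.
Qed.

Lemma root_mul b n : b \in roots D -> (1 < n)%N -> b *+ n \notin roots D.
Proof.
move=> br n1; apply/negP => nr.
have [] := @roots_reduced D (b *+ n) b 1 n nr br (ltac:(by [])).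
- by rewrite mulr1z pmulrn.
- by move=> E; have := pairing_coroot br; rewrite {1}E prMnl pairing_coroot //; lia.
- by move=> E; have := pairing_coroot br; rewrite {1}E prNl prMnl pairing_coroot //; lia.
Qed.

Lemma dbl_inj a b : a *+ 2 = b *+ 2 -> a = b.
Proof.
by move=> E; apply: pr_injl => y; have := congr1 (fun x => pairing x y) E; rewrite !prMnl; lia.
Qed.

(** The bijection from R_0 onto R_1 that rewrites the products of [mres] as products over R_0. *)
Definition nrroot b := if even_coroot b then b *+ 2 else b.

Lemma mem_roots_nr a : (a \in roots_nr D) <->
  a \in roots D \/ exists b, [/\ b \in roots D, even_coroot b & a = b *+ 2].
Proof.
rewrite /roots_nr in_fsetU; split=> [/orP[|/imfsetP[b /= + ->]]|[->//|[b [br be ->]]]]; first by left.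
  by rewrite !inE => /andP[br be]; right; exists b.
by apply/orP; right; apply/imfsetP; exists b; rewrite //= !inE br.
Qed.

Lemma mem_roots_1 a : (a \in roots_1 D) <-> exists2 b, b \in roots D & a = nrroot b.
Proof.
rewrite /roots_1; have mem_roots_nr := mem_roots_nr; move: (roots_nr D) mem_roots_nr => N memN.
rewrite !inE /=; split.
  move=> /andP[/memN[ar|[b [br be ->]]] an]; last by exists b; rewrite /nrroot ?be.
  exists a => //; rewrite /nrroot; case: ifP => // ae; case/negP: an.
  by apply/memN; right; exists a.
move=> [b br ->]; rewrite /nrroot; case: ifP => be; apply/andP; split.
- by apply/memN; right; exists b.
- rewrite -mulrnA; apply/negP => /memN[|[c [cr _]]]; first exact/negP/root_mul.
  by rewrite (mulrnA b 2 2) => /dbl_inj E; move: cr; rewrite -E; apply/negP/root_mul.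
- by apply/memN; left.
- apply/negP => /memN[|[c [cr ce /dbl_inj E]]]; first exact/negP/root_mul.
  by move: be; rewrite E ce.
Qed.

Lemma nrroot_inj : {in roots D &, injective nrroot}.
Proof.
move=> b c br cr; rewrite /nrroot; case: ifP => be; case: ifP => ce // E; first exact: dbl_inj.
  by move: cr; rewrite -E; have /negP := root_mul br (isT : (1 < 2)%N).
by move: br; rewrite E; have /negP := root_mul cr (isT : (1 < 2)%N).
Qed.

Lemma prod_roots_1 (C : comNzRingType) (F : X -> C) :
  \prod_(a <- roots_1 D) F a = \prod_(b <- roots D) F (nrroot b).
Proof.
rewrite -(big_map nrroot xpredT F); apply: perm_big; apply: uniq_perm; first exact: fset_uniq.
  by rewrite map_inj_in_uniq ?fset_uniq //; exact: nrroot_inj.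
move=> a; apply/idP/mapP => [/mem_roots_1[b br ->]|[b br ->]]; first by exists b.
by apply/mem_roots_1; exists b.
Qed.

Lemma half_root_even b : b \in roots D -> half_root (b *+ 2) = Some b.
Proof.
move=> br; rewrite /half_root; case E : [seq _ <- _ | _] => [|c l] /=.
  have : b \in [seq c <- roots D | c *+ 2 == b *+ 2] by rewrite mem_filter eqxx.
  by rewrite E.
have : c \in [seq c <- roots D | c *+ 2 == b *+ 2] by rewrite E mem_head.
by rewrite mem_filter => /andP[/eqP/dbl_inj->].
Qed.

Lemma half_root_root b : b \in roots D -> half_root b = None.
Proof.
move=> br; rewrite /half_root; case E : [seq _ <- _ | _] => [|c l] //=.
have : c \in [seq c <- roots D | c *+ 2 == b] by rewrite E mem_head.
rewrite mem_filter => /andP[/eqP cE cr]; move: br; rewrite -cE.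
by have /negP := root_mul cr (isT : (1 < 2)%N).
Qed.

Lemma prod_rootsN (C : comNzRingType) (F : X -> C) :
  \prod_(b <- roots D) F (- b) = \prod_(b <- roots D) F b.
Proof.
rewrite -(big_map -%R xpredT F); apply: perm_big; apply: uniq_perm; last 2 first.
- exact: fset_uniq.
- move=> b; apply/mapP/idP => [[c cr ->]|br]; first by rewrite rootN.
  by exists (- b); rewrite ?rootN ?opprK.
by rewrite map_inj_uniq ?fset_uniq //; exact: oppr_inj.
Qed.

End NonreducedRoots.

(** * Masses of orbits *)

Section Mass.
Variables (R : realType) (D : rootDatum) (L : labels R D) (H : heckeAlgebra L).
Variables (V : hilbertCompletion H) (A : cstarCompletion V).
Variable w0 : latX D -> latX D.
Hypothesis w0l : @longest D w0.
Local Notation X := (latX D).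
Local Notation qc w := ((qW L w)%:C%C).
Local Notation "x %:CC" := (x%:C%C : R[i]) (at level 2, format "x %:CC").
Implicit Types (r t s : torus R D) (b x : X) (w : X -> X) (z : R[i]).

(** A translation that pairs to 1 with the coroot carries [(b, 1)] to [(b, 0)]. *)
Lemma q01_odd b : b \in roots D -> ~~ even_coroot b -> q1 L b = q0 L b.
Proof.
move=> br be; have [x xo] := odd_pairing be.
pose y := x - b *~ (pairing x (coroot b) %/ 2)%Z.
have E : pairing y (coroot b) = 1 by rewrite prBl prMzl pairing_coroot //; lia.
by have := qlab_shift L y 1 br; rewrite E subrr /q0 /q1.
Qed.

Lemma hbE b : b \in roots D -> Num.sqrt (qhalf L b) = hb L b.
Proof.
move=> br; rewrite /qhalf /hb; case: ifPn => // be.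
by rewrite q01_odd // divff // gt_eqF // (q0_pos H).
Qed.

Lemma cbE b : b \in roots D -> hb L b * q0 L b = cb L b.
Proof.
move=> br; have p1 := q1_pos L br; have p0 := q0_pos H br.
have E : q1 L b * q0 L b = q1 L b / q0 L b * q0 L b ^+ 2 by field; rewrite gt_eqF.
rewrite /cb E sqrtrM; last by rewrite divr_ge0 // ltW.
by rewrite sqrtr_sqr ger0_norm // ltW.
Qed.

Lemma omit0N z : exists e : rat, omit0 (- z) = ratr e * omit0 z.
Proof.
rewrite /omit0 oppr_eq0; case: eqP => _; first by exists 1; rewrite rmorph1 mulr1.
by exists (-1); rewrite rmorphN1 mulN1r.
Qed.

Lemma omit0_neq0 z : omit0 z != 0.
Proof. by rewrite /omit0; case: ifPn => // _; exact: oner_neq0. Qed.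

(* The contribution of [b] to [mres], and the one that comes out of the trace formula. *)
Definition mfac r b : R[i] := if even_coroot b
  then omit0 (r (b *+ 2) - 1) / (omit0 ((hb L b)%:CC * r b + 1) * omit0 ((cb L b)%:CC * r b - 1))
  else omit0 (r b - 1) / omit0 ((q0 L b)%:CC * r b - 1).
Definition tfac r b : R[i] :=
  omit0 (1 - r (b *+ 2)) / (omit0 (1 + (hb L b)%:CC * r b) * omit0 (1 - (cb L b)%:CC * r b)).

Lemma mresE r : mres L w0 r = qc w0 * \prod_(b <- roots D) mfac r b.
Proof.
rewrite /mres -mulrA; congr (_ * _); rewrite !prod_roots_1 -prodf_div !big_seq.
apply: eq_bigr => b br; rewrite /mfac /nrroot /mdenom; case: ifPn => be.
  by rewrite half_root_even // hbE // -/(q0 L b) cbE.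
by rewrite half_root_root.
Qed.

Lemma mres_W0 w r : W0 w -> mres L w0 (tact w r) = mres L w0 r.
Proof.
move=> ww; rewrite !mresE -[in RHS](big_roots_W0 _ ww); congr (_ * _); rewrite !big_seq.
apply: eq_bigr => b br; rewrite /mfac even_W0 // hb_W0 // cb_W0 // q0_W0 // !tactE //.
by rewrite mulr2n (W0D ww) -mulr2n.
Qed.

(** For an even coroot the factors differ by signs. Otherwise [hb] is 1, and [(1 - z^2)/(1 + z)]
    replaces [z - 1], which again is a sign, except at [z = 1] and [z = -1], where the omitted zeros
    leave the ratios 1/2 and -1/2. *)
Lemma tfac_mfac r b : b \in roots D -> exists e : rat, tfac r b = ratr e * mfac r b.
Proof.
move=> br; rewrite /tfac /mfac; case: ifPn => be.
  have [e1 E1] := omit0N (r (b *+ 2) - 1); have [e2 E2] := omit0N ((cb L b)%:CC * r b - 1).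
  move: E1 E2; rewrite !opprB => E1 E2.
  exists (e1 / e2); rewrite E1 E2 (addrC 1) fmorph_div !invfM /=; set o := omit0 _; set h := omit0 _; set k := omit0 _.
  by ring.
have q10 := q01_odd br be; have hb1 : hb L b = 1 by rewrite -hbE // /qhalf (negPf be) sqrtr1.
have cq : cb L b = q0 L b by rewrite -cbE // hb1 mul1r.
rewrite hb1 cq rmorph1 mul1r.
have [e2 E2] := omit0N ((q0 L b)%:CC * r b - 1); move: E2; rewrite opprB => ->.
have [e1 E1] : exists e1 : rat, omit0 (1 - r (b *+ 2)) / omit0 (1 + r b) = ratr e1 * omit0 (r b - 1).
  have rE : r (b *+ 2) = r b ^+ 2 by rewrite mulr2n tcharD expr2.
  rewrite rE; set z := r b; rewrite /omit0.
  have [->|z1] := eqVneq z 1.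
    exists 2^-1; rewrite expr1n !subrr eqxx mulr1 fmorphV rmorph_nat mul1r.
    by rewrite (_ : 1 + 1 = 2) // pnatr_eq0.
  have [->|zm] := eqVneq z (-1).
    exists (- 2^-1); rewrite sqrrN expr1n subrr eqxx invr1 mulr1.
    rewrite (_ : - 1 - 1 = - 2); last by ring.
    by rewrite oppr_eq0 pnatr_eq0 rmorphN fmorphV rmorph_nat mulrNN mulVf // pnatr_eq0.
  have n1 : z - 1 != 0 by rewrite subr_eq0.
  have n2 : 1 + z != 0 by rewrite addrC addr_eq0.
  have E : 1 - z ^+ 2 = - (z - 1) * (1 + z) by ring.
  exists (-1); rewrite E mulf_eq0 oppr_eq0 (negPf n1) (negPf n2) /=.
  by rewrite mulfK // rmorphN1 mulN1r.
exists (e1 / e2); rewrite invfM mulrA E1 fmorph_div invfM /=.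
set u := omit0 _; set v := omit0 _; by ring.
Qed.

Lemma teval_bpol r : teval (bpol L r) r =
  \prod_(b <- roots D) (omit0 (1 + (hb L b)%:CC * r b) * omit0 (1 - (cb L b)%:CC * r b)).
Proof.
rewrite /bpol tev_prod big_mkcond /facs big_flatten big_map; apply: eq_bigr => b _.
rewrite !big_cons big_nil /= mulr1 /polar /fac /= !tevB !tev1 !tev_mono.
have one z : (if z != 1 then 1 - z else 1) = omit0 (1 - z).
  by rewrite /omit0 subr_eq0 eq_sym; case: eqP.
by rewrite !one mulNr opprK.
Qed.

Lemma resC_tfac r : resC L w0 r / teval (bpol L r) r = qc w0 * \prod_(b <- roots D) tfac r b.
Proof.
rewrite teval_bpol /resC -mulrA prodf_div; congr (_ * (_ / _)).
rewrite -(prod_rootsN (fun b => omit0 (1 - r (b *+ 2)))) big_mkcond; apply: eq_bigr => b _.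
by rewrite /dz mulNrn /omit0 subr_eq0 eq_sym; case: eqP.
Qed.

Lemma prod_tfac r : exists e : rat, qc w0 * \prod_(b <- roots D) tfac r b = ratr e * mres L w0 r.
Proof.
have [e eE] : exists e : X -> rat, forall b, b \in roots D -> tfac r b = ratr (e b) * mfac r b.
  have /choice[e h] : forall b, exists e : rat, b \in roots D -> tfac r b = ratr e * mfac r b.
    move=> b; have [br|_] := boolP (b \in roots D); last by exists 0.
    by have [e E] := tfac_mfac r br; exists e.
  by exists e.
exists (\prod_(b <- roots D) e b); rewrite mresE rmorph_prod mulrCA -big_split /= !big_seq.
by congr (_ * _); apply: eq_bigr => b /eE.
Qed.

Variables (p0 : irrep A) (mu : {measure set (spectrumB p0) -> \bar R}).
Hypothesis muP : is_plancherel mu.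

Lemma Ispec_pt r : exists rho : rat, Ispec mu (pt r) = ratr rho * mres L w0 r.
Proof.
have [Kr|nK] := pselect (Kpt A r); last first.
  (* A point outside [Kpt] is not a weight of any irreducible representation, so its atom is
     zero. *)
  exists 0; rewrite rmorph0 mul0r -(mul0r (Ispec mu (fun=> 0))).
  rewrite -(IspecZ muP 0 (@BorA_cst R D L H V A 0)); apply: Ispec_ext => t Kt; rewrite /pt mulr0.
  by case: eqP => // E; case: nK; rewrite -E.
have [rho E] := atom_rational w0l muP Kr; have [e eE] := prod_tfac r.
have b0 : teval (bpol L r) r != 0.
  by rewrite teval_bpol prodf_seq_neq0; apply/allP => b _; rewrite mulf_neq0 ?omit0_neq0.
exists (rho * e); rewrite rmorphM -mulrA -eE -resC_tfac mulrA -E mulfK //.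
Qed.

Lemma Ispec_pts (s : seq (torus R D)) :
  BorA A (fun t => \sum_(u <- s) pt u t) /\
  Ispec mu (fun t => \sum_(u <- s) pt u t) = \sum_(u <- s) Ispec mu (pt u).
Proof.
elim: s => [|u s [IH1 IH2]].
  rewrite (_ : (fun t => _) = fun=> 0); last by apply/funext => t; rewrite big_nil.
  split; first exact: BorA_cst.
  rewrite big_nil -[RHS](mul0r (Ispec mu (fun=> 0))) -(IspecZ muP 0 (@BorA_cst R D L H V A 0)).
  by apply: Ispec_ext => t _; rewrite mulr0.
rewrite (_ : (fun t => _) = fun t => pt u t + \sum_(v <- s) pt v t); last first.
  by apply/funext => t; rewrite big_cons.
have hu := BorA_pt A w0l u; split; first exact: BorAD.
by rewrite (IspecD muP hu IH1) IH2 big_cons.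
Qed.

Variable nu : probability (torusB R D) R.
Hypothesis nuP : is_nu A nu.

(** The atoms of the spectral integral may differ along the orbit, unlike those of [nu]; but each is
    a rational multiple of the same number, since [mres] is W_0-invariant. *)
Lemma orbit_mass r : exists rho : rat, (fine (nu (torus_orbit r)))%:CC = ratr rho * mres L w0 r.
Proof.
have w0_ex : exists w0, @longest D w0 by exists w0.
rewrite -(Ispec_orb w0_ex muP nuP).
have [rho rhoE] := choice Ispec_pt; pose O := fset_set (torus_orbit r).
have OE t : (t \in O) <-> torus_orbit r t.
  by rewrite in_fset_set; [split=> [/set_mem//|/mem_set//]|exact: torus_orbit_finite].
have -> : orb r = fun t => \sum_(u <- O) pt u t.
  apply/funext => t; rewrite /orb; case: asboolP => [/OE tO|nO].
    rewrite (big_rem t) //= /pt eqxx big_seq big1 ?addr0 // => u.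
    by rewrite mem_rem_uniq ?fset_uniq // !inE eq_sym => /andP[/negPf->].
  rewrite big_seq big1 // => u /OE uO; rewrite /pt; case: eqP => // E.
  by case: nO; rewrite E.
have [_ ->] := Ispec_pts O; exists (\sum_(u <- O) rho u).
rewrite raddf_sum mulr_suml !big_seq; apply: eq_bigr => u /OE/orbitP[w ww ->].
by rewrite rhoE mres_W0.
Qed.

Lemma point_mass r t : torus_orbit r t ->
  (fine (nu (torus_orbit r)))%:CC = (#|` fset_set (torus_orbit r)|)%:R * (fine (nu [set t]))%:CC.
Proof.
move=> /orbitP[v vv ->]; have [nu1 _ _] := nuP.
have inv w : W0 w -> nu [set tact w r] = nu [set r].
  move=> ww; rewrite -(nu1 w _ ww (measurable_torus_point r)); congr (nu _).
  apply/seteqP; split=> [_ -> /=|s /= [_ -> rs]]; first by exists r => // x; rewrite tactE.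
  by apply: torus_ext => x; rewrite tactE // rs.
have -> : nu (torus_orbit r) = (\sum_(t <- fset_set (torus_orbit r)) nu [set t])%E.
  rewrite -fsbig_finite; last exact: torus_orbit_finite.
  rewrite -measure_fin_bigcup.
  - congr (nu _); apply/seteqP; split=> [s rs|s [u ru ->//]]; by exists s.
  - exact: torus_orbit_finite.
  - by move=> i j _ _ [s [-> ->]].
  - by move=> s _; exact: measurable_torus_point.
rewrite inv // big_seq (eq_bigr (fun=> nu [set r])); last first.
  move=> s; rewrite in_fset_set; last exact: torus_orbit_finite.
  by move=> /set_mem/orbitP[w ww ->]; exact: inv.
rewrite -big_seq big_const_seq count_predT /=.
have nf : nu [set r] \is a fin_num.
  by rewrite ge0_fin_numE //; apply: le_lt_trans (probability_le1 _ (measurable_torus_point r)) _; rewrite ltry.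
elim: (size _) => [|m IH]; first by rewrite mul0r.
have fm : iter m (+%E (nu [set r])) 0%E \is a fin_num.
  by elim: (m) => //= k; rewrite fin_numD nf.
rewrite iterS fineD // rmorphD /= -natr1 mulrDl mul1r addrC; congr (_ + _).
exact: IH.
Qed.

End Mass.

Theorem corollary3p32 (R : realType) (D : rootDatum) (L : labels R D)
  (H : heckeAlgebra L) (V : hilbertCompletion H) (A : cstarCompletion V)
  (w0 : latX D -> latX D) (w0_longest : longest w0)
  (p0 : irrep A) (mu : {measure set (spectrumB p0) -> \bar R})
  (mu_plancherel : is_plancherel mu)
  (nu : probability (torusB R D) R) (nuP : is_nu A nu)
  (chi : torus R D -> H -> R[i]) (chiP : is_local_trace nu chi)
  (r : torus R D) (r_residual : residual_point L r)
  (deg : spectrum p0 -> R) (degP : residual_degree chi r deg) :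
  exists kappa : rat,
    (forall r', torus_orbit r r' ->
       (fine (nu [set r']))%:C%C = ratr kappa * mres L w0 r') /\
    (forall delta : spectrum p0, Delta r delta ->
       fdim mu delta = ((deg delta)%:E * nu (torus_orbit r))%E /\
       (fine (fdim mu delta))%:C%C =
         (#|` fset_set (torus_orbit r)|)%:R * ratr kappa * (deg delta)%:C%C
           * mres L w0 r).
Proof.
have w0_ex : exists w0, @longest D w0 by exists w0.
have [rho rhoE] := orbit_mass w0_longest mu_plancherel nuP r.
set m := #|` _|; have m0 : (m%:R : R[i]) != 0.
  rewrite pnatr_eq0 -lt0n cardfs_gt0; apply/fset0Pn; exists r.
  by rewrite in_fset_set; [apply/mem_set; exact: orb_self|exact: torus_orbit_finite].
(* [rho] belongs to the mass of the whole orbit, which [nu] distributes equally over its [m]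
   points. *)
exists (rho / m%:R); rewrite fmorph_div rmorph_nat; split=> [t rt|delta dD].
  apply: (mulfI m0); rewrite -(point_mass nuP rt) rhoE.
  by move: rt => /orbitP[w ww ->]; rewrite mres_W0 //; field.
have E := formal_degree w0_ex mu_plancherel nuP chiP degP dD; split=> //.
rewrite /fdim E; have nf : nu (torus_orbit r) \is a fin_num.
  by rewrite ge0_fin_numE //; apply: le_lt_trans (probability_le1 _ (measurable_orbit r)) _; rewrite ltry.
by rewrite fineM // rmorphM /= rhoE; field.
Qed.
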